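(* Let $\Theta\subset\mathbb{R}^d$ be compact and let $\{f_\theta:\theta\in\Theta\}$ be a family of non-decreasing functions $f_\theta:\mathbb{N}_+\to(0,\infty)$ such that $\theta\mapsto f_\theta(k)$ is twice continuously differentiable for every $k$, with gradient $\dot f_\theta(k)\in\mathbb{R}^d$ and Hessian $\ddot f_\theta(k)\in\mathbb{R}^{d\times d}$. Suppose there is a constant $C>0$ such that, for every $\theta\in\Theta$, either $f_\theta(k)\le Ck^{\beta}$ for every $k\in\mathbb{N}_+$, for some $\beta<1$, or $f_\theta(k)=k+\alpha$ for every $k\in\mathbb{N}_+$, for some $\alpha>-1$. Assume in addition that for some constants $\gamma>0$ and $C>0$, for all $\theta\in\Theta$ and all $k\ge 2$, $$\|\dot f_\theta(k)\|+\|\ddot f_\theta(k)\|\le Ck\log^\gamma k,\qquad \Bigl\|\frac{\dot f_\theta}{f_\theta}(k)\Bigr\|+\Bigl\|\frac{\ddot f_\theta}{f_\theta}(k)\Bigr\|\le C\log^\gamma k .$$ Let the preferential attachment tree be generated with true parameter $\theta_0\in\Theta$, and let $$V_0=\sum_{k=1}^\infty\frac{\dot f_{\theta_0}\dot f_{\theta_0}^T}{f_{\theta_0}^2}(k)\,p^{(0)}_{>k}-\Bigl(\sum_{k=1}^\infty\frac{\dot f_{\theta_0}}{f_{\theta_0}}(k)\,p^{(0)}_{>k}\Bigr)\Bigl(\sum_{k=1}^\infty\frac{\dot f_{\theta_0}^T}{f_{\theta_0}}(k)\,p^{(0)}_{>k}\Bigr),$$ assumed nonsingular. Then, for any sequence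 $\hat\theta_n$ of solutions to the likelihood equations $\dot\iota_n(f_\theta)=0$ that is consistent for $\theta_0$, the sequence $\sqrt n(\hat\theta_n-\theta_0)$ converges in distribution to $N(0,V_0^{-1})$ as $n\to\infty$. In particular, this is true for the maximum likelihood estimator (a maximizer over $\Theta$ of $\theta\mapsto\iota_n(f_\theta)$) if $\theta_0$ is identifiable and interior to $\Theta$.
   Context: Preferential attachment (PA) tree with PA function $f:\mathbb{N}_+\to(0,\infty)$: at time $1$ there is a single node $v_1$, of degree $1$ (a root with a loose edge). Given the tree at time $n$ with nodes $v_1,\dots,v_n$ of degrees $d_1(n),\dots,d_n(n)$, a new node $v_{n+1}$ of degree $1$ is attached by an edge to the node $v_i$ with conditional probability $f(d_i(n))/\sum_{j=1}^n f(d_j(n))$ given the past; the degree of the chosen node increases by $1$. $N_k(n)$ is the number of nodes of degree $k$ at time $n$, $P_k(n)=N_k(n)/n$, $P_{>k}(n)=\sum_{l>k}P_l(n)$, and for a function $h$ on $\mathbb{N}_+$, $S_h(n)=\sum_{k}h(k)N_k(n)$. The scaled log-likelihood (up to a term free of $\theta$) and its gradient are $$\iota_n(f_\theta)=\sum_{k=1}^\infty \log f_\theta(k)\,P_{>k}(n)-\frac1n\sum_{t=2}^n\log S_{f_\theta}(t-1),\qquad \dot\iota_n(f_\theta)=\sum_{k=1}^\infty\frac{\dot f_\theta}{f_\theta}(k)P_{>k}(n)-\frac1n\sum_{t=2}^n\frac{S_{\dot f_\theta}(t-1)}{S_{f_\theta}(t-1)}.$$ The limiting degree distribution for PA function $f$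 is $p_k=\frac{\lambda^*}{\lambda^*+f(k)}\prod_{j=1}^{k-1}\frac{f(j)}{\lambda^*+f(j)}$, where the Malthusian parameter $\lambda^*>0$ solves $\sum_{l=1}^\infty\prod_{k=1}^l\frac{f(k)}{\lambda^*+f(k)}=1$; $p^{(0)}_k$ is $p_k$ for $f=f_{\theta_0}$ and $p^{(0)}_{>k}=\sum_{l>k}p^{(0)}_l$. $\theta_0$ is identifiable if for $\theta\in\Theta$: $f_\theta=cf_{\theta_0}$ on $\mathbb{N}_+$ for some constant $c$ iff $\theta=\theta_0$. $\|\cdot\|$ is the maximum absolute entry of a vector or matrix.
   Formalization: For general consistent solutions, it is additionally assumed that the segment from θ_0 to any point of Θ near θ_0 lies in Θ (automatic for θ_0 interior or Θ convex); for arbitrary compact Θ that claim fails. The likelihood equations need hold only with probability tending to one. *)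

(* Defs.v *)
From HB Require Import structures.
From mathcomp Require Import all_boot all_order all_algebra.
From mathcomp Require Import all_classical all_reals all_analysis.

Set Implicit Arguments.
Unset Strict Implicit.
Unset Printing Implicit Defensive.

Import Order.TTheory GRing.Theory Num.Theory.
Import numFieldNormedType.Exports.

Local Open Scope classical_set_scope.
Local Open Scope ring_scope.

Notation "\sum_ ( m <= i '<oo' ) F" :=
  (\big[+%R/0%R]_(m <= i <oo) F%R) : ring_scope.

Section PreferentialAttachmentTree.

(* Nodes are numbered from 0: the node [i] is v_(i+1).  If [a] is an attachment
   sequence, [a m] is the node to which v_(m+2) is attached, chosen among
   v_1, ..., v_(m+1); the tree at time n is determined by [a m], m < n - 1. *)
Definition attachments := forall m : nat, 'I_m.+1.

Definition deg (a : attachments) (n i : nat) : nat :=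
  (1 + \sum_(m < n.-1) (a m == i :> nat))%N.

Definition Ndeg (a : attachments) (n k : nat) : nat :=
  #|[set i : 'I_n | deg a n i == k]|.

Variable R : realType.

Definition Pdeg (a : attachments) (n k : nat) : R := (Ndeg a n k)%:R / n%:R.

Definition Pgt (a : attachments) (n k : nat) : R :=
  \sum_(k.+1 <= l <oo) Pdeg a n l.

Definition Ssum (V : normedModType R) (h : nat -> V) (a : attachments) (n : nat)
  : V := \sum_(1 <= k <oo) (h k *+ Ndeg a n k).

(* The conditional law of the next attachment given the past, written as
   P(past and choice) = P(past) * conditional probability of the choice. *)
Definition pa_tree (disp : measure_display) (T : measurableType disp)
    (P : probability T R) (f : nat -> R) (A : T -> attachments) : Prop :=
  (forall m (i : 'I_m.+1), measurable [set w | A w m = i]) /\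
  forall (n : nat) (a : attachments),
    P [set w | forall m, (m <= n)%N -> A w m = a m] =
    (P [set w | forall m, (m < n)%N -> A w m = a m] *
     (f (deg a n.+1 (a n)) / \sum_(j < n.+1) f (deg a n.+1 j))%:E)%E.

End PreferentialAttachmentTree.

Section LimitingDegreeDistribution.
Variables (R : realType) (f : nat -> R).

(* The positive solution is unique, because the terms of the series are
   strictly decreasing in the parameter. *)
Definition malthus : R :=
  get [set lam : R | 0 < lam /\
    (fun n => \sum_(1 <= l < n) \prod_(1 <= k < l.+1) (f k / (lam + f k)))
      @ \oo --> (1 : R)].

Definition plim (k : nat) : R :=
  malthus / (malthus + f k) * \prod_(1 <= j < k) (f j / (malthus + f j)).

Definition plim_gt (k : nat) : R := \sum_(k.+1 <= l <oo) plim l.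

End LimitingDegreeDistribution.

Section Calculus.
Variables (R : realType) (d : nat).
Implicit Types (g : 'rV[R]_d -> R) (x : 'rV[R]_d).

Definition partial g (i : 'I_d) x : R := 'D_(delta_mx 0 i) g x.

Definition gradient g x : 'rV[R]_d := \row_i partial g i x.

Definition hessian g x : 'M[R]_d := \matrix_(i, j) partial (partial g j) i x.

(* [g] is twice continuously differentiable on the (in general not open) set
   [A]: it is so on an open neighbourhood of [A]. *)
Definition C2_on (A : set 'rV[R]_d) g : Prop :=
  exists U : set 'rV[R]_d, [/\ open U, A `<=` U,
    forall x, U x -> differentiable g x,
    forall i x, U x -> differentiable (partial g i) x &
    forall i j x, U x -> {for x, continuous (partial (partial g j) i)}].

(* The segments from [x] to the nearby points of [A] stay in [A], so that
   functions controlled on [A] only can be expanded around [x]. This holds if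
   [x] is interior to [A], and if [A] is convex. *)
Definition star_shaped_near (A : set 'rV[R]_d) x : Prop :=
  exists2 e : R, 0 < e & forall y, A y -> `|y - x| < e ->
    forall s : R, 0 <= s <= 1 -> A (x + s *: (y - x)).

End Calculus.

Section Likelihood.
Variables (R : realType) (d : nat) (f : 'rV[R]_d -> nat -> R).
Implicit Types (theta : 'rV[R]_d) (a : attachments) (n : nat).

Definition fdot theta (k : nat) : 'rV[R]_d := gradient (f^~ k) theta.
Definition fddot theta (k : nat) : 'M[R]_d := hessian (f^~ k) theta.

Definition loglik a n theta : R :=
  \sum_(1 <= k <oo) (ln (f theta k) * Pgt R a n k)
  - n%:R^-1 * \sum_(2 <= t < n.+1) ln (Ssum (f theta) a t.-1).

Definition score a n theta : 'rV[R]_d :=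
  \sum_(1 <= k <oo) (Pgt R a n k *: ((f theta k)^-1 *: fdot theta k))
  - n%:R^-1 *: \sum_(2 <= t < n.+1)
      ((Ssum (f theta) a t.-1)^-1 *: Ssum (fdot theta) a t.-1).

(* Vectors are rows, so that the column-vector product v v^T reads
   [v^T *m v]. *)
Definition asym_info theta : 'M[R]_d :=
  let r k := (f theta k)^-1 *: fdot theta k in
  let m := \sum_(1 <= k <oo) (plim_gt (f theta) k *: r k) in
  \sum_(1 <= k <oo) (plim_gt (f theta) k *: ((r k)^T *m r k)) - m^T *m m.

Definition identifiable (Theta : set 'rV[R]_d) (theta0 : 'rV[R]_d) : Prop :=
  forall theta, Theta theta ->
    (exists c : R, forall k, (0 < k)%N -> f theta k = c * f theta0 k) <->
    theta = theta0.

End Likelihood.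

Section Convergence.
Variable R : realType.

(* E g(Z) for Z a row of d independent N(0,1) variables, as an iterated
   integral. *)
Fixpoint std_normal_expectation (d : nat) : ('rV[R]_d -> \bar R) -> \bar R :=
  match d with
  | 0 => fun g => g 0
  | d'.+1 => fun g => (\int[normal_prob (0 : R) 1]_x
      std_normal_expectation (fun v : 'rV[R]_d' => g (row_mx x%:M v)))%E
  end.

Variables (disp : measure_display) (T : measurableType disp).
Variables (P : probability T R) (d : nat).

(* N(0, Sigma) is the law of Z *m L, for Z a standard normal row and any L with
   L^T *m L = Sigma; it does not depend on the choice of L. *)
Definition cvg_in_distribution_normal (X : nat -> T -> 'rV[R]_d)
    (Sigma : 'M[R]_d) : Prop :=
  exists2 L : 'M[R]_d, L^T *m L = Sigma &
  forall g : 'rV[R]_d -> R, continuous g ->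
    (exists M : R, forall x, `|g x| <= M) ->
    (fun n => (\int[P]_w (g (X n w))%:E)%E) @ \oo -->
      std_normal_expectation (fun z => (g (z *m L))%:E).

Definition cvg_in_probability (X : nat -> T -> 'rV[R]_d) (x : 'rV[R]_d)
    : Prop :=
  forall e : R, 0 < e ->
    (fun n => P [set w | e <= `|X n w - x|]) @ \oo --> (0%E : \bar R).

Definition random_vectors (X : nat -> T -> 'rV[R]_d) : Prop :=
  forall n i, measurable_fun [set: T] (fun w => X n w 0 i).

End Convergence.

Section Estimators.
Variables (R : realType) (disp : measure_display) (T : measurableType disp).
Variables (P : probability T R) (d : nat) (A : T -> attachments).
Variables (f : 'rV[R]_d -> nat -> R) (Theta : set 'rV[R]_d).

(* In a given finite tree the likelihood equations may have no solution, so
   that they are only required to hold with probability tending to one. *)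
Definition solves_likelihood_equations (hat : nat -> T -> 'rV[R]_d) : Prop :=
  (fun n => P [set w | Theta (hat n w) /\ score f (A w) n (hat n w) = 0])
    @ \oo --> (1%E : \bar R).

Definition is_mle (hat : nat -> T -> 'rV[R]_d) : Prop :=
  forall n w, Theta (hat n w) /\
    forall theta, Theta theta ->
      loglik f (A w) n theta <= loglik f (A w) n (hat n w).

End Estimators.

(* Main.v *)
(* Under the true parameter, the counts N_k of nodes of degree k form a growth
   process whose mean matrix has the left eigenvector h (reproductive values) and
   the right eigenvector p, the limiting degree law. With u_k the ratio of N_k to
   its equilibrium value p_k sum_j h_j N_j, the bounded concave functional
   sum_k h_k p_k u_k / (1 + u_k) (a general relative entropy) is nearly
   increasing, and it increases strictly away from equilibrium. Since it cannot
   increase at a rate of order 1/n over a long window, u_k tends to 1 in L^1; with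
   moment bounds this gives sum_k w_k |P_k(n) - p_k| -> 0 in L^1 for weights w
   slightly larger than linear.

   The score at theta0 is a martingale, whose increments have conditional variances
   converging by this law of large numbers, and its characteristic function is
   followed one step at a time. Pointwise convergence of characteristic functions
   and tightness give convergence in law, because on a large box bounded continuous
   functions are approximated by trigonometric polynomials, obtained from the
   Bernstein operator in the variables sin x_i. The derivative of the score is,
   uniformly over Theta, within a multiple of the same L^1 error of its limit, which
   is continuous and equal to - V_0 at theta0; a mean value expansion between theta0
   and the estimator then identifies sqrt n (hat - theta0) V_0 with the normalized
   score.

   For the maximum likelihood estimator, the limit of iota_n(theta) - iota_n(theta0)
   is negative away from theta0 by the strict Jensen inequality and by
   identifiability, so that compactness of Theta gives consistency, and an interior
   maximizer solves the likelihood equations. *)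

Require Import Defs.
From HB Require Import structures.
From mathcomp Require Import all_boot all_order all_algebra.
From mathcomp Require Import all_classical all_reals all_analysis.
From mathcomp Require Import measurable_realfun.
From mathcomp Require Import ring lra zify.

Set Implicit Arguments.
Unset Strict Implicit.
Unset Printing Implicit Defensive.

Import Order.TTheory GRing.Theory Num.Theory.
Import numFieldNormedType.Exports.

Local Open Scope classical_set_scope.
Local Open Scope ring_scope.

(** * Attachment histories *)

Section Tree.
Implicit Types (a b : attachments) (m n i j k : nat).

(** Probability enters as finite weighted sums: an event about the first n attachments depends on
    finitely many choices, so that [expect] is a finite recursion, and [integral_law] is the bridge
    to the abstract space.

    The obstacle is integrability. When f(k) = k + alpha with alpha near -1, the limiting law has
    moments of order below 2 + alpha only. The power [d] in the controlled moment k^(1+d) is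
    therefore chosen after alpha, and the weight [b] = k^(d/4) absorbs the logarithms: a derivative
    of f divided by f costs one [b], a product of two costs two, and summing over the past degrees
    of a node costs a factor k.

    All limits are bounded through the one error [wdist] (with its running mean, [errbar]), with
    constants that do not depend on theta. This is what makes the random intermediate point of the
    mean value theorem and the maximization over Theta harmless. The limit identities rest on f(k)
    p_k = lam p_{>k}: the degree of a chosen node has asymptotically the law p_{>k}. *)

Definition upd a m i : attachments :=
  fun j => if j == m then inord i else a j.

Lemma upd_same a m i : (i < m.+1)%N -> upd a m i m = i :> nat.
Proof. by move=> im; rewrite /upd eqxx inordK. Qed.

Lemma upd_other a m i j : j != m -> upd a m i j = a j.
Proof. by rewrite /upd => /negPf ->. Qed.

Definition agree m a b := forall j, (j < m)%N -> a j = b j.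

(** Stands for measurability with respect to the first [m] attachments. *)
Definition determined (X : Type) m (phi : attachments -> X) :=
  forall a b, agree m a b -> phi a = phi b.

Lemma determinedW (X : Type) m n (phi : attachments -> X) :
  (m <= n)%N -> determined m phi -> determined n phi.
Proof. by move=> mn h a b ab; apply: h => j jm; apply: ab; exact: leq_trans mn. Qed.

Lemma agree_upd m i a : agree m (upd a m i) a.
Proof. by move=> j jm; rewrite upd_other // neq_ltn jm. Qed.

Lemma agree_updS m i a b : agree m a b -> agree m.+1 (upd a m i) (upd b m i).
Proof.
by move=> ab j; rewrite ltnS leq_eqVlt /upd => /orP[->//|jm];
  rewrite ab// ltn_eqF.
Qed.

Lemma agree_upd_id m a : agree m.+1 (upd a m (a m)) a.
Proof.
move=> j _; rewrite /upd; case: eqP => // ->.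
by apply: val_inj; rewrite /= inordK.
Qed.

Lemma degS a m j : deg a m.+2 j = (deg a m.+1 j + (a m == j :> nat))%N.
Proof. by rewrite /deg /= big_ord_recr /= addnA. Qed.

Lemma deg1 a i : deg a 1 i = 1%N.
Proof. by rewrite /deg big_ord0. Qed.

(** Targets precede the node being attached, so a node not yet born already has degree 1, its degree
    at birth; the new node needs no separate treatment in recursions. *)
Lemma deg_new a m i : (m <= i)%N -> deg a m.+1 i = 1%N.
Proof.
move=> mi; rewrite /deg /= big1 // => j _; apply/eqP; rewrite eqb0 neq_ltn.
by rewrite (leq_trans (ltn_ord (a j))) // (leq_trans _ mi).
Qed.

Lemma deg_gt0 a n i : (0 < deg a n i)%N. Proof. by []. Qed.

Lemma deg_le a n i : (deg a n.+1 i <= n.+1)%N.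
Proof.
rewrite /deg /= add1n ltnS -[leqRHS]card_ord -sum1_card leq_sum // => j _.
exact: leq_b1.
Qed.

Lemma eq_deg a b n i : agree n.-1 a b -> deg a n i = deg b n i.
Proof. by move=> ab; rewrite /deg; under eq_bigr do rewrite ab//. Qed.

Lemma deg_upd a m i j : (i < m.+1)%N ->
  deg (upd a m i) m.+2 j = (deg a m.+1 j + (i == j))%N.
Proof.
by move=> im; rewrite degS upd_same // (@eq_deg _ a)//; exact: agree_upd.
Qed.

Variable V : zmodType.
Implicit Type g : nat -> V.

Definition nsum g a n : V := \sum_(i < n) g (deg a n i).

Lemma eq_nsum a b g n : agree n.-1 a b -> nsum g a n = nsum g b n.
Proof. by move=> ab; apply: eq_bigr => i _; rewrite (eq_deg _ ab). Qed.

Lemma nsum1 g a : nsum g a 1 = g 1%N.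
Proof. by rewrite /nsum big_ord_recl big_ord0 addr0 deg1. Qed.

(** One degree increases by one and a leaf appears. The one-step recursions for counts, reproductive
    value and moments are all instances of this identity. *)
Lemma nsum_upd g a m i : (i < m.+1)%N ->
  nsum g (upd a m i) m.+2 =
  nsum g a m.+1 + (g (deg a m.+1 i).+1 - g (deg a m.+1 i)) + g 1%N.
Proof.
move=> im; rewrite /nsum big_ord_recr /= deg_upd // deg_new // (ltn_eqF im).
congr (_ + _); rewrite (bigD1 (Ordinal im)) //= deg_upd // eqxx addn1.
rewrite [in RHS](bigD1 (Ordinal im)) //= addrC addrAC addrCA subrr addr0 addrC.
congr (_ + _); apply: eq_bigr => j ji.
rewrite deg_upd //; case: eqP => [e|_]; rewrite ?addn0//.
by case/eqP: ji; apply: val_inj.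
Qed.

Lemma nsumS g a m : let D := deg a m.+1 (a m) in
  nsum g a m.+2 = nsum g a m.+1 + (g D.+1 - g D) + g 1%N.
Proof.
rewrite /= -(nsum_upd g a (ltn_ord (a m))).
by apply: eq_nsum => j jm; rewrite agree_upd_id.
Qed.

End Tree.

Section NodeSum.
Variable R : realType.
Implicit Types (a : attachments) (m n i j k : nat) (g : nat -> R).

Lemma eventually_zero_sum (V : normedModType R) (u : nat -> V) m n :
  (forall k, (n <= k)%N -> u k = 0) ->
  (fun N => \sum_(m <= k < N) u k) @ \oo --> \sum_(m <= k < n) u k.
Proof.
move=> u0; apply: cvg_near_cst; near=> N.
have nN : (n <= N)%N by near: N; exact: nbhs_infty_ge.
have [mn|nm] := leqP m n.
  rewrite (big_cat_nat mn nN)/= [X in _ + X]big_nat_cond [X in _ + X]big1 ?addr0//.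
  by move=> k /andP[/andP[nk _] _]; exact: u0.
rewrite [RHS]big_geq ?(ltnW nm)// big_nat_cond big1 // => k /andP[/andP[mk _] _].
by apply: u0; apply: leq_trans mk; exact: ltnW.
Unshelve. all: by end_near. Qed.

Lemma NdegE a n k : Ndeg a n k = (\sum_(i < n) (deg a n i == k))%N.
Proof.
rewrite /Ndeg -sum1_card big_mkcond /=; apply: eq_bigr => i _.
by rewrite unfold_in /= asboolb; case: (_ == _).
Qed.

Lemma sum_Ndeg (V : zmodType) (h : nat -> V) a n :
  \sum_(1 <= k < n.+1) h k *+ Ndeg a n k = nsum h a n.
Proof.
rewrite /nsum.
under eq_bigr => k _ do rewrite NdegE -sumrMnr.
rewrite exchange_big /=; apply: eq_bigr => i _.
case: n i => [[]//|n] i.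
rewrite (bigD1_seq (deg a n.+1 i)) ?iota_uniq//=; last first.
  by rewrite mem_index_iota deg_gt0 ltnS deg_le.
rewrite eqxx mulr1n big1 ?addr0// => k kd.
by rewrite eq_sym (negPf kd) mulr0n.
Qed.

Lemma Ndeg_big a n k : (n < k)%N -> Ndeg a n k = 0%N.
Proof.
move=> nk; rewrite NdegE big1 // => i _.
case: n nk i => [|n] nk i; first by case: i.
by rewrite ltn_eqF// (leq_trans _ nk)// ltnS deg_le.
Qed.

Lemma SsumE (V : normedModType R) (h : nat -> V) a n :
  Ssum h a n = nsum h a n.
Proof.
rewrite -sum_Ndeg /Ssum; apply/cvg_lim => //.
by apply: eventually_zero_sum => k nk; rewrite Ndeg_big ?mulr0n.
Qed.

Lemma nsumD g g' a n : nsum (fun k => g k + g' k) a n = nsum g a n + nsum g' a n.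
Proof. by rewrite /nsum big_split. Qed.

Lemma nsumZ c g a n : nsum (fun k => c * g k) a n = c * nsum g a n.
Proof. by rewrite /nsum mulr_sumr. Qed.

Lemma ler_nsum g g' a n : (forall k, (0 < k)%N -> g k <= g' k) ->
  nsum g a n <= nsum g' a n.
Proof. by move=> gg'; apply: ler_sum => i _; exact: gg'. Qed.

Lemma eq_nsum_fun g g' a n : (forall k, (0 < k)%N -> g k = g' k) ->
  nsum g a n = nsum g' a n.
Proof. by move=> gg'; apply: eq_bigr => i _; exact: gg'. Qed.

Lemma nsum_cst (c : R) a n : nsum (fun=> c) a n = c * n%:R.
Proof. by rewrite /nsum sumr_const card_ord mulr_natr. Qed.

Lemma nsum_ge0 g a n : (forall k, (0 < k)%N -> 0 <= g k) -> 0 <= nsum g a n.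
Proof. by move=> g0; apply: sumr_ge0 => i _; exact: g0. Qed.

(** There are [n] edges, each counted twice, and the loose edge of the root. *)
Lemma nsum_id a n : nsum (fun k => k%:R : R) a n.+1 = 2 * n%:R + 1.
Proof.
elim: n => [|n IH]; first by rewrite nsum1 mulr0 add0r.
by rewrite nsumS /= IH -!natr1; ring.
Qed.

End NodeSum.

(** * Expectation over finite histories and law of the tree *)

Section Expectation.
Variables (R : realType) (f : nat -> R).
Hypothesis f_gt0 : forall k, (0 < k)%N -> 0 < f k.
Implicit Types (a b : attachments) (m n i j k : nat) (phi psi : attachments -> R).

Definition choice_prob m a i : R := f (deg a m.+1 i) / nsum f a m.+1.

Definition cond_exp m phi a : R :=
  \sum_(i < m.+1) choice_prob m a i * phi (upd a m i).

(** Attachments are averaged from the last to the first. If [phi] is [determined m] this is its mean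
    ([integral_law]), and the history [fun=> ord0] of the base case is then immaterial. *)
Fixpoint expect m phi : R :=
  if m is m'.+1 then expect m' (cond_exp m' phi) else phi (fun=> ord0).

Lemma nsum_gt0 a m : 0 < nsum f a m.+1.
Proof.
rewrite /nsum big_ord_recl /= ltr_pwDl ?f_gt0// sumr_ge0// => i _.
exact/ltW/f_gt0.
Qed.

Lemma choice_prob_ge0 m a i : 0 <= choice_prob m a i.
Proof. by rewrite divr_ge0// ltW ?nsum_gt0 ?f_gt0. Qed.

Lemma choice_prob_sum m a : \sum_(i < m.+1) choice_prob m a i = 1.
Proof. by rewrite -mulr_suml divff// gt_eqF// nsum_gt0. Qed.

Lemma eq_choice_prob m a b i : agree m a b ->
  choice_prob m a i = choice_prob m b i.
Proof.
by move=> ab; rewrite /choice_prob (eq_nsum _ (n := m.+1) ab) (eq_deg i (n := m.+1) ab).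
Qed.

Lemma cond_expD m phi psi a :
  cond_exp m (fun a => phi a + psi a) a = cond_exp m phi a + cond_exp m psi a.
Proof. by rewrite /cond_exp -big_split; apply: eq_bigr => i _; rewrite mulrDr. Qed.

Lemma cond_expMl m phi psi a : determined m psi ->
  cond_exp m (fun a => psi a * phi a) a = psi a * cond_exp m phi a.
Proof.
move=> dpsi; rewrite /cond_exp mulr_sumr; apply: eq_bigr => i _.
by rewrite mulrCA (dpsi _ a)//; exact: agree_upd.
Qed.

Lemma cond_exp_id m phi a : determined m phi -> cond_exp m phi a = phi a.
Proof.
move=> dphi; rewrite -[RHS]mul1r -(choice_prob_sum m a) mulr_suml.
by apply: eq_bigr => i _; rewrite (dphi _ a)//; exact: agree_upd.
Qed.

Lemma ler_cond_exp m phi psi a :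
  (forall i, (i < m.+1)%N -> phi (upd a m i) <= psi (upd a m i)) ->
  cond_exp m phi a <= cond_exp m psi a.
Proof.
by move=> h; apply: ler_sum => i _; rewrite ler_wpM2l ?choice_prob_ge0 ?h.
Qed.

(** A quantity that sees the next attachment through the degree of the chosen node only has as
    conditional mean a ratio of two tree sums, to which the law of large numbers applies. *)
Lemma cond_exp_choice m phi a (F : nat -> R) :
  (forall i, (i < m.+1)%N -> phi (upd a m i) = F (deg a m.+1 i)) ->
  cond_exp m phi a = nsum (fun k => f k * F k) a m.+1 / nsum f a m.+1.
Proof.
move=> h; rewrite /cond_exp /choice_prob [in RHS]/nsum mulr_suml.
by apply: eq_bigr => i _; rewrite h// mulrAC.
Qed.

Lemma expectD m phi psi :
  expect m (fun a => phi a + psi a) = expect m phi + expect m psi.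
Proof.
elim: m phi psi => //= m IH phi psi; rewrite -IH; congr (expect m _).
by apply/funext => a; exact: cond_expD.
Qed.

Lemma expectZ m (c : R) phi : expect m (fun a => c * phi a) = c * expect m phi.
Proof.
elim: m phi => //= m IH phi; rewrite -IH; congr (expect m _).
by apply/funext => a; exact: cond_expMl.
Qed.

Lemma expect_cst m (c : R) : expect m (fun=> c) = c.
Proof.
elim: m => //= m IH; rewrite -[RHS]IH; congr (expect m _).
by apply/funext => a; exact: cond_exp_id.
Qed.

Lemma expectB m phi psi :
  expect m (fun a => phi a - psi a) = expect m phi - expect m psi.
Proof.
rewrite -mulN1r -expectZ -expectD; congr (expect m _).
by apply/funext => a; rewrite mulN1r.
Qed.

Lemma ler_expect m phi psi :
  (forall a, phi a <= psi a) -> expect m phi <= expect m psi.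
Proof.
elim: m phi psi => [|m IH] phi psi h /=; first exact: h.
by apply: IH => a; apply: ler_cond_exp => i _; exact: h.
Qed.

Lemma expect_ge0 m phi : (forall a, 0 <= phi a) -> 0 <= expect m phi.
Proof. by move=> h; rewrite -(expect_cst m 0); exact: ler_expect. Qed.

Lemma ler_norm_expect m phi : `|expect m phi| <= expect m (fun a => `|phi a|).
Proof.
rewrite ler_norml -[X in X <= _]mulN1r -expectZ !ler_expect// => a.
  exact: ler_norm.
by rewrite mulN1r lerNl -normrN ler_norm.
Qed.

Lemma expect_sum m (I : Type) (r : seq I) (phi : I -> attachments -> R) :
  expect m (fun a => \sum_(i <- r) phi i a) = \sum_(i <- r) expect m (phi i).
Proof.
elim: r => [|i r IH].
  by rewrite big_nil -[RHS](expect_cst m 0); congr (expect m _); apply/funext => a;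
    rewrite big_nil.
rewrite big_cons -IH -expectD; congr (expect m _); apply/funext => a.
by rewrite big_cons.
Qed.

Lemma expectS m phi : determined m phi -> expect m.+1 phi = expect m phi.
Proof.
move=> dphi; congr (expect m _); apply/funext => a; exact: cond_exp_id.
Qed.

Lemma expect_widen m n phi :
  (m <= n)%N -> determined m phi -> expect n phi = expect m phi.
Proof.
move=> /subnK <- dphi; elim: (n - m)%N => // k IH; rewrite addSn expectS//.
by apply: determinedW dphi; rewrite leq_addl.
Qed.

End Expectation.

Section Law.
Variables (R : realType) (f : nat -> R).
Hypothesis f_gt0 : forall k, (0 < k)%N -> 0 < f k.
Variables (disp : measure_display) (T : measurableType disp).
Variables (P : probability T R) (A : T -> attachments).
Hypothesis A_pa : pa_tree P f A.
Implicit Types (a b : attachments) (m n i j k : nat).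

Lemma choice_measurable m i : (i < m.+1)%N -> measurable [set w | A w m = i :> nat].
Proof.
move=> im; have [/(_ m (Ordinal im)) + _] := A_pa; congr measurable.
by apply/seteqP; split=> w /=; [move=> ->|move=> e; exact: val_inj].
Qed.

(** Split on the finitely many values of the last attachment and freeze it with [upd], which leaves
    a property of the earlier ones. *)
Lemma determined_measurable m (Q : attachments -> Prop) :
  determined m Q -> measurable [set w | Q (A w)].
Proof.
elim: m Q => [|m IH] Q dQ.
  have [q|nq] := pselect (Q (fun=> ord0)).
    rewrite (_ : [set _ | _] = setT)//; apply/seteqP; split => w //= _.
    by rewrite (dQ _ (fun=> ord0)).
  rewrite (_ : [set _ | _] = set0)//; apply/seteqP; split => w //= qw; apply: nq.
  by rewrite -(dQ (A w)).
rewrite (_ : [set _ | _] = \bigcup_(i in `I_m.+1)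
    ([set w | A w m = i :> nat] `&` [set w | Q (upd (A w) m i)])); last first.
  apply/seteqP; split => w /=.
    move=> Qw; exists (A w m); rewrite /= ?ltn_ord//; split => //.
    by rewrite (dQ _ (A w))//; exact: agree_upd_id.
  move=> [i im [<-]] /=; rewrite (dQ (upd (A w) m (A w m)) (A w))//.
  exact: agree_upd_id.
apply: bigcup_measurable => i /= im; apply: measurableI.
  exact: choice_measurable.
apply: (IH (fun a => Q (upd a m i))) => a b ab; apply: dQ; exact: agree_updS.
Qed.

Lemma determined_measurable_fun m (phi : attachments -> R) :
  determined m phi -> measurable_fun [set: T] (fun w => phi (A w)).
Proof.
move=> dphi _ Y _; rewrite setTI.
apply: (@determined_measurable m (fun a => Y (phi a))) => a b ab.
by rewrite (dphi a b).
Qed.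

Definition history m a : set T := [set w | agree m (A w) a].

Lemma history_measurable m a : measurable (history m a).
Proof.
apply: (@determined_measurable m (fun b => agree m b a)) => b b' bb'.
by apply/propext; split => h j jm; [rewrite -bb'|rewrite bb']; rewrite ?h.
Qed.

Lemma historyS m a : history m a =
  \big[setU/set0]_(i < m.+1) history m.+1 (upd a m i).
Proof.
rewrite -(bigcup_mkord m.+1 (fun i => history m.+1 (upd a m i))).
apply/seteqP; split => w.
  move=> h; exists (A w m); rewrite /= ?ltn_ord// => j jm.
  rewrite /upd; case: eqP => [->|/eqP jn].
    by apply: val_inj; rewrite /= inordK.
  by apply: h; rewrite ltn_neqAle jn.
move=> [i /= im] h j jm; rewrite h ?(ltnW jm)//.
  by rewrite upd_other// ltn_eqF.
by rewrite ltnS ltnW.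
Qed.

Lemma trivIset_history m a : trivIset `I_m.+1 (fun i => history m.+1 (upd a m i)).
Proof.
move=> i j /= im jm [w [hi hj]].
by rewrite -(upd_same a im) -(upd_same a jm) -hi// -hj.
Qed.

Lemma history_prob m a i : (i < m.+1)%N ->
  P (history m.+1 (upd a m i)) = (P (history m a) * (choice_prob f m a i)%:E)%E.
Proof.
move=> im; have [_ /(_ m (upd a m i)) h] := A_pa.
rewrite (eq_choice_prob _ _ (b := upd a m i)); last first.
  by move=> j jm; rewrite agree_upd.
rewrite [LHS]h upd_same//; congr (P _ * _)%E.
apply/seteqP; split => w /= hw j jm; rewrite hw// ?agree_upd//.
Qed.

(** [expect] peels off the last attachment, whereas a history is refined by its next one. This
    forward recursion from a known history takes the second point of view, and [hist_expS]
    reconciles the two. *)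
Fixpoint hist_exp n m (phi : attachments -> R) a : R :=
  if n is n'.+1 then cond_exp f m (hist_exp n' m.+1 phi) a else phi a.

Lemma hist_expS n m phi :
  hist_exp n.+1 m phi = hist_exp n m (cond_exp f (m + n) phi).
Proof.
elim: n m => [|n IH] m; first by rewrite addn0.
apply/funext => a; rewrite [LHS]/= -/(hist_exp n.+1 m.+1 phi) IH /=.
by rewrite addSnnS.
Qed.

Lemma expect_hist n phi : expect f n phi = hist_exp n 0 phi (fun=> ord0).
Proof. by elim: n phi => // n IH phi; rewrite hist_expS /= IH. Qed.

(** A history is the disjoint union of its [m.+1] one-step continuations, whose probabilities are
    prescribed by [pa_tree]. *)
Lemma integral_history n m (phi : attachments -> R) a :
  determined (m + n) phi ->
  (\int[P]_(w in history m a) (phi (A w))%:E =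
   P (history m a) * (hist_exp n m phi a)%:E)%E.
Proof.
elim: n m a => [|n IH] m a dphi.
  rewrite addn0 in dphi.
  rewrite -[RHS]muleC -integral_cst; last exact: history_measurable.
  by apply: eq_integral => w; rewrite inE => /dphi ->.
rewrite [in LHS]historyS -(big_mkord xpredT (fun i => history m.+1 (upd a m i))).
rewrite integral_bigsetU_EFin ?iota_uniq//=; first last.
- apply: measurable_funS (subsetT _) _ => //.
  exact/measurable_realfun.measurable_EFinP/(determined_measurable_fun dphi).
- move=> i j; rewrite /= !mem_index_iota /= => im jm; exact: trivIset_history.
- by move=> i; exact: history_measurable.
have [p Pp] : exists p : R, P (history m a) = p%:E.
  exists (fine (P (history m a))); rewrite fineK//.
  by apply: fin_num_measure; exact: history_measurable.
rewrite big_mkord Pp -EFinM /cond_exp mulr_sumr -sumEFin.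
apply: eq_bigr => i _; rewrite IH ?addSnnS// history_prob//.
by rewrite [X in (X * _ * _)%E]Pp -muleA.
Qed.

Lemma integral_law m (phi : attachments -> R) : determined m phi ->
  (\int[P]_w (phi (A w))%:E = (expect f m phi)%:E)%E.
Proof.
move=> dphi; rewrite expect_hist -[RHS]mul1e -(@probability_setT _ _ _ P).
rewrite (_ : setT = history 0 (fun=> ord0)).
  by rewrite (@integral_history m 0).
by apply/seteqP; split.
Qed.

(** Markov's inequality, with the mean computed by [expect]. *)
Lemma prob_law_le m (phi : attachments -> R) (e : R) : 0 < e ->
  determined m phi -> (forall a, 0 <= phi a) ->
  (P [set w | (e <= phi (A w))%R] <= (expect f m phi / e)%:E)%E.
Proof.
move=> e0 dphi phi0.
have dS : determined m (fun a => (if e <= phi a then 1 else 0) : R).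
  by move=> a b ab; rewrite (dphi _ _ ab).
rewrite (_ : P _ = (expect f m (fun a => if e <= phi a then 1 else 0))%:E).
  rewrite lee_fin ler_pdivlMr// mulrC -expectZ ler_expect// => a.
  by case: ifPn => [h|_]; rewrite ?mulr1// mulr0.
rewrite -integral_law//.
rewrite -[X in P X]setIT -integral_indic//; last first.
  apply: (@determined_measurable m (fun a => e <= phi a)) => a b ab.
  by rewrite (dphi _ _ ab).
apply: eq_integral => w _; rewrite indicE; case: ifPn => h.
  by rewrite mem_set.
by rewrite memNset//; exact/negP.
Qed.

End Law.

(** * The limiting degree law *)

Section Summable.
Variable R : realType.
Implicit Types (u v : nat -> R).

Definition summable1 u := cvgn (fun n => \sum_(1 <= k < n) u k).

Lemma ge0_partial_sum_nd u : (forall k, (0 < k)%N -> 0 <= u k) ->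
  nondecreasing_seq (fun n => \sum_(1 <= k < n) u k).
Proof.
move=> u0; apply/nondecreasing_seqP => -[|n]; first by rewrite !big_geq.
by rewrite [leRHS]big_nat_recr //= lerDl u0.
Qed.

Lemma ge0_summable1 u M : (forall k, (0 < k)%N -> 0 <= u k) ->
  (forall n, \sum_(1 <= k < n) u k <= M) -> summable1 u.
Proof.
move=> u0 uM; apply: nondecreasing_is_cvgn; first exact: ge0_partial_sum_nd.
by exists M => _ [n _ <-]; exact: uM.
Qed.

Lemma ge0_partial_le_sum u n : (forall k, (0 < k)%N -> 0 <= u k) ->
  summable1 u -> \sum_(1 <= k < n) u k <= \sum_(1 <= k <oo) u k.
Proof. by move=> u0 su; apply: nondecreasing_cvgn_le => //; exact: ge0_partial_sum_nd. Qed.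

Lemma ge0_sum_le u M : (forall n, \sum_(1 <= k < n) u k <= M) ->
  summable1 u -> \sum_(1 <= k <oo) u k <= M.
Proof. by move=> uM su; apply: limr_le => //; exact: nearW. Qed.

Lemma summable1D u v : summable1 u -> summable1 v -> summable1 (fun k => u k + v k).
Proof.
move=> su sv; rewrite /summable1; under eq_fun do rewrite big_split /=.
exact: is_cvgD.
Qed.

Lemma sum1D u v : summable1 u -> summable1 v ->
  \sum_(1 <= k <oo) (u k + v k) = \sum_(1 <= k <oo) u k + \sum_(1 <= k <oo) v k.
Proof.
by move=> su sv; under eq_fun do rewrite big_split /=; exact: limD.
Qed.

Lemma summable1Z (c : R) u : summable1 u -> summable1 (fun k => c * u k).
Proof.
move=> su; rewrite /summable1; under eq_fun do rewrite -mulr_sumr.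
exact: is_cvgMr.
Qed.

Lemma sum1Z (c : R) u : summable1 u ->
  \sum_(1 <= k <oo) (c * u k) = c * \sum_(1 <= k <oo) u k.
Proof.
move=> su; apply/cvg_lim => //; under eq_fun do rewrite -mulr_sumr.
by apply: cvgM => //; exact: cvg_cst.
Qed.

Lemma eq_summable1 u v : (forall k, (0 < k)%N -> u k = v k) ->
  summable1 u -> summable1 v.
Proof.
move=> uv; rewrite /summable1 (_ : (fun n => \sum_(1 <= k < n) u k) =
  (fun n => \sum_(1 <= k < n) v k))//; apply/funext => n.
by apply: eq_big_nat => k /andP[k0 _]; rewrite uv.
Qed.

Lemma eq_sum1 (V : normedModType R) (u v : nat -> V) :
  (forall k, (0 < k)%N -> u k = v k) ->
  \sum_(1 <= k <oo) u k = \sum_(1 <= k <oo) v k.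
Proof.
move=> uv; rewrite (_ : (fun n => \sum_(1 <= k < n) u k) =
  (fun n => \sum_(1 <= k < n) v k))//; apply/funext => n.
by apply: eq_big_nat => k /andP[k0 _]; rewrite uv.
Qed.

Lemma le_summable1 u v : (forall k, (0 < k)%N -> `|u k| <= v k) ->
  summable1 v -> summable1 u.
Proof.
move=> uv sv.
have v0 k : (0 < k)%N -> 0 <= v k by move=> /uv; exact: le_trans.
have sa : summable1 (fun k => u k + v k).
  apply: (@ge0_summable1 _ (2 * \sum_(1 <= k <oo) v k)) => [k k0|n].
    by have := uv k k0; rewrite ler_norml => /andP[]; lra.
  apply: (@le_trans _ _ (2 * \sum_(1 <= k < n) v k)).
    rewrite mulr_sumr big_nat_cond [leRHS]big_nat_cond ler_sum // => k.
    by rewrite andbT => /andP[k0 _]; have := uv k k0; rewrite ler_norml => /andP[]; lra.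
  by rewrite ler_pM2l// ge0_partial_le_sum.
have := summable1D sa (summable1Z (c := -1) sv).
by apply: eq_summable1 => k _; lra.
Qed.

Lemma ler_norm_sum1 u v : (forall k, (0 < k)%N -> `|u k| <= v k) ->
  summable1 v -> `|\sum_(1 <= k <oo) u k| <= \sum_(1 <= k <oo) v k.
Proof.
move=> uv sv; have su := le_summable1 uv sv.
have v0 k : (0 < k)%N -> 0 <= v k by move=> /uv; exact: le_trans.
have : (fun n => `|\sum_(1 <= k < n) u k|) @ \oo --> `|\sum_(1 <= k <oo) u k|.
  exact: cvg_norm.
move=> /cvg_lim <- //; apply: limr_le; first exact: is_cvg_norm.
apply: nearW => n; apply: le_trans (ge0_partial_le_sum n v0 sv).
apply: le_trans (ler_norm_sum _ _ _) _.
rewrite big_nat_cond [leRHS]big_nat_cond ler_sum // => k.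
by rewrite andbT => /andP[k0 _]; exact: uv.
Qed.

Lemma summable1_tail u : summable1 u -> forall e, 0 < e -> exists K, forall n,
  (K <= n)%N -> `|\sum_(1 <= k <oo) u k - \sum_(1 <= k < n) u k| <= e.
Proof.
move=> su e e0; have /cvgrPdist_le /(_ e e0) [K _ h] : _ --> _ := su.
by exists K => n; exact: h.
Qed.

Lemma ge0_tail_cut u : (forall k, (0 < k)%N -> 0 <= u k) -> summable1 u ->
  forall e, 0 < e -> exists K, forall m n, (K <= m)%N -> \sum_(m <= k < n) u k <= e.
Proof.
move=> u0 su e e0; have [K h] := summable1_tail su e0.
exists K.+1 => m n Km.
have [mn|nm] := leqP m n; last by rewrite big_geq ?ltW// ltnW.
have := h m (ltnW Km); rewrite ler_norml => /andP[_].
have := ge0_partial_le_sum n u0 su.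
rewrite (@big_cat_nat _ _ _ m 1%N n) //=; last exact: leq_trans Km.
lra.
Qed.

Lemma summable1B u v : summable1 u -> summable1 v -> summable1 (fun k => u k - v k).
Proof.
move=> su sv; rewrite /summable1; under eq_fun do rewrite big_split /= sumrN.
exact: is_cvgB.
Qed.

Lemma sum1B u v : summable1 u -> summable1 v ->
  \sum_(1 <= k <oo) (u k - v k) = \sum_(1 <= k <oo) u k - \sum_(1 <= k <oo) v k.
Proof.
by move=> su sv; under eq_fun do rewrite big_split /= sumrN; exact: limB.
Qed.

End Summable.
Arguments summable1 {R}.

(** * Survival function and reproductive values *)

Section Spectral.
Variables (R : realType) (f : nat -> R) (lam : R).
Hypothesis f_gt0 : forall k, (0 < k)%N -> 0 < f k.
Hypothesis lam_gt0 : 0 < lam.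

(* p_{>k} and p_k of the limiting degree law with Malthusian parameter [lam]. *)
Definition surv k : R := \prod_(1 <= j < k.+1) (f j / (lam + f j)).
Definition pdist k : R := lam / (lam + f k) * surv k.-1.

Lemma surv0 : surv 0 = 1. Proof. by rewrite /surv big_geq. Qed.

Lemma survS k : surv k.+1 = surv k * (f k.+1 / (lam + f k.+1)).
Proof. by rewrite /surv big_nat_recr. Qed.

Lemma lamf_gt0 k : (0 < k)%N -> 0 < lam + f k.
Proof. by move=> k0; rewrite addr_gt0 ?f_gt0. Qed.

Lemma surv_gt0 k : 0 < surv k.
Proof.
elim: k => [|k IH]; first by rewrite surv0.
by rewrite survS mulr_gt0// divr_gt0 ?f_gt0 ?lamf_gt0.
Qed.

Lemma pdistE k : pdist k.+1 = surv k - surv k.+1.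
Proof.
rewrite survS /pdist /=; have := lamf_gt0 (ltn0Sn k).
by move=> /lt0r_neq0 h; field.
Qed.

Lemma f_pdist k : (0 < k)%N -> f k * pdist k = lam * surv k.
Proof.
case: k => // k _; rewrite survS /pdist /=; have := lamf_gt0 (ltn0Sn k).
by move=> /lt0r_neq0 h; field.
Qed.

Lemma lamf_pdist k : (lam + f k.+1) * pdist k.+1 = lam * surv k.
Proof.
rewrite /pdist /=; have := lamf_gt0 (ltn0Sn k).
by move=> /lt0r_neq0 h; field.
Qed.

Lemma pdist_gt0 k : (0 < k)%N -> 0 < pdist k.
Proof. by move=> k0; rewrite mulr_gt0 ?surv_gt0// divr_gt0 ?lamf_gt0. Qed.

Lemma pdist_partial n : \sum_(1 <= k < n.+1) pdist k = 1 - surv n.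
Proof.
elim: n => [|n IH]; first by rewrite big_geq// surv0 subrr.
by rewrite big_nat_recr//= IH pdistE; ring.
Qed.

(** Summation by parts, [pdist] being the decrement of [surv]. *)
Lemma mean_partial n : \sum_(1 <= k < n.+2) k%:R * pdist k =
  1 + \sum_(1 <= k < n.+1) surv k - n.+1%:R * surv n.+1.
Proof.
elim: n => [|n IH].
  by rewrite big_nat1 big_geq// pdistE surv0; ring.
by rewrite big_nat_recr//= IH pdistE [in RHS]big_nat_recr//= -[n.+2%:R]natr1; ring.
Qed.

(** The hypothesis says that g(k) = A k + B satisfies (lam + f k) g(k) >= f k (g(k+1) + 1), so that
    g is a supersolution of the equation in [rval_rec]; multiplied by [surv], the inequality
    telescopes. *)
Lemma surv_supersol A B : (forall k, (0 < k)%N -> (A + 1) * f k <= lam * (A * k%:R + B)) ->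
  forall k n, \sum_(k.+1 <= l < k.+1 + n) surv l + surv (k + n) * (A * (k + n).+1%:R + B)
    <= surv k * (A * k.+1%:R + B).
Proof.
move=> AB k; elim=> [|n IH]; first by rewrite !addn0 big_geq// add0r.
rewrite addnS big_nat_recr ?leq_addr//= -addrA; apply: le_trans IH; rewrite lerD2l.
rewrite addSn addnS survS -[X in X + _]mulr1 -mulrDr -mulrA ler_pM2l ?surv_gt0//.
set m := (k + n).+1; have m0 : (0 < m)%N by [].
rewrite mulrAC ler_pdivrMr ?lamf_gt0//; have := AB _ m0.
by rewrite -natr1; set x := f m; set y := m%:R; nra.
Qed.

Hypothesis malth : (fun n => \sum_(1 <= l < n) surv l) @ \oo --> (1 : R).

Lemma surv_partial_lt1 n : \sum_(1 <= l < n) surv l <= 1.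
Proof.
have <- := cvg_lim (@Rhausdorff _) malth.
apply: nondecreasing_cvgn_le; last by apply/cvg_ex; exists 1.
by apply: ge0_partial_sum_nd => k _; exact/ltW/surv_gt0.
Qed.

(* The expected discounted number of future children of a node of degree [k]:
   a left eigenvector, for the eigenvalue [lam], of the mean matrix of the growth
   process. *)
Definition rval k : R := (1 - \sum_(1 <= l < k) surv l) / surv k.-1.

Lemma rval1 : rval 1 = 1.
Proof. by rewrite /rval big_geq//= surv0 subr0 divr1. Qed.

Lemma rval_rec k : (0 < k)%N -> rval k * (lam + f k) = f k * (rval k.+1 + 1).
Proof.
case: k => // k _; rewrite /rval /= (big_nat_recr k.+1) //= survS.
have := lt0r_neq0 (lamf_gt0 (ltn0Sn k)); have := lt0r_neq0 (surv_gt0 k).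
have := lt0r_neq0 (f_gt0 (ltn0Sn k)) => h1 h2 h3.
by field; rewrite h1 h2 h3.
Qed.

(** Only the first term of the remaining series is kept in the numerator of [rval]. *)
Lemma rval_ge k : (0 < k)%N -> f k / (lam + f k) <= rval k.
Proof.
case: k => // k _; rewrite /rval /= ler_pdivlMr ?surv_gt0// mulrC -survS.
by rewrite lerBrDr addrC -big_nat_recr//= surv_partial_lt1.
Qed.

Lemma rval_gt0 k : (0 < k)%N -> 0 < rval k.
Proof.
by move=> k0; apply: lt_le_trans (rval_ge k0); rewrite divr_gt0 ?f_gt0 ?lamf_gt0.
Qed.

(** An affine supersolution dominates the tail series that defines [rval]. *)
Lemma rval_le A B : 0 <= A -> 0 <= B ->
  (forall k, (0 < k)%N -> (A + 1) * f k <= lam * (A * k%:R + B)) ->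
  forall k, (0 < k)%N -> rval k <= A * k%:R + B.
Proof.
move=> A0 B0 AB [//|k] _; rewrite /rval /= ler_pdivrMr ?surv_gt0// mulrC.
rewrite lerBlDr -[leLHS](cvg_lim (@Rhausdorff _) malth).
apply: limr_le; first by apply/cvg_ex; exists 1.
near=> n; have kn : (k.+1 <= n)%N by near: n; exact: nbhs_infty_ge.
rewrite (big_cat_nat _ kn)//= addrC lerD2r.
apply: le_trans (surv_supersol AB k (n - k.+1)).
rewrite subnKC// lerDl mulr_ge0 ?(ltW (surv_gt0 _))//.
by rewrite addr_ge0// mulr_ge0.
Unshelve. all: by end_near. Qed.

(** By parts, the partial means are at most 1 plus the sum of [surv], that is 2: a tree has about
    two half-edges per node. *)
Lemma mean_summable : summable1 (fun k => k%:R * pdist k).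
Proof.
apply: (@ge0_summable1 _ _ 2) => [k k0|].
  by rewrite mulr_ge0// ltW// pdist_gt0.
move=> [|[|n]]; [by rewrite big_geq|by rewrite big_geq|].
rewrite mean_partial; have := surv_partial_lt1 n.+1.
have : 0 <= n.+1%:R * surv n.+1 by rewrite mulr_ge0// ltW// surv_gt0.
lra.
Qed.

Lemma surv_cvg0 : surv @ \oo --> (0 : R).
Proof.
have sm : summable1 surv by apply/cvg_ex; exists 1.
apply/cvgrPdist_le => e e0.
have [K h] := ge0_tail_cut (fun k _ => ltW (surv_gt0 k)) sm e0.
near=> n; rewrite sub0r normrN gtr0_norm ?surv_gt0//.
have := h n n.+1; rewrite big_nat1; apply.
by near: n; exact: nbhs_infty_ge.
Unshelve. all: by end_near. Qed.

Lemma pdist_cvg1 : (fun n => \sum_(1 <= k < n) pdist k) @ \oo --> (1 : R).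
Proof.
rewrite -(cvg_shiftS (fun n => \sum_(1 <= k < n) pdist k)) /=.
under eq_fun do rewrite pdist_partial.
have := cvgB (cvg_cst (1 : R)) surv_cvg0; rewrite subr0; exact.
Qed.

(** k p_{>k} is at most the sum of j p_j over j > k, the tail of a convergent series. *)
Lemma surv_linear_cvg0 (e : R) : 0 < e ->
  exists K, forall k, (K <= k)%N -> k%:R * surv k <= e.
Proof.
move=> e0.
have u0 k : (0 < k)%N -> 0 <= k%:R * pdist k.
  by move=> k0; rewrite mulr_ge0// ltW// pdist_gt0.
have [K h] := ge0_tail_cut u0 mean_summable e0.
exists K => k Kk.
have cv : (fun n => k%:R * (surv k - surv n)) @ \oo --> (k%:R * (surv k - 0)).
  apply: cvgM; first exact: cvg_cst.
  by apply: cvgB; [exact: cvg_cst|exact: surv_cvg0].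
rewrite -[surv k]subr0 -(cvg_lim (@Rhausdorff _) cv); apply: limr_le.
  by apply/cvg_ex; eexists; exact: cv.
near=> n; have kn : (k <= n)%N by near: n; exact: nbhs_infty_ge.
apply: le_trans (h k.+1 n.+1 (leqW Kk)).
have -> : surv k - surv n = \sum_(k.+1 <= j < n.+1) pdist j.
  have := pdist_partial n; rewrite (@big_cat_nat _ _ _ k.+1)//= pdist_partial.
  lra.
rewrite mulr_sumr big_nat_cond [leRHS]big_nat_cond ler_sum // => j.
rewrite andbT => /andP[kj _].
have pj : 0 < pdist j by apply: pdist_gt0; exact: leq_trans kj.
by rewrite ler_pM2r// ler_nat ltnW.
Unshelve. all: by end_near. Qed.

End Spectral.

(** * Law of large numbers for the degrees *)

Section RealLemmas.
Variable R : realType.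
Implicit Types (u x y : R).

(** The concave function u / (1 + u) against its tangent at [v], with the exact remainder; this
    remainder is the source of the dissipation. *)
Lemma tangent_gap u v : 0 <= u -> 0 <= v ->
  (u - v) / (1 + v) ^+ 2 =
  u / (1 + u) - v / (1 + v) + (u - v) ^+ 2 / ((1 + v) ^+ 2 * (1 + u)).
Proof.
move=> u0 v0; have h1 : 1 + u != 0 by lra.
have h2 : 1 + v != 0 by lra.
by field; rewrite h1 h2.
Qed.

Lemma odds_frac_gap u : 0 <= u ->
  u / (1 + u) = 1 / 4 + u / 4 - (u - 1) ^+ 2 / (4 * (1 + u)).
Proof. by move=> u0; have h1 : 1 + u != 0; [lra|field; rewrite h1]. Qed.

Lemma odds_frac_ge u : 0 <= u -> 1 / 2 - `|u - 1| <= u / (1 + u).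
Proof.
move=> u0; rewrite ler_pdivlMr; last lra.
case: (ger0P (u - 1)) => h; nra.
Qed.

Lemma odds_frac_le1 u : 0 <= u -> 0 <= u / (1 + u) <= 1.
Proof.
move=> u0; rewrite divr_ge0 ?addr_ge0//= ler_pdivrMr; lra.
Qed.

(** With u = X / (p H) the fraction is u / (1 + u); [dX] and [D] are the jumps of a count and of the
    total reproductive value. The remainder is of order H^-2, which costs O(n^-2) per step. *)
Lemma odds_frac_step (c p X H dX D : R) : 0 <= c -> 0 < p -> 0 <= X -> 0 < H -> 0 <= D ->
  `|dX| <= 1 -> 0 <= X + dX -> X <= c * H ->
  p * (dX * H - X * D) / (X + p * H) ^+ 2
    - (1 + c) * (1 + p) / p ^+ 2 * ((1 + D) ^+ 2 / H ^+ 2) <=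
  (X + dX) / ((X + dX) + p * (H + D)) - X / (X + p * H).
Proof.
move=> c0 p0 X0 H0 D0 dX1 XdX XH.
have pH : 0 < p * H by rewrite mulr_gt0.
have pD : 0 <= p * D by rewrite mulr_ge0// ltW.
set q := X + p * H; set q' := X + dX + p * (H + D).
have q0 : 0 < q by rewrite /q; lra.
have q'0 : 0 < q' by rewrite /q' mulrDr; lra.
have qH : p * H <= q by rewrite /q; lra.
have q'H : p * H <= q' by rewrite /q' mulrDr; lra.
have -> : (X + dX) / q' - X / q = p * (dX * H - X * D) / q ^+ 2
   - (p * (dX * H - X * D) / q) * (dX + p * D) / (q * q').
  have h1 : q != 0 by rewrite gt_eqF.
  have h2 : q' != 0 by rewrite gt_eqF.
  rewrite /q /q' in h1 h2 *; field; rewrite h1 h2 //.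
rewrite lerD2l lerN2.
have b1 : `|p * (dX * H - X * D) / q| <= (1 + c) * (1 + D).
  rewrite normrM normfV (gtr0_norm q0) ler_pdivrMr// normrM gtr0_norm//.
  have h1 : `|dX * H - X * D| <= H + X * D.
    apply: le_trans (ler_normB _ _) _; rewrite !normrM (ger0_norm X0) (ger0_norm D0).
    by rewrite (gtr0_norm H0) lerD2r ger_pMl.
  have h2 : p * (H + X * D) <= (1 + D * c) * (p * H).
    by rewrite mulrDr mulrDl mul1r lerD2l; have : X * D <= c * H * D;
      [rewrite ler_wpM2r|nra].
  have h3 : (1 + D * c) * (p * H) <= (1 + D * c) * q.
    by rewrite ler_wpM2l// addr_ge0// mulr_ge0.
  have h4 : (1 + D * c) * q <= (1 + c) * (1 + D) * q.
    by rewrite ler_wpM2r ?(ltW q0)//; nra.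
  have h5 : p * `|dX * H - X * D| <= p * (H + X * D) by rewrite ler_pM2l.
  lra.
have b2 : `|dX + p * D| <= (1 + p) * (1 + D).
  apply: le_trans (ler_normD _ _) _; rewrite (ger0_norm pD); nra.
have b3 : (q * q')^-1 <= (p * H) ^- 2.
  by rewrite lef_pV2 ?posrE ?exprn_gt0 ?mulr_gt0// expr2 ler_pM// ltW.
apply: le_trans (ler_norm _) _.
have qq : 0 < q * q' by rewrite mulr_gt0.
rewrite 2!normrM normfV (gtr0_norm qq).
have -> : (1 + c) * (1 + p) / p ^+ 2 * ((1 + D) ^+ 2 / H ^+ 2) =
  ((1 + c) * (1 + D)) * ((1 + p) * (1 + D)) * (p * H) ^- 2.
  have h1 : p != 0 by rewrite gt_eqF.
  have h2 : H != 0 by rewrite gt_eqF.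
  by field; rewrite h1 h2.
rewrite ler_pM ?invr_ge0 ?mulr_ge0 ?(ltW q0) ?(ltW q'0)//.
by rewrite ler_pM.
Qed.

End RealLemmas.

(** * Entropy production *)

Section Drift.
Variables (R : realType) (f p h : nat -> R) (lam : R).
Hypothesis f_gt0 : forall k, (0 < k)%N -> 0 < f k.
Hypothesis lam_gt0 : 0 < lam.
Hypothesis p_gt0 : forall k, (0 < k)%N -> 0 < p k.
Hypothesis h_gt0 : forall k, (0 < k)%N -> 0 < h k.
Hypothesis h_rec : forall k, (0 < k)%N -> h k * (lam + f k) = f k * (h k.+1 + h 1%N).
Hypothesis p_rec : forall k, (0 < k)%N -> (lam + f k.+1) * p k.+1 = f k * p k.
Hypothesis p_one : (lam + f 1%N) * p 1%N = lam.

Let x u : R := u / (1 + u).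

(** The terms linear in x(u) cancel up to boundary terms, because the flows of value balance at
    every degree in equilibrium. *)
Lemma linear_part (u : nat -> R) K :
  \sum_(1 <= j < K.+2) h 1%N * (f j * p j) * (x (u j) - x (u 1%N)) +
  \sum_(1 <= j < K.+1) h j.+1 * (f j * p j) * (x (u j) - x (u j.+1)) =
  h 1%N * x (u 1%N) * (lam - \sum_(1 <= j < K.+2) f j * p j)
  - h K.+2 * (f K.+1 * p K.+1) * x (u K.+1).
Proof.
elim: K => [|K IH].
  rewrite !big_nat1 big_geq//.
  have e1 := h_rec (ltn0Sn 0).
  have : (h 1%N * (lam + f 1%N)) * p 1%N = (f 1%N * (h 2%N + h 1%N)) * p 1%N by rewrite e1.
  by rewrite -mulrA p_one => e2; rewrite subrr mulr0 addr0; ring: e2.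
rewrite [X in X + _]big_nat_recr//= [X in _ + X]big_nat_recr//= addrACA IH.
rewrite [in RHS]big_nat_recr//=.
have := h_rec (ltn0Sn K.+1); have := p_rec (ltn0Sn K).
set a := h _; set b := f K.+1; set b' := f K.+2; set c := p K.+1; set c' := p K.+2.
set a' := h K.+3.
move=> e1 e2.
(* The value flowing into degree K+2 equals the value flowing out of it, to degree K+3 and to the
   new leaf: both eigenvector equations are used here. *)
have e3 : a * (b * c) = (b' * (a' + h 1%N)) * c'.
  by rewrite -e2 -e1; ring.
by ring: e3.
Qed.

(* The entropy production of [\sum_k h k * p k * x (u k)], and the error made when
   the degrees above [K] are discarded. *)
Definition gre_dissip (u : nat -> R) K : R :=
  h 1%N * \sum_(1 <= j < K.+1)
    f j * p j * ((u j - u 1%N) ^+ 2 / ((1 + u 1%N) ^+ 2 * (1 + u j))).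

Definition gre_err K : R :=
  h K.+1 * (f K * p K) + h 1%N * (lam - \sum_(1 <= j < K.+1) f j * p j).

(** Each flow j -> j+1 or j -> 1 is compared with the tangent of x at the ratio of its target. The
    remainders of the flows into degree 1 are kept as the dissipation, the other ones are dropped by
    positivity, and the linear terms go to [linear_part]. The number [s] is S / H; only a lower
    bound on it is available, since degrees above [K] contribute too. *)
Lemma gre_drift (u : nat -> R) (s : R) K :
  (forall k, 0 <= u k) -> \sum_(1 <= j < K.+1) f j * p j <= lam ->
  \sum_(1 <= j < K.+1) f j * p j * u j <= s -> (0 < K)%N ->
  gre_dissip u K - gre_err K <=
  \sum_(1 <= k < K.+1) h k * ((if k == 1%N then s else f k.-1 * p k.-1 * u k.-1)
     - (f k + lam) * p k * u k) / (1 + u k) ^+ 2.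
Proof.
case: K => // K u0 fp_le s_ge _.
rewrite big_nat_recl//=.
have h1 := h_gt0 (ltn0Sn 0).
have u1 := u0 1%N.
pose F := \sum_(1 <= j < K.+2) f j * p j.
have v2 : 0 < (1 + u 1%N) ^+ 2 by rewrite exprn_gt0//; lra.
have uv : u 1%N / (1 + u 1%N) ^+ 2 <= 1 by rewrite ler_pdivrMr// mul1r; nra.
have b1 : \sum_(1 <= j < K.+2) h 1%N * (f j * p j) * ((u j - u 1%N) / (1 + u 1%N) ^+ 2)
    - h 1%N * (lam - F) <=
    h 1%N * (s - (f 1%N + lam) * p 1%N * u 1%N) / (1 + u 1%N) ^+ 2.
  have -> : \sum_(1 <= j < K.+2) h 1%N * (f j * p j) * ((u j - u 1%N) / (1 + u 1%N) ^+ 2)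
     = h 1%N / (1 + u 1%N) ^+ 2 * (\sum_(1 <= j < K.+2) f j * p j * u j - F * u 1%N).
    rewrite mulr_suml -sumrB mulr_sumr; apply: eq_bigr => j _.
    by rewrite -mulrBr; field; rewrite lt0r_neq0//; lra.
  rewrite (addrC (f 1%N)) p_one.
  have c0 : 0 <= h 1%N / (1 + u 1%N) ^+ 2 by rewrite divr_ge0 ?ltW.
  have -> : h 1%N * (s - lam * u 1%N) / (1 + u 1%N) ^+ 2 =
    h 1%N / (1 + u 1%N) ^+ 2 * (s - F * u 1%N) - h 1%N * (lam - F) * (u 1%N / (1 + u 1%N) ^+ 2).
    by field; rewrite lt0r_neq0//; lra.
  apply: lerB.
    by rewrite ler_wpM2l// lerD2r.
  by rewrite ler_piMr// mulr_ge0 ?subr_ge0 ?(ltW h1).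
have -> : \sum_(1 <= i < K.+1) h i.+1 * ((if i.+1 == 1%N then s else f i * p i * u i)
     - (f i.+1 + lam) * p i.+1 * u i.+1) / (1 + u i.+1) ^+ 2 =
  \sum_(1 <= j < K.+1) h j.+1 * (f j * p j) * ((u j - u j.+1) / (1 + u j.+1) ^+ 2).
  apply: eq_big_nat => j /andP[j0 _]; rewrite eqSS gtn_eqF//.
  by rewrite (addrC (f j.+1)) p_rec//; field; rewrite lt0r_neq0//; have := u0 j.+1; lra.
have b2 : \sum_(1 <= j < K.+1) h j.+1 * (f j * p j) * (x (u j) - x (u j.+1)) <=
   \sum_(1 <= j < K.+1) h j.+1 * (f j * p j) * ((u j - u j.+1) / (1 + u j.+1) ^+ 2).
  rewrite big_nat_cond [leRHS]big_nat_cond ler_sum // => j; rewrite andbT => /andP[j0 _].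
  have c0 : 0 < h j.+1 * (f j * p j) by rewrite !mulr_gt0 ?h_gt0 ?f_gt0 ?p_gt0.
  rewrite (ler_pM2l c0).
  rewrite tangent_gap// /x lerDl divr_ge0 ?sqr_ge0// mulr_ge0 ?sqr_ge0//.
  by have := u0 j; lra.
have b3 : \sum_(1 <= j < K.+2) h 1%N * (f j * p j) * ((u j - u 1%N) / (1 + u 1%N) ^+ 2) =
  \sum_(1 <= j < K.+2) h 1%N * (f j * p j) * (x (u j) - x (u 1%N)) + gre_dissip u K.+1.
  rewrite /gre_dissip mulr_sumr -big_split/=; apply: eq_bigr => j _.
  by rewrite tangent_gap// /x; ring.
have lp := linear_part u K.
have /andP[x1 _] := odds_frac_le1 (u0 1%N).
have /andP[_ x2] := odds_frac_le1 (u0 K.+1).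
have b4 : 0 <= h 1%N * x (u 1%N) * (lam - F).
  by apply: mulr_ge0; [exact: mulr_ge0 (ltW h1) x1|rewrite subr_ge0].
have b5 : h K.+2 * (f K.+1 * p K.+1) * x (u K.+1) <= h K.+2 * (f K.+1 * p K.+1).
  by rewrite ger_pMr ?mulr_gt0 ?h_gt0 ?f_gt0 ?p_gt0.
rewrite /gre_err -/F in lp b4 *.
move: b1 b2 lp b4 b5; rewrite b3 -/F.
lra.
Qed.

End Drift.

Section Window.
Variable R : realType.
Implicit Types (e d : nat -> R).

Lemma harmonic_block_ge m j : (0 < m)%N ->
  j%:R / 2 <= \sum_(m <= t < 2 ^ j * m) (t.+1%:R^-1 : R).
Proof.
move=> m0; elim: j => [|j IH]; first by rewrite mul0r mul1n big_geq.
have mm : (m <= 2 ^ j * m)%N by rewrite leq_pmull// expn_gt0.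
have mm2 : (2 ^ j * m <= 2 ^ j.+1 * m)%N by rewrite leq_mul2r leq_pexp2l ?orbT.
rewrite (big_cat_nat mm mm2)/= -natr1 mulrDl lerD//.
set M := (2 ^ j * m)%N; have M0 : (0 < M)%N by rewrite muln_gt0 expn_gt0.
have -> : (2 ^ j.+1 * m = M + M)%N by rewrite /M expnS -mulnA mul2n addnn.
apply: (@le_trans _ _ (\sum_(M <= t < M + M) (M + M)%:R^-1)).
  rewrite sumr_const_nat addnK natrD -[_ *+ M]mulr_natr.
  have : 0 < (M%:R : R) by rewrite ltr0n.
  move: (M%:R : R) => y y0; rewrite [leRHS]mulrC ler_pdivlMr; lra.
apply: ler_sum_nat => t /andP[_ tM]; rewrite lef_pV2 ?posrE ?ltr0n// ?ler_nat//.
by rewrite addn_gt0 M0.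
Qed.

Lemma inv_square_block_le m n : (0 < m)%N ->
  \sum_(m <= t < n) (t.+1%:R ^- 2 : R) <= m%:R^-1.
Proof.
move=> m0; have [nm|mn] := leqP n m; first by rewrite big_geq.
apply: (@le_trans _ _ (m%:R^-1 - n%:R^-1)); last by rewrite gerBl.
rewrite -(subnKC (ltnW mn)); elim: (n - m)%N => [|k IH].
  by rewrite addn0 big_geq// subrr.
rewrite addnS big_nat_recr ?leq_addr//=.
set y : R := (m + k)%:R; have y0 : 0 < y by rewrite ltr0n addn_gt0 m0.
have -> : (m + k).+1%:R = y + 1 by rewrite -natr1.
apply: le_trans (lerD IH (lexx _)) _; rewrite -addrA lerD2l.
rewrite -subr_ge0 -/y.
have -> : - (y + 1)^-1 - (- y^-1 + (y + 1) ^- 2) = (y * (y + 1) ^+ 2)^-1.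
  by field; apply/andP; split; rewrite lt0r_neq0//; lra.
by rewrite invr_ge0 mulr_ge0 ?sqr_ge0// ltW.
Qed.

(* If [e] nearly increases at rate [d m / m], it cannot do so over a long
   window, since it is bounded: hence [d] is small somewhere in the window, and
   [e] loses little from there on. *)
Lemma window (c eta del : R) : 0 < c -> 0 < eta -> 0 < del ->
  exists2 eps0, 0 < eps0 & forall (e d : nat -> R) (eps C : R),
  0 <= eps <= eps0 -> 0 <= C -> (forall m, 0 <= e m <= 1) -> (forall m, 0 <= d m) ->
  (forall m, e m + (c * d m - eps) / m.+1%:R - C / m.+1%:R ^+ 2 <= e m.+1) ->
  exists M, forall m, (M <= m)%N -> exists2 t, d t < eta & e t - del <= e m.
Proof.
move=> c0 eta0 del0.
(* J doublings of time bring the sum of 1 / m to at least J / 2; growth at rate c eta / 2 then gives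
   c eta J / 4 > 2, more than [e] in [0, 1] allows even after a loss of 1. *)
pose J := (Num.truncn (8 / (c * eta))).+1.
have J8 : 8 / (c * eta) < J%:R.
  by rewrite /J truncnS_gt// divr_ge0 ?mulr_ge0 ?ltW.
(* The first bound keeps half of the drift c eta. The second limits to del / 2 the loss due to [eps]
   over the window, which has at most 2^J (m0 + 1) steps, each losing at most eps / (m0 + 1). *)
pose eps0 := Num.min (c * eta / 2) (del / (2 * 2 ^+ J)).
exists eps0.
  by rewrite lt_min !divr_gt0 ?mulr_gt0 ?exprn_gt0.
move=> e d eps C /andP[eps_ge0 eps_le] C0 e01 d0 step.
have [epsA epsB] : eps <= c * eta / 2 /\ eps * (2 * 2 ^+ J) <= del.
  move: eps_le; rewrite le_min => /andP[-> h]; split => //.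
  by rewrite -ler_pdivlMr ?mulr_gt0 ?exprn_gt0.
(* From M0 on, the quadratic errors add up to at most 1 and to at most del / 2. *)
pose M0 := (Num.truncn (Num.max C (2 * C / del))).+1.
have M0C : Num.max C (2 * C / del) < M0%:R.
  by rewrite /M0 truncnS_gt// le_max C0.
exists (2 ^ J * M0)%N => m Mm.
pose m0 := (m %/ 2 ^ J)%N.
have m0M : (M0 <= m0)%N by rewrite leq_divRL ?expn_gt0// mulnC.
have m0_gt0 : (0 < m0)%N by apply: leq_trans m0M.
have m0R : 0 < (m0%:R : R) by rewrite ltr0n.
have m0m : (2 ^ J * m0 <= m)%N by rewrite mulnC leq_divM.
have m0m' : (m0 <= m)%N by apply: leq_trans m0m; rewrite leq_pmull ?expn_gt0.
have mlt : (m < 2 ^ J * m0.+1)%N by rewrite mulnC ltn_ceil ?expn_gt0.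
have Cm0 : C / m0%:R <= 1 /\ C / m0%:R <= del / 2.
  have : Num.max C (2 * C / del) <= m0%:R.
    by apply: ltW; apply: lt_le_trans M0C _; rewrite ler_nat.
  rewrite ge_max => /andP[h1 h2]; rewrite !ler_pdivrMr// mul1r; split => //.
  by move: h2; rewrite ler_pdivrMr//; lra.
have tele s t : (s <= t)%N ->
  e s + \sum_(s <= i < t) ((c * d i - eps) / i.+1%:R - C / i.+1%:R ^+ 2) <= e t.
  move=> /subnKC <-; elim: (t - s)%N => [|k IH]; first by rewrite addn0 big_geq// addr0.
  rewrite addnS big_nat_recr ?leq_addr//= addrA; apply: le_trans (step _).
  by rewrite -[leRHS]addrA lerD2r.
have sq t : (m0 <= t)%N -> \sum_(t <= i < m) C / i.+1%:R ^+ 2 <= C / m0%:R.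
  move=> mt; rewrite -mulr_sumr ler_wpM2l//.
  apply: le_trans (inv_square_block_le m m0_gt0).
  have [mt'|tm] := leqP m t.
    by rewrite big_geq// sumr_ge0.
  by rewrite [leRHS](big_cat_nat mt (ltnW tm)) /= lerDr sumr_ge0.
have [[t /andP[m0t tm] dt]|none] :=
    pselect (exists2 t, (m0 <= t < m)%N & d t < eta).
  exists t => //.
  have := tele t m (ltnW tm); rewrite sumrB.
  have h1 : \sum_(t <= i < m) (c * d i - eps) / i.+1%:R >= - (del / 2).
    apply: (@le_trans _ _ (\sum_(t <= i < m) (- eps / m0.+1%:R))).
      rewrite sumr_const_nat -[_ *+ (m - t)]mulr_natr !mulNr lerN2 mulrAC.
      rewrite ler_pdivrMr ?ltr0n//.
      have : (m - t)%:R <= 2 ^+ J * m0.+1%:R :> R.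
        by rewrite -natrX -natrM ler_nat (leq_trans (leq_subr _ _))// ltnW.
      have := ltr0n R m0.+1; rewrite ltnS /=.
      move=> h0 h; apply: (@le_trans _ _ (eps * (2 ^+ J * m0.+1%:R))).
        by rewrite ler_wpM2l.
      by rewrite mulrA ler_wpM2r// ?ler0n//; lra.
    rewrite big_nat_cond [leRHS]big_nat_cond ler_sum // => i.
    rewrite andbT => /andP[ti _]; rewrite mulrBl mulNr.
    have h2 : eps / i.+1%:R <= eps / m0.+1%:R.
      rewrite ler_wpM2l// lef_pV2 ?posrE ?ltr0n// ler_nat ltnS.
      exact: leq_trans ti.
    have h3 : 0 <= c * d i / i.+1%:R by rewrite divr_ge0 ?mulr_ge0 ?(ltW c0).
    by apply: (@le_trans _ _ (- (eps / i.+1%:R))); rewrite ?lerN2// lerDr.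
  have := sq t m0t; have [_] := Cm0; lra.
(* If the dissipation stayed above [eta] on the whole window, [e] would increase by more than 1. *)
exfalso.
have dge i : (m0 <= i < m)%N -> eta <= d i.
  by move=> im; rewrite leNgt; apply/negP => h; apply: none; exists i.
have := tele m0 m m0m'; rewrite sumrB.
have h1 : c * eta / 2 * (J%:R / 2) <= \sum_(m0 <= i < m) (c * d i - eps) / i.+1%:R.
  apply: (@le_trans _ _ (\sum_(m0 <= i < m) (c * eta / 2) / i.+1%:R)).
    rewrite -mulr_sumr ler_pM2l ?divr_gt0 ?mulr_gt0//.
    apply: le_trans (harmonic_block_ge J m0_gt0) _.
    rewrite [leRHS](@big_cat_nat _ _ _ (2 ^ J * m0))//= ?leq_pmull ?expn_gt0//.
    by rewrite lerDl sumr_ge0.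
  rewrite big_nat_cond [leRHS]big_nat_cond ler_sum // => i.
  rewrite andbT => im; rewrite ler_wpM2r ?invr_ge0//.
  have : c * eta <= c * d i by rewrite ler_pM2l// dge.
  lra.
have h2 := sq m0 (leqnn _).
have /andP[e1 _] := e01 m0; have /andP[_ e2] := e01 m.
have h3 : 2 < c * eta / 2 * (J%:R / 2).
  by move: J8; rewrite ltr_pdivrMr ?mulr_gt0//; lra.
have [h4 _] := Cm0.
lra.
Qed.

End Window.

Section Counts.
Variable R : realType.
Implicit Types (g : nat -> R) (a : attachments).

(** A real-valued [Ndeg], written as a tree sum so that [nsum_upd] gives its jumps. *)
Definition cnt a n k : R := nsum (fun l => (l == k)%:R) a n.

Lemma cnt_ge0 a n k : 0 <= cnt a n k.
Proof. by apply: nsum_ge0 => *; exact: ler0n. Qed.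

Lemma cnt0 a n : cnt a n 0 = 0.
Proof. by rewrite /cnt /nsum big1. Qed.

Lemma cnt_le a n k : cnt a n k <= n%:R.
Proof.
rewrite -[leRHS]mul1r -(nsum_cst 1 a); apply: ler_nsum => l _.
by rewrite lern1 leq_b1.
Qed.

Lemma cnt_Ndeg a n k : cnt a n k = (Ndeg a n k)%:R.
Proof. by rewrite NdegE /cnt /nsum natr_sum. Qed.

Lemma nsum_cnt g a n K : \sum_(1 <= k < K.+1) g k * cnt a n k =
  nsum (fun d => if (d <= K)%N then g d else 0) a n.
Proof.
rewrite /cnt /nsum; under eq_bigr do rewrite mulr_sumr.
rewrite exchange_big /=; apply: eq_bigr => i _.
case: ifPn => [dK|]; last first.
  rewrite -ltnNge => Kd; rewrite big_nat_cond big1// => k /andP[/andP[_ kK] _].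
  by rewrite gtn_eqF ?mulr0// (leq_trans kK).
rewrite (bigD1_seq (deg a n i)) ?iota_uniq//=; last first.
  by rewrite mem_index_iota deg_gt0 ltnS.
rewrite eqxx mulr1 big1 ?addr0// => k kd.
by rewrite eq_sym (negPf kd) mulr0.
Qed.

Lemma nsum_split g a n K : nsum g a n = \sum_(1 <= k < K.+1) g k * cnt a n k +
  nsum (fun d => if (K < d)%N then g d else 0) a n.
Proof.
rewrite nsum_cnt -nsumD; apply: eq_nsum_fun => d _.
by rewrite leqNgt; case: ltnP; rewrite ?addr0 ?add0r.
Qed.

Lemma cnt_block_le g a n K N : (forall k, (0 < k)%N -> 0 <= g k) ->
  \sum_(K.+1 <= k < N) g k * cnt a n k <=
  nsum (fun d => if (K < d)%N then g d else 0) a n.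
Proof.
move=> g0; case: N => [|N].
  by rewrite big_geq// nsum_ge0// => d d0; case: ifP => // _; exact: g0.
have [NK|KN] := leqP N K.
  by rewrite big_geq// nsum_ge0// => d d0; case: ifP => // _; exact: g0.
have h1 : nsum (fun d => if (d <= N)%N then g d else 0) a n <= nsum g a n.
  by apply: ler_nsum => d d0; case: ifP => // _; exact: g0.
have KN1 : (K.+1 <= N.+1)%N by rewrite ltnS ltnW.
move: h1; rewrite -nsum_cnt (nsum_split g a n K) (big_cat_nat (ltn0Sn K) KN1)/=.
by rewrite lerD2l.
Qed.

Lemma nsum_mul_indic g a n k :
  nsum (fun d => g d * (d == k)%:R) a n = g k * cnt a n k.
Proof.
rewrite -nsumZ; apply: eq_nsum_fun => d _.
by case: eqP => [->//|_]; rewrite !mulr0.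
Qed.

Lemma nsum_sum (r : seq nat) (g : nat -> nat -> R) a n :
  nsum (fun d => \sum_(k <- r) g k d) a n = \sum_(k <- r) nsum (g k) a n.
Proof. by rewrite /nsum exchange_big. Qed.

End Counts.

Section CondChoice.
Variables (R : realType) (f : nat -> R).
Hypothesis f_gt0 : forall k, (0 < k)%N -> 0 < f k.

Lemma cond_exp_choice_le m a (phi : attachments -> R) F :
  (forall i, (i < m.+1)%N -> F (deg a m.+1 i) <= phi (upd a m i)) ->
  nsum (fun k => f k * F k) a m.+1 / nsum f a m.+1 <= cond_exp f m phi a.
Proof.
move=> h; rewrite /cond_exp /choice_prob [in X in X / _]/nsum mulr_suml.
apply: ler_sum => i _; rewrite mulrAC ler_wpM2l ?h//.
by rewrite divr_ge0// ltW ?f_gt0 ?nsum_gt0.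
Qed.

Lemma ge_cond_exp_choice m a (phi : attachments -> R) F :
  (forall i, (i < m.+1)%N -> phi (upd a m i) <= F (deg a m.+1 i)) ->
  cond_exp f m phi a <= nsum (fun k => f k * F k) a m.+1 / nsum f a m.+1.
Proof.
move=> h; rewrite /cond_exp /choice_prob [in X in _ <= X / _]/nsum mulr_suml.
apply: ler_sum => i _; rewrite [leRHS]mulrAC ler_wpM2l ?h//.
by rewrite divr_ge0// ltW ?f_gt0 ?nsum_gt0.
Qed.

End CondChoice.

Section Equilibrium.
Variables (R : realType) (f p h : nat -> R).
Hypothesis f_gt0 : forall k, (0 < k)%N -> 0 < f k.
Hypothesis p_gt0 : forall k, (0 < k)%N -> 0 < p k.
Hypothesis h_gt0 : forall k, (0 < k)%N -> 0 < h k.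
Hypothesis hp_sum : (fun n => \sum_(1 <= k < n) h k * p k) @ \oo --> (1 : R).

Let x u : R := u / (1 + u).

Lemma hp_gt0 k : (0 < k)%N -> 0 < h k * p k.
Proof. by move=> k0; rewrite mulr_gt0 ?h_gt0 ?p_gt0. Qed.

Lemma hp_partial_le1 n : \sum_(1 <= k < n) h k * p k <= 1.
Proof.
rewrite -[leRHS](cvg_lim (@Rhausdorff _) hp_sum).
apply: nondecreasing_cvgn_le; last by apply/cvg_ex; exists 1.
by apply: ge0_partial_sum_nd => k k0; exact/ltW/hp_gt0.
Qed.

(** Replaces the square root of [B] by a bound linear in [B], through which means pass directly. *)
Lemma le_soft (s y B : R) : 0 < s -> y ^+ 2 <= B -> `|y| <= s + B / s.
Proof.
move=> s0 yB; have h1 : y ^+ 2 / s <= B / s by rewrite ler_wpM2r// invr_ge0 ltW.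
suff : `|y| <= s + y ^+ 2 / s by lra.
rewrite -subr_ge0 -(real_normK (num_real y)).
set z := `|y|; have z0 : 0 <= z by exact: normr_ge0.
have -> : s + z ^+ 2 / s - z = (s ^+ 2 + z ^+ 2 - z * s) / s.
  by field; rewrite gt_eqF.
by apply: divr_ge0; [nra|exact: ltW].
Qed.

Lemma quot_bound (F y A B D : R) : 0 < F -> 0 < A -> A <= B -> 0 <= D ->
  F * (y / A) <= D -> y <= B / F * D.
Proof.
move=> F0 A0 AB D0 FD; rewrite mulrAC ler_pdivlMr// mulrC.
apply: (@le_trans _ _ (A * D)); last by rewrite ler_wpM2r.
have -> : F * y = A * (F * (y / A)) by field; rewrite gt_eqF.
by rewrite ler_pM2l.
Qed.

(** A small dissipation makes u_k close to u_1 for k <= K0; the h-mass being 1 up to the tail [T],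
    u_1 is then close to 1 and the functional close to its equilibrium value 1/2. The constant [C]
    must not depend on the truncation [K], which is chosen after it. *)
Lemma near_equilibrium (s : R) K1 : 0 < s -> exists2 K0, (K1 <= K0)%N &
  exists2 C : R, 0 <= C & forall K (u : nat -> R) (T : R), (K0 <= K)%N ->
  (forall k, 0 <= u k) -> (forall k, (0 < k)%N -> h k * p k * u k <= 1) ->
  0 <= T -> \sum_(1 <= k < K0.+1) h k * p k * u k + T = 1 ->
  1 / 2 - \sum_(1 <= k < K.+1) h k * p k * x (u k) <=
    s + C * gre_dissip f p h u K + T.
Proof.
move=> s0.
pose U k := (h k * p k)^-1.
have U0 k : (0 < k)%N -> 0 < U k by move=> k0; rewrite invr_gt0 hp_gt0.
have U1 := U0 1%N isT.
(* The final bound spends 2 s1 on the oscillation of u_k, s1 U_1 on the equilibrium mass above K0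
   multiplied by u_1, and s1 / 2 on that mass itself. *)
have [s1 s10 sE] : exists2 s1, 0 < s1 & s = s1 * (3 + U 1%N).
  exists (s / (3 + U 1%N)); first by rewrite divr_gt0//; lra.
  by rewrite divfK// gt_eqF//; lra.
have /cvgrPdist_le/(_ s1 s10)[K2 _ hK2] := hp_sum.
pose K0 := maxn K1 (maxn K2 1).
exists K0; first exact: leq_maxl.
have K0_gt0 : (0 < K0)%N by rewrite /K0; lia.
have kappa : 1 - s1 <= \sum_(1 <= k < K0.+1) h k * p k.
  have := hK2 K0.+1; rewrite /= leqW; last by rewrite /K0; lia.
  by move=> /(_ isT); rewrite ler_norml => /andP[_]; lra.
(* The inverse of the coefficient of (u_k - u_1)^2 in the dissipation, the ratios in it being
   replaced by their a priori bounds U. *)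
pose c k := (1 + U 1%N) ^+ 2 * (1 + U k) / (h 1%N * (f k * p k)).
have c0 k : (0 < k)%N -> 0 <= c k.
  move=> k0; rewrite divr_ge0 ?mulr_ge0 ?sqr_ge0 ?(ltW (h_gt0 _)) ?(ltW (f_gt0 _))
    ?(ltW (p_gt0 _))//; have := U0 k k0; lra.
pose C1 := \sum_(1 <= k < K0.+1) c k.
have C10 : 0 <= C1 by rewrite /C1 big_nat_cond sumr_ge0// => k /andP[/andP[k0 _] _]; exact: c0.
exists (2 * C1 / s1); first by rewrite divr_ge0 ?mulr_ge0 ?(ltW s10).
move=> K u T K0K u0 hpu T0 sum1.
set D := gre_dissip f p h u K.
have uU k : (0 < k)%N -> u k <= U k.
  by move=> k0; rewrite /U -[leRHS]mul1r ler_pdivlMr ?hp_gt0// mulrC hpu.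
have term0 j : (0 < j)%N -> 0 <= f j * p j * ((u j - u 1%N) ^+ 2 / ((1 + u 1%N) ^+ 2 * (1 + u j))).
  move=> j0; apply: mulr_ge0; first by rewrite ltW// mulr_gt0 ?f_gt0 ?p_gt0.
  apply: divr_ge0; first exact: sqr_ge0.
  by apply: mulr_ge0; [exact: sqr_ge0|have := u0 j; lra].
have D0 : 0 <= D.
  rewrite mulr_ge0 ?(ltW (h_gt0 _))// big_nat_cond sumr_ge0// => j /andP[/andP[j0 _] _].
  exact: term0.
have sqk k : (0 < k <= K0)%N -> (u k - u 1%N) ^+ 2 <= C1 * D.
  move=> /andP[k0 kK0].
  have ck : (u k - u 1%N) ^+ 2 <= c k * D.
    have : h 1%N * (f k * p k * ((u k - u 1%N) ^+ 2 / ((1 + u 1%N) ^+ 2 * (1 + u k)))) <= D.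
      rewrite /D /gre_dissip ler_pM2l ?h_gt0//.
      rewrite (bigD1_seq k) ?iota_uniq//=; last first.
        by rewrite mem_index_iota k0 ltnS (leq_trans kK0).
      rewrite lerDl big_seq_cond sumr_ge0// => j.
      by rewrite mem_index_iota => /andP[/andP[j0 _] _]; exact: term0.
    have fp0 : 0 < h 1%N * (f k * p k) by rewrite !mulr_gt0 ?h_gt0 ?f_gt0 ?p_gt0.
    have A0 : 0 < (1 + u 1%N) ^+ 2 * (1 + u k).
      by rewrite mulr_gt0 ?exprn_gt0//; [have := u0 1%N|have := u0 k]; lra.
    rewrite [X in X <= D]mulrA => hD.
    have hA : (1 + u 1%N) ^+ 2 * (1 + u k) <= (1 + U 1%N) ^+ 2 * (1 + U k).
      rewrite ler_pM ?sqr_ge0//.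
      - by have := u0 k; lra.
      - by rewrite lerXn2r ?nnegrE ?lerD2l ?uU// addr_ge0// ltW.
      - by rewrite lerD2l uU.
    exact: quot_bound hD.
  apply: le_trans ck _; rewrite ler_wpM2r// /C1.
  rewrite (bigD1_seq k) ?iota_uniq//=; last by rewrite mem_index_iota k0 ltnS.
  rewrite lerDl big_seq_cond sumr_ge0// => j.
  by rewrite mem_index_iota => /andP[/andP[j0 _] _]; exact: c0.
pose Del := s1 + C1 * D / s1.
have absk k : (0 < k <= K0)%N -> `|u k - u 1%N| <= Del.
  by move=> kK; apply: le_soft => //; exact: sqk.
have Del0 : 0 <= Del by apply: le_trans (absk 1%N K0_gt0); exact: normr_ge0.
set kap := \sum_(1 <= k < K0.+1) h k * p k in kappa.
have kap1 : kap <= 1 by exact: hp_partial_le1.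
have kap0 : 0 <= kap.
  by rewrite /kap big_nat_cond sumr_ge0// => k /andP[/andP[k0 _] _]; exact/ltW/hp_gt0.
have v1 : `|kap * u 1%N + T - 1| <= Del.
  rewrite -sum1 opprD addrACA subrr addr0 mulr_suml -sumrB.
  apply: le_trans (ler_norm_sum _ _ _) _.
  apply: (@le_trans _ _ (kap * Del)); last by rewrite ler_piMl.
  rewrite mulr_suml; apply: ler_sum_nat => k /andP[k0 kK].
  rewrite -mulrBr normrM (gtr0_norm (hp_gt0 k0)) ler_pM2l ?hp_gt0// distrC.
  by apply: absk; rewrite k0.
have u1U := uU 1%N isT; have u10 := u0 1%N.
(* Mass balance: kap u_1 + T is within [Del] of 1, and 1 - kap <= s1. *)
have v2 : `|u 1%N - 1| <= Del + T + s1 * U 1%N.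
  have e1 : u 1%N - 1 = (kap * u 1%N + T - 1) - T + (1 - kap) * u 1%N by ring.
  have e2 : 0 <= (1 - kap) * u 1%N <= s1 * U 1%N.
    by rewrite mulr_ge0 ?subr_ge0//= ler_pM ?subr_ge0//; lra.
  rewrite e1; apply: le_trans (ler_normD _ _) _; apply: lerD.
    by apply: le_trans (ler_normB _ _) _; rewrite (ger0_norm T0) lerD2r.
  by case/andP: e2 => e2 e3; rewrite ger0_norm.
have xk k : (0 < k <= K0)%N -> 1 / 2 - (2 * Del + T + s1 * U 1%N) <= x (u k).
  move=> kK; apply: le_trans (odds_frac_ge (u0 k)); rewrite lerD2l lerN2.
  have -> : u k - 1 = (u k - u 1%N) + (u 1%N - 1) by ring.
  by apply: le_trans (ler_normD _ _) _; have := absk k kK; lra.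
set E := 2 * Del + T + s1 * U 1%N in xk.
have E0 : 0 <= E by rewrite /E !addr_ge0 ?mulr_ge0 ?(ltW s10) ?(ltW U1).
have WK : kap * (1 / 2 - E) <= \sum_(1 <= k < K.+1) h k * p k * x (u k).
  rewrite (@big_cat_nat _ _ _ K0.+1) //=.
  rewrite -[leLHS]addr0 lerD//; last first.
    rewrite big_nat_cond sumr_ge0// => k /andP[/andP[k0 _] _].
    rewrite mulr_ge0 ?(ltW (hp_gt0 _)) ?(leq_trans _ k0)//.
    by have /andP[] := odds_frac_le1 (u0 k).
  rewrite mulr_suml; apply: ler_sum_nat => k /andP[k0 kK].
  by rewrite ler_pM2l ?hp_gt0// xk// k0.
have kE : kap * E <= E by rewrite ler_piMl.

have CE : 2 * C1 / s1 * D = 2 * (C1 * D / s1) by rewrite mulrAC -!mulrA.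
rewrite CE sE.
move: WK kE; rewrite /E /Del mulrBr; lra.
Qed.

(** The tangent of u / (1 + u) at u = 1 is 1/4 + u/4, and each of its two parts sums to at most 1/4;
    the gap to 1/2 therefore bounds every quadratic remainder. *)
Lemma gap_dominates u K k : (forall j, 0 <= u j) ->
  \sum_(1 <= j < K.+1) h j * p j * u j <= 1 -> (0 < k <= K)%N ->
  h k * p k * ((u k - 1) ^+ 2 / (4 * (1 + u k))) <=
  1 / 2 - \sum_(1 <= j < K.+1) h j * p j * x (u j).
Proof.
move=> u0 sum1 /andP[k0 kK].
have -> : \sum_(1 <= j < K.+1) h j * p j * x (u j) =
  \sum_(1 <= j < K.+1) h j * p j / 4 + \sum_(1 <= j < K.+1) h j * p j * u j / 4
  - \sum_(1 <= j < K.+1) h j * p j * ((u j - 1) ^+ 2 / (4 * (1 + u j))).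
  by rewrite -big_split -sumrB/=; apply: eq_bigr => j _; rewrite /x odds_frac_gap//; ring.
have h1 : \sum_(1 <= j < K.+1) h j * p j / 4 <= 1 / 4.
  by rewrite -mulr_suml ler_wpM2r// hp_partial_le1.
have h2 : \sum_(1 <= j < K.+1) h j * p j * u j / 4 <= 1 / 4.
  by rewrite -mulr_suml ler_wpM2r.
have h3 : h k * p k * ((u k - 1) ^+ 2 / (4 * (1 + u k))) <=
    \sum_(1 <= j < K.+1) h j * p j * ((u j - 1) ^+ 2 / (4 * (1 + u j))).
  rewrite [leRHS](bigD1_seq k) ?iota_uniq//=; last by rewrite mem_index_iota k0 ltnS.
  rewrite lerDl big_seq_cond sumr_ge0// => j.
  rewrite mem_index_iota => /andP[/andP[j0 _] _].
  rewrite mulr_ge0 ?(ltW (hp_gt0 _))// divr_ge0 ?sqr_ge0// mulr_ge0//.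
  by have := u0 j; lra.
lra.
Qed.

End Equilibrium.

Lemma exists_ge4 a b c d : exists K, [/\ (a <= K)%N, (b <= K)%N, (c <= K)%N & (d <= K)%N].
Proof. by exists (maxn (maxn a b) (maxn c d)); split; lia. Qed.

(** * Weighted distance to the limiting law *)

Section WeightedDistance.
Variables (R : realType) (p w : nat -> R).
Hypothesis w_ge0 : forall k, (0 < k)%N -> 0 <= w k.
Hypothesis p_gt0 : forall k, (0 < k)%N -> 0 < p k.
Hypothesis wp_summable : summable1 (fun k => w k * p k).

(** [m] counts attachments, so the tree has [m.+1] nodes. Later limits are all expressed through
    this error. *)
Definition wdist a m : R :=
  \sum_(1 <= k <oo) w k * `|cnt R a m.+1 k / m.+1%:R - p k|.

Lemma cnt_big a n k : (n < k)%N -> cnt R a n k = 0.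
Proof. by move=> nk; rewrite cnt_Ndeg Ndeg_big. Qed.

Lemma w_nsum_summable a m : summable1 (fun k => w k * (cnt R a m.+1 k / m.+1%:R)).
Proof.
apply/cvg_ex; eexists; apply: (@eventually_zero_sum R _ _ 1 m.+2) => k mk.
by rewrite cnt_big// mul0r mulr0.
Qed.

Lemma wdist_summable a m : summable1 (fun k => w k * `|cnt R a m.+1 k / m.+1%:R - p k|).
Proof.
have sm : summable1 (fun k => w k * (cnt R a m.+1 k / m.+1%:R) + w k * p k).
  by apply: summable1D; [exact: w_nsum_summable|exact: wp_summable].
apply: (le_summable1 _ sm) => k k0.
have w0 := w_ge0 k0; have p0 := p_gt0 k0.
rewrite normrM normr_id (ger0_norm w0) -mulrDr ler_wpM2l//.
apply: le_trans (ler_normB _ _) _.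
by rewrite (gtr0_norm p0) ger0_norm// divr_ge0// cnt_ge0.
Qed.

Lemma wdist_ge0 a m : 0 <= wdist a m.
Proof.
apply: limr_ge; first exact: wdist_summable.
apply: nearW => n; rewrite big_nat_cond sumr_ge0// => k /andP[/andP[k0 _] _].
by rewrite mulr_ge0 ?w_ge0.
Qed.

Lemma nsum_mean (g : nat -> R) a m :
  (fun n => \sum_(1 <= k < n) g k * (cnt R a m.+1 k / m.+1%:R)) @ \oo -->
  nsum g a m.+1 / m.+1%:R.
Proof.
have -> : nsum g a m.+1 / m.+1%:R =
    \sum_(1 <= k < m.+2) g k * (cnt R a m.+1 k / m.+1%:R).
  under eq_bigr do rewrite mulrA.
  rewrite -mulr_suml nsum_cnt; congr (_ / _).
  by apply: eq_bigr => i _; rewrite deg_le.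
apply: (@eventually_zero_sum R _ _ 1 m.+2) => k mk.
by rewrite cnt_big// mul0r mulr0.
Qed.

(** Tree averages depend on [g] through its domination by [w] only, which is what makes the later
    bounds uniform over the family. *)
Lemma nsum_mean_gap (g : nat -> R) (C : R) a m :
  (forall k, (0 < k)%N -> `|g k| <= C * w k) ->
  `|nsum g a m.+1 / m.+1%:R - \sum_(1 <= k <oo) g k * p k| <= C * wdist a m.
Proof.
move=> gC.
have sm : summable1 (fun k => w k * `|cnt R a m.+1 k / m.+1%:R - p k|).
  by exact: wdist_summable.
have sgp : summable1 (fun k => g k * p k).
  have sC : summable1 (fun k => C * (w k * p k)) by exact: summable1Z.
  apply: (le_summable1 _ sC) => k k0.
  by rewrite normrM (gtr0_norm (p_gt0 k0)) mulrA ler_pM2r ?p_gt0// gC.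
have ng : (fun n => \sum_(1 <= k < n) g k * (cnt R a m.+1 k / m.+1%:R)) @ \oo -->
    nsum g a m.+1 / m.+1%:R by exact: nsum_mean.
rewrite -(cvg_lim (@Rhausdorff _) ng) -sum1B//; last by apply/cvg_ex; eexists; exact: ng.
rewrite -sum1Z//.
apply: ler_norm_sum1; last exact: summable1Z.
move=> k k0; rewrite -mulrBr normrM mulrA ler_wpM2r//; exact: gC.
Qed.

End WeightedDistance.

(** * Convergence of the degree frequencies *)

Section LawOfLargeNumbers.
Variables (R : realType) (f p h G : nat -> R) (lam h0 Ch Cf CG CJ : R).
Hypothesis f_gt0 : forall k, (0 < k)%N -> 0 < f k.
Hypothesis lam_gt0 : 0 < lam.
Hypothesis p_gt0 : forall k, (0 < k)%N -> 0 < p k.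
Hypothesis h0_gt0 : 0 < h0.
Hypothesis h_lo : forall k, (0 < k)%N -> h0 <= h k.
Hypothesis h_hi : forall k, (0 < k)%N -> h k <= Ch * k%:R.
Hypothesis h_rec : forall k, (0 < k)%N -> h k * (lam + f k) = f k * (h k.+1 + h 1%N).
Hypothesis p_rec : forall k, (0 < k)%N -> (lam + f k.+1) * p k.+1 = f k * p k.
Hypothesis p_one : (lam + f 1%N) * p 1%N = lam.
Hypothesis p_sum : (fun n => \sum_(1 <= k < n) p k) @ \oo --> (1 : R).
Hypothesis hp_sum : (fun n => \sum_(1 <= k < n) h k * p k) @ \oo --> (1 : R).
Hypothesis fp_le : forall n, \sum_(1 <= j < n) f j * p j <= lam.
Hypothesis err_small : forall e : R, 0 < e -> exists K0, forall K, (K0 <= K)%N ->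
  gre_err f p h lam K <= e.
Hypothesis f_nd : forall k, (0 < k)%N -> f 1%N <= f k.
Hypothesis f_hi : forall k, (0 < k)%N -> f k <= Cf * k%:R.
Hypothesis G_ge0 : forall k, (0 < k)%N -> 0 <= G k.
Hypothesis G_mom : forall m, expect f m (fun a => nsum G a m.+1) <= CG * m.+1%:R.
Hypothesis G_jump : forall k, (0 < k)%N -> f k * (1 + lam * h k / f k) ^+ 2 <= CJ * G k.
Hypothesis G_super : forall e : R, 0 < e -> exists K, forall k, (K <= k)%N -> k%:R <= e * G k.

Let h_gt0 k : (0 < k)%N -> 0 < h k.
Proof. by move=> /h_lo; exact: lt_le_trans. Qed.

Let f1_gt0 : 0 < f 1%N. Proof. exact: f_gt0. Qed.

Let Ch_gt0 : 0 < Ch.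
Proof. by apply: lt_le_trans (h_gt0 (ltn0Sn 0)) _; have := h_hi (ltn0Sn 0); rewrite mulr1. Qed.

Let Cf_gt0 : 0 < Cf.
Proof. by apply: lt_le_trans f1_gt0 _; have := f_hi (ltn0Sn 0); rewrite mulr1. Qed.

Let x u : R := u / (1 + u).

Let H a m : R := nsum h a m.+1.
Let S a m : R := nsum f a m.+1.
Let u a m k : R := cnt R a m.+1 k / (p k * H a m).
(** The truncation at [K] keeps the second-order constant [CK K] finite: its terms grow like 1 /
    p_k. *)
Let W K m a : R := \sum_(1 <= k < K.+1) h k * p k * x (u a m k).

Lemma H_ge a m : h0 * m.+1%:R <= H a m.
Proof. by rewrite -(nsum_cst h0 a); apply: ler_nsum => k; exact: h_lo. Qed.

Lemma H_gt0 a m : 0 < H a m.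
Proof. by apply: lt_le_trans (H_ge a m); rewrite mulr_gt0. Qed.

Lemma S_ge a m : f 1%N * m.+1%:R <= S a m.
Proof. by rewrite -(nsum_cst (f 1%N) a); apply: ler_nsum => k; exact: f_nd. Qed.

Lemma S_gt0 a m : 0 < S a m.
Proof. by apply: lt_le_trans (S_ge a m); rewrite mulr_gt0. Qed.

Lemma S_le a m : S a m <= 2 * Cf * m.+1%:R.
Proof.
apply: (@le_trans _ _ (nsum (fun k => Cf * k%:R) a m.+1)); first exact: ler_nsum.
rewrite nsumZ nsum_id -natr1; set y := m%:R.
by rewrite -mulrA [leRHS]mulrCA ler_pM2l//; lra.
Qed.

Lemma pH_gt0 a m k : (0 < k)%N -> 0 < p k * H a m.
Proof. by move=> k0; rewrite mulr_gt0 ?H_gt0 ?p_gt0. Qed.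

Lemma u_ge0 a m k : 0 <= u a m k.
Proof.
case: k => [|k]; first by rewrite /u cnt0 mul0r.
by rewrite divr_ge0 ?cnt_ge0 ?(ltW (pH_gt0 _ _ _)).
Qed.

Lemma xu a m k : (0 < k)%N ->
  x (u a m k) = cnt R a m.+1 k / (cnt R a m.+1 k + p k * H a m).
Proof.
move=> k0; rewrite /x /u; have := pH_gt0 a m k0; have := cnt_ge0 R a m.+1 k.
set X := cnt _ _ _ _; set Y := p k * H a m => X0 Y0.
by field; apply/andP; split; apply: lt0r_neq0; lra.
Qed.

Lemma hpu a m k : (0 < k)%N -> h k * p k * u a m k = h k * cnt R a m.+1 k / H a m.
Proof.
move=> k0; rewrite /u; have h1 := H_gt0 a m; have h2 := p_gt0 k0.
by field; rewrite !gt_eqF.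
Qed.

Definition hpu_tail a m K : R := nsum (fun d => if (K < d)%N then h d else 0) a m.+1 / H a m.

Lemma hpu_tail_ge0 a m K : 0 <= hpu_tail a m K.
Proof.
rewrite divr_ge0 ?(ltW (H_gt0 _ _))// nsum_ge0// => k k0.
by case: ifP => // _; exact/ltW/h_gt0.
Qed.

Lemma hpu_sum a m K :
  \sum_(1 <= k < K.+1) h k * p k * u a m k + hpu_tail a m K = 1.
Proof.
rewrite (eq_big_nat _ _ (F2 := fun k => (h k * cnt R a m.+1 k) / H a m)); last first.
  by move=> k /andP[k0 _]; exact: hpu.
by rewrite -mulr_suml -mulrDl -nsum_split divff// gt_eqF// H_gt0.
Qed.

Lemma hpu_sum_le1 a m K : \sum_(1 <= k < K.+1) h k * p k * u a m k <= 1.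
Proof. by rewrite -[leRHS](hpu_sum a m K) lerDl hpu_tail_ge0. Qed.

Lemma hpu_le1 a m k : (0 < k)%N -> h k * p k * u a m k <= 1.
Proof.
move=> k0; apply: le_trans (hpu_sum_le1 a m k).
rewrite big_nat_recr//= lerDr big_nat_cond sumr_ge0// => j /andP[/andP[j0 _] _].
by rewrite mulr_ge0 ?u_ge0// ltW// mulr_gt0 ?h_gt0 ?p_gt0.
Qed.

Let J d : R := h d.+1 - h d + h 1%N.

(** The left eigenvector equation solved for the jump of H; weighted by f, it makes the mean drift
    of H exactly lam H / S. *)
Lemma JE d : (0 < d)%N -> J d = lam * h d / f d.
Proof.
move=> d0; have fd := f_gt0 d0; have := h_rec d0; rewrite /J => e.
by apply: (mulIf (lt0r_neq0 fd)); rewrite divfK ?gt_eqF//; lra.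
Qed.

Let dN k d : R := (k == 1%N)%:R + (d.+1 == k)%:R - (d == k)%:R.

Lemma cnt_upd a m i k : (i < m.+1)%N ->
  cnt R (upd a m i) m.+2 k = cnt R a m.+1 k + dN k (deg a m.+1 i).
Proof.
move=> im; rewrite /cnt nsum_upd// /dN (eq_sym 1%N).
by ring.
Qed.

Lemma H_upd a m i : (i < m.+1)%N -> H (upd a m i) m.+1 = H a m + J (deg a m.+1 i).
Proof. by move=> im; rewrite /H nsum_upd// /J; ring. Qed.

Lemma nsum_dN a m k : (0 < k)%N -> nsum (fun d => f d * dN k d) a m.+1 =
  (if k == 1%N then S a m else f k.-1 * cnt R a m.+1 k.-1) - f k * cnt R a m.+1 k.
Proof.
move=> k0.
have -> : nsum (fun d => f d * dN k d) a m.+1 =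
   nsum (fun d => f d * (k == 1%N)%:R) a m.+1 + nsum (fun d => f d * (d == k.-1)%:R) a m.+1
   - nsum (fun d => f d * (d == k)%:R) a m.+1.
  rewrite -mulN1r -nsumZ -!nsumD; apply: eq_nsum_fun => d _; rewrite /dN.
  by case: k k0 => // k _; rewrite eqSS; ring.
rewrite !nsum_mul_indic; congr (_ - _).
case: eqP => [->|_]; first by rewrite cnt0 mulr0 addr0; apply: eq_nsum_fun => d _; rewrite mulr1.
rewrite (_ : nsum (fun d => f d * 0) _ _ = 0) ?add0r//.
by rewrite /nsum big1// => i _; rewrite mulr0.
Qed.

Lemma dN_le1 k d : (0 < d)%N -> `|dN k d| <= 1.
Proof.
move=> d0; rewrite /dN.
have [->|kd] := eqVneq d k.
  rewrite (gtn_eqF (leqnn k.+1)); case: eqP => _ /=;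
    rewrite ?addr0 ?add0r ?subrr ?normr0 ?normrN ?normr1//.
have [<-|_] := eqVneq d.+1 k.
  by rewrite eqSS gtn_eqF//= add0r subr0 normr1.
by case: eqP => _; rewrite !addr0 subr0 ?normr1 ?normr0.
Qed.

(** The remainder constant of [odds_frac_step] for c = h0^-1: a count is at most n, and H >= h0
    n. *)
Let cst_k k : R := (1 + h0^-1) * (1 + p k) / p k ^+ 2.
Let CK K : R := \sum_(1 <= k < K.+1) h k * p k * cst_k k.

Let F K a m d : R := \sum_(1 <= k < K.+1) h k * p k *
  (p k * (dN k d * H a m - cnt R a m.+1 k * J d) / (cnt R a m.+1 k + p k * H a m) ^+ 2)
  - CK K / H a m ^+ 2 * (1 + J d) ^+ 2.

Lemma W_upd K a m i : (i < m.+1)%N ->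
  W K m a + F K a m (deg a m.+1 i) <= W K m.+1 (upd a m i).
Proof.
move=> im; set d := deg _ _ _; have d0 : (0 < d)%N by [].
rewrite /W /F /CK -mulrA mulr_suml -sumrB -big_split /=.
apply: ler_sum_nat => k /andP[k0 _].
rewrite -[X in _ + (_ - X)]mulrA -mulrBr -mulrDr ler_pM2l ?(hp_gt0 p_gt0 h_gt0)//.
rewrite !xu// cnt_upd// H_upd// -/d addrC -lerBrDr.
have hc : 0 <= h0^-1 by rewrite invr_ge0 ltW.
have hJ : 0 <= J d by rewrite JE// !mulr_ge0 ?invr_ge0 ?(ltW lam_gt0) ?(ltW (f_gt0 _)) ?(ltW (h_gt0 _)).
have hX : 0 <= cnt R a m.+1 k + dN k d by rewrite -cnt_upd// cnt_ge0.
have hXH : cnt R a m.+1 k <= h0^-1 * H a m.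
  apply: le_trans (cnt_le _ _ _ _) _; rewrite -ler_pdivrMl ?invr_gt0// invrK.
  exact: H_ge.
apply: le_trans (odds_frac_step hc (p_gt0 k0) (cnt_ge0 _ _ _ _) (H_gt0 a m) hJ
  (dN_le1 k d0) hX hXH).
rewrite lerD2l lerN2 /cst_k [in leRHS](mulrC (H a m ^- 2)) //.
Qed.

Lemma nsum_fJ a m : nsum (fun d => f d * J d) a m.+1 = lam * H a m.
Proof.
rewrite /H -nsumZ; apply: eq_nsum_fun => d d0.
by rewrite JE// mulrC divfK// gt_eqF// f_gt0.
Qed.

Lemma nsum_fF K a m : nsum (fun d => f d * F K a m d) a m.+1 =
  \sum_(1 <= k < K.+1) h k * p k * p k / (cnt R a m.+1 k + p k * H a m) ^+ 2 *
    (nsum (fun d => f d * dN k d) a m.+1 * H a m - cnt R a m.+1 k * (lam * H a m))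
  - CK K / H a m ^+ 2 * nsum (fun d => f d * (1 + J d) ^+ 2) a m.+1.
Proof.
rewrite -nsum_fJ -nsumZ -mulN1r -nsumZ.
rewrite (eq_bigr (fun k => nsum (fun d => h k * p k * p k / (cnt R a m.+1 k + p k * H a m) ^+ 2 *
  (f d * dN k d * H a m - cnt R a m.+1 k * (f d * J d))) a m.+1)); last first.
  move=> k _; rewrite nsumZ; congr (_ * _).
  rewrite -[cnt R a m.+1 k * _]nsumZ mulrC -nsumZ -mulN1r -nsumZ -nsumD.
  by apply: eq_nsum_fun => d _; ring.
rewrite -nsum_sum -nsumD; apply: eq_nsum_fun => d _.
rewrite /F mulrBr mulr_sumr; congr (_ + _); last by ring.
by apply: eq_bigr => k _; ring.
Qed.

(** [W_upd] averaged over the choice: the first-order part is the sum bounded below in [gre_drift],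
    with s = S / H, and the squared jumps of H carry the error. *)
Lemma W_drift K a m : (0 < K)%N ->
  W K m a + (gre_dissip f p h (u a m) K - gre_err f p h lam K) / S a m
    - CK K / H a m ^+ 2 * (nsum (fun d => f d * (1 + J d) ^+ 2) a m.+1 / S a m) <=
  cond_exp f m (W K m.+1) a.
Proof.
move=> K0.
apply: le_trans (cond_exp_choice_le f_gt0 (F := fun d => W K m a + F K a m d) _); last first.
  by move=> i; exact: W_upd.
have -> : nsum (fun k => f k * (W K m a + F K a m k)) a m.+1 =
    W K m a * S a m + nsum (fun d => f d * F K a m d) a m.+1.
  by rewrite /S -nsumZ -nsumD; apply: eq_nsum_fun => d _; ring.
have S0 := S_gt0 a m.
rewrite -/(S a m) [leRHS]mulrDl mulfK ?gt_eqF// -addrA lerD2l mulrA -mulrBl ler_pM2r ?invr_gt0//.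
rewrite nsum_fF lerD2r.
have s_ge : \sum_(1 <= j < K.+1) f j * p j * u a m j <= S a m / H a m.
  rewrite (eq_big_nat _ _ (F2 := fun k => (f k * cnt R a m.+1 k) / H a m)); last first.
    move=> k /andP[k0 _]; rewrite /u; have h1 := H_gt0 a m; have h2 := p_gt0 k0.
    by field; rewrite !gt_eqF.
  rewrite -mulr_suml ler_wpM2r ?invr_ge0 ?(ltW (H_gt0 _ _))//.
  rewrite /S (nsum_split f a m.+1 K) lerDl nsum_ge0// => d d0.
  by case: ifP => // _; exact/ltW/f_gt0.
have gd := gre_drift f_gt0 p_gt0 h_gt0 h_rec p_rec p_one (u_ge0 a m) (fp_le _) s_ge K0.
apply: le_trans gd _.
apply: ler_sum_nat => k /andP[k0 _]; rewrite nsum_dN//.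
have -> : cnt R a m.+1 k = u a m k * (p k * H a m).
  by rewrite /u divfK// gt_eqF// pH_gt0.
have := H_gt0 a m; have := p_gt0 k0; have := u_ge0 a m k.
case: eqP => [_|/eqP k1].
  move: (u a m k) (p k) (H a m) => v q Z v0 q0 Z0.
  rewrite le_eqVlt; apply/orP; left; apply/eqP; field.
  have qZ := mulr_gt0 q0 Z0; have vqZ := mulr_ge0 v0 (ltW qZ).
  by apply/and3P; split; apply: lt0r_neq0; lra.
have -> : cnt R a m.+1 k.-1 = u a m k.-1 * (p k.-1 * H a m).
  rewrite /u divfK// gt_eqF// pH_gt0//; lia.
move: (u a m k) (p k) (H a m) => v q Z v0 q0 Z0.
rewrite le_eqVlt; apply/orP; left; apply/eqP; field.
have qZ := mulr_gt0 q0 Z0; have vqZ := mulr_ge0 v0 (ltW qZ).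
by apply/andP; split; apply: lt0r_neq0; lra.
Qed.

Lemma W_itv K m a : 0 <= W K m a <= 1.
Proof.
apply/andP; split.
  rewrite /W big_nat_cond sumr_ge0// => k /andP[/andP[k0 _] _].
  apply: mulr_ge0; first by rewrite ltW// mulr_gt0 ?h_gt0 ?p_gt0.
  by have /andP[] := odds_frac_le1 (u_ge0 a m k).
apply: le_trans (hp_partial_le1 p_gt0 h_gt0 hp_sum K.+1).
apply: ler_sum_nat => k /andP[k0 _]; rewrite ler_piMr//.
  by rewrite ltW// mulr_gt0 ?h_gt0 ?p_gt0.
by have /andP[] := odds_frac_le1 (u_ge0 a m k).
Qed.

Lemma dissip_ge0 K m a : 0 <= gre_dissip f p h (u a m) K.
Proof.
apply: mulr_ge0; first exact/ltW/h_gt0.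
rewrite big_nat_cond sumr_ge0// => j /andP[/andP[j0 _] _].
apply: mulr_ge0; first by rewrite ltW// mulr_gt0 ?f_gt0 ?p_gt0.
apply: divr_ge0; first exact: sqr_ge0.
by apply: mulr_ge0; [exact: sqr_ge0|have := u_ge0 a m j; lra].
Qed.

(** The random S is at most 2 Cf n for the dissipation and at least f(1) n for the errors. The
    squared jumps of H are dominated by [G], whose mean is linear in n; divided by H^2 S they leave
    O(n^-2). *)
Lemma expect_W_drift K : (0 < K)%N -> exists2 C, 0 <= C & forall m,
  expect f m (W K m) + ((2 * Cf)^-1 * expect f m (fun a => gre_dissip f p h (u a m) K)
     - Num.max 0 (gre_err f p h lam K) / f 1%N) / m.+1%:R - C / m.+1%:R ^+ 2 <=
  expect f m.+1 (W K m.+1).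
Proof.
move=> K0; set eps := Num.max 0 _.
have CK0 : 0 <= CK K.
  rewrite /CK big_nat_cond sumr_ge0// => k /andP[/andP[k0 _] _].
  apply: mulr_ge0; first by rewrite ltW// mulr_gt0 ?h_gt0 ?p_gt0.
  apply: divr_ge0; last exact: sqr_ge0.
  by apply: mulr_ge0; rewrite addr_ge0// ?invr_ge0 ltW// p_gt0.
have CJG k : (0 < k)%N -> 0 <= f k * (1 + J k) ^+ 2.
  by move=> k0; rewrite mulr_ge0 ?sqr_ge0// ltW// f_gt0.
pose C := CK K / h0 ^+ 2 * (CJ * CG) / f 1%N.
exists (Num.max 0 C); first by rewrite le_max lexx.
move=> m; pose n : R := m.+1%:R; have n0 : 0 < n by rewrite ltr0n.
have step a : W K m a + ((2 * Cf)^-1 * gre_dissip f p h (u a m) K) / n + (- (eps / f 1%N / n))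
    + (- (CK K / h0 ^+ 2 / f 1%N / n ^+ 3 * CJ)) * nsum G a m.+1 <= cond_exp f m (W K m.+1) a.
  apply: le_trans (W_drift a m K0).
  have S0 := S_gt0 a m; have Sl := S_le a m; have Sg := S_ge a m.
  have D0 := dissip_ge0 K m a; have H1 := H_ge a m; have Hp := H_gt0 a m.
  have b1 : ((2 * Cf)^-1 * gre_dissip f p h (u a m) K) / n <= gre_dissip f p h (u a m) K / S a m.
    rewrite mulrAC mulrC ler_wpM2l// -invfM lef_pV2// posrE//.
    by rewrite !mulr_gt0.
  have b2 : gre_err f p h lam K / S a m <= eps / f 1%N / n.
    apply: (@le_trans _ _ (eps / S a m)).
      by rewrite ler_wpM2r ?invr_ge0 ?(ltW S0)// le_max lexx orbT.
    rewrite -mulrA -invfM ler_wpM2l// ?le_max ?lexx// lef_pV2// posrE//.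
    by rewrite mulr_gt0.
  have b3 : CK K / H a m ^+ 2 * (nsum (fun d => f d * (1 + J d) ^+ 2) a m.+1 / S a m) <=
      CK K / h0 ^+ 2 / f 1%N / n ^+ 3 * CJ * nsum G a m.+1.
    have j1 : nsum (fun d => f d * (1 + J d) ^+ 2) a m.+1 <= CJ * nsum G a m.+1.
      by rewrite -nsumZ; apply: ler_nsum => d d0; rewrite JE// G_jump.
    have j0 : 0 <= nsum (fun d => f d * (1 + J d) ^+ 2) a m.+1 by exact: nsum_ge0.
    have -> : CK K / h0 ^+ 2 / f 1%N / n ^+ 3 * CJ * nsum G a m.+1 =
      CK K / (h0 * n) ^+ 2 * ((CJ * nsum G a m.+1) / (f 1%N * n)).
      by field; rewrite !gt_eqF.
    apply: ler_pM.
    - by rewrite divr_ge0 ?sqr_ge0.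
    - by rewrite divr_ge0 ?(ltW S0).
    - rewrite ler_wpM2l// lef_pV2 ?posrE ?exprn_gt0 ?mulr_gt0//.
      by rewrite lerXn2r ?nnegrE ?(ltW Hp)// mulr_ge0 ?(ltW h0_gt0) ?(ltW n0).
    - by rewrite ler_pM ?invr_ge0 ?(ltW S0)// lef_pV2 ?posrE ?mulr_gt0.
  rewrite [X in _ <= _ + X - _]mulrBl mulNr.
  apply: lerB b3; rewrite -addrA lerD2l; exact: lerB.
have -> : expect f m.+1 (W K m.+1) = expect f m (cond_exp f m (W K m.+1)) by [].
apply: le_trans (ler_expect f_gt0 m step).
have lin (w dd g : attachments -> R) (c1 c2 c3 : R) :
    expect f m (fun a => w a + c1 * dd a / n + c2 + c3 * g a) =
    expect f m w + c1 * expect f m dd / n + c2 + c3 * expect f m g.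
  rewrite !expectD// expect_cst// expectZ//; congr (_ + _ + _ + _).
  by rewrite mulrAC -expectZ//; congr (expect f m _); apply/funext => a; rewrite mulrAC.
rewrite lin.
have bG : CK K / h0 ^+ 2 / f 1%N / n ^+ 3 * CJ * expect f m (fun a => nsum G a m.+1) <=
    Num.max 0 C / n ^+ 2.
  apply: (@le_trans _ _ (C / n ^+ 2)); last first.
    by rewrite ler_wpM2r ?invr_ge0 ?sqr_ge0// le_max lexx orbT.
  have -> : C / n ^+ 2 = CK K / h0 ^+ 2 / f 1%N / n ^+ 3 * CJ * (CG * n).
    by rewrite /C; field; rewrite !gt_eqF.
  have G0 : 0 <= nsum G (fun=> ord0) 1 by exact: nsum_ge0.
  have CJ0 : 0 <= CJ * G 1%N by apply: le_trans (G_jump (ltn0Sn 0)); rewrite -JE// CJG.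
  (* A negative [CJ] is excluded by [G_jump] at degree 1. *)
  have [CJ1|CJ1] := leP 0 CJ.
    rewrite ler_wpM2l// ?G_mom//.
    rewrite mulr_ge0// !divr_ge0// ?sqr_ge0 ?(ltW f1_gt0)//; apply: exprn_ge0; exact: ltW.
  have := G_jump (ltn0Sn 0).
  have : CJ * G 1%N <= 0 by rewrite mulr_le0_ge0 ?G_ge0// ltW.
  have : 0 < f 1%N * (1 + lam * h 1%N / f 1%N) ^+ 2.
    rewrite mulr_gt0// exprn_gt0// addr_gt0// divr_gt0// mulr_gt0//; exact: h_gt0.
  lra.
rewrite mulNr; apply: lerB bG.
by rewrite -addrA lerD2l mulrBl.
Qed.

Lemma G_super_pos (e : R) : 0 < e -> exists K, forall k, (K <= k)%N -> (0 < k)%N ->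
  k%:R <= e * G k.
Proof. by move=> /G_super[K hK]; exists K => k /hK. Qed.

Lemma tail_le (g : nat -> R) (c : R) K a m :
  (forall k, (K < k)%N -> g k <= c * G k) -> 0 <= c ->
  nsum (fun d => if (K < d)%N then g d else 0) a m.+1 <= c * nsum G a m.+1.
Proof.
move=> gc c0; rewrite -nsumZ; apply: ler_nsum => d d0.
by case: ifPn => [/gc//|_]; rewrite mulr_ge0// G_ge0.
Qed.

Lemma CG_ge0 : 0 <= CG.
Proof.
have := G_mom 0; rewrite mulr1; apply: le_trans.
by apply: expect_ge0 => // a; exact: nsum_ge0.
Qed.

(** 1/2 is the value of the functional at equilibrium. [window] provides a time t of small
    dissipation from which little is lost until m, and [near_equilibrium] bounds the gap to 1/2 at
    time t. *)
Lemma mass_cvg1 (del : R) k0 : 0 < del -> exists K, (k0 <= K)%N /\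
  exists M, forall m, (M <= m)%N -> 1 / 2 - expect f m (W K m) <= del.
Proof.
move=> del0.
have d4 : 0 < del / 4 by lra.
have e0 : 0 < del / 4 * h0 / (Ch * (CG + 1)).
  by rewrite divr_gt0 ?mulr_gt0// ltr_wpDl// CG_ge0.
have [K1 hK1] := G_super_pos e0.
have [K0 K10 [C C0 near]] := near_equilibrium f_gt0 p_gt0 h_gt0 hp_sum K1 d4.
have eta0 : 0 < del / 4 / (C + 1) by rewrite divr_gt0// ltr_wpDl.
have c0 : 0 < (2 * Cf)^-1 by rewrite invr_gt0 mulr_gt0.
have [eps0 eps00 win] := window c0 eta0 d4.
have ef0 : 0 < eps0 * f 1%N by rewrite mulr_gt0.
have [K2 hK2] := err_small ef0.
(* [K] comes last: the truncation error must be below what [window] tolerates for the threshold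
   fixed by [C]. *)
have [K [k0K K_gt0 K0K K2K]] := exists_ge4 k0 1 K0 K2.
exists K; split => //.
have [CW CW0 drift] := expect_W_drift K_gt0.
have [|//|m|m|m|M hM] := win (fun m => expect f m (W K m))
  (fun m => expect f m (fun a => gre_dissip f p h (u a m) K))
  (Num.max 0 (gre_err f p h lam K) / f 1%N) CW.
- rewrite divr_ge0 ?le_max ?lexx ?(ltW f1_gt0)//= ler_pdivrMr// ge_max (ltW ef0)/=.
  exact: hK2.
- rewrite expect_ge0//=; last by move=> a; have /andP[] := W_itv K m a.
  rewrite -(expect_cst f_gt0 m 1); apply: ler_expect => // a.
  by have /andP[] := W_itv K m a.
- by apply: expect_ge0 => // a; exact: dissip_ge0.
- exact: drift.
exists M => m /hM[t dt et].
suff : 1 / 2 - expect f t (W K t) <= del / 4 + C * (del / 4 / (C + 1)) + del / 4.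
  have : C * (del / 4 / (C + 1)) <= del / 4.
    rewrite mulrCA ler_piMr ?(ltW d4)// ler_pdivrMr ?mul1r ?lerDl// ltr_wpDl//.
  lra.
have pt a : 1 / 2 - W K t a <= del / 4 + C * gre_dissip f p h (u a t) K + hpu_tail a t K0.
  apply: near => //.
  - exact: u_ge0.
  - by move=> k; exact: hpu_le1.
  - exact: hpu_tail_ge0.
  - exact: hpu_sum.
have lin (w dd g : attachments -> R) (c1 c2 : R) :
    expect f t (fun a => c1 + c2 * dd a + g a) =
    c1 + c2 * expect f t dd + expect f t g.
  by rewrite !expectD// expect_cst// expectZ.
have := ler_expect f_gt0 t pt; rewrite lin// expectB// expect_cst//.
move=> /le_trans; apply; rewrite lerD//.
  by rewrite lerD2l ler_wpM2l// ltW.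
have pt2 a : hpu_tail a t K0 <= (del / 4 / (CG + 1)) / t.+1%:R * nsum G a t.+1.
  rewrite /hpu_tail ler_pdivrMr ?H_gt0//.
  apply: (@le_trans _ _ (Ch * (del / 4 * h0 / (Ch * (CG + 1))) * nsum G a t.+1)).
    apply: tail_le; last by rewrite mulr_ge0 ?(ltW Ch_gt0)// ltW.
    move=> k Kk; have kk0 : (0 < k)%N by apply: leq_trans Kk.
    apply: le_trans (h_hi kk0) _; rewrite -mulrA ler_pM2l// hK1//.
    by rewrite (leq_trans K10)// ltnW.
  have CG1 : 0 < CG + 1 by rewrite ltr_wpDl// CG_ge0.
  rewrite [leRHS]mulrAC; apply: ler_wpM2r; first exact: nsum_ge0.
  have -> : Ch * (del / 4 * h0 / (Ch * (CG + 1))) = del / 4 / (CG + 1) / t.+1%:R * (h0 * t.+1%:R).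
    by field; rewrite !gt_eqF// ltr0n.
  by rewrite ler_pM2l ?H_ge// !divr_gt0.
apply: le_trans (ler_expect f_gt0 t pt2) _; rewrite expectZ//.
have CG1 : 0 < CG + 1 by rewrite ltr_wpDl// CG_ge0.
apply: (@le_trans _ _ (del / 4 / (CG + 1) / t.+1%:R * (CG * t.+1%:R))).
  by rewrite ler_pM2l ?G_mom// !divr_gt0.
have -> : del / 4 / (CG + 1) / t.+1%:R * (CG * t.+1%:R) = (del / 4) * (CG / (CG + 1)).
  by field; rewrite !gt_eqF// ltr0n.
by rewrite ler_piMr ?(ltW d4)// ler_pdivrMr// mul1r lerDl.
Qed.

(** Since u_k is at most 1 / (h_k p_k), [gap_dominates] turns the gap 1/2 - W into a bound on (u_k -
    1)^2. *)
Lemma u_cvg1 k (e : R) : (0 < k)%N -> 0 < e -> exists M, forall m, (M <= m)%N ->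
  expect f m (fun a => `|u a m k - 1|) <= e.
Proof.
move=> k0 e0; have c0 := hp_gt0 p_gt0 h_gt0 k0.
pose B : R := 4 * (1 + (h k * p k)^-1) / (h k * p k).
have U0 : 0 < 1 + (h k * p k)^-1 by rewrite addr_gt0 ?invr_gt0.
have B0 : 0 < B by rewrite divr_gt0// mulr_gt0.
have s0 : 0 < e / 2 by lra.
have del0 : 0 < (e / 2) ^+ 2 / B by rewrite divr_gt0 ?exprn_gt0.
have [K [kK [M hM]]] := mass_cvg1 k del0.
exists M => m /hM Wm.
have pt a : `|u a m k - 1| <= e / 2 + B / (e / 2) * (1 / 2 - W K m a).
  apply: le_trans (le_soft s0 (B := B * (1 / 2 - W K m a)) _) _; last first.
    by rewrite mulrAC.
  have kK' : (0 < k <= K)%N by rewrite k0.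
  have := gap_dominates p_gt0 h_gt0 hp_sum (u_ge0 a m) (hpu_sum_le1 a m K) kK'.
  have u0 := u_ge0 a m k; have u1 : u a m k <= (h k * p k)^-1.
    by rewrite -[leRHS]mul1r ler_pdivlMr// mulrC hpu_le1.
  rewrite -/(W K m a); set Q := 1 / 2 - _ => hQ.
  have Q0 : 0 <= Q.
    apply: le_trans hQ; apply: mulr_ge0; first exact: ltW.
    by rewrite divr_ge0 ?sqr_ge0// mulr_ge0//; lra.
  by apply: quot_bound hQ => //; [lra|rewrite ler_pM2l// lerD2l].
apply: le_trans (ler_expect f_gt0 m pt) _.
have lin (w : attachments -> R) (c1 c2 : R) :
    expect f m (fun a => c1 + c2 * (1 / 2 - w a)) = c1 + c2 * (1 / 2 - expect f m w).
  by rewrite expectD// expect_cst// expectZ// expectB// expect_cst.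
rewrite lin.
have : B / (e / 2) * (1 / 2 - expect f m (W K m)) <= B / (e / 2) * ((e / 2) ^+ 2 / B).
  by rewrite ler_pM2l// divr_gt0.
have -> : B / (e / 2) * ((e / 2) ^+ 2 / B) = e / 2 by field; rewrite !gt_eqF.
lra.
Qed.

Lemma lead_tail_small (e : R) : 0 < e -> exists K0, forall K m, (K0 <= K)%N ->
  expect f m (fun a => nsum (fun d => if (K < d)%N then 1 else 0) a m.+1 / H a m) <= e.
Proof.
move=> e0; have CG1 : 0 < CG + 1 by rewrite ltr_wpDl// CG_ge0.
have e1 : 0 < e * h0 / (CG + 1) by rewrite !mulr_gt0 ?invr_gt0.
have [K0 hK0] := G_super_pos e1.
exists K0 => K m K0K.
have pt a : nsum (fun d => if (K < d)%N then 1 else 0) a m.+1 / H a m <=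
    e / (CG + 1) / m.+1%:R * nsum G a m.+1.
  rewrite ler_pdivrMr ?H_gt0//.
  apply: (@le_trans _ _ (e * h0 / (CG + 1) * nsum G a m.+1)).
    apply: tail_le; last exact: ltW.
    move=> k Kk; have kk0 : (0 < k)%N by apply: leq_trans Kk.
    apply: le_trans (hK0 k _ kk0); first by rewrite ler1n.
    by rewrite (leq_trans K0K)// ltnW.
  rewrite [leRHS]mulrAC; apply: ler_wpM2r; first exact: nsum_ge0.
  have -> : e * h0 / (CG + 1) = e / (CG + 1) / m.+1%:R * (h0 * m.+1%:R).
    by field; rewrite !gt_eqF// ltr0n.
  by rewrite ler_pM2l ?H_ge// !divr_gt0.
apply: le_trans (ler_expect f_gt0 m pt) _; rewrite expectZ//.
apply: (@le_trans _ _ (e / (CG + 1) / m.+1%:R * (CG * m.+1%:R))).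
  by rewrite ler_pM2l ?G_mom// !divr_gt0.
have -> : e / (CG + 1) / m.+1%:R * (CG * m.+1%:R) = e * (CG / (CG + 1)).
  by field; rewrite !gt_eqF// ltr0n.
by rewrite ler_piMr ?(ltW e0)// ler_pdivrMr// mul1r lerDl.
Qed.

Lemma p_partial_le1 n : \sum_(1 <= k < n) p k <= 1.
Proof.
rewrite -[leRHS](cvg_lim (@Rhausdorff _) p_sum).
apply: nondecreasing_cvgn_le; last by apply/cvg_ex; exists 1.
by apply: ge0_partial_sum_nd => k k0; exact/ltW/p_gt0.
Qed.

Lemma eventually_all (Q : nat -> nat -> Prop) K :
  (forall k, (0 < k)%N -> exists M, forall m, (M <= m)%N -> Q k m) ->
  exists M, forall m, (M <= m)%N -> forall k, (0 < k < K)%N -> Q k m.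
Proof.
move=> hQ; elim: K => [|K [M IH]]; first by exists 0%N => m _ k; rewrite ltn0 andbF.
case: K IH => [|K] IH; first by exists 0%N => m _ [|k].
have [M' h'] := hQ K.+1 isT.
exists (maxn M M') => m; rewrite geq_max => /andP[Mm M'm] k /andP[k0].
rewrite ltnS leq_eqVlt => /orP[/eqP->|kK]; first exact: h'.
by apply: IH => //; rewrite k0.
Qed.

(** Counting nodes, n / H is the sum of p_k u_k, which is close to the sum of p_k, that is 1. This
    converts the ratios u_k into frequencies. *)
Lemma size_ratio_cvg1 (e : R) : 0 < e -> exists M, forall m, (M <= m)%N ->
  expect f m (fun a => `|1 - m.+1%:R / H a m|) <= e.
Proof.
move=> e0; have e3 : 0 < e / 3 by lra.
have [K1 hK1] := lead_tail_small e3.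
have /cvgrPdist_le/(_ _ e3)[K2 _ hK2] := p_sum.
have [K [K1K _ K2K _]] := exists_ge4 K1 1 K2 0.
have [M hM] := @eventually_all
  (fun k m => expect f m (fun a => `|u a m k - 1|) <= e / 3) K.+1
  (fun k k0 => u_cvg1 k0 e3).
exists M => m Mm.
have pt a : `|1 - m.+1%:R / H a m| <= \sum_(1 <= k < K.+1) p k * `|u a m k - 1| +
    e / 3 + nsum (fun d => if (K < d)%N then 1 else 0) a m.+1 / H a m.
  set T := nsum _ a _ / _.
  have T0 : 0 <= T.
    rewrite divr_ge0 ?(ltW (H_gt0 _ _))// nsum_ge0// => k _; by case: ifP.
  have -> : 1 - m.+1%:R / H a m =
      - \sum_(1 <= k < K.+1) p k * (u a m k - 1) + (1 - \sum_(1 <= k < K.+1) p k) - T.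
    have -> : m.+1%:R / H a m = \sum_(1 <= k < K.+1) p k * u a m k + T.
      rewrite -(mul1r m.+1%:R) -(nsum_cst 1 a) (nsum_split _ a m.+1 K) mulrDl; congr (_ + _).
      rewrite mulr_suml; apply: eq_big_nat => k /andP[k0 _]; rewrite /u.
      have := p_gt0 k0; have := H_gt0 a m => h1 h2.
      by field; rewrite !gt_eqF.
    under [in RHS]eq_bigr do rewrite mulrBr mulr1.
    by rewrite sumrB; ring.
  apply: le_trans (ler_normB _ _) _; rewrite (ger0_norm T0) lerD2r.
  apply: le_trans (ler_normD _ _) _; rewrite normrN lerD//; last first.
    by apply: hK2; rewrite /= (leq_trans K2K).
  apply: le_trans (ler_norm_sum _ _ _) _; apply: ler_sum_nat => k /andP[k0 _].
  by rewrite normrM gtr0_norm ?p_gt0.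
apply: le_trans (ler_expect f_gt0 m pt) _.
rewrite !expectD// expect_cst// expect_sum//.
have h1 := hK1 K m K1K.
suff : \sum_(1 <= i < K.+1) expect f m (fun a => p i * `|u a m i - 1|) <= e / 3 by lra.
apply: (@le_trans _ _ (\sum_(1 <= i < K.+1) p i * (e / 3))).
  by apply: ler_sum_nat => k kK; rewrite expectZ// ler_pM2l ?hM// p_gt0//; case/andP: kK.
by rewrite -mulr_suml ler_piMl ?(ltW e3)// p_partial_le1.
Qed.

Lemma degree_cvg k (e : R) : (0 < k)%N -> 0 < e -> exists M, forall m, (M <= m)%N ->
  expect f m (fun a => `|cnt R a m.+1 k / m.+1%:R - p k|) <= e.
Proof.
move=> k0 e0; have e2 : 0 < e / 2 by lra.
have e2p : 0 < e / 2 / p k by rewrite divr_gt0 ?p_gt0.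
have [M1 hM1] := size_ratio_cvg1 e2.
have [M2 hM2] := u_cvg1 k0 e2p.
exists (maxn M1 M2) => m; rewrite geq_max => /andP[/hM1 h1 /hM2 h2].
have pt a : `|cnt R a m.+1 k / m.+1%:R - p k| <=
    `|1 - m.+1%:R / H a m| + p k * `|u a m k - 1|.
  have := H_gt0 a m; have pk := p_gt0 k0 => Ha.
  have n0 : 0 < (m.+1%:R : R) by rewrite ltr0n.
  have -> : cnt R a m.+1 k / m.+1%:R - p k =
    cnt R a m.+1 k / m.+1%:R * (1 - m.+1%:R / H a m) + p k * (u a m k - 1).
    by rewrite /u; field; rewrite !gt_eqF.
  apply: le_trans (ler_normD _ _) _; rewrite !normrM (gtr0_norm pk) lerD2r.
  rewrite normfV (ger0_norm (cnt_ge0 _ _ _ _)) (gtr0_norm n0) ler_piMl//.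
  by rewrite ler_pdivrMr// mul1r cnt_le.
apply: le_trans (ler_expect f_gt0 m pt) _.
rewrite expectD// expectZ//.
have : p k * expect f m (fun a => `|u a m k - 1|) <= p k * (e / 2 / p k).
  by rewrite ler_pM2l ?p_gt0.
have -> : p k * (e / 2 / p k) = e / 2 by field; rewrite gt_eqF// p_gt0.
lra.
Qed.

Section Weighted.
Variables (w : nat -> R) (Cw : R).
Hypothesis w_ge0 : forall k, (0 < k)%N -> 0 <= w k.
Hypothesis w_le : forall k, (0 < k)%N -> w k <= Cw * G k.
Hypothesis w_small : forall e : R, 0 < e -> exists K, forall k, (K <= k)%N ->
  w k <= e * G k.

(** Fatou's lemma by hand: at a late time M the first n frequencies are so close to p that the
    weighted error is at most s / (1 + s) <= 1 in mean, and the empirical moment of w is bounded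
    through [G]. *)
Let wp_partial n : \sum_(1 <= k < n) w k * p k <= 1 + `|Cw| * CG.
Proof.
pose s := \sum_(1 <= k < n) w k.
have s0 : 0 <= s by rewrite /s big_nat_cond sumr_ge0// => k /andP[/andP[k0 _] _]; exact: w_ge0.
have e0 : 0 < (1 + s)^-1 by rewrite invr_gt0; lra.
have [M hM] := @eventually_all
  (fun k m => expect f m (fun a => `|cnt R a m.+1 k / m.+1%:R - p k|) <= (1 + s)^-1) n
  (fun k k0 => degree_cvg k0 e0).
have n0 : 0 < (M.+1%:R : R) by rewrite ltr0n.
have pt a : \sum_(1 <= k < n) w k * p k <=
  \sum_(1 <= k < n) w k * `|cnt R a M.+1 k / M.+1%:R - p k|
   + `|Cw| / M.+1%:R * nsum G a M.+1.
  apply: (@le_trans _ _ (\sum_(1 <= k < n) w k * `|cnt R a M.+1 k / M.+1%:R - p k|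
    + (\sum_(1 <= k < n) w k * cnt R a M.+1 k) / M.+1%:R)).
    rewrite mulr_suml -big_split/=; apply: ler_sum_nat => k /andP[k0 _].
    rewrite -mulrA -mulrDr ler_wpM2l ?w_ge0//.
    by rewrite -lerBlDr distrC ler_norm.
  rewrite lerD2l mulrAC ler_pM2r ?invr_gt0//.
  case: n {s s0 e0 hM} => [|n'].
    by rewrite big_geq// mulr_ge0// nsum_ge0.
  rewrite nsum_cnt -nsumZ; apply: ler_nsum => k k0.
  case: ifP => _; last by rewrite mulr_ge0// G_ge0.
  by apply: le_trans (w_le k0) _; rewrite ler_wpM2r ?G_ge0// ler_norm.
have := ler_expect f_gt0 M pt; rewrite expect_cst// expectD// expectZ// expect_sum//.
move=> /le_trans; apply; apply: lerD.
  apply: (@le_trans _ _ (\sum_(1 <= k < n) w k * (1 + s)^-1)).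
    apply: ler_sum_nat => k kn; rewrite expectZ// ler_wpM2l ?hM//.
    by apply: w_ge0; case/andP: kn.
  rewrite -mulr_suml -/s ler_pdivrMr; lra.
rewrite -mulrA ler_wpM2l// mulrC ler_pdivrMr//; exact: G_mom.
Qed.

Lemma wp_summable : summable1 (fun k => w k * p k).
Proof.
apply: ge0_summable1 wp_partial => k k0.
by rewrite mulr_ge0 ?w_ge0// ltW// p_gt0.
Qed.

(** Finitely many degrees converge, w p is summable, and the empirical tail is small uniformly in
    time because w is negligible against [G]. *)
Lemma wdist_cvg0 : (fun m => expect f m (fun a => wdist p w a m)) @ \oo --> (0 : R).
Proof.
apply/cvgrPdist_le => e e0.
have CG1 : 0 < CG + 1 by rewrite ltr_wpDl// CG_ge0.
have e3 : 0 < e / 3 by lra.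
have e4 : 0 < e / 3 / (CG + 1) by rewrite divr_gt0.
have [K1 hK1] := w_small e4.
have wp0 k : (0 < k)%N -> 0 <= w k * p k by move=> k0; rewrite mulr_ge0 ?w_ge0// ltW// p_gt0.
have [K2 hK2] := ge0_tail_cut wp0 wp_summable e3.
have [K [K1K _ K2K _]] := exists_ge4 K1 1 K2 0.
pose s := \sum_(1 <= k < K.+1) w k.
have s0 : 0 <= s by rewrite /s big_nat_cond sumr_ge0// => k /andP[/andP[k0 _] _]; exact: w_ge0.
have es : 0 < e / 3 / (1 + s) by rewrite divr_gt0//; lra.
have [M hM] := @eventually_all
  (fun k m => expect f m (fun a => `|cnt R a m.+1 k / m.+1%:R - p k|) <= e / 3 / (1 + s)) K.+1
  (fun k k0 => degree_cvg k0 es).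
exists M => // m /= Mm; rewrite sub0r normrN ger0_norm; last first.
  by apply: expect_ge0 => // a; exact: (wdist_ge0 w_ge0 p_gt0 wp_summable).
have n0 : 0 < (m.+1%:R : R) by rewrite ltr0n.
have ws a' : summable1 (fun k => w k * `|cnt R a' m.+1 k / m.+1%:R - p k|).
  by exact: (wdist_summable w_ge0 p_gt0 wp_summable).
have pt a : wdist p w a m <= \sum_(1 <= k < K.+1) w k * `|cnt R a m.+1 k / m.+1%:R - p k|
   + e / 3 + e / 3 / (CG + 1) / m.+1%:R * nsum G a m.+1.
  apply: ge0_sum_le; last exact: ws.
  move=> n.
  have nn : (n <= maxn n K.+1)%N by rewrite leq_maxl.
  apply: (@le_trans _ _ (\sum_(1 <= k < maxn n K.+1) w k * `|cnt R a m.+1 k / m.+1%:R - p k|)).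
    apply: (@ge0_partial_sum_nd _ (fun k => w k * `|cnt R a m.+1 k / m.+1%:R - p k|)) => // k k0.
    by rewrite mulr_ge0 ?w_ge0.
  rewrite (@big_cat_nat _ _ _ K.+1)/= ?leq_maxr// -addrA lerD2l.
  apply: (@le_trans _ _ (\sum_(K.+1 <= k < maxn n K.+1) w k * p k +
     (\sum_(K.+1 <= k < maxn n K.+1) w k * cnt R a m.+1 k) / m.+1%:R)).
    rewrite mulr_suml -big_split/=; apply: ler_sum_nat => k /andP[Kk _].
    have k0 : (0 < k)%N by apply: leq_trans Kk.
    rewrite -mulrA -mulrDr ler_wpM2l ?w_ge0//.
    apply: le_trans (ler_normB _ _) _; rewrite (gtr0_norm (p_gt0 k0)) addrC lerD2l.
    by rewrite ger0_norm// divr_ge0// cnt_ge0.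
  apply: lerD; first by apply: hK2; rewrite (leq_trans K2K).
  rewrite [leRHS]mulrAC ler_pM2r ?invr_gt0//.
  apply: le_trans (tail_le (g := w) (K := K) a m _ (ltW e4)); last first.
    by move=> k Kk; apply: hK1; rewrite (leq_trans K1K)// ltnW.
  exact: cnt_block_le.
apply: le_trans (ler_expect f_gt0 m pt) _.
rewrite !expectD// expect_cst// expectZ// expect_sum//.
have b1 : \sum_(1 <= k < K.+1) expect f m (fun a => w k * `|cnt R a m.+1 k / m.+1%:R - p k|)
    <= e / 3.
  apply: (@le_trans _ _ (\sum_(1 <= k < K.+1) w k * (e / 3 / (1 + s)))).
    apply: ler_sum_nat => k kn; rewrite expectZ// ler_wpM2l ?hM//.
    by apply: w_ge0; case/andP: kn.
  rewrite -mulr_suml -/s mulrCA ler_piMr ?(ltW e3)// ler_pdivrMr; lra.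
have b2 : e / 3 / (CG + 1) / m.+1%:R * expect f m (fun a => nsum G a m.+1) <= e / 3.
  apply: (@le_trans _ _ (e / 3 / (CG + 1) / m.+1%:R * (CG * m.+1%:R))).
    by rewrite ler_pM2l ?G_mom// divr_gt0.
  have -> : e / 3 / (CG + 1) / m.+1%:R * (CG * m.+1%:R) = e / 3 * (CG / (CG + 1)).
    by field; rewrite !gt_eqF.
  by rewrite ler_piMr ?(ltW e3)// ler_pdivrMr// mul1r lerDl.
apply: le_trans (lerD (lerD b1 (lexx _)) b2) _; lra.
Qed.

Lemma expect_w_le m : expect f m (fun a => nsum w a m.+1) <= `|Cw| * CG * m.+1%:R.
Proof.
have pt a : nsum w a m.+1 <= `|Cw| * nsum G a m.+1.
  rewrite -nsumZ; apply: ler_nsum => k k0; apply: le_trans (w_le k0) _.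
  by rewrite ler_wpM2r ?G_ge0// ler_norm.
by apply: le_trans (ler_expect f_gt0 m pt) _; rewrite expectZ// -mulrA ler_wpM2l.
Qed.

End Weighted.

End LawOfLargeNumbers.

(** * Existence and uniqueness of the Malthusian parameter *)

Section Malthusian.
Variables (R : realType) (f : nat -> R).
Hypothesis f_gt0 : forall k, (0 < k)%N -> 0 < f k.

Lemma surv_cont l (s : R) : 0 < s -> {for s, continuous (fun s => surv f s l)}.
Proof.
move=> s0; elim: l => [|l IH].
  rewrite (_ : (fun s => surv f s 0) = cst 1); first exact: cvg_cst.
  by apply/funext => t; rewrite surv0.
rewrite (_ : (fun s => surv f s l.+1) =
  (fun s => surv f s l * (f l.+1 / (s + f l.+1)))); last first.
  by apply/funext => t; rewrite survS.
apply: cvgM; first exact: IH.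
apply: cvgM; first exact: cvg_cst.
apply: cvgV; first by rewrite gt_eqF// addr_gt0// f_gt0.
by apply: cvgD; [exact: cvg_id|exact: cvg_cst].
Qed.

Lemma surv_partial_cont n (s : R) : 0 < s ->
  {for s, continuous (fun s => \sum_(1 <= l < n) surv f s l)}.
Proof.
move=> s0; elim: n => [|[|n] IH].
- rewrite (_ : (fun s => _) = cst 0); first exact: cvg_cst.
  by apply/funext => t; rewrite big_geq.
- rewrite (_ : (fun s => _) = cst 0); first exact: cvg_cst.
  by apply/funext => t; rewrite big_geq.
- rewrite (_ : (fun s => \sum_(1 <= l < n.+2) surv f s l) =
    (fun s => \sum_(1 <= l < n.+1) surv f s l + surv f s n.+1)); last first.
    by apply/funext => t; rewrite big_nat_recr.
  by apply: cvgD; [exact: IH|exact: surv_cont].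
Qed.

Lemma surv_mono l (s t : R) : 0 < s -> s <= t -> surv f t l <= surv f s l.
Proof.
move=> s0 st; have t0 : 0 < t by exact: lt_le_trans st.
elim: l => [|l IH]; first by rewrite !surv0.
have fl := f_gt0 (ltn0Sn l).
rewrite !survS; apply: ler_pM => //.
- exact/ltW/surv_gt0.
- by rewrite divr_ge0 ?addr_ge0 ?ltW.
- by rewrite ler_pM2l// lef_pV2 ?posrE ?addr_gt0// lerD2r.
Qed.

Lemma surv_partial_mono n (s t : R) : 0 < s -> s <= t ->
  \sum_(1 <= l < n) surv f t l <= \sum_(1 <= l < n) surv f s l.
Proof. by move=> s0 st; apply: ler_sum => l _; exact: surv_mono. Qed.

Lemma surv_partial_le_supersol A B (s : R) n : 0 < s -> 0 <= A -> 0 <= B ->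
  (forall k, (0 < k)%N -> (A + 1) * f k <= s * (A * k%:R + B)) ->
  \sum_(1 <= l < n) surv f s l <= A + B.
Proof.
move=> s0 A0 B0 AB; case: n => [|n]; first by rewrite big_geq// addr_ge0.
have := surv_supersol f_gt0 s0 AB 0 n; rewrite surv0 mul1r mulr1 add1n.
apply: le_trans; rewrite lerDl mulr_ge0 ?(ltW (surv_gt0 _ _ _))//.
by rewrite addr_ge0// mulr_ge0.
Qed.

Definition malthus_prop (lam : R) := 0 < lam /\
  (fun n => \sum_(1 <= l < n) surv f lam l) @ \oo --> (1 : R).

Lemma malthus_unique (s t : R) : malthus_prop s -> malthus_prop t -> s = t.
Proof.
wlog st : s t / s < t.
  move=> wl hs ht; have [st|ts|//] := ltgtP s t; first exact: wl.
  by apply/esym; exact: wl.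
move=> [s0 hs] [t0 ht]; exfalso.
have f1 := f_gt0 (ltn0Sn 0).
have lt1 : surv f t 1 < surv f s 1.
  by rewrite !survS !surv0 !mul1r ltr_pM2l// ltf_pV2 ?posrE ?addr_gt0// ltrD2r.
have : 1 <= 1 - (surv f s 1 - surv f t 1).
  rewrite -[X in X <= _](cvg_lim (@Rhausdorff _) ht); apply: limr_le.
    by apply/cvg_ex; exists 1.
  near=> n; have n2 : (2 <= n)%N by near: n; exact: nbhs_infty_ge.
  have := surv_partial_lt1 f_gt0 s0 hs n.
  rewrite !(@big_cat_nat _ _ _ 2 1 n)//= !big_nat1.
  have : \sum_(2 <= l < n) surv f t l <= \sum_(2 <= l < n) surv f s l.
    by apply: ler_sum => l _; apply: surv_mono => //; exact: ltW.
  lra.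
lra.
Unshelve. all: by end_near. Qed.

Hypothesis f_nd : forall k, (0 < k)%N -> f 1%N <= f k.

(** lam is the supremum of the parameters at which some partial sum exceeds 1. By continuity none
    exceeds 1 at lam itself; that the full sum reaches 1 requires tails that are small uniformly in
    the parameter, whence the domination by the series at [s0]. *)
Lemma malthus_exists_sublinear (C : R) : (forall k, (0 < k)%N -> f k <= C * k%:R) ->
  (forall e : R, 0 < e -> exists2 c, 0 <= c & forall k, (0 < k)%N -> f k <= e * k%:R + c) ->
  exists lam, malthus_prop lam.
Proof.
move=> fC fsub.
have f1 := f_gt0 (ltn0Sn 0).
have C0 : 0 < C by apply: lt_le_trans f1 _; have := fC 1%N isT; rewrite mulr1.
(* At this parameter the first two terms are at least 4/5 and 16/25, so they already exceed 1. *)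
pose s0 := f 1%N / 4; have s00 : 0 < s0 by rewrite divr_gt0.
pose r n s := \sum_(1 <= l < n) surv f s l.
pose E := [set s | s0 <= s /\ exists n, 1 < r n s].
have Es0 : E s0.
  split => //; exists 3%N; rewrite /r big_nat_recr//= big_nat1 !survS surv0 mul1r.
  have -> : f 1%N / (s0 + f 1%N) = 4 / 5 by rewrite /s0; field; rewrite !gt_eqF//; lra.
  have : 4 / 5 <= f 2%N / (s0 + f 2%N).
    have f2 := f_nd (ltn0Sn 1); rewrite ler_pdivlMr; rewrite /s0; lra.
  lra.
(* At 5 C, A = B = 1/4 is a supersolution, so the sum is at most 1/2. *)
have Eub : ubound E (5 * C).
  move=> s [s0s [n rn]]; rewrite leNgt; apply/negP => Cs.
  have : r n s <= r n (5 * C) by apply: surv_partial_mono; [rewrite mulr_gt0|exact: ltW].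
  have : r n (5 * C) <= 1 / 4 + 1 / 4.
    apply: surv_partial_le_supersol; rewrite ?mulr_gt0//; try lra.
    move=> k k0; have := fC k k0; have : (0 : R) <= k%:R by [].
    move: (k%:R : R) => y; nra.
  lra.
have hE : has_sup E by split; [exists s0|exists (5 * C)].
pose lam := sup E.
have s0lam : s0 <= lam by apply: sup_upper_bound.
have lam0 : 0 < lam by exact: lt_le_trans s0lam.
have claim1 n : r n lam <= 1.
  rewrite leNgt; apply/negP => rn.
  have /cvgrPdist_lt /(_ (r n lam - 1)) := @surv_partial_cont n _ lam0.
  rewrite subr_gt0 => /(_ rn) [e /= e0 he].
  have : E (lam + e / 2).
    split; first by rewrite ler_wpDr// divr_ge0// ltW.
    exists n; have := he (lam + e / 2); rewrite /ball_ /= opprD addNKr normrN.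
    rewrite gtr0_norm ?divr_gt0// ltr_pdivrMr// ltr_pMr// ltr1n => /(_ isT).
    by rewrite ltr_norml -/(r n lam) -/(r n _) => /andP[_]; lra.
  move=> /(sup_upper_bound hE); rewrite -/lam; have : 0 < e / 2 by rewrite divr_gt0.
  lra.
exists lam; split => //.
(* Sublinearity with slope s0 / 2 gives a supersolution with A = 1. *)
have sum0 : summable1 (surv f s0).
  have [c c0 hc] := fsub (s0 / 2) ltac:(by rewrite divr_gt0).
  apply: (@ge0_summable1 _ _ (1 + 2 * c / s0)); first by move=> k _; exact/ltW/surv_gt0.
  move=> n; apply: surv_partial_le_supersol => //; first by rewrite divr_ge0 ?mulr_ge0// ltW.
  move=> k k0; have := hc k k0; rewrite mul1r mulrDr [s0 * (_ / _)]mulrCA divff ?gt_eqF//; lra.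
apply/cvgrPdist_le => e e0.
have e2 : 0 < e / 2 by lra.
have [L hL] := ge0_tail_cut (fun k _ => ltW (surv_gt0 f_gt0 s00 k)) sum0 e2.
have L1 : (L <= L.+1)%N by [].
have claim2 : 1 - e <= r L.+1 lam.
  have /cvgrPdist_lt /(_ _ e2) [eta /= eta0 heta] := @surv_partial_cont L.+1 _ lam0.
  have [s [s0s [n rn]] slam] := sup_adherent eta0 hE.
  have sle : s <= lam by apply: sup_upper_bound => //; split => //; exists n.
  have := heta s; rewrite /ball_ /= ger0_norm ?subr_ge0//.
  rewrite ltrBlDr -ltrBlDl => /(_ slam); rewrite ltr_norml -/(r _ lam) -/(r _ s) => /andP[h1 h2].
  have sp : 0 < s by exact: lt_le_trans s0s.
  have : r n s <= r L.+1 s + e / 2.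
    apply: (@le_trans _ _ (r (maxn n L.+1) s)).
      apply: (@ge0_partial_sum_nd _ (surv f s)); last by rewrite leq_maxl.
      by move=> k _; exact/ltW/surv_gt0.
    rewrite /r (@big_cat_nat _ _ _ L.+1)/= ?leq_maxr// lerD2l.
    apply: le_trans (hL L.+1 (maxn n L.+1) L1).
    by apply: ler_sum => l _; exact: surv_mono.
  lra.
near=> n; have nL : (L.+1 <= n)%N by near: n; exact: nbhs_infty_ge.
have : r L.+1 lam <= r n lam.
  by apply: (@ge0_partial_sum_nd _ (surv f lam)) => // k _; exact/ltW/surv_gt0.
have := claim1 n; rewrite -/(r n lam) ger0_norm ?subr_ge0//; lra.
Unshelve. all: by end_near. Qed.

(** (k + alpha) / (1 + alpha) solves the recursion exactly, which gives the identity [rem]. Its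
    remainder becomes small: otherwise surv n would stay above a multiple of 1 / n, and the partial
    sums, bounded by 1, would diverge. *)
Lemma malthus_affine (alpha : R) : -1 < alpha ->
  (forall k, (0 < k)%N -> f k = k%:R + alpha) -> malthus_prop (2 + alpha).
Proof.
move=> al fE; have lam0 : 0 < 2 + alpha by lra.
split => //; pose g k : R := (k%:R + alpha) / (1 + alpha).
have a1 : 0 < 1 + alpha by lra.
have kpos k : 0 < k.+1%:R + alpha by rewrite -natr1 -addrA ltr_wpDl//; lra.
have rem n : \sum_(1 <= l < n.+1) surv f (2 + alpha) l + surv f (2 + alpha) n * g n.+1 = 1.
  elim: n => [|n IH]; first by rewrite big_geq// surv0 add0r mul1r /g divff// gt_eqF.
  rewrite big_nat_recr//= -[RHS]IH -addrA; congr (_ + _).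
  rewrite -[X in X + _]mulr1 -mulrDr survS fE// /g -[n.+2%:R]natr1 -mulrA.
  congr (_ * _); have := kpos n; move: (n.+1%:R : R) => y y0.
  by field; apply/andP; split; apply: lt0r_neq0; lra.
have le1 n : \sum_(1 <= l < n.+1) surv f (2 + alpha) l <= 1.
  rewrite -[leRHS](rem n) lerDl mulr_ge0 ?(ltW (surv_gt0 _ _ _))//.
  by rewrite divr_ge0// ltW.
apply/cvgrPdist_le => e e0.
have [[N hN]|none] := pselect (exists N, 1 - e <= \sum_(1 <= l < N.+1) surv f (2 + alpha) l).
  near=> n; have nN : (N.+1 <= n)%N by near: n; exact: nbhs_infty_ge.
  have : \sum_(1 <= l < N.+1) surv f (2 + alpha) l <= \sum_(1 <= l < n) surv f (2 + alpha) l.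
    by apply: (@ge0_partial_sum_nd _ (surv f (2 + alpha))) => // k _; exact/ltW/surv_gt0.
  have : \sum_(1 <= l < n) surv f (2 + alpha) l <= 1 by rewrite -(prednK (leq_ltn_trans (leq0n N) nN)).
  by move=> h1 h2; rewrite ger0_norm ?subr_ge0//; lra.
exfalso.
pose M := 1 + `|alpha|.
have M0 : 0 < M by rewrite /M ltr_wpDr.
have sge n : e * (1 + alpha) / M * n.+1%:R^-1 <= surv f (2 + alpha) n.
  have h1 : e <= surv f (2 + alpha) n * g n.+1.
    have : ~ (1 - e <= \sum_(1 <= l < n.+1) surv f (2 + alpha) l) by move=> h; apply: none; exists n.
    move=> /negP; rewrite -ltNge; have := rem n; lra.
  have h2 : n.+1%:R + alpha <= M * n.+1%:R.
    have := ler_norm alpha; have : (1 : R) <= n.+1%:R by rewrite ler1n.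
    rewrite /M; have := normr_ge0 alpha; move: (n.+1%:R : R) `|alpha| => y z; nra.
  rewrite -mulrA -invfM ler_pdivrMr ?mulr_gt0//.
  have h3 : surv f (2 + alpha) n * (n.+1%:R + alpha) <= surv f (2 + alpha) n * (M * n.+1%:R).
    by rewrite ler_pM2l// surv_gt0.
  by apply: le_trans h3; rewrite -ler_pdivlMr// mulrA in h1 *.
pose c := e * (1 + alpha) / M; have c0 : 0 < c by rewrite !mulr_gt0 ?invr_gt0.
pose J := (Num.truncn (2 / c)).+1.
have hJ : 2 / c < J%:R by rewrite /J truncnS_gt// divr_ge0// ltW.
have hb := harmonic_block_ge R J (ltn0Sn 0).
have : c * (J%:R / 2) <= 1.
  apply: (@le_trans _ _ (c * \sum_(1 <= t < 2 ^ J * 1) t.+1%:R^-1)).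
    by rewrite ler_pM2l.
  apply: (@le_trans _ _ (\sum_(1 <= t < 2 ^ J * 1) surv f (2 + alpha) t)).
    by rewrite mulr_sumr; apply: ler_sum => t _; exact: sge.
  have p0 : (0 < 2 ^ J * 1)%N by rewrite muln1 expn_gt0.
  by rewrite -(prednK p0).
by move: hJ; rewrite ltr_pdivrMr// => h1 h2; lra.
Unshelve. all: by end_near. Qed.

(** [malthus] is a choice by [get], meaningful once a solution is known to exist. *)
Lemma malthusP : (exists lam, malthus_prop lam) -> malthus_prop (malthus f).
Proof. by move=> h; exact: (getPex h). Qed.

End Malthusian.

(** * Powers and logarithms of integers *)

Section Powers.
Variable R : realType.
Implicit Types (d e x : R).

Lemma powR_large d (M : R) : 0 < d ->
  exists K, forall k, (K <= k)%N -> M <= (k%:R : R) `^ d.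
Proof.
move=> d0; pose M' := Num.max M 0; have M0 : 0 <= M' by rewrite le_max lexx orbT.
exists (Num.truncn (M' `^ d^-1)).+1 => k Kk.
have h1 : M' `^ d^-1 <= k%:R.
  apply/ltW; apply: lt_le_trans (_ : (Num.truncn (M' `^ d^-1)).+1%:R <= _).
    by rewrite truncnS_gt// powR_ge0.
  by rewrite ler_nat.
have := ge0_ler_powR (ltW d0) (powR_ge0 _ _) (ler0n _ k) h1.
rewrite -powRrM mulVf ?gt_eqF// powRr1//; apply: le_trans.
by rewrite le_max lexx.
Qed.

(** Young's inequality for the product of (1 + x)^d and 1, with exponents 1/d and 1/(1-d). *)
Lemma powR_bernoulli d x : 0 < d <= 1 -> 0 <= x -> (1 + x) `^ d <= 1 + d * x.
Proof.
move=> /andP[d0]; rewrite le_eqVlt => /orP[/eqP->|d1] x0.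
  by rewrite powRr1 ?mul1r// addr_ge0.
have x1 : 0 <= 1 + x by rewrite addr_ge0.
have d1' : 0 < 1 - d by lra.
have := conjugate_powR (powR_ge0 (1 + x) d) (ler01 : (0 : R) <= 1)
  (p := d^-1) (q := (1 - d)^-1).
rewrite !invr_gt0 !invrK powR1 mulr1 -powRrM divff ?gt_eqF// powRr1//.
by move=> /(_ d0 d1'); rewrite addrC subrK => /(_ erefl); lra.
Qed.

Lemma powR1D k d : (0 < k)%N -> (k%:R : R) `^ (1 + d) = k%:R * k%:R `^ d.
Proof.
move=> k0; rewrite powRD ?powRr1//.
by apply/implyP => _; rewrite pnatr_eq0 -lt0n.
Qed.

Lemma powR_nat_le d k : 0 <= d <= 1 -> (0 < k)%N -> (k%:R : R) `^ d <= k%:R.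
Proof. by move=> /andP[d0 d1] k0; rewrite ler1_powR// ler1n. Qed.

Lemma powR_nat_ge1 d k : 0 <= d -> (0 < k)%N -> 1 <= (k%:R : R) `^ d.
Proof.
move=> d0 k0; have k1 : 1 <= (k%:R : R) by rewrite ler1n.
by have := ler_powR k1 d0; rewrite powRr0.
Qed.

Lemma powR_succ_le d k : 0 < d <= 1 -> (0 < k)%N ->
  (k.+1%:R : R) `^ (1 + d) - k%:R `^ (1 + d) <= (1 + d) * (k%:R `^ d + 1).
Proof.
move=> d01 k0; have k0R : 0 < (k%:R : R) by rewrite ltr0n.
rewrite !powR1D//.
have -> : k.+1%:R = k%:R * (1 + k%:R^-1) :> R.
  by rewrite mulrDr mulr1 divff ?gt_eqF// natr1.
rewrite powRM ?addr_ge0//.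
have := powR_bernoulli d01 (_ : 0 <= k%:R^-1); rewrite invr_ge0 ler0n => /(_ isT).
have : (k%:R : R) `^ d <= k%:R by apply: powR_nat_le => //; case/andP: d01 => /ltW ->.
have : 0 <= (k%:R : R) `^ d by exact: powR_ge0.
move: (k%:R `^ d) ((1 + _) `^ d) => a c a0 ak cb.
set y := (k%:R : R) in k0R ak cb *.
case/andP: d01 => d0 d1.
have h1 : y * (1 + y^-1) * (a * c) <= y * (1 + y^-1) * (a * (1 + d * y^-1)).
  rewrite ler_pM2l; first by rewrite ler_wpM2l.
  by rewrite mulr_gt0// addr_gt0// invr_gt0.
have h2 : y * (1 + y^-1) * (a * (1 + d * y^-1)) = y * a + (1 + d) * a + d * (a / y).
  by field; rewrite gt_eqF.
have h3 : d * (a / y) <= 1 + d.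
  have : a / y <= 1 by rewrite ler_pdivrMr// mul1r.
  have : 0 <= a / y by rewrite divr_ge0// ltW.
  nra.
lra.
Qed.

Lemma linear_le_powR d (e : R) : 0 < d -> 0 < e -> exists2 c : R, 0 <= c &
  forall k, (0 < k)%N -> k%:R <= e * k%:R `^ (1 + d) + c.
Proof.
move=> d0 e0; have [K hK] := powR_large e^-1 d0.
exists K%:R => // k k0; rewrite powR1D//.
have [Kk|/ltnW kK] := leqP K k.
  apply: (@le_trans _ _ (e * (k%:R * k%:R `^ d))); last by rewrite lerDl.
  rewrite mulrCA ler_peMr//; have := hK k Kk.
  by move=> h; rewrite -[leLHS](divff (lt0r_neq0 e0)) ler_pM2l.
apply: (@le_trans _ _ (K%:R)); first by rewrite ler_nat.
by rewrite lerDr !mulr_ge0 ?powR_ge0// ltW.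
Qed.

(** ln k = (g / e) ln k^(e/g) < (g / e) k^(e/g), raised to the power g. *)
Lemma ln_powR_le g e k : 0 < g -> 0 < e -> (0 < k)%N ->
  ln (k%:R : R) `^ g <= (g / e) `^ g * k%:R `^ e.
Proof.
move=> g0 e0 k0; have k0R : 0 < (k%:R : R) by rewrite ltr0n.
have ge0 : 0 < g / e by rewrite divr_gt0.
have l0 : 0 <= ln (k%:R : R) by rewrite ln_ge0// ler1n.
have h : ln (k%:R : R) <= g / e * k%:R `^ (e / g).
  have := ln_sublinear (powR_gt0 (e / g) k0R); rewrite ln_powR => /ltW.
  rewrite -(ler_pM2l ge0) mulrA -[X in X * ln _](_ : 1 = g / e * (e / g)) ?mul1r//.
  by field; rewrite !gt_eqF.
have := ge0_ler_powR (ltW g0) l0 (_ : g / e * k%:R `^ (e / g) \is Num.nneg) h.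
rewrite nnegrE mulr_ge0 ?powR_ge0 ?(ltW ge0)// => /(_ isT); rewrite powRM ?powR_ge0 ?(ltW ge0)//.
by rewrite -powRrM divfK// gt_eqF.
Qed.

End Powers.

(** * Moments of order 1 + d of the degrees *)

Section Moments.
Variables (R : realType) (f : nat -> R) (c c' s d : R) (M0 : nat).
Hypothesis f_gt0 : forall k, (0 < k)%N -> 0 < f k.
Hypothesis d01 : 0 < d <= 1.
Hypothesis c0 : 0 <= c.
Hypothesis c'0 : 0 <= c'.
Hypothesis f_le : forall k, (0 < k)%N -> f k <= c * k%:R + c'.
Hypothesis cs : (1 + d) * c < s.
Hypothesis S_ge : forall m a, (M0 <= m)%N -> s * m.+1%:R <= nsum f a m.+1.

Let G k : R := k%:R `^ (1 + d).

Let G_ge0 k : 0 <= G k. Proof. exact: powR_ge0. Qed.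

(** The generator applied to k^(1+d) is at most (1 + d) c k^(1+d) up to lower order terms. The gap
    between (1 + d) c and s absorbs these; a1 is the midpoint. *)
Lemma moment_drift : exists2 a1 : R, 0 <= a1 < s & exists2 a2 : R, 0 <= a2 &
  forall k, (0 < k)%N -> f k * (G k.+1 - G k) <= a1 * G k + a2.
Proof.
case/andP: (d01) => d0 d1.
have dc : 0 <= (1 + d) * c by rewrite mulr_ge0// addr_ge0// ltW.
pose z := (1 + d) * (c + c') + 1.
have z0 : 0 < z by rewrite ltr_wpDl// mulr_ge0 ?addr_ge0// ltW.
have e0 : 0 < (s - (1 + d) * c) / 2 / z by rewrite divr_gt0// divr_gt0// subr_gt0.
have [K K0 hK] := linear_le_powR d0 e0.
exists (((1 + d) * c + s) / 2).
  have h (t : R) : 0 <= t -> t < s -> 0 <= (t + s) / 2 < s.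
    by move=> t0 ts; apply/andP; split; lra.
  exact: h.
exists (z * K + (1 + d) * c').
  by rewrite addr_ge0 ?mulr_ge0 ?(ltW z0) ?addr_ge0 ?(ltW d0).
move=> k k0; have := powR_succ_le d01 k0; rewrite -/(G k) -/(G k.+1) => h1.
have fk := f_gt0 k0; have fle := f_le k0.
have kd : (k%:R : R) `^ d <= k%:R by apply: powR_nat_le => //; rewrite ltW.
have kd0 : 0 <= (k%:R : R) `^ d by exact: powR_ge0.
have Gk : G k = k%:R * k%:R `^ d by exact: powR1D.
have hk := hK k k0; rewrite -/(G k) in hk.
have h2 : f k * (G k.+1 - G k) <= (c * k%:R + c') * ((1 + d) * (k%:R `^ d + 1)).
  apply: le_trans (_ : f k * ((1 + d) * (k%:R `^ d + 1)) <= _).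
    by rewrite ler_pM2l.
  by rewrite ler_wpM2r// mulr_ge0 ?addr_ge0// ltW.
have h3 : (c * k%:R + c') * ((1 + d) * (k%:R `^ d + 1)) <=
    (1 + d) * c * G k + (1 + d) * (c + c') * k%:R + (1 + d) * c'.
  rewrite Gk; set y := (k%:R : R); set v := _ `^ _ in kd kd0 *.
  have -> : (c * y + c') * ((1 + d) * (v + 1)) =
    (1 + d) * c * (y * v) + (1 + d) * c * y + (1 + d) * c' * v + (1 + d) * c' by ring.
  have : (1 + d) * c' * v <= (1 + d) * c' * y by rewrite ler_wpM2l// mulr_ge0// addr_ge0// ltW.
  lra.
have h4 : (1 + d) * (c + c') * k%:R <= z * k%:R by rewrite ler_wpM2r// /z lerDl.
have h5 : z * k%:R <= (s - (1 + d) * c) / 2 * G k + z * K.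
  have -> : (s - (1 + d) * c) / 2 * G k + z * K = z * ((s - (1 + d) * c) / 2 / z * G k + K).
    by field; rewrite gt_eqF.
  by rewrite ler_pM2l.
lra.
Qed.

(** The mean M of the sum obeys M' <= (1 + a1 / (s n)) M + B; as a1 < s, linear growth is stable
    under this recursion. *)
Lemma moment_bound : exists CG : R, forall m,
  expect f m (fun a => nsum G a m.+1) <= CG * m.+1%:R.
Proof.
have [a1 /andP[a10 a1s] [a2 a20 drift]] := moment_drift.
have s0 : 0 < s by exact: le_lt_trans a1s.
have r1 : 0 < 1 - a1 / s by rewrite subr_gt0 ltr_pdivrMr// mul1r.
pose B := a2 / s + G 1%N.
have B0 : 0 <= B by rewrite addr_ge0// divr_ge0// ltW.
have d0 : 0 <= 1 + d by case/andP: d01 => d0 _; rewrite addr_ge0// ltW.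
(* CG (1 - a1 / s) >= B makes the linear bound inductive; the other term covers the times up to
   [M0], when all degrees are at most M0 + 1. *)
pose CG := Num.max (G M0.+1) (B / (1 - a1 / s)).
have CG0 : 0 <= CG by rewrite le_max G_ge0.
exists CG => m.
have small n : (n <= M0)%N -> expect f n (fun a => nsum G a n.+1) <= CG * n.+1%:R.
  move=> nM; rewrite -(expect_cst f_gt0 n (CG * n.+1%:R)); apply: ler_expect => // a.
  rewrite -(nsum_cst CG a) /nsum; apply: ler_sum => i _; rewrite le_max; apply/orP; left.
  apply: ge0_ler_powR => //; rewrite ?nnegrE// ler_nat.
  by apply: leq_trans (deg_le _ _ _) _.
have [/small//|/ltnW] := leqP m M0.
move=> /subnKC <-; elim: (m - M0)%N => [|n IH]; first by rewrite addn0 small.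
rewrite addnS; set k := (M0 + n)%N in IH *.
have Mk : (M0 <= k)%N by rewrite leq_addr.
have k0 : 0 < (k.+1%:R : R) by rewrite ltr0n.
have step a : cond_exp f k (fun a => nsum G a k.+2) a <=
    (1 + a1 / s / k.+1%:R) * nsum G a k.+1 + B.
  have S0 : 0 < nsum f a k.+1 by exact: nsum_gt0.
  apply: le_trans (ge_cond_exp_choice f_gt0
    (F := fun d => nsum G a k.+1 + (G d.+1 - G d) + G 1%N) _) _.
    by move=> i ik; rewrite nsum_upd.
  have -> : nsum (fun d => f d * (nsum G a k.+1 + (G d.+1 - G d) + G 1%N)) a k.+1 =
     (nsum G a k.+1 + G 1%N) * nsum f a k.+1 + nsum (fun d => f d * (G d.+1 - G d)) a k.+1.
    by rewrite -nsumZ -nsumD; apply: eq_nsum_fun => j _; ring.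
  rewrite mulrDl mulfK ?gt_eqF//.
  have : nsum (fun d => f d * (G d.+1 - G d)) a k.+1 / nsum f a k.+1 <=
      (a1 * nsum G a k.+1 + a2 * k.+1%:R) / (s * k.+1%:R).
    have h1 : nsum (fun d => f d * (G d.+1 - G d)) a k.+1 <= a1 * nsum G a k.+1 + a2 * k.+1%:R.
      by rewrite -nsumZ -(nsum_cst a2 a) -nsumD; apply: ler_nsum.
    have G0 : 0 <= nsum G a k.+1 by exact: nsum_ge0.
    apply: le_trans (_ : (a1 * nsum G a k.+1 + a2 * k.+1%:R) / nsum f a k.+1 <= _).
      by rewrite ler_pM2r// invr_gt0.
    rewrite ler_wpM2l ?addr_ge0 ?mulr_ge0//.
    by rewrite lef_pV2 ?posrE ?S_ge// mulr_gt0.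
  have -> : (a1 * nsum G a k.+1 + a2 * k.+1%:R) / (s * k.+1%:R) =
    a1 / s / k.+1%:R * nsum G a k.+1 + a2 / s.
    by field; rewrite !gt_eqF.
  have -> : (1 + a1 / s / k.+1%:R) * nsum G a k.+1 + B =
    nsum G a k.+1 + G 1%N + (a1 / s / k.+1%:R * nsum G a k.+1 + a2 / s).
    by rewrite /B; ring.
  by rewrite lerD2l.
apply: le_trans (ler_expect f_gt0 k step) _.
rewrite expectD// expectZ// expect_cst//.
apply: le_trans (_ : (1 + a1 / s / k.+1%:R) * (CG * k.+1%:R) + B <= _).
  rewrite lerD2r ler_wpM2l// addr_ge0// !divr_ge0// ltW//.
rewrite -[k.+2%:R]natr1 [leRHS]mulrDr mulr1 mulrDl mul1r -addrA lerD2l.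
have -> : a1 / s / k.+1%:R * (CG * k.+1%:R) = a1 / s * CG by field; rewrite !gt_eqF.
have : B <= CG * (1 - a1 / s) by rewrite -ler_pdivrMr// le_max lexx orbT.
by rewrite mulrBr mulr1 (mulrC CG); lra.
Qed.

End Moments.

(** * Law of large numbers for the preferential attachment tree *)

Section TreeLaw.
Variables (R : realType) (f : nat -> R) (C gamma : R).
Hypothesis f_gt0 : forall k, (0 < k)%N -> 0 < f k.
Hypothesis f_nd : forall k l, (0 < k)%N -> (k <= l)%N -> f k <= f l.
Hypothesis C_gt0 : 0 < C.
Hypothesis gamma_gt0 : 0 < gamma.
Hypothesis f_growth :
  (exists2 beta : R, beta < 1 & forall k, (0 < k)%N -> f k <= C * k%:R `^ beta) \/
  (exists2 alpha : R, -1 < alpha & forall k, (0 < k)%N -> f k = k%:R + alpha).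

Lemma sublinear_bound (beta e : R) : beta < 1 ->
  (forall k, (0 < k)%N -> f k <= C * k%:R `^ beta) -> 0 < e ->
  exists2 c : R, 0 <= c & forall k, (0 < k)%N -> f k <= e * k%:R + c.
Proof.
move=> b1 fb e0; have b1' : 0 < 1 - beta by rewrite subr_gt0.
have [K hK] := powR_large (C / e) b1'.
exists (f K.+1); first exact/ltW/f_gt0.
move=> k k0; have k0R : 0 < (k%:R : R) by rewrite ltr0n.
have [kK|Kk] := leqP k K.+1.
  by apply: le_trans (f_nd k0 kK) _; rewrite lerDr mulr_ge0// ltW.
apply: (@le_trans _ _ (e * k%:R)); last by rewrite lerDl ltW// f_gt0.
apply: le_trans (fb k k0) _.
have kE : (k%:R : R) = k%:R `^ beta * k%:R `^ (1 - beta).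
  rewrite -powRD; first by rewrite addrC subrK powRr1.
  by apply/implyP => _; rewrite gt_eqF.
rewrite [X in _ <= _ * X]kE mulrC [leRHS]mulrCA ler_wpM2l ?powR_ge0//.
by have := hK k (ltnW (ltnW Kk)); rewrite ler_pdivrMr// mulrC.
Qed.

Let lam := malthus f.

(** Reduces both growth regimes to the same constants: the slope [c] of f against the rate [s] of S
    for the moments, an affine supersolution (A, B) to bound [rval], and [CF] to bound the square of
    the reproductive value divided by f. *)
Lemma growth_facts : exists d c c' s A B CF : R, exists M0 : nat,
  [/\ 0 < d <= 1, 0 <= c /\ 0 <= c', (forall k, (0 < k)%N -> f k <= c * k%:R + c'),
      (1 + d) * c < s & forall m a, (M0 <= m)%N -> s * m.+1%:R <= nsum f a m.+1] /\
  [/\ malthus_prop f lam, 0 <= A, 0 <= B,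
    (forall k, (0 < k)%N -> (A + 1) * f k <= lam * (A * k%:R + B)) &
    forall k, (0 < k)%N -> k%:R ^+ 2 <= CF * k%:R `^ (1 + d) * f k].
Proof.
have f1 := f_gt0 (ltn0Sn 0).
case: f_growth => [[beta b1 fb]|[alpha a1 fE]].
  have fsub (e : R) : 0 < e -> exists2 c : R, 0 <= c & forall k, (0 < k)%N -> f k <= e * k%:R + c.
    by move=> e0; exact: sublinear_bound fb e0.
  have mp : malthus_prop f lam.
    apply: malthusP; apply: (@malthus_exists_sublinear _ _ f_gt0 _ C) => //.
      by move=> k k0; exact: f_nd.
    move=> k k0; apply: le_trans (fb k k0) _; rewrite ler_pM2l//.
    by rewrite ler1_powR ?ler1n// ltW.
  have [lam0 _] := mp.
  have f14 : 0 < f 1%N / 4 by rewrite divr_gt0.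
  have [c' c'0 hc'] := fsub _ f14.
  have lam2 : 0 < lam / 2 by rewrite divr_gt0.
  have [c2 c20 hc2] := fsub _ lam2.
  (* Sublinear case: every positive slope is available, so d = 1 with slope f(1) / 4 stays below the
     trivial rate f(1). *)
  exists 1, (f 1%N / 4), c', (f 1%N), 1, (2 * c2 / lam), (f 1%N)^-1, 0%N; split; split => //.
  - by rewrite ltr01 lexx.
  - by split => //; exact: ltW.
  - lra.
  - by move=> m a _; rewrite -(nsum_cst (f 1%N) a); apply: ler_nsum => k k0; exact: f_nd.
  - by rewrite divr_ge0 ?mulr_ge0// ltW.
  - move=> k k0; have := hc2 k k0.
    have -> : lam * (1 * k%:R + 2 * c2 / lam) = lam * k%:R + 2 * c2.
      by field; rewrite gt_eqF.
    lra.
  - move=> k k0; rewrite powR1D// powRr1// mulrAC -expr2 mulrC ler_peMr ?sqr_ge0//.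
    by rewrite mulrC ler_pdivlMr// mul1r; exact: f_nd.
have a1' : 0 < 1 + alpha by lra.
have mp2 : malthus_prop f (2 + alpha) by exact: malthus_affine.
have mp : malthus_prop f lam by apply: malthusP; exists (2 + alpha).
have lamE : lam = 2 + alpha by exact: malthus_unique mp mp2.
(* Affine case: S is about (2 + alpha) n against slope 1, so 1 + d must stay below 2 + alpha; [s] is
   put halfway between the two. *)
pose d := Num.min 1 ((1 + alpha) / 2).
have d0 : 0 < d by rewrite lt_min ltr01 divr_gt0.
have d1 : d <= 1 by rewrite ge_min lexx.
have da : d <= (1 + alpha) / 2 by rewrite ge_min lexx orbT.
pose s := (1 + d + (2 + alpha)) / 2.
have sd : 1 + d < s by rewrite /s; lra.
have s2 : 0 < 2 + alpha - s by rewrite /s; lra.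
(* S equals (2 + alpha) n - 1, and the missing 1 is absorbed once n exceeds 1 / (2 + alpha - s). *)
pose M0 := Num.truncn (2 + alpha - s)^-1.
have hM : (2 + alpha - s)^-1 < M0.+1%:R by rewrite truncnS_gt// invr_ge0 ltW.
pose c0 := Num.min 1 (1 + alpha).
have c00 : 0 < c0 by rewrite lt_min ltr01.
have c0f k : (0 < k)%N -> c0 * k%:R <= f k.
  move=> k0; rewrite fE//; have : (1 : R) <= k%:R by rewrite ler1n.
  have : c0 <= 1 by rewrite ge_min lexx.
  have : c0 <= 1 + alpha by rewrite ge_min lexx orbT.
  move: (k%:R : R) => y; have [al|al] := leP 0 alpha; nra.
(* A and B come from the exact solution (k + alpha) / (1 + alpha), with |alpha| to keep B
   nonnegative. *)
exists d, 1, `|alpha|, s, (1 + alpha)^-1, (`|alpha| / (1 + alpha)), c0^-1, M0; split; split => //.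
- by rewrite d0.
- by move=> k k0; rewrite fE// mul1r lerD2l ler_norm.
- by rewrite mulr1.
- move=> m a Mm.
  have -> : nsum f a m.+1 = (2 + alpha) * m.+1%:R - 1.
    rewrite (eq_nsum_fun a m.+1 fE) nsumD nsum_id nsum_cst -natr1; ring.
  have : 1 <= (2 + alpha - s) * m.+1%:R.
    rewrite mulrC -ler_pdivrMr// mul1r; apply/ltW/(lt_le_trans hM).
    by rewrite ler_nat ltnS.
  lra.
- by rewrite invr_ge0 ltW.
- by rewrite divr_ge0// ltW.
- move=> k k0; rewrite lamE fE//.
  have -> : ((1 + alpha)^-1 + 1) * (k%:R + alpha) = (2 + alpha) * ((1 + alpha)^-1 * k%:R + alpha / (1 + alpha)).
    by field; rewrite gt_eqF.
  rewrite ler_pM2l; last lra.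
  by rewrite lerD2l ler_pM2r ?invr_gt0// ler_norm.
- move=> k k0; have k0R : 0 < (k%:R : R) by rewrite ltr0n.
  apply: (@le_trans _ _ (c0^-1 * k%:R `^ (1 + d) * (c0 * k%:R))); last first.
    by rewrite ler_wpM2l ?c0f// mulr_ge0 ?powR_ge0// invr_ge0 ltW.
  have -> : c0^-1 * k%:R `^ (1 + d) * (c0 * k%:R) = k%:R `^ (1 + d) * k%:R.
    by field; rewrite gt_eqF.
  rewrite powR1D// expr2 ler_pM2r// ler_peMr ?(ltW k0R)//.
  by rewrite powR_nat_ge1 ?(ltW d0).
Qed.

Let p := pdist f lam.

(* The weight [b], a small power of [k], leaves room for the logarithms in the
   bounds on the family: three factors [b] are allowed in the law of large numbers. *)
Lemma tree_lln : exists (b : nat -> R) (Cb : R),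
  [/\ forall k, (0 < k)%N -> 1 <= b k,
      forall k l, (0 < k)%N -> (k <= l)%N -> b k <= b l,
      0 < Cb, (forall k, (0 < k)%N -> ln k%:R `^ gamma <= Cb * b k /\ ln k%:R <= Cb * b k) &
      forall k, (0 < k)%N -> b k ^+ 4 <= k%:R] /\
  let w k := k%:R * b k ^+ 3 in
  [/\ malthus_prop f lam, summable1 (fun k => w k * p k),
      (fun m => expect f m (fun a => wdist p w a m)) @ \oo --> (0 : R) &
      exists Cw : R, forall m, expect f m (fun a => nsum w a m.+1) <= Cw * m.+1%:R].
Proof.
have [d [c [c' [s [A [B [CF [M0 [[/andP[d0 d1] [c0 c'0] f_le cs S_ge]
  [mp A0 B0 AB CFf]]]]]]]]]] := growth_facts.
have d01 : 0 < d <= 1 by rewrite d0.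
have [lam0 ml] := mp.
have f1 := f_gt0 (ltn0Sn 0).
(* k b^4 = k^(1+d) is exactly the controlled moment, so w = k b^3 is negligible against it by one
   factor b. *)
pose e := d / 4; have e0 : 0 < e by rewrite divr_gt0.
pose b k : R := k%:R `^ e.
have b1 k : (0 < k)%N -> 1 <= b k by move=> k0; rewrite powR_nat_ge1// ltW.
exists b, ((gamma / e) `^ gamma + (1 / e) `^ 1); split.
  split=> //.
  - move=> k l k0 kl; apply: ge0_ler_powR; rewrite ?nnegrE ?ler_nat//; exact: ltW.
  - by rewrite addr_gt0// powR_gt0// divr_gt0.
  - move=> k k0; have bk0 : 0 <= b k by exact: powR_ge0.
    split; rewrite mulrDl.
      by apply: le_trans (ln_powR_le gamma_gt0 e0 k0) _; rewrite lerDl mulr_ge0 ?powR_ge0.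
    rewrite -[leLHS]powRr1 ?ln_ge0 ?ler1n//.
    by apply: le_trans (ln_powR_le ltr01 e0 k0) _; rewrite lerDr mulr_ge0 ?powR_ge0.
  - move=> k k0; rewrite /b -powR_mulrn ?powR_ge0// -powRrM /e divfK//.
    by apply: powR_nat_le; rewrite ?(ltW d0).
move=> w.
pose G k : R := k%:R `^ (1 + d).
have GE k : (0 < k)%N -> G k = w k * b k.
  move=> k0; rewrite /G powR1D// /w -mulrA -exprSr; congr (_ * _).
  by rewrite /b -powR_mulrn ?powR_ge0// -powRrM; congr powR; rewrite /e divfK.
have w_ge0 k : (0 < k)%N -> 0 <= w k.
  by move=> k0; rewrite mulr_ge0// exprn_ge0// powR_ge0.
have [CG G_mom] := moment_bound f_gt0 d01 c0 c'0 f_le cs S_ge.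
have G_super (e1 : R) : 0 < e1 -> exists K, forall k, (K <= k)%N -> w k <= e1 * G k.
  move=> e10; have [K hK] := powR_large e1^-1 e0.
  exists K.+1 => k Kk; have k0 : (0 < k)%N by apply: leq_trans Kk.
  rewrite GE// mulrCA ler_peMr ?w_ge0//; have := hK k (ltnW Kk).
  by move=> h; rewrite -[leLHS](divff (lt0r_neq0 e10)) ler_pM2l.
have kw k : (0 < k)%N -> k%:R <= w k.
  by move=> k0; rewrite /w ler_peMr// exprn_ege1// b1.
(* The reproductive value is normalized by its mean under p, so that h p sums to 1 and H is
   comparable to the number of nodes. *)
have [kap kap0 kapE] : exists2 kap : R, 0 < kap &
    (fun n => \sum_(1 <= k < n) rval f lam k * p k) @ \oo --> kap.
  have rp0 k : (0 < k)%N -> 0 <= rval f lam k * p k.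
    by move=> k0; rewrite mulr_ge0// ltW// ?pdist_gt0 ?(rval_gt0 f_gt0 lam0 ml).
  have sm : summable1 (fun k => rval f lam k * p k).
    apply: (@le_summable1 _ _ (fun k => (A + B) * (k%:R * p k))).
      move=> k k0; rewrite ger0_norm ?rp0// mulrA ler_wpM2r ?(ltW (pdist_gt0 _ _ _))//.
      apply: le_trans (rval_le f_gt0 lam0 ml A0 B0 AB k0) _.
      by rewrite mulrDl lerD2l ler_peMr// ler1n.
    exact/summable1Z/(mean_summable f_gt0 lam0 ml).
  exists (\sum_(1 <= k <oo) rval f lam k * p k); last exact: sm.
  apply: lt_le_trans (ge0_partial_le_sum 2 rp0 sm).
  by rewrite big_nat1 rval1 mul1r pdist_gt0.
pose h k := rval f lam k / kap.
have h_gt0 k : (0 < k)%N -> 0 < h k.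
  by move=> k0; rewrite divr_gt0// (rval_gt0 f_gt0 lam0 ml).
have h_hi k : (0 < k)%N -> h k <= (A + B) / kap * k%:R.
  move=> k0; rewrite /h [leRHS]mulrAC ler_pM2r ?invr_gt0//.
  apply: le_trans (rval_le f_gt0 lam0 ml A0 B0 AB k0) _.
  by rewrite mulrDl lerD2l ler_peMr// ler1n.
pose h0 := f 1%N / (lam + f 1%N) / kap.
have h00 : 0 < h0 by rewrite !divr_gt0// addr_gt0.
have h_lo k : (0 < k)%N -> h0 <= h k.
  move=> k0; rewrite /h0 /h ler_pM2r ?invr_gt0//.
  apply: le_trans (rval_ge f_gt0 lam0 ml k0); have fk := f_gt0 k0.
  have f1k := f_nd (ltn0Sn 0) k0.
  rewrite ler_pdivrMr ?addr_gt0// mulrAC ler_pdivlMr ?addr_gt0//.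
  by rewrite !mulrDr; have : lam * f 1%N <= lam * f k; [rewrite ler_pM2l|lra].
have h_rec k : (0 < k)%N -> h k * (lam + f k) = f k * (h k.+1 + h 1%N).
  move=> k0; rewrite /h rval1 -mulrDl mulrAC (rval_rec f_gt0 lam0 k0).
  by rewrite mulrA.
have p_gt0 k : (0 < k)%N -> 0 < p k by exact: pdist_gt0.
have p_rec k : (0 < k)%N -> (lam + f k.+1) * p k.+1 = f k * p k.
  by move=> k0; rewrite /p lamf_pdist// f_pdist.
have p_one : (lam + f 1%N) * p 1%N = lam by rewrite /p lamf_pdist// surv0 mulr1.
have p_sum := pdist_cvg1 f_gt0 lam0 ml.
have hp_sum : (fun n => \sum_(1 <= k < n) h k * p k) @ \oo --> (1 : R).
  rewrite (_ : (fun n => _) = (fun n => (\sum_(1 <= k < n) rval f lam k * p k) * kap^-1)).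
    rewrite -(divff (lt0r_neq0 kap0)); apply: cvgM; [exact: kapE|exact: cvg_cst].
  by apply/funext => n; rewrite mulr_suml; apply: eq_bigr => k _; rewrite mulrAC.
have fpE n : \sum_(1 <= j < n) f j * p j = lam * \sum_(1 <= j < n) surv f lam j.
  by rewrite mulr_sumr; apply: eq_big_nat => k /andP[k0 _]; exact: f_pdist.
have fp_le n : \sum_(1 <= j < n) f j * p j <= lam.
  by rewrite fpE ler_piMr ?(ltW lam0)// (surv_partial_lt1 f_gt0 lam0 ml).
(* The flow across K is small because h is at most linear and k p_{>k} tends to 0; the other part is
   the missing mass in the equation that defines lam. *)
have err_small (e1 : R) : 0 < e1 -> exists K0, forall K, (K0 <= K)%N ->
    gre_err f p h lam K <= e1.
  move=> e10.
  have AB1 : 0 < 2 * lam * ((A + B) / kap) + 1.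
    by rewrite ltr_wpDl// !mulr_ge0 ?addr_ge0 ?invr_ge0 ?(ltW kap0) ?(ltW lam0).
  have e2 : 0 < e1 / 2 / (2 * lam * ((A + B) / kap) + 1) by rewrite !divr_gt0.
  have [K1 hK1] := surv_linear_cvg0 f_gt0 lam0 ml e2.
  have hl1 : 0 < h 1%N * lam by rewrite mulr_gt0// h_gt0.
  have e3 : 0 < e1 / 2 / (h 1%N * lam) by rewrite !divr_gt0.
  have /cvgrPdist_le/(_ _ e3)[K2 _ hK2] := ml.
  exists (maxn K1.+1 K2) => K; rewrite geq_max => /andP[K1K K2K].
  have K0 : (0 < K)%N by apply: leq_trans K1K.
  rewrite /gre_err fpE f_pdist//.
  have t1 : h K.+1 * (lam * surv f lam K) <= e1 / 2.
    have sK := surv_gt0 f_gt0 lam0 K.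
    apply: (@le_trans _ _ ((A + B) / kap * K.+1%:R * (lam * surv f lam K))).
      by rewrite ler_pM2r ?h_hi// mulr_gt0.
    apply: (@le_trans _ _ (2 * lam * ((A + B) / kap) * (K%:R * surv f lam K))).
      have -> : (A + B) / kap * K.+1%:R * (lam * surv f lam K) =
        lam * ((A + B) / kap) * (K.+1%:R * surv f lam K) by ring.
      rewrite -[X in _ <= X](_ : lam * ((A + B) / kap) * (2 * K%:R * surv f lam K) = _); last by ring.
      apply: ler_wpM2l.
        by rewrite !mulr_ge0 ?addr_ge0 ?invr_ge0 ?(ltW kap0) ?(ltW lam0).
      by rewrite ler_pM2r// -natrM ler_nat mul2n -addnn -addn1 leq_add2l.
    have := hK1 K (ltnW K1K); set y := _ * surv _ _ _; move=> hy.
    have y0 : 0 <= y by rewrite mulr_ge0// ltW.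
    apply: (@le_trans _ _ ((2 * lam * ((A + B) / kap) + 1) * y)).
      by rewrite ler_wpM2r// lerDl.
    by rewrite mulrC -ler_pdivlMr.
  have t2 : h 1%N * (lam - lam * \sum_(1 <= j < K.+1) surv f lam j) <= e1 / 2.
    have := hK2 K.+1 (leqW K2K); rewrite ler_norml => /andP[_].
    rewrite -(ler_pM2l hl1) mulrCA divff ?gt_eqF// mulr1; apply: le_trans.
    by rewrite -[X in _ * (X - _) <= _]mulr1 -mulrBr mulrA.
  lra.
have f_nd1 k : (0 < k)%N -> f 1%N <= f k by move=> k0; exact: f_nd.
have f_hi k : (0 < k)%N -> f k <= (c + c') * k%:R.
  move=> k0; apply: le_trans (f_le k k0) _.
  by rewrite mulrDl lerD2l ler_peMr// ler1n.
have G_ge0 k : (0 < k)%N -> 0 <= G k by move=> _; exact: powR_ge0.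
have kG k : (0 < k)%N -> k%:R <= G k.
  by move=> k0; apply: le_trans (kw k k0) _; rewrite GE// ler_peMr ?w_ge0 ?b1.
(* (1 + z)^2 <= 2 + 2 z^2 leaves f and h^2 / f, and [CF] was introduced for the latter. *)
have G_jump k : (0 < k)%N -> f k * (1 + lam * h k / f k) ^+ 2 <=
    (2 * (c + c') + 2 * lam ^+ 2 * ((A + B) / kap) ^+ 2 * CF) * G k.
  move=> k0; have fk := f_gt0 k0.
  apply: (@le_trans _ _ (2 * f k + 2 * lam ^+ 2 * (h k ^+ 2 / f k))).
    have -> : 2 * f k + 2 * lam ^+ 2 * (h k ^+ 2 / f k) = f k * (2 + 2 * (lam * h k / f k) ^+ 2).
      by field; rewrite gt_eqF.
    rewrite ler_pM2l//; have := sqr_ge0 (1 - lam * h k / f k).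
    set z := lam * h k / f k; nra.
  rewrite [leRHS]mulrDl lerD//.
    rewrite -mulrA ler_pM2l//; apply: le_trans (f_hi k k0) _.
    by rewrite ler_wpM2l ?kG// addr_ge0.
  rewrite -[leRHS]mulrA -[leRHS]mulrA ler_pM2l ?mulr_gt0 ?exprn_gt0//.
  rewrite ler_pdivrMr//.
  apply: (@le_trans _ _ (((A + B) / kap * k%:R) ^+ 2)).
    by rewrite lerXn2r ?nnegrE ?h_hi// ?(ltW (h_gt0 _ _))// !mulr_ge0 ?addr_ge0 ?invr_ge0 ?(ltW kap0).
  have := CFf k k0; rewrite -/(G k) => h1.
  by rewrite exprMn -[leRHS]mulrA ler_wpM2l ?sqr_ge0.
have G_super1 (e1 : R) : 0 < e1 -> exists K, forall k, (K <= k)%N -> k%:R <= e1 * G k.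
  move=> /G_super[K hK]; exists K.+1 => k Kk; have k0 : (0 < k)%N by apply: leq_trans Kk.
  by apply: le_trans (kw k k0) (hK k (ltnW Kk)).
have w_le k : (0 < k)%N -> w k <= 1 * G k.
  by move=> k0; rewrite mul1r GE// ler_peMr ?w_ge0 ?b1.
split => //.
- exact: (wp_summable f_gt0 lam0 p_gt0 h00 h_lo h_hi h_rec p_rec p_one p_sum hp_sum
    fp_le err_small f_nd1 f_hi G_ge0 G_mom G_jump G_super1 w_ge0 w_le).
- exact: (wdist_cvg0 f_gt0 lam0 p_gt0 h00 h_lo h_hi h_rec p_rec p_one p_sum hp_sum
    fp_le err_small f_nd1 f_hi G_ge0 G_mom G_jump G_super1 w_ge0 w_le G_super).
- exists (`|1| * CG) => m.
  by apply: (expect_w_le (G := G)); eassumption.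
Qed.

End TreeLaw.

(** * Martingale central limit theorem *)

Section Trigonometric.
Variable R : realType.
Implicit Types x z : R.

Lemma mean_value_0 (f df : R -> R) z : (forall x, is_derive x 1 f (df x)) ->
  exists2 c, `|c| <= `|z| & f z - f 0 = df c * z.
Proof.
move=> dfE; have cf x y : {within `[x, y], continuous f}.
  by apply: derivable_within_continuous => t _; have [] := dfE t.
have [z0|z0] := leP 0 z.
  have [c] := MVT_segment z0 (fun x _ => dfE x) (cf _ _).
  rewrite in_itv/= => /andP[c0 cz] e; exists c; last by rewrite e subr0.
  by rewrite !ger0_norm.
have [c] := MVT_segment (ltW z0) (fun x _ => dfE x) (cf _ _).
rewrite in_itv/= => /andP[zc c0] e; exists c; first by rewrite !ler0_norm ?lerN2// ltW.
by rewrite -opprB e sub0r mulrN opprK.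
Qed.

Lemma norm_sin_le z : `|sin z| <= `|z|.
Proof.
have [c _] := mean_value_0 z (@is_derive_sin R).
rewrite sin0 subr0 => ->; rewrite normrM ler_piMl//; exact: cos_max.
Qed.

Lemma sin_quadratic z : 1 - cos z = 2 * sin (z / 2) ^+ 2.
Proof.
have -> : cos z = cos ((z / 2) *+ 2) by rewrite -mulr_natr divfK.
rewrite cos_mulr2n cos2sin2; move: (sin _) => s; rewrite -mulr_natr; ring.
Qed.

Lemma sin_cubic z : `|sin z - z| <= `|z| ^+ 3 / 2.
Proof.
have dg x : is_derive x 1 (fun x => sin x - x) (cos x - 1) by apply: is_deriveB.
have [c cz] := mean_value_0 z dg.
rewrite sin0 !subr0 => ->; rewrite normrM [X in _ <= X / 2]exprSr mulrAC ler_wpM2r//.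
rewrite distrC sin_quadratic normrM ger0_norm// normrX.
have h : `|sin (c / 2)| <= `|z| / 2.
  apply: le_trans (norm_sin_le _) _.
  by rewrite normrM (@ger0_norm _ (2^-1))// ler_pM2r.
have : `|sin (c / 2)| ^+ 2 <= (`|z| / 2) ^+ 2 by rewrite lerXn2r ?nnegrE ?divr_ge0.
have : 0 <= `|z| by [].
move: `|sin _| => s; move: `|z| => y; lra.
Qed.

(** For |z| <= 1 a difference of squares gains the third power; beyond 1 the quadratic bound is
    already below the cubic one. *)
Lemma cos_cubic z : `|cos z - 1 + z ^+ 2 / 2| <= `|z| ^+ 3 / 2.
Proof.
have [z1|z1] := leP `|z| 1.
  have -> : cos z - 1 + z ^+ 2 / 2 = 2 * ((z / 2 - sin (z / 2)) * (z / 2 + sin (z / 2))).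
    have -> : cos z = 1 - 2 * sin (z / 2) ^+ 2 by rewrite -sin_quadratic; ring.
    by field.
  rewrite !normrM ger0_norm//.
  have h1 : `|z / 2 - sin (z / 2)| <= `|z| ^+ 3 / 16.
    rewrite distrC; apply: le_trans (sin_cubic _) _.
    rewrite normrM (@ger0_norm _ (2^-1))// exprMn; lra.
  have h2 : `|z / 2 + sin (z / 2)| <= 1.
    apply: le_trans (ler_normD _ _) _; have := norm_sin_le (z / 2).
    by rewrite normrM (@ger0_norm _ (2^-1))//; lra.
  have := ler_pM (normr_ge0 _) (normr_ge0 _) h1 h2.
  have : 0 <= `|z| ^+ 3 by rewrite exprn_ge0.
  lra.
have h1 : `|cos z - 1 + z ^+ 2 / 2| <= z ^+ 2 / 2.
  have : 0 <= 2 * sin (z / 2) ^+ 2 <= z ^+ 2 / 2.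
    rewrite mulr_ge0 ?sqr_ge0//=.
    have : `|sin (z / 2)| ^+ 2 <= `|z / 2| ^+ 2 by rewrite lerXn2r ?nnegrE// norm_sin_le.
    by rewrite !real_normK ?num_real// exprMn; lra.
  by rewrite -sin_quadratic ler_norml; lra.
apply: le_trans h1 _; rewrite -real_normK ?num_real// ler_pM2r//.
by rewrite exprS [leRHS]exprS; rewrite -[X in X <= _]mul1r ler_wpM2r ?mulr_ge0 ?exprn_ge0// ltW.
Qed.

Lemma cos_taylor x z :
  `|cos (x + z) - cos x + z * sin x + z ^+ 2 / 2 * cos x| <= `|z| ^+ 3.
Proof.
have -> : cos (x + z) - cos x + z * sin x + z ^+ 2 / 2 * cos x =
  cos x * (cos z - 1 + z ^+ 2 / 2) - sin x * (sin z - z) by rewrite cosD; ring.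
apply: le_trans (ler_normB _ _) _; rewrite !normrM.
have h1 := ler_pM (normr_ge0 _) (normr_ge0 _) (cos_max x) (cos_cubic z).
have h2 := ler_pM (normr_ge0 _) (normr_ge0 _) (sin_max x) (sin_cubic z).
have := lerD h1 h2; rewrite !mul1r; lra.
Qed.

Lemma expR_linear (u : R) : 0 <= u <= 1 -> `|expR (- u) - (1 - u)| <= u ^+ 2.
Proof.
move=> /andP[u0 u1]; have h1 : 1 - u <= expR (- u) by have := @expR_ge1Dx R (- u).
have h2 : expR (- u) * (1 + u) <= 1.
  apply: (@le_trans _ _ (expR (- u) * expR u)); last by rewrite -expRD addNr expR0.
  by rewrite ler_wpM2l ?expR_ge0// expR_ge1Dx.
rewrite ger0_norm; last by lra.
have : expR (- u) <= 1 by rewrite -[leRHS]expR0 ler_expR; lra.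
have := expR_ge0 (- u); move: (expR _) h1 h2 => y h1 h2 y0 y1; nra.
Qed.

End Trigonometric.

Lemma cvg0Z (R : realType) (c : R) (u : nat -> R) : u @ \oo --> (0 : R) ->
  (fun n => c * u n) @ \oo --> (0 : R).
Proof. by move=> u0; rewrite -[X in _ --> X](mulr0 c); apply: cvgM => //; exact: cvg_cst. Qed.

(** * Characteristic function of the score martingale *)

Section MartingaleCLT.
Variables (R : realType) (f b : nat -> R) (lam Cf : R).
Hypothesis f_gt0 : forall k, (0 < k)%N -> 0 < f k.
Hypothesis f_ge1 : forall k, (0 < k)%N -> f 1%N <= f k.
Hypothesis f_le : forall k, (0 < k)%N -> f k <= Cf * k%:R.
Hypothesis b_ge1 : forall k, (0 < k)%N -> 1 <= b k.
Hypothesis b_nd : forall k l, (0 < k)%N -> (k <= l)%N -> b k <= b l.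
Hypothesis b_pow4 : forall k, (0 < k)%N -> b k ^+ 4 <= k%:R.
Hypothesis lam_gt0 : 0 < lam.
Hypothesis surv_sum :
  (fun n => \sum_(1 <= k < n) surv f lam k) @ \oo --> (1 : R).
Let p := pdist f lam.
Let w k : R := k%:R * b k ^+ 3.
Hypothesis wp_summable : summable1 (fun k => w k * p k).
Hypothesis wdist_small :
  (fun m => expect f m (fun a => wdist p w a m)) @ \oo --> (0 : R).
Implicit Types (a : attachments) (g : nat -> R).

Let p_gt0 k : (0 < k)%N -> 0 < p k. Proof. by move=> k0; exact: pdist_gt0. Qed.

Let w_ge0 k : (0 < k)%N -> 0 <= w k.
Proof. by move=> k0; rewrite mulr_ge0// exprn_ge0// (le_trans _ (b_ge1 k0)). Qed.

Let Cf_gt0 : 0 < Cf.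
Proof. by have := lt_le_trans (f_gt0 (ltn0Sn 0)) (f_le (ltn0Sn 0)); rewrite mulr1. Qed.

Let fg_le g Cg k : (0 < k)%N -> `|g k| <= Cg * b k ^+ 2 ->
  `|f k * g k| <= Cf * Cg * w k.
Proof.
move=> k0 gC; rewrite normrM (gtr0_norm (f_gt0 k0)).
have b1 := b_ge1 k0.
apply: (@le_trans _ _ (Cf * k%:R * (Cg * b k ^+ 2))).
  by apply: ler_pM => //; [exact/ltW/f_gt0|exact: f_le].
have Cg0 : 0 <= Cg * b k ^+ 2 by exact: le_trans gC.
have Cg1 : 0 <= Cg by rewrite -(pmulr_lge0 _ (_ : 0 < b k ^+ 2))// exprn_gt0//; lra.
rewrite /w -mulrA -[leRHS]mulrA ler_pM2l// mulrCA ler_wpM2l// ler_wpM2l//.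
by rewrite ler_weXn2l.
Qed.

Lemma surv_summable g Cg : (forall k, (0 < k)%N -> `|g k| <= Cg * b k ^+ 2) ->
  summable1 (fun k => g k * surv f lam k).
Proof.
move=> gC; have sm : summable1 (fun k => lam^-1 * (Cf * Cg * (w k * p k))).
  by do 2 apply: summable1Z.
apply: (le_summable1 _ sm) => k k0.
have -> : g k * surv f lam k = lam^-1 * (f k * g k * p k).
  rewrite [f k * _]mulrC -mulrA f_pdist//; field; exact: lt0r_neq0.
rewrite normrM gtr0_norm ?invr_gt0// ler_pM2l ?invr_gt0// normrM.
by rewrite (gtr0_norm (p_gt0 k0)) mulrA ler_pM2r ?p_gt0// fg_le// gC.
Qed.

(** The chosen node has degree k with probability f(k) N_k / S_f, whose limit f(k) p_k / lam is
    p_{>k} by [f_pdist]. *)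
Lemma cond_mean_gap g Cg : (forall k, (0 < k)%N -> `|g k| <= Cg * b k ^+ 2) ->
  exists2 C : R, 0 <= C & forall a m,
    `|nsum (fun k => f k * g k) a m.+1 / nsum f a m.+1
      - \sum_(1 <= k <oo) g k * surv f lam k| <= C * wdist p w a m.
Proof.
move=> gC; set E := \sum_(1 <= k <oo) _.
have f1 := f_gt0 (ltn0Sn 0).
have Cg0 : 0 <= Cg.
  have := le_trans (normr_ge0 _) (gC 1%N isT).
  by rewrite pmulr_lge0// exprn_gt0// (lt_le_trans _ (b_ge1 (ltn0Sn 0))).
have fE : \sum_(1 <= k <oo) f k * p k = lam.
  rewrite (@eq_sum1 _ _ _ (fun k => lam * surv f lam k)); last by move=> k; exact: f_pdist.
  have h : summable1 (surv f lam) by apply/cvg_ex; exists 1; exact: surv_sum.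
  by rewrite sum1Z// (cvg_lim (@Rhausdorff _) surv_sum) mulr1.
have fgE : \sum_(1 <= k <oo) (f k * g k) * p k = lam * E.
  rewrite (@eq_sum1 _ _ _ (fun k => lam * (g k * surv f lam k))); last first.
    by move=> k k0; rewrite [f k * _]mulrC -mulrA f_pdist// mulrCA.
  have h : summable1 (fun k => g k * surv f lam k) by exact: surv_summable gC.
  by rewrite sum1Z.
exists ((Cf * Cg + `|E| * Cf) / f 1%N).
  by rewrite divr_ge0 ?(ltW f1)// addr_ge0// mulr_ge0// ltW.
move=> a m.
have h1 := nsum_mean_gap w_ge0 p_gt0 wp_summable (g := fun k => f k * g k) a m
  (fun k k0 => fg_le k0 (gC k k0)).
have fw k : (0 < k)%N -> `|f k| <= Cf * w k.
  move=> k0; rewrite gtr0_norm ?f_gt0//; apply: le_trans (f_le k0) _.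
  by rewrite ler_pM2l// ler_peMr// exprn_ege1// b_ge1.
have h2 := nsum_mean_gap w_ge0 p_gt0 wp_summable (g := f) a m fw.
move: h1 h2; rewrite fE fgE.
have n0 : 0 < (m.+1%:R : R) by rewrite ltr0n.
have S0 : f 1%N <= nsum f a m.+1 / m.+1%:R.
  by rewrite ler_pdivlMr// -(nsum_cst (f 1%N) a); exact: ler_nsum.
have -> : nsum (fun k => f k * g k) a m.+1 / nsum f a m.+1 =
  (nsum (fun k => f k * g k) a m.+1 / m.+1%:R) / (nsum f a m.+1 / m.+1%:R).
  by field; rewrite !gt_eqF// nsum_gt0.
have d0 : 0 <= wdist p w a m by exact: wdist_ge0.
move: (nsum _ _ _ / _) S0 (nsum _ _ _ / _) (wdist _ _ _ _) d0 => S S1 X D D0 hX hS.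
have S0 : 0 < S by exact: lt_le_trans S1.
have -> : X / S - E = ((X - lam * E) - E * (S - lam)) / S.
  by field; exact: lt0r_neq0.
rewrite normrM normfV (gtr0_norm S0) ler_pdivrMr//.
apply: (@le_trans _ _ ((Cf * Cg + `|E| * Cf) * D)).
  rewrite mulrDl; apply: le_trans (ler_normB _ _) _; apply: lerD => //.
  by rewrite normrM -mulrA ler_wpM2l.
have -> : (Cf * Cg + `|E| * Cf) / f 1%N * D * S =
  (Cf * Cg + `|E| * Cf) * D * (S / f 1%N) by field; exact: lt0r_neq0.
rewrite ler_peMr//; last by rewrite ler_pdivlMr// mul1r.
by rewrite mulr_ge0// addr_ge0// mulr_ge0// ltW.
Qed.

Section Increments.
Variables (rho : nat -> R) (Cr : R).
Hypothesis rho_le : forall k, (0 < k)%N -> `|rho k| <= Cr * b k.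

(** [rho] is to be the logarithmic derivative of f at the true parameter in a fixed direction;
    [incr] is then one term of the score and [mart] their sum. *)
Definition cond_mean a m : R := nsum (fun k => f k * rho k) a m.+1 / nsum f a m.+1.
Definition incr a m : R := rho (deg a m.+1 (a m)) - cond_mean a m.
Definition mart a n : R := \sum_(m < n) incr a m.
Definition cond_var a m : R := cond_exp f m (fun a => incr a m ^+ 2) a.
Definition lim_var : R := \sum_(1 <= k <oo) rho k ^+ 2 * surv f lam k
  - (\sum_(1 <= k <oo) rho k * surv f lam k) ^+ 2.

Lemma cond_mean_determined m : determined m (cond_mean^~ m).
Proof. by move=> a c ac; rewrite /cond_mean !(@eq_nsum _ a c _ m.+1). Qed.

Lemma incr_upd a m i : (i < m.+1)%N ->
  incr (upd a m i) m = rho (deg a m.+1 i) - cond_mean a m.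
Proof.
move=> im; rewrite /incr (@cond_mean_determined m _ a); last exact: agree_upd.
by rewrite (@eq_deg _ a)/= ?upd_same//; exact: agree_upd.
Qed.

Lemma incr_determined m : determined m.+1 (incr^~ m).
Proof.
move=> a c ac; rewrite /incr (@cond_mean_determined m a c); last first.
  by move=> j jm; apply: ac; exact: ltnW.
by rewrite ac// (@eq_deg a c)//= => j jm; apply: ac; exact: ltnW.
Qed.

Lemma mart_determined n : determined n (mart^~ n).
Proof.
move=> a c ac; apply: eq_bigr => m _; apply: incr_determined => j jm.
by apply: ac; rewrite (leq_trans jm).
Qed.

Lemma martS a n : mart a n.+1 = mart a n + incr a n.
Proof. by rewrite /mart big_ord_recr. Qed.

Lemma cond_exp_incr a m : cond_exp f m (incr^~ m) a = 0.
Proof.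
rewrite (@cond_exp_choice _ _ _ _ _ (fun k => rho k - cond_mean a m)); last first.
  by move=> i im; rewrite incr_upd.
have -> : nsum (fun k => f k * (rho k - cond_mean a m)) a m.+1 =
  nsum (fun k => f k * rho k) a m.+1 - cond_mean a m * nsum f a m.+1.
  rewrite -(mulNr (cond_mean a m)) -nsumZ -nsumD; apply: eq_nsum_fun => k _; ring.
rewrite /cond_mean divfK ?subrr ?mul0r// gt_eqF// nsum_gt0//.
Qed.

Lemma cond_varE a m : cond_var a m =
  nsum (fun k => f k * rho k ^+ 2) a m.+1 / nsum f a m.+1 - cond_mean a m ^+ 2.
Proof.
rewrite /cond_var (@cond_exp_choice _ _ _ _ _ (fun k => (rho k - cond_mean a m) ^+ 2)); last first.
  by move=> i im; rewrite incr_upd.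
have -> : nsum (fun k => f k * (rho k - cond_mean a m) ^+ 2) a m.+1 =
  nsum (fun k => f k * rho k ^+ 2) a m.+1
  + (- 2 * cond_mean a m) * nsum (fun k => f k * rho k) a m.+1
  + cond_mean a m ^+ 2 * nsum f a m.+1.
  by rewrite -!nsumZ -!nsumD; apply: eq_nsum_fun => k _; ring.
rewrite /cond_mean; field; rewrite gt_eqF// nsum_gt0//.
Qed.

Lemma cond_var_ge0 a m : 0 <= cond_var a m.
Proof.
rewrite sumr_ge0// => i _; rewrite mulr_ge0 ?sqr_ge0// choice_prob_ge0//.
Qed.

(** The squared mean makes the error quadratic in [wdist]. Above 1, positivity of the variance
    allows the squared mean to be dropped, which gives a linear bound again. *)
Lemma cond_var_gap : exists2 C : R, 0 <= C & forall a m,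
  `|cond_var a m - lim_var| <= C * wdist p w a m.
Proof.
have Cr0 : 0 <= Cr.
  have := le_trans (normr_ge0 _) (rho_le (ltn0Sn 0)).
  by rewrite pmulr_lge0// (lt_le_trans _ (b_ge1 (ltn0Sn 0))).
have r1 k : (0 < k)%N -> `|rho k| <= Cr * b k ^+ 2.
  move=> k0; apply: le_trans (rho_le k0) _; rewrite ler_wpM2l// expr2.
  by have := b_ge1 k0 => h; rewrite ler_peMr//; lra.
have r2 k : (0 < k)%N -> `|rho k ^+ 2| <= Cr ^+ 2 * b k ^+ 2.
  by move=> k0; rewrite normrX -exprMn lerXn2r ?nnegrE ?rho_le// (le_trans _ (rho_le k0)).
have [C1 C10 h1] := cond_mean_gap r1; have [C2 C20 h2] := cond_mean_gap r2.
rewrite /lim_var; set E1 := \sum_(1 <= k <oo) rho k * _; set E2 := \sum_(1 <= k <oo) rho k ^+ 2 * _.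
exists (C2 + C1 * (C1 + 2 * `|E1|) + `|E2| + `|E2 - E1 ^+ 2|).
  by rewrite !addr_ge0// mulr_ge0// addr_ge0// mulr_ge0.
move=> a m; have d0 : 0 <= wdist p w a m by exact: wdist_ge0.
have v0 := cond_var_ge0 a m.
move: (h1 a m) (h2 a m) v0; rewrite cond_varE -/(cond_mean a m) -/E1 -/E2.
move: (nsum _ _ _ / _) (cond_mean a m) (wdist _ _ _ _) d0 => M2 M1 D D0 k1 k2 v0.
have [D1|D1] := leP D 1.
  have -> : M2 - M1 ^+ 2 - (E2 - E1 ^+ 2) =
    (M2 - E2) - (M1 - E1) * ((M1 - E1) + 2 * E1) by ring.
  apply: le_trans (ler_normB _ _) _.
  have k3 : `|M1 - E1 + 2 * E1| <= C1 + 2 * `|E1|.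
    apply: le_trans (ler_normD _ _) _; rewrite normrM ger0_norm// lerD2r.
    by apply: le_trans k1 _; rewrite ler_piMr.
  have k4 : `|(M1 - E1) * (M1 - E1 + 2 * E1)| <= C1 * D * (C1 + 2 * `|E1|).
    by rewrite normrM ler_pM.
  apply: le_trans (lerD k2 k4) _; rewrite mulrAC -mulrDl ler_wpM2r//.
  by rewrite -addrA lerDl addr_ge0.
have : `|M2 - M1 ^+ 2| <= `|E2| + C2 * D.
  rewrite ger0_norm//; have : 0 <= M1 ^+ 2 by exact: sqr_ge0.
  move: k2; rewrite ler_norml => /andP[_]; have := ler_norm E2; lra.
have := ler_normB (M2 - M1 ^+ 2) (E2 - E1 ^+ 2).
have n2 : `|E2| <= `|E2| * D by rewrite ler_peMr// ltW.
have n3 : `|E2 - E1 ^+ 2| <= `|E2 - E1 ^+ 2| * D by rewrite ler_peMr// ltW.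
have n4 : 0 <= C1 * (C1 + 2 * `|E1|) * D.
  by apply: mulr_ge0 => //; apply: mulr_ge0 => //; rewrite addr_ge0// mulr_ge0.
rewrite !mulrDl; lra.
Qed.

(** Degrees are at most n before time n, so the increments are of order n^(1/4) at most: after
    division by sqrt n they are uniformly negligible, and no Lindeberg truncation occurs. *)
Lemma incr_bound a m n : (m < n)%N -> `|incr a m| <= 2 * Cr * b n.
Proof.
move=> mn; have rb k : (0 < k <= n)%N -> `|rho k| <= Cr * b n.
  move=> /andP[k0 kn]; have Cr0 : 0 <= Cr.
    have := le_trans (normr_ge0 _) (rho_le (ltn0Sn 0)).
    by rewrite pmulr_lge0// (lt_le_trans _ (b_ge1 (ltn0Sn 0))).
  by apply: le_trans (rho_le k0) _; rewrite ler_wpM2l// b_nd.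
have dn i : (0 < deg a m.+1 i <= n)%N by rewrite deg_gt0 (leq_trans (deg_le _ _ _)).
rewrite -mulrA [2 * _]mulrC mulr2n mulrDr mulr1.
apply: le_trans (ler_normB _ _) _; apply: lerD; first exact: rb.
rewrite /cond_mean normrM normfV (gtr0_norm (nsum_gt0 f_gt0 _ _)).
rewrite ler_pdivrMr ?nsum_gt0// /nsum mulr_sumr.
apply: le_trans (ler_norm_sum _ _ _) _; apply: ler_sum => i _.
by rewrite normrM gtr0_norm ?f_gt0// mulrC ler_pM2r ?f_gt0// rb.
Qed.

Lemma wdist_mean_bounded : exists2 M : R, 0 <= M &
  forall m, expect f m (fun a => wdist p w a m) <= M.
Proof.
have [M [_ /(_ (`|M| + 1))]] := cvg_seq_bounded (cvgP _ wdist_small).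
have h : M < `|M| + 1 by apply: le_lt_trans (ler_norm M) _; rewrite ltrDl.
move=> /(_ h) hM; exists (`|M| + 1); first by rewrite addr_ge0.
by move=> m; apply: le_trans (ler_norm _) (hM m _).
Qed.

Lemma lim_var_ge0 : 0 <= lim_var.
Proof.
have [C C0 hC] := cond_var_gap.
have lim0 : (fun m => - (C * expect f m (fun a => wdist p w a m))) @ \oo --> (0 : R).
  by rewrite -[X in _ --> X]oppr0; apply: cvgN; exact: cvg0Z.
rewrite -(cvg_lim (@Rhausdorff _) lim0); apply: limr_le; first by apply/cvg_ex; exists 0.
apply: nearW => m; rewrite -mulNr -expectZ -(expect_cst f_gt0 m lim_var).
apply: ler_expect => // a; have := hC a m; have := cond_var_ge0 a m.
rewrite ler_norml => v0 /andP[_]; lra.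
Qed.

Lemma expect_cond_var_le : exists2 C : R, 0 <= C & forall m,
  expect f m (cond_var^~ m) <= C.
Proof.
have [C C0 hC] := cond_var_gap; have [M M0 hM] := wdist_mean_bounded.
exists (`|lim_var| + C * M); first by rewrite addr_ge0 ?mulr_ge0.
move=> m; apply: (@le_trans _ _ (expect f m (fun a => `|lim_var| + C * wdist p w a m))).
  apply: ler_expect => // a; have := hC a m; rewrite ler_norml => /andP[_].
  have := ler_norm lim_var; lra.
by rewrite expectD expect_cst// expectZ lerD2l ler_wpM2l.
Qed.

Lemma expect_mart_sq : exists2 C : R, 0 <= C & forall n,
  expect f n (fun a => mart a n ^+ 2) <= C * n%:R.
Proof.
have [C C0 hC] := expect_cond_var_le; exists C => // n.
elim: n => [|n IH]; first by rewrite /= /mart big_ord0 expr0n mulr0.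
rewrite [X in X <= _](_ : _ = expect f n (fun a => mart a n ^+ 2 + cond_var a n)).
  by rewrite expectD -natr1 mulrDr mulr1 lerD.
rewrite [LHS]/=; congr (expect f n _); apply/funext => a.
have -> : (fun a => mart a n.+1 ^+ 2) =
    (fun a => mart a n ^+ 2 + (2 * mart a n * incr a n + incr a n ^+ 2)).
  by apply/funext => c; rewrite martS; ring.
rewrite !cond_expD (@cond_exp_id _ _ f_gt0 n (fun a => mart a n ^+ 2)); last first.
  by move=> x y xy; rewrite (mart_determined xy).
rewrite (@cond_expMl _ f n (incr^~ n) (fun a => 2 * mart a n)); last first.
  by move=> x y xy; rewrite (mart_determined xy).
by rewrite cond_exp_incr mulr0 add0r.
Qed.

Lemma cube_norm_le (s x B : R) : 0 <= s -> `|x| <= B ->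
  `|s * x| ^+ 3 <= s ^+ 3 * B * x ^+ 2.
Proof.
move=> s0 xB; rewrite normrM (ger0_norm s0) exprMn -mulrA ler_wpM2l ?exprn_ge0//.
by rewrite -[X in _ * X](real_normK (num_real x)) exprS ler_wpM2r ?sqr_ge0.
Qed.

Lemma chf_step (s c B : R) m : 0 <= s -> (forall a, `|incr a m| <= B) ->
  `|expect f m.+1 (fun a => cos (s * mart a m.+1 + c))
    - (1 - s ^+ 2 * lim_var / 2) * expect f m (fun a => cos (s * mart a m + c))|
  <= expect f m (fun a => s ^+ 3 * B * cond_var a m
       + s ^+ 2 / 2 * `|cond_var a m - lim_var|).
Proof.
move=> s0 hB; rewrite -expectZ [in X in X - _]/= -expectB.
apply: le_trans (ler_norm_expect f_gt0 _ _) _; apply: ler_expect => // a.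
set X := s * mart a m + c.
have detX : determined m (fun a => s * mart a m + c).
  by move=> x y xy; rewrite (mart_determined xy).
pose G a' := cos (s * mart a' m + c + s * incr a' m) - cos (s * mart a' m + c)
  + s * incr a' m * sin (s * mart a' m + c)
  + (s * incr a' m) ^+ 2 / 2 * cos (s * mart a' m + c).
have -> : cond_exp f m (fun a => cos (s * mart a m.+1 + c)) a =
    cond_exp f m G a + cos X - s ^+ 2 / 2 * cond_var a m * cos X.
  have e1 : (fun a => cos (s * mart a m.+1 + c)) =
    (fun a' => G a' + (cos (s * mart a' m + c)
      + ((- s * sin (s * mart a' m + c)) * incr a' m
      + (- (s ^+ 2 / 2) * cos (s * mart a' m + c)) * incr a' m ^+ 2))).
    apply/funext => a'; rewrite /G martS mulrDr.
    by rewrite [s * mart a' m + _ + c]addrAC; ring.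
  rewrite e1 !cond_expD (@cond_exp_id _ _ f_gt0 m (fun a => cos (s * mart a m + c))); last first.
    by move=> x y xy; rewrite (detX x y).
  rewrite (@cond_expMl _ f m (incr^~ m) (fun a' => - s * sin (s * mart a' m + c))); last first.
    by move=> x y xy; rewrite (detX x y).
  rewrite (@cond_expMl _ f m (fun a => incr a m ^+ 2) (fun a' => - (s ^+ 2 / 2) * cos (s * mart a' m + c))); last first.
    by move=> x y xy; rewrite (detX x y).
  by rewrite cond_exp_incr -/(cond_var a m) -/X; ring.
have -> : cond_exp f m G a + cos X - s ^+ 2 / 2 * cond_var a m * cos X
    - (1 - s ^+ 2 * lim_var / 2) * cos X =
    cond_exp f m G a - s ^+ 2 / 2 * ((cond_var a m - lim_var) * cos X) by field.
have hG : `|cond_exp f m G a| <= s ^+ 3 * B * cond_var a m.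
  rewrite /cond_var -[X in X * cond_exp _ _ _ _]/((fun=> s ^+ 3 * B) a) -cond_expMl//.
  apply: le_trans (ler_norm_sum _ _ _) _; apply: ler_sum => i _.
  rewrite normrM ger0_norm ?choice_prob_ge0// ler_wpM2l ?choice_prob_ge0//.
  apply: le_trans (cos_taylor _ _) _.
  exact: cube_norm_le.
apply: le_trans (ler_normB _ _) _; apply: lerD => //.
have n0 : 0 <= s ^+ 2 / 2 by rewrite divr_ge0// sqr_ge0.
by rewrite normrM (ger0_norm n0) ler_wpM2l// normrM ler_piMr// cos_max.
Qed.

(** At the fixed scale s_n, the mean of the cosine at the times t <= n is compared with cos c exp(-
    t u). Each step multiplies the past error by exp(- u) <= 1, so the one-step errors merely add
    up. *)
Lemma mart_chf c : (fun n => expect f n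
    (fun a => cos (mart a n / Num.sqrt n.+1%:R + c))) @ \oo -->
  cos c * expR (- (lim_var / 2)).
Proof.
have [C C0 hC] := cond_var_gap; have [K K0 hK] := expect_cond_var_le.
have l0 := lim_var_ge0.
have Cr0 : 0 <= Cr.
  have := le_trans (normr_ge0 _) (rho_le (ltn0Sn 0)).
  by rewrite pmulr_lge0// (lt_le_trans _ (b_ge1 (ltn0Sn 0))).
pose D m := expect f m (fun a => wdist p w a m).
pose s n : R := Num.sqrt n.+1%:R^-1.
have s_ge0 n : 0 <= s n by exact: sqrtr_ge0.
have sE n : s n ^+ 2 = n.+1%:R^-1 by rewrite sqr_sqrtr.
have sqrt0 (u : nat -> R) : u @ \oo --> (0 : R) -> (fun n => Num.sqrt (u n)) @ \oo --> (0 : R).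
  by move=> u0; rewrite -[X in _ --> X]sqrtr0; apply: continuous_cvg => //; exact: sqrt_continuous.
have s0 : s @ \oo --> (0 : R) by apply: sqrt0; exact: cvg_harmonic.
have s20 : (fun n => s n ^+ 2) @ \oo --> (0 : R).
  by under eq_fun do rewrite sE; exact: cvg_harmonic.
(* In order: the conditional variances against their limit, which leaves a Cesaro mean; the
   third-order Taylor terms; exp(- u) against 1 - u. *)
pose err n : R := C / 2 * (n.+1%:R^-1 * \sum_(t < n.+1) D t)
  + 2 * Cr * K * Num.sqrt (s n) + (lim_var / 2) ^+ 2 * s n ^+ 2.
have err0 : err @ \oo --> (0 : R).
  rewrite /err -[X in _ --> X](addr0 0); apply: cvgD; last exact: cvg0Z.
  rewrite -[X in _ --> X](addr0 0); apply: cvgD; last exact/cvg0Z/sqrt0.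
  apply: cvg0Z.
  have := cesaro wdist_small; rewrite /arithmetic_mean /series /=.
  by under eq_fun do rewrite big_mkord.
have D_ge0 t : 0 <= D t by apply: expect_ge0 => // a; exact: wdist_ge0.
have bound n : s n ^+ 2 * lim_var / 2 <= 1 ->
    `|expect f n (fun a => cos (s n * mart a n + c))
    - cos c * expR (- (n%:R * (s n ^+ 2 * lim_var / 2)))| <= err n.
  set u := s n ^+ 2 * lim_var / 2 => u1.
  have u0 : 0 <= u by rewrite divr_ge0// mulr_ge0// sqr_ge0.
  pose B := 2 * Cr * b n.+1.
  have b0 : 0 <= b n.+1 by apply: le_trans (b_ge1 (ltn0Sn n)).
  have B0 : 0 <= B by rewrite !mulr_ge0.
  pose r t := s n ^+ 3 * B * K + s n ^+ 2 / 2 * (C * D t) + u ^+ 2.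
  have rec t : (t <= n)%N -> `|expect f t (fun a => cos (s n * mart a t + c))
      - cos c * expR (- (t%:R * u))| <= \sum_(j < t) r j.
    elim: t => [_|t IH tn].
      rewrite big_ord0 [expect _ _ _]/= /mart big_ord0 mulr0 add0r mul0r oppr0.
      by rewrite expR0 mulr1 subrr normr0.
    have incB a : `|incr a t| <= B by apply: incr_bound; rewrite ltnS ltnW.
    have := chf_step c (s_ge0 n) incB; rewrite -/u.

    have phi1 : `|expect f t (fun a => cos (s n * mart a t + c))| <= 1.
      apply: le_trans (ler_norm_expect f_gt0 _ _) _.
      rewrite -[leRHS](expect_cst f_gt0 t 1); apply: ler_expect => // a.
      exact: cos_max.
    have ler : expect f t (fun a => s n ^+ 3 * B * cond_var a t
        + s n ^+ 2 / 2 * `|cond_var a t - lim_var|) <=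
        s n ^+ 3 * B * K + s n ^+ 2 / 2 * (C * D t).
      rewrite expectD !expectZ; apply: lerD.
        by apply: ler_wpM2l => //; apply: mulr_ge0 => //; exact: exprn_ge0.
      apply: ler_wpM2l; first by rewrite divr_ge0// sqr_ge0.
      by rewrite /D -expectZ; apply: ler_expect.
    have eu : `|expR (- u) - (1 - u)| <= u ^+ 2 by apply: expR_linear; rewrite u0.
    have eu1 : `|expR (- u)| <= 1.
      by rewrite ger0_norm ?expR_ge0// -[leRHS]expR0 ler_expR oppr_le0.
    move=> /le_trans/(_ ler) h2.
    have := IH (ltnW tn); move: h2; rewrite big_ord_recr/=.
    have -> : - (t.+1%:R * u) = - (t%:R * u) + - u by rewrite -natr1; ring.
    rewrite expRD.
    move: (expect f t (cond_exp _ _ _)) (expect f t _) phi1 (expR (- u)) eu eu1 => p1 p0 phi1 eu heu eu1 h2 h1.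
    rewrite (_ : p1 - _ = (p1 - (1 - u) * p0) - p0 * (eu - (1 - u))
       + eu * (p0 - cos c * expR (- (t%:R * u)))); last by ring.
    apply: le_trans (ler_normD _ _) _; rewrite [leRHS]addrC; apply: lerD.
      apply: le_trans (ler_normB _ _) _; apply: lerD => //.
      by rewrite normrM; apply: le_trans heu; rewrite ler_piMl.
    by rewrite normrM; apply: le_trans h1; rewrite ler_piMl.
  apply: le_trans (rec n (leqnn n)) _.
  have sn1 : n%:R * s n ^+ 2 <= 1.
    by rewrite sE ler_pdivrMr ?mul1r ?ler_nat// ltr0n.
  rewrite /r !big_split/= !sumr_const card_ord -mulr_sumr -mulr_sumr /err.
  apply: lerD; last first.
    rewrite -[X in X <= _]mulr_natr /u.
    have -> : (s n ^+ 2 * lim_var / 2) ^+ 2 * n%:R =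
      (lim_var / 2) ^+ 2 * s n ^+ 2 * (n%:R * s n ^+ 2) by ring.
    by rewrite ler_piMr// mulr_ge0// sqr_ge0.
  rewrite addrC; apply: lerD.
    have -> : s n ^+ 2 / 2 * (C * \sum_(i < n) D i) =
      C / 2 * (n.+1%:R^-1 * \sum_(i < n) D i) by rewrite sE; ring.
    rewrite ler_wpM2l ?divr_ge0// ler_wpM2l ?invr_ge0//.
    by rewrite [leRHS]big_ord_recr/= lerDl.
  (* The third-order terms add up to a multiple of s b, and b^4 <= k makes s b at most sqrt s. *)
  have sb2 : s n * b n.+1 ^+ 2 <= 1.
    rewrite -(@ler_pXn2r _ 2%N)// ?nnegrE ?mulr_ge0 ?exprn_ge0// expr1n exprMn sE -exprM.
    by rewrite mulrC ler_pdivrMr ?mul1r ?b_pow4// ltr0n.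
  have sb : s n * b n.+1 <= Num.sqrt (s n).
    rewrite -(@ler_pXn2r _ 2%N)// ?nnegrE ?mulr_ge0 ?sqrtr_ge0// sqr_sqrtr//.
    have -> : (s n * b n.+1) ^+ 2 = s n * (s n * b n.+1 ^+ 2) by ring.
    by rewrite ler_piMr.
  rewrite -[X in X <= _]mulr_natr /B.
  have -> : s n ^+ 3 * (2 * Cr * b n.+1) * K * n%:R =
     2 * Cr * K * (s n * b n.+1 * (n%:R * s n ^+ 2)) by ring.
  rewrite ler_wpM2l ?mulr_ge0//; apply: le_trans sb.
  by rewrite ler_piMr// mulr_ge0.
have nearu : \forall n \near \oo, s n ^+ 2 * lim_var / 2 <= 1.
  have : (fun n => s n ^+ 2 * lim_var / 2) @ \oo --> (0 : R).
    rewrite (_ : (fun n => _) = (fun n => lim_var / 2 * s n ^+ 2)); first exact: cvg0Z.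
    by apply/funext => n; rewrite -mulrA mulrC.
  move=> /cvgrPdist_le/(_ 1 ltr01); apply: filterS => n.
  by rewrite sub0r normrN => /(le_trans (ler_norm _)).
have lim1 : (fun n => cos c * expR (- (n%:R * (s n ^+ 2 * lim_var / 2)))) @ \oo -->
    cos c * expR (- (lim_var / 2)).
  apply: cvgM; first exact: cvg_cst.
  apply: continuous_cvg; first exact: continuous_expR.
  apply: cvgN; rewrite (_ : (fun n => _) = (fun n => lim_var / 2 - s n ^+ 2 * (lim_var / 2))).
    rewrite -[X in _ --> X]subr0 -[X in _ --> _ - X](mul0r (lim_var / 2)).
    by apply: cvgB; [exact: cvg_cst|apply: cvgM => //; exact: cvg_cst].
  apply/funext => n; rewrite sE; have : (n.+1%:R : R) != 0 by rewrite pnatr_eq0.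
  by rewrite -natr1 => n0; field.
apply/cvgrPdist_le => e e0.
have e2 : 0 < e / 2 by lra.
have /cvgrPdist_le/(_ _ e2) h1 := lim1.
have /cvgrPdist_le/(_ _ e2) h2 := err0.
near=> n.
have hs : s n ^+ 2 * lim_var / 2 <= 1 by near: n.
have k1 := bound n hs.
have k2 : `|cos c * expR (- (lim_var / 2)) -
  cos c * expR (- (n%:R * (s n ^+ 2 * lim_var / 2)))| <= e / 2 by near: n.
have k3 : `|0 - err n| <= e / 2 by near: n.
move: k3; rewrite sub0r normrN => /(le_trans (ler_norm _)) k3.
have -> : (fun a => cos (mart a n / Num.sqrt n.+1%:R + c)) =
   (fun a => cos (s n * mart a n + c)).
  have sV : s n = (Num.sqrt n.+1%:R)^-1 by rewrite /s sqrtrV.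
  by apply/funext => a; rewrite sV [_^-1 * _]mulrC.
move: k1 k2; move: (expect _ _ _) => x; move: (cos c * _) (cos c * _) => y z.
rewrite !ler_norml => /andP[k1 k1'] /andP[k2 k2']; apply/andP; split; lra.
Unshelve. all: by end_near. Qed.

End Increments.
End MartingaleCLT.

(** * Gaussian expectations and convergence in law *)

Section GaussianCharacteristic.
Variable R : realType.
Notation mu := (@lebesgue_measure R).
Notation pdf := (normal_pdf (0 : R) 1).
Implicit Types (w c x : R).

Lemma std_pdfE x : pdf x = normal_peak 1 * expR (- (x ^+ 2 / 2)).
Proof.
by rewrite normal_pdfE ?oner_neq0// /normal_fun subr0 expr1n mulNr.
Qed.

Lemma is_derive_std_pdf x : is_derive x 1 (pdf : R -> R) (- x * pdf x).
Proof.
have -> : pdf = (fun x => normal_peak 1 * expR (- (x ^+ 2 / 2))).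
  by apply/funext => y; exact: std_pdfE.
by apply: is_derive_eq; rewrite /GRing.scale/=; field.
Qed.

Lemma integrable_bounded_std_pdf (g : R -> R) (M : R) :
  measurable_fun setT g -> (forall x, `|g x| <= M) ->
  mu.-integrable setT (fun x => (g x * pdf x)%:E).
Proof.
move=> mg gM.
have iM : mu.-integrable setT (fun x => (M%:E * (pdf x)%:E)%E).
  by apply: integrableZl => //; exact: integrable_normal_pdf.
apply: (le_integrable _ _ _ iM) => //.
  apply/measurable_EFinP/measurable_funM => //.
  exact: measurable_normal_pdf.
move=> x _; rewrite -EFinM !abse_EFin lee_fin !normrM ler_wpM2r//.
by apply: le_trans (gM x) _; exact: ler_norm.
Qed.

Lemma integral_std_normal (g : R -> R) (M : R) :
  measurable_fun setT g -> (forall x, `|g x| <= M) ->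
  (\int[normal_prob 0 1]_x (g x)%:E = \int[mu]_x (g x * pdf x)%:E)%E.
Proof.
move=> mg gM.
have M0 : 0 <= M by apply: le_trans (gM 0).
have iM : (normal_prob (0 : R) 1).-integrable setT (fun=> M%:E).
  exact: finite_measure_integrable_cst.
rewrite -(Radon_Nikodym_change_of_variables (normal_prob_dominates (0 : R) 1))//=; last first.
  apply: (le_integrable _ _ _ iM) => //.
    exact/measurable_EFinP.
  by move=> x _; rewrite !abse_EFin lee_fin (ger0_norm M0).
under [in RHS]eq_integral do rewrite EFinM.
have mpdf : measurable_fun setT (fun x : R => (pdf x)%:E).
  apply/measurable_EFinP; exact: measurable_normal_pdf.
have mgE : measurable_fun setT (fun x : R => (g x)%:E).
  exact/measurable_EFinP.
apply: ae_eq_integral => //.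
- apply: emeasurable_funM => //; apply: (measurable_int mu).
  by apply: Radon_Nikodym_integrable; exact: normal_prob_dominates.
- exact: emeasurable_funM.
- apply: ae_eqe_mul2l => /=.
  rewrite Radon_NikodymE//=; first exact: normal_prob_dominates.
  move=> abmu; case: cid => /= h [h1 h2 h3].
  by apply: integral_ae_eq => // E E01 mE; rewrite -h3.
Qed.

(** |x| <= 1 + x^2 / 4 <= exp(x^2 / 4), so the integrand is at most a multiple of the normal density
    of variance 2. *)
Lemma integrable_id_std_pdf : mu.-integrable setT (fun x => (`|x| * pdf x)%:E).
Proof.
have s0 : Num.sqrt (2 : R) != 0 by rewrite gt_eqF// sqrtr_gt0.
pose k : R := normal_peak 1 / normal_peak (Num.sqrt 2).
have ik : mu.-integrable setT (fun x => (k%:E * (normal_pdf 0 (Num.sqrt 2) x)%:E)%E).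
  by apply: integrableZl => //; exact: integrable_normal_pdf.
apply: (le_integrable _ _ _ ik) => //.
  apply/measurable_EFinP/measurable_funM.
    by exact: normr_measurable.
  exact: measurable_normal_pdf.
move=> x _; rewrite -EFinM !abse_EFin lee_fin.
have k0 : 0 <= k by rewrite divr_ge0 ?normal_peak_ge0.
rewrite [X in X <= _]ger0_norm; last by rewrite mulr_ge0 ?normal_pdf_ge0.
rewrite [X in _ <= X]ger0_norm; last by rewrite mulr_ge0 ?normal_pdf_ge0.
have -> : k * normal_pdf 0 (Num.sqrt 2) x = normal_peak 1 * normal_fun 0 (Num.sqrt 2) x.
  by rewrite normal_pdfE// /k mulrA divfK// gt_eqF// normal_peak_gt0.
rewrite std_pdfE mulrCA ler_pM2l ?normal_peak_gt0 ?oner_neq0//.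
rewrite /normal_fun subr0 sqr_sqrtr//.
have -> : - x ^+ 2 / (2 *+ 2) = x ^+ 2 / 4 + - (x ^+ 2 / 2) by rewrite -mulr_natr; field.
rewrite expRD ler_wpM2r ?expR_ge0//; apply: le_trans (expR_ge1Dx _).
have := sqr_ge0 (`|x| / 2 - 1); rewrite -[x ^+ 2]real_normK ?num_real//.
move: `|x| => y; rewrite sqrrB; lra.
Qed.

Lemma affine_continuous w c : continuous (fun x => w * x + c).
Proof. by move=> x; apply: cvgD; [apply: cvgM; [exact: cvg_cst|exact: cvg_id]|exact: cvg_cst]. Qed.

Lemma cos_affine_measurable w c : measurable_fun setT (fun x => cos (w * x + c)).
Proof.
apply: continuous_measurable_fun => x.
apply: (@continuous_comp _ _ _ (fun x => w * x + c)); first exact: affine_continuous.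
exact: continuous_cos.
Qed.

Lemma sin_affine_measurable w c : measurable_fun setT (fun x => sin (w * x + c)).
Proof.
apply: continuous_measurable_fun => x.
apply: (@continuous_comp _ _ _ (fun x => w * x + c)); first exact: affine_continuous.
exact: continuous_sin.
Qed.

Lemma integrable_moment_std_pdf (g : R -> R) : measurable_fun setT g ->
  (forall x, `|g x| <= 1) -> mu.-integrable setT (fun x => (x * g x * pdf x)%:E).
Proof.
move=> mg g1; apply: le_integrable integrable_id_std_pdf => //.
  apply/measurable_EFinP; apply: measurable_funM; last exact: measurable_normal_pdf.
  exact: measurable_funM.
move=> x _; rewrite !abse_EFin lee_fin !normrM normr_id ler_wpM2r// ler_piMr//.
Qed.

Definition gauss_trig w c : R := \int[mu]_(x in setT) (cos (w * x + c) * pdf x).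

Lemma symmetric_exhaustion (v : R -> R) : mu.-integrable setT (EFin \o v) ->
  (fun n => \int[mu]_(x in `[- n%:R, n%:R]) v x) @ \oo --> \int[mu]_(x in setT) v x.
Proof.
move=> iv.
pose D n : set R := [set` `[- (n%:R : R), n%:R]].
have mv : measurable_fun setT (EFin \o v) by exact: measurable_int iv.
have [] := @dominated_convergence _ _ _ mu setT measurableT
  (fun n => (EFin \o v) \_ (D n)) (EFin \o v) (fun x => `|(v x)%:E|%E).
- move=> n; apply/(measurable_restrictT _ _).1; first exact: measurable_itv.
  exact: measurable_funTS mv.
- exact: mv.
- apply: aeW => x _; apply: cvg_near_cst; near=> n.
  rewrite patchE mem_set//= /D /= in_itv/= -ler_norml.
  by near: n; exact: nbhs_infty_ger.
- exact: integrable_abse.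
- apply: aeW => x n _; rewrite patchE; case: ifP => //= _.
  by rewrite normr0 lee_fin.
move=> _ _ h; apply: fine_cvg; rewrite fineK; last exact: integrable_fin_num.
move: h; rewrite (_ : [sequence _]_n = (fun n => \int[mu]_(x in D n) (v x)%:E)%E)//.
by apply/funext => n; rewrite [RHS]integral_mkcond.
Unshelve. all: by end_near. Qed.

(** Stein's identity: the integrand is the derivative of sin(w x + c) times the density, which
    vanishes at infinity. *)
Lemma integral_derivative_std_pdf w c :
  \int[mu]_(x in setT) (w * cos (w * x + c) * pdf x - x * sin (w * x + c) * pdf x) = 0.
Proof.
pose v x := w * cos (w * x + c) * pdf x - x * sin (w * x + c) * pdf x.
pose u x := sin (w * x + c) * pdf x.
have du x : is_derive x 1 u (v x).
  have h := is_derive_std_pdf x.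
  by apply: is_derive_eq; rewrite /GRing.scale/= /v; ring.
have cpdf : continuous (pdf : R -> R).
  by move=> x; apply: differentiable_continuous; apply/derivable1_diffP; have [] := is_derive_std_pdf x.
have cu : continuous u.
  by move=> x; apply: differentiable_continuous; apply/derivable1_diffP; have [] := du x.
have cv : continuous v.
  move=> x; have ca : continuous (fun x => w * x + c) by exact: affine_continuous.
  apply: cvgB; apply: cvgM; try exact: cpdf; apply: cvgM; try exact: cvg_cst; try exact: cvg_id.
    by apply: (@continuous_comp _ _ _ (fun x => w * x + c)); [exact: ca|exact: continuous_cos].
  by apply: (@continuous_comp _ _ _ (fun x => w * x + c)); [exact: ca|exact: continuous_sin].
have iv : mu.-integrable setT (EFin \o v).
  have i1 : mu.-integrable setT (fun x => (w * cos (w * x + c) * pdf x)%:E).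
    apply: (@integrable_bounded_std_pdf _ `|w|).
      by apply: measurable_funM => //; exact: cos_affine_measurable.
    by move=> x; rewrite normrM ler_piMr// cos_max.
  have i2 : mu.-integrable setT (fun x => (x * sin (w * x + c) * pdf x)%:E).
    apply: integrable_moment_std_pdf; first exact: sin_affine_measurable.
    by move=> x; exact: sin_max.
  by have := integrableB measurableT i1 i2; apply: eq_integrable.
have lim1 := symmetric_exhaustion iv.
have ub x : `|u x| <= pdf x.
  by rewrite normrM (ger0_norm (normal_pdf_ge0 _ _ _)) ler_piMl ?normal_pdf_ge0// sin_max.
have lim0 : (fun n => \int[mu]_(x in `[- n%:R, n%:R]) v x) @ \oo --> (0 : R).
  have pdf0 : (fun n => 4 * normal_peak 1 * n.+1%:R^-1) @ \oo --> (0 : R).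
    by apply: cvg0Z; exact: cvg_harmonic.
  rewrite -cvg_shiftS; apply/norm_cvg0P.
  apply: (@squeeze_cvgr _ _ _ _ (cst 0) _ _ _ _ _ pdf0) => //; last exact: cvg_cst.
  apply: nearW => n; rewrite normr_ge0/=.
  have -> : \int[mu]_(x in `[- n.+1%:R, n.+1%:R]) v x = u n.+1%:R - u (- n.+1%:R).
    rewrite /Rintegral (@continuous_FTC2 _ v u)//.
    - by rewrite -subr_gt0 opprK addr_gt0 ?ltr0n.
    - exact: continuous_subspaceT.
    - split.
      + by move=> x _; have [] := du x.
      + by apply: cvg_at_right_filter; exact: cu.
      + by apply: cvg_at_left_filter; exact: cu.
    - by move=> x _; rewrite derive1E; apply: derive_val.
  apply: le_trans (ler_normB _ _) _.
  have pdfb (y : R) : `|y| = n.+1%:R -> `|u y| <= 2 * normal_peak 1 * n.+1%:R^-1.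
    move=> yn; apply: le_trans (ub y) _; rewrite std_pdfE.
    have -> : 2 * normal_peak 1 / n.+1%:R = normal_peak 1 * (2 / n.+1%:R) :> R by ring.
    rewrite ler_pM2l ?normal_peak_gt0 ?oner_neq0//.
    rewrite expRN -[y ^+ 2]real_normK ?num_real// yn.
    have n0 : 0 < (n.+1%:R : R) by rewrite ltr0n.
    have n1 : 1 <= (n.+1%:R : R) by rewrite ler1n.
    have h := expR_ge1Dx ((n.+1%:R : R) ^+ 2 / 2).
    rewrite -[leLHS]mul1r ler_pdivrMr ?expR_gt0// mulrAC ler_pdivlMr// mul1r.
    apply: (@le_trans _ _ (2 * (1 + (n.+1%:R : R) ^+ 2 / 2))); last by rewrite ler_pM2l.
    move: (n.+1%:R : R) n1 => z z1; nra.
  have h1 := pdfb _ (ger0_norm (ler0n R n.+1)).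
  have := pdfb (- n.+1%:R); rewrite normrN => /(_ (ger0_norm (ler0n R n.+1))) h2.
  by apply: le_trans (lerD h1 h2) _; rewrite le_eqVlt; apply/orP; left; apply/eqP; ring.
by rewrite -(cvg_lim (@Rhausdorff _) lim1) (cvg_lim (@Rhausdorff _) lim0).
Qed.

(** Differentiation under the integral produces x sin(w x + c), and Stein's identity returns to the
    cosine. *)
Lemma is_derive_gauss_trig w c : is_derive w 1 (gauss_trig^~ c) (- w * gauss_trig w c).
Proof.
pose F (v y : R) := cos (v * y + c) * pdf y.
have dF (v y : R) : is_derive v 1 (F^~ y) (- (y * sin (v * y + c) * pdf y)).
  by apply: is_derive_eq; rewrite /GRing.scale/=; ring.
have iF v : mu.-integrable setT (EFin \o F v).
  apply: (@integrable_bounded_std_pdf _ 1); first exact: cos_affine_measurable.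
  by move=> y; exact: cos_max.
have iS : mu.-integrable setT (fun x => (x * sin (w * x + c) * pdf x)%:E).
  apply: integrable_moment_std_pdf; first exact: sin_affine_measurable.
  by move=> x; exact: sin_max.
have iC : mu.-integrable setT (fun x => (w * (cos (w * x + c) * pdf x))%:E).
  have -> : (fun x => (w * (cos (w * x + c) * pdf x))%:E) = (fun x => (w%:E * (EFin \o F w) x)%E).
    by apply/funext => x.
  exact: integrableZl.
have w1 : w \in `]w - 1, w + 1[ by rewrite in_itv/= ltrBlDr ltrDl ltr01.
have G0 (y : R) : 0 <= `|y| * pdf y by rewrite mulr_ge0 ?normal_pdf_ge0.
have Gb (v y : R) : [set` `]w - 1, w + 1[] v -> setT y -> `|partial1of2 F v y| <= `|y| * pdf y.
  move=> _ _; rewrite partial1of2E; have [_ ->] := dF v y.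
  rewrite normrN !normrM (ger0_norm (normal_pdf_ge0 _ _ _)) ler_wpM2r ?normal_pdf_ge0//.
  by rewrite ler_piMr// sin_max.
have dFI (v y : R) : [set` `]w - 1, w + 1[] v -> setT y -> derivable (F^~ y) v 1.
  by move=> _ _; have [] := dF v y.
have h1 := derivable_under_integral measurableT w1 (fun v _ => iF v) dFI G0 integrable_id_std_pdf Gb.
have h2 := differentiation_under_integral measurableT w1 (fun v _ => iF v) dFI G0 integrable_id_std_pdf Gb.
apply: DeriveDef; first exact: h1.
rewrite -derive1E [LHS]h2.
have -> : \int[mu]_(y in setT) partial1of2 F^~ y w =
   \int[mu]_(y in setT) (- (y * sin (w * y + c) * pdf y)).
  by apply: eq_Rintegral => y _; rewrite partial1of2E; have [_ ->] := dF w y.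
have := integral_derivative_std_pdf w c.
rewrite RintegralB//; last first.
  by move: iC; apply: eq_integrable => // x _; rewrite mulrA.
move/eqP; rewrite subr_eq0 => /eqP e1.
have -> : \int[mu]_(y in setT) (- (y * sin (w * y + c) * pdf y)) =
    \int[mu]_(y in setT) (-1 * (y * sin (w * y + c) * pdf y)).
  by apply: eq_Rintegral => y _; rewrite mulN1r.
rewrite RintegralZl// -e1 mulN1r mulNr; congr (- _).
have -> : \int[mu]_(y in setT) (w * cos (w * y + c) * pdf y) =
    \int[mu]_(y in setT) (w * (cos (w * y + c) * pdf y)).
  by apply: eq_Rintegral => y _; rewrite mulrA.
by rewrite RintegralZl//; exact: iF.
Qed.

(** A solution of phi' = - w phi is a multiple of exp(- w^2 / 2); the value at 0 gives the
    factor. *)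
Lemma gauss_trigE w c : gauss_trig w c = cos c * expR (- (w ^+ 2 / 2)).
Proof.
pose F w := gauss_trig w c * expR (w ^+ 2 / 2).
have dF (v : R) : is_derive v 1 F 0.
  have h := is_derive_gauss_trig v c.
  by apply: is_derive_eq; rewrite /GRing.scale/=; field.
have := @is_derive_0_is_cst _ F w 0 dF.
rewrite /F expr0n mul0r expR0 mulr1 => h.
have <- : gauss_trig 0 c = cos c.
  rewrite /gauss_trig; under eq_Rintegral do rewrite mul0r add0r.
  rewrite RintegralZl//; last exact: integrable_normal_pdf.
  by rewrite /Rintegral integral_normal_pdf mulr1.
by rewrite -h expRN mulfK// gt_eqF// expR_gt0.
Qed.

Lemma std_normal_trig w c :
  (\int[normal_prob 0 1]_x (cos (w * x + c))%:E = (cos c * expR (- (w ^+ 2 / 2)))%:E)%E.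
Proof.
rewrite (@integral_std_normal _ 1); first last.
- by move=> x; exact: cos_max.
- exact: cos_affine_measurable.
rewrite -gauss_trigE /gauss_trig /Rintegral fineK//.
apply: integrable_fin_num => //; apply: (@integrable_bounded_std_pdf _ 1).
- exact: cos_affine_measurable.
- by move=> x; exact: cos_max.
Qed.

End GaussianCharacteristic.

Section Continuity.
Variable R : realType.

Lemma lipschitz_continuous (V W : normedModType R) (f : V -> W) (C : R) :
  (forall x y, `|f x - f y| <= C * `|x - y|) -> continuous f.
Proof.
move=> fC x; apply/cvgrPdist_le => e e0.
have C1 : 0 < `|C| + 1 by rewrite ltr_wpDl.
near=> y; apply: le_trans (fC x y) _.
apply: (@le_trans _ _ ((`|C| + 1) * `|x - y|)).
  by rewrite ler_wpM2r//; have := ler_norm C; lra.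
rewrite mulrC -ler_pdivlMr//.
by near: y; apply: cvgr_dist_le; [exact: cvg_id|rewrite divr_gt0].
Unshelve. all: by end_near. Qed.

Lemma continuous_lin (T : topologicalType) (a : R) (g h : T -> R) :
  continuous g -> continuous h -> continuous (fun x => a * g x + h x).
Proof.
move=> cg ch x; apply: cvgD; last exact: ch.
by apply: cvgM; [exact: cvg_cst|exact: cg].
Qed.

Lemma continuous_comp_real (T : topologicalType) (f : R -> R) (g : T -> R) :
  continuous f -> continuous g -> continuous (fun x => f (g x)).
Proof. by move=> cf cg x; apply: continuous_comp; [exact: cg|exact: cf]. Qed.

End Continuity.

Section MatrixNorm.
Variable R : realType.

Lemma mx_norm_ler m n (x : 'M[R]_(m, n)) (r : R) : 0 <= r ->
  (forall i j, `|x i j| <= r) -> `|x| <= r.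
Proof.
move=> r0 xr; rewrite [leLHS]/Num.Def.normr/= mx_normrE; apply/bigmax_leP; by split => // -[i j] _.
Qed.

Lemma mx_coord_le m n (x : 'M[R]_(m, n)) i j : `|x i j| <= `|x|.
Proof.
by rewrite [leRHS]/Num.Def.normr/= mx_normrE; apply/bigmax_geP; right; exists (i, j).
Qed.

Definition dot d (u x : 'rV[R]_d) : R := \sum_i u 0 i * x 0 i.

Lemma dotDl d (u v x : 'rV[R]_d) : dot (u + v) x = dot u x + dot v x.
Proof. by rewrite /dot -big_split/=; apply: eq_bigr => i _; rewrite mxE mulrDl. Qed.

Lemma dotNl d (u x : 'rV[R]_d) : dot (- u) x = - dot u x.
Proof. by rewrite /dot -sumrN; apply: eq_bigr => i _; rewrite mxE mulNr. Qed.

Lemma dotC d (u x : 'rV[R]_d) : dot u x = dot x u.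
Proof. by apply: eq_bigr => i _; rewrite mulrC. Qed.

Lemma dotE d (u x : 'rV[R]_d) : dot u x = (x *m u^T) 0 0.
Proof. by rewrite mxE; apply: eq_bigr => i _; rewrite mxE mulrC. Qed.

Lemma norm_dot_le d (u x : 'rV[R]_d) : `|dot u x| <= d%:R * `|u| * `|x|.
Proof.
apply: le_trans (ler_norm_sum _ _ _) _.
apply: (@le_trans _ _ (\sum_(i < d) `|u| * `|x|)).
  by apply: ler_sum => i _; rewrite normrM ler_pM// mx_coord_le.
by rewrite sumr_const card_ord -[leLHS]mulr_natl mulrA.
Qed.

Lemma dot_continuous d (u : 'rV[R]_d) : continuous (dot u).
Proof.
apply: (@lipschitz_continuous R 'rV[R]_d R^o _ (d%:R * `|u|)) => x y.
have -> : dot u x - dot u y = dot u (x - y).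
  by rewrite ![dot u _]dotC -dotNl -dotDl.
exact: norm_dot_le.
Qed.

End MatrixNorm.

Lemma bounded_integrable (R : realType) (disp : measure_display) (T : measurableType disp)
    (P : probability T R) (M : R) (g : T -> R) : measurable_fun setT g ->
  (forall x, `|g x| <= M) -> P.-integrable setT (fun x => (g x)%:E).
Proof.
move=> mg gM; have iM : P.-integrable setT (fun=> `|M|%:E).
  exact: finite_measure_integrable_cst.
apply: (le_integrable _ _ _ iM) => //; first exact/measurable_EFinP.
by move=> x _; rewrite !abse_EFin lee_fin normr_id (le_trans (gM x))// ler_norm.
Qed.

(** * Standard normal means in several dimensions *)

Section StandardNormal.
Variable R : realType.

Definition bounded_continuous d (g : 'rV[R]_d -> R) :=
  continuous g /\ exists M : R, forall x, `|g x| <= M.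

Lemma bounded_continuous_lin d (a : R) (g h : 'rV[R]_d -> R) :
  bounded_continuous g -> bounded_continuous h ->
  bounded_continuous (fun x => a * g x + h x).
Proof.
move=> [cg [M hM]] [ch [M' hM']]; split.
  exact: continuous_lin.
exists (`|a| * M + M') => x; apply: le_trans (ler_normD _ _) _.
by rewrite normrM lerD// ler_wpM2l.
Qed.

Lemma bounded_continuous_cst d (c : R) :
  bounded_continuous ((fun=> c) : 'rV[R]_d -> R).
Proof. by split; [exact: cst_continuous|exists `|c|]. Qed.

Lemma bounded_continuous_cos d (u : 'rV[R]_d) (c : R) :
  bounded_continuous (fun x => cos (dot u x + c)).
Proof.
split; last by exists 1 => x; exact: cos_max.
apply: continuous_comp_real; first exact: continuous_cos.
rewrite (_ : (fun x => _) = (fun x => 1 * dot u x + c)); last first.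
  by apply/funext => x; rewrite mul1r.
by apply: continuous_lin; [exact: dot_continuous|exact: cst_continuous].
Qed.

Definition slice d (g : 'rV[R]_d.+1 -> R) (x : R) (v : 'rV[R]_d) : R :=
  g (row_mx x%:M v).

Lemma row_mx_dist d (x y : R) (v w : 'rV[R]_d) :
  `|(row_mx x%:M v : 'rV[R]_(1 + d)) - row_mx y%:M w| <= `|x - y| + `|v - w|.
Proof.
rewrite opp_row_mx add_row_mx; apply: mx_norm_ler; first exact: addr_ge0.
move=> i j; case: (split_ordP j) => k ->.
  rewrite row_mxEl ord1 (ord1 k) !mxE eqxx !mulr1n.
  by rewrite -[leLHS]addr0 lerD.
rewrite row_mxEr; apply: le_trans (mx_coord_le _ _ _) _.
by rewrite -[leLHS]add0r lerD.
Qed.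

Lemma slice_continuous d (g : 'rV[R]_d.+1 -> R) x :
  continuous g -> continuous (slice g x).
Proof.
move=> cg v; apply: (@continuous_comp _ _ _ (fun v => row_mx x%:M v : 'rV[R]_d.+1) g); last exact: cg.
apply: (@lipschitz_continuous R 'rV[R]_d 'rV[R]_d.+1 _ 1) => y z; rewrite mul1r.
by apply: le_trans (row_mx_dist _ _ _ _) _; rewrite subrr normr0 add0r.
Qed.

Lemma slice_cvg d (g : 'rV[R]_d.+1 -> R) (u : nat -> R) x v : continuous g ->
  u @ \oo --> x -> (fun n => slice g (u n) v) @ \oo --> slice g x v.
Proof.
move=> cg ux; apply: (@continuous_cvg _ _ _ _ _ (fun n => row_mx (u n)%:M v : 'rV[R]_d.+1) g); first exact: cg.
apply: (@continuous_cvg _ _ _ _ _ u (fun x : R => row_mx x%:M v : 'rV[R]_d.+1)) => //.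
apply: (@lipschitz_continuous R R^o 'rV[R]_d.+1 _ 1) => y z; rewrite mul1r.
by apply: le_trans (row_mx_dist _ _ _ _) _; rewrite subrr normr0 addr0.
Qed.

Definition std_normal_mean d (g : 'rV[R]_d -> R) : R :=
  fine (std_normal_expectation (fun x => (g x)%:E)).

Lemma std_normal_meanS d (g : 'rV[R]_d.+1 -> R) :
  (forall x, std_normal_expectation (fun v => (slice g x v)%:E) \is a fin_num) ->
  (std_normal_expectation (fun x => (g x)%:E) =
  \int[normal_prob 0 1]_x (std_normal_mean (slice g x))%:E)%E.
Proof. by move=> h; apply: eq_integral => x _; rewrite fineK. Qed.

(** Proved together by induction on [d]: the iterated integral requires the inner mean to be
    measurable in the first coordinate, which follows from its continuity, hence from dominated
    convergence in dimension [d]. *)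
Record std_normal_facts d : Prop := {
  snf_fin : forall g : 'rV[R]_d -> R, bounded_continuous g ->
    std_normal_expectation (fun x => (g x)%:E) \is a fin_num ;
  snf_lin : forall (a : R) (g h : 'rV[R]_d -> R), bounded_continuous g ->
    bounded_continuous h ->
    std_normal_mean (fun x => a * g x + h x) = a * std_normal_mean g + std_normal_mean h ;
  snf_ge0 : forall g : 'rV[R]_d -> R, bounded_continuous g -> (forall x, 0 <= g x) ->
    0 <= std_normal_mean g ;
  snf_cst : forall c, std_normal_mean ((fun=> c) : 'rV[R]_d -> R) = c ;
  snf_dct : forall (gn : nat -> 'rV[R]_d -> R) g (M : R), (forall n, continuous (gn n)) ->
    continuous g -> (forall n x, `|gn n x| <= M) ->
    (forall x, (fun n => gn n x) @ \oo --> g x) ->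
    (fun n => std_normal_mean (gn n)) @ \oo --> std_normal_mean g }.

Lemma snf_le d (S : std_normal_facts d) (g h : 'rV[R]_d -> R) :
  bounded_continuous g -> bounded_continuous h -> (forall x, g x <= h x) ->
  std_normal_mean g <= std_normal_mean h.
Proof.
move=> bg bh gh; have := snf_ge0 S (bounded_continuous_lin (-1) bg bh).
rewrite (snf_lin S)// mulN1r addrC subr_ge0; apply=> x.
by rewrite mulN1r addrC subr_ge0.
Qed.

Lemma snf_norm_le d (S : std_normal_facts d) (g : 'rV[R]_d -> R) (M : R) :
  continuous g -> (forall x, `|g x| <= M) -> `|std_normal_mean g| <= M.
Proof.
move=> cg gM; have bg : bounded_continuous g by split => //; exists M.
have gM2 x : - M <= g x <= M by have := gM x; rewrite ler_norml.
rewrite ler_norml; apply/andP; split.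
  rewrite -[leLHS](snf_cst S); apply: snf_le => //; first exact: bounded_continuous_cst.
  by move=> x; have /andP[] := gM2 x.
rewrite -[leRHS](snf_cst S); apply: snf_le => //; first exact: bounded_continuous_cst.
by move=> x; have /andP[] := gM2 x.
Qed.

Lemma snf_dist_le d (S : std_normal_facts d) (g h k : 'rV[R]_d -> R) :
  bounded_continuous g -> bounded_continuous h -> bounded_continuous k ->
  (forall x, `|g x - h x| <= k x) ->
  `|std_normal_mean g - std_normal_mean h| <= std_normal_mean k.
Proof.
move=> bg bh bk ghk.
have e1 : std_normal_mean (fun x => -1 * h x + g x) = std_normal_mean g - std_normal_mean h.
  by rewrite (snf_lin S)// mulN1r addrC.
have e2 : std_normal_mean (fun x => -1 * k x + 0) = - std_normal_mean k.
  rewrite (snf_lin S) ?(snf_cst S) ?mulN1r ?addr0//; exact: bounded_continuous_cst.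
rewrite -e1 ler_norml -e2 !(snf_le S)//; try exact: bounded_continuous_lin.
- by move=> x; have := ghk x; rewrite ler_norml => /andP[_]; lra.
- exact: bounded_continuous_lin bk (bounded_continuous_cst _ _).
- by move=> x; have := ghk x; rewrite ler_norml => /andP[+ _]; lra.
Qed.

Section Step.
Variables (d : nat) (S : std_normal_facts d).

Let bc_slice (g : 'rV[R]_d.+1 -> R) : bounded_continuous g ->
  forall x, bounded_continuous (slice g x).
Proof.
by move=> [cg [M gM]] x; split; [exact: slice_continuous|exists M => v; exact: gM].
Qed.

Let slice_mean_continuous (g : 'rV[R]_d.+1 -> R) (M : R) :
  continuous g -> (forall x, `|g x| <= M) ->
  continuous (fun x => std_normal_mean (slice g x)).
Proof.
move=> cg gM x; apply/continuous_withinNx; apply/cvgr_dnbhsP => u [_ ux].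
apply: (snf_dct S (M := M)) => [n||n v|v].
- exact: slice_continuous.
- exact: slice_continuous.
- exact: gM.
- exact: slice_cvg.
Qed.

Let slice_mean_measurable (g : 'rV[R]_d.+1 -> R) (M : R) :
  continuous g -> (forall x, `|g x| <= M) ->
  measurable_fun setT (fun x => std_normal_mean (slice g x)).
Proof. by move=> cg gM; apply: continuous_measurable_fun; exact: slice_mean_continuous gM. Qed.

Let slice_mean_le (g : 'rV[R]_d.+1 -> R) (M : R) x :
  continuous g -> (forall x, `|g x| <= M) -> `|std_normal_mean (slice g x)| <= M.
Proof.
move=> cg gM; apply: snf_norm_le => //; first exact: slice_continuous.
by move=> v; exact: gM.
Qed.

Let slice_mean_integrable (g : 'rV[R]_d.+1 -> R) (M : R) :
  continuous g -> (forall x, `|g x| <= M) ->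
  (normal_prob (0 : R) 1).-integrable setT (fun x => (std_normal_mean (slice g x))%:E).
Proof.
move=> cg gM; have M0 : 0 <= M by apply: le_trans (gM 0).
apply: bounded_integrable; first exact: slice_mean_measurable gM.
by move=> x; exact: slice_mean_le gM.
Qed.

Let meanSE (g : 'rV[R]_d.+1 -> R) : bounded_continuous g ->
  (std_normal_expectation (fun x => (g x)%:E) =
  \int[normal_prob 0 1]_x (std_normal_mean (slice g x))%:E)%E.
Proof. by move=> bg; apply: std_normal_meanS => x; apply: (snf_fin S); exact: bc_slice. Qed.

Lemma std_normal_facts_step : std_normal_facts d.+1.
Proof.
have fin (g : 'rV[R]_d.+1 -> R) : bounded_continuous g ->
    std_normal_expectation (fun x => (g x)%:E) \is a fin_num.
  move=> bg; rewrite meanSE//; have [cg [M gM]] := bg.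
  by apply: integrable_fin_num => //; exact: slice_mean_integrable gM.
split => //.
- move=> a g h bg bh; have [cg [Mg gM]] := bg; have [ch [Mh hM]] := bh.
  have bgh := bounded_continuous_lin a bg bh.
  have ig := slice_mean_integrable cg gM; have ih := slice_mean_integrable ch hM.
  rewrite [in LHS]/std_normal_mean meanSE//.
  under eq_integral => x _.
    rewrite (_ : std_normal_mean _ = a * std_normal_mean (slice g x) + std_normal_mean (slice h x)).
      rewrite EFinD EFinM; over.
    by rewrite -(snf_lin S)//; exact: bc_slice.
  rewrite /= integralD//; last exact: integrableZl.
  rewrite integralZl// -!meanSE//.
  rewrite fineD ?fin_numM ?fin//.
  by rewrite fineM ?fin.
- move=> g bg g0; rewrite /std_normal_mean meanSE// fine_ge0// integral_ge0// => x _.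
  rewrite lee_fin; apply: (snf_ge0 S); first exact: bc_slice.
  by move=> v; exact: g0.
- move=> c; rewrite /std_normal_mean meanSE//; last exact: bounded_continuous_cst.
  under eq_integral => x _ do rewrite (snf_cst S).
  transitivity (fine (c%:E * normal_prob (0 : R) 1 setT)%E).
    by rewrite -integral_cst.
  by rewrite probability_setT mule1.
- move=> gn g M cgn cg gM gng.
  have M0 : 0 <= M by apply: le_trans (gM 0%N 0).
  have gM' x : `|g x| <= M.
    have h : (fun n => `|gn n x|) @ \oo --> `|g x| by apply: cvg_norm; exact: gng.
    rewrite -(cvg_lim (@Rhausdorff _) h); apply: limr_le; first by apply/cvg_ex; exists `|g x|.
    exact: nearW.
  have iM : (normal_prob (0 : R) 1).-integrable setT (fun=> M%:E).
    exact: finite_measure_integrable_cst.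
  have [] := @dominated_convergence _ _ _ (normal_prob (0 : R) 1) setT measurableT
    (fun n x => (std_normal_mean (slice (gn n) x))%:E)
    (fun x => (std_normal_mean (slice g x))%:E) (fun=> M%:E).
  + by move=> n; apply/measurable_EFinP; exact: slice_mean_measurable (gM n).
  + by apply/measurable_EFinP; exact: slice_mean_measurable gM'.
  + apply: aeW => x _; apply: cvg_EFin; first exact: nearW.
    apply: (snf_dct S (M := M)) => [n||n v|v].
    * exact: slice_continuous.
    * exact: slice_continuous.
    * exact: gM.
    * exact: gng.
  + exact: iM.
  + by apply: aeW => x n _; rewrite abse_EFin lee_fin slice_mean_le.
  move=> _ _ h; apply: fine_cvg; rewrite fineK; last by apply: fin; split => //; exists M.
  rewrite meanSE; last by split => //; exists M.
  rewrite (_ : (fun n => _) = [sequence (\int[normal_prob 0 1]_x (std_normal_mean (slice (gn n) x))%:E)%E]_n)//.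
  by apply/funext => n; rewrite meanSE//; split => //; exists M.
Qed.

End Step.

Lemma std_normal_factsP d : std_normal_facts d.
Proof.
elim: d => [|d IH]; last exact: std_normal_facts_step.
split => // [|gn g M _ _ _ h].
  by move=> g bg g0; exact: g0.
exact: h.
Qed.

(** The phase absorbs the first coordinate: the inner mean is the same quantity in one dimension
    less, with phase u_0 x + c. *)
Lemma std_normal_mean_trig d (u : 'rV[R]_d) (c : R) :
  std_normal_mean (fun z => cos (dot u z + c)) = cos c * expR (- (dot u u / 2)).
Proof.
elim: d u c => [|d IH] u c.
  by rewrite /std_normal_mean /= /dot !big_ord0 add0r mul0r oppr0 expR0 mulr1.
pose u0 := u 0 0; pose u' : 'rV[R]_d := rsubmx (u : 'rV[R]_(1 + d)).
have dotS (z : 'rV[R]_d) (x : R) : dot u (row_mx x%:M z : 'rV[R]_(1 + d)) = u0 * x + dot u' z.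
  rewrite /dot big_ord_recl; congr (_ * _ + _).
    have -> : ord0 = lshift d ord0 :> 'I_(1 + d) by apply: val_inj.
    by apply: etrans (row_mxEl _ _ _ _) _; rewrite mxE eqxx mulr1n.
  apply: eq_bigr => i _.
  have -> : lift ord0 i = rshift 1 i :> 'I_(1 + d) by apply: val_inj.
  by congr (_ * _); [rewrite mxE|exact: row_mxEr].
have dotuu : dot u u = u0 ^+ 2 + dot u' u'.
  rewrite /dot big_ord_recl expr2; congr (_ + _); apply: eq_bigr => i _; rewrite !mxE.
  by have -> : rshift 1 i = lift ord0 i :> 'I_(1 + d) by apply: val_inj.
have bc := bounded_continuous_cos u c.
rewrite /std_normal_mean std_normal_meanS; last first.
  move=> x; apply: (snf_fin (std_normal_factsP d)); case: bc => cg [M gM].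
  by split; [exact: slice_continuous|exists M => v; exact: gM].
under eq_integral => x _.
  rewrite (_ : std_normal_mean _ = expR (- (dot u' u' / 2)) * cos (u0 * x + c)).
    rewrite EFinM; over.
  rewrite [RHS]mulrC -IH; congr std_normal_mean; apply/funext => z.
  by rewrite /slice dotS -addrA addrCA.
rewrite integralZl//=; last first.
  apply: (@bounded_integrable _ _ _ _ 1); first exact: cos_affine_measurable.
  by move=> x; exact: cos_max.
rewrite std_normal_trig -EFinM/= dotuu mulrDl opprD expRD.
by move: (expR (- (dot u' u' / 2))) (expR _) (cos c) => p q r; ring.
Qed.

End StandardNormal.

(** * Approximation by trigonometric polynomials *)

Section BernsteinWalk.
Variables (R : realType) (d : nat).
Implicit Types (t : 'I_d -> R) (k : 'I_d -> nat) (s : seq 'I_d) (F G : ('I_d -> nat) -> R).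

Definition bump k (j : 'I_d) : 'I_d -> nat := fun i => (k i + (i == j))%N.

(* The mean of [F] at the end of a walk on [nat ^ d] started from [k], which
   at each step [j] of [s] moves in direction [j] with probability [t j]. *)
Fixpoint walk t s F k : R :=
  if s is j :: s' then t j * walk t s' F (bump k j) + (1 - t j) * walk t s' F k
  else F k.

Lemma walkD t s F G k : walk t s (fun k => F k + G k) k = walk t s F k + walk t s G k.
Proof. by elim: s k => //= j s IH k; rewrite !IH; ring. Qed.

Lemma walkZ t s (c : R) F k : walk t s (fun k => c * F k) k = c * walk t s F k.
Proof. by elim: s k => //= j s IH k; rewrite !IH; ring. Qed.

Lemma walk_cst t s (c : R) k : walk t s (fun=> c) k = c.
Proof. by elim: s k => //= j s IH k; rewrite !IH; ring. Qed.

Lemma walk_sum t s (I : Type) (r : seq I) (F : I -> ('I_d -> nat) -> R) k :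
  walk t s (fun k => \sum_(i <- r) F i k) k = \sum_(i <- r) walk t s (F i) k.
Proof.
elim: r => [|i r IH].
  by rewrite big_nil -[RHS](walk_cst t s 0 k); congr walk; apply/funext => x; rewrite big_nil.
rewrite big_cons -IH -walkD; congr walk; apply/funext => x; by rewrite big_cons.
Qed.

Lemma ler_walk t s F G k : (forall j, 0 <= t j <= 1) -> (forall k, F k <= G k) ->
  walk t s F k <= walk t s G k.
Proof.
move=> t01 FG; elim: s k => //= j s IH k; have /andP[t0 t1] := t01 j.
by apply: lerD; rewrite ler_wpM2l// subr_ge0.
Qed.

Lemma norm_walk_le t s F (M : R) k : (forall j, 0 <= t j <= 1) -> (forall k, `|F k| <= M) ->
  `|walk t s F k| <= M.
Proof.
move=> t01 FM; rewrite ler_norml -[X in X <= _ <= _](walk_cst t s _ k) -[X in _ <= _ <= X](walk_cst t s _ k).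
by rewrite !ler_walk// => x; have := FM x; rewrite ler_norml => /andP[].
Qed.

Lemma ler_norm_walk t s F k : (forall j, 0 <= t j <= 1) ->
  `|walk t s F k| <= walk t s (fun k => `|F k|) k.
Proof.
move=> t01; rewrite ler_norml; apply/andP; split; last first.
  by apply: ler_walk => // x; exact: ler_norm.
have := @ler_walk t s (fun k => -1 * `|F k|) F k t01; rewrite walkZ mulN1r; apply=> x.
by rewrite mulN1r lerNl -normrN ler_norm.
Qed.

(** The centre [a] is arbitrary because the starting point moves during the induction. *)
Lemma walk_sq t s i (a : R) k : walk t s (fun k => ((k i)%:R - a) ^+ 2) k =
  ((k i)%:R + (count_mem i s)%:R * t i - a) ^+ 2 + (count_mem i s)%:R * (t i * (1 - t i)).
Proof.
elim: s k => [|j s IH] k /=; first by ring.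
rewrite !IH /bump; have [->|ij] := eqVneq i j.
  have -> : (k j + true)%N = (k j).+1 by rewrite addn1.
  have -> : (true + count_mem j s)%N = (count_mem j s).+1 by [].
  by rewrite -!natr1; ring.
have -> : (k i + false)%N = k i by rewrite addn0.
have -> : (false + count_mem i s)%N = count_mem i s by [].
by ring.
Qed.

Definition all_directions N : seq 'I_d := flatten (nseq N (enum 'I_d)).

Lemma count_all_directions N i : count_mem i (all_directions N) = N.
Proof.
elim: N => //= N IH; rewrite /all_directions/= count_cat -/(all_directions N) IH.
by rewrite count_uniq_mem ?enum_uniq// mem_enum.
Qed.

Lemma walk_variance t N i : (0 < N)%N -> 0 <= t i <= 1 ->
  walk t (all_directions N) (fun k => ((k i)%:R / N%:R - t i) ^+ 2) (fun=> 0%N) <= N%:R^-1.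
Proof.
move=> N0 /andP[t0 t1]; have n0 : 0 < (N%:R : R) by rewrite ltr0n.
have -> : (fun k : 'I_d -> nat => ((k i)%:R / N%:R - t i) ^+ 2) =
    (fun k => (N%:R^-1) ^+ 2 * ((k i)%:R - N%:R * t i) ^+ 2).
  by apply/funext => k; field; exact: lt0r_neq0.
rewrite walkZ walk_sq count_all_directions add0r subrr expr0n add0r.
have -> : N%:R^-1 ^+ 2 * (N%:R * (t i * (1 - t i))) = N%:R^-1 * (t i * (1 - t i)).
  by field; exact: lt0r_neq0.
by rewrite ler_piMr ?invr_ge0 ?ltW//; nra.
Qed.

End BernsteinWalk.

Section TrigonometricApproximation.
Variables (R : realType) (d : nat).
Implicit Types (x y : 'rV[R]_d).

(** Cosines with a phase also produce sines and constants, and the product formula keeps their span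
    stable under products, so real functions suffice. *)
Inductive trig : ('rV[R]_d -> R) -> Prop :=
| TrigCos u c : trig (fun x => cos (dot u x + c))
| TrigLin (a : R) g h : trig g -> trig h -> trig (fun x => a * g x + h x).

Lemma trig_cst (c : R) : trig (fun=> c).
Proof.
have t1 : trig (fun=> 1).
  have := TrigCos 0 0; congr trig; apply/funext => x.
  by rewrite /dot big1 ?addr0 ?cos0// => i _; rewrite mxE mul0r.
have := TrigLin (c - 1) t1 t1; congr trig; apply/funext => x; ring.
Qed.

Lemma trigD g h : trig g -> trig h -> trig (fun x => g x + h x).
Proof. by move=> tg th; have := TrigLin 1 tg th; congr trig; apply/funext => x; ring. Qed.

Lemma trigZ (a : R) g : trig g -> trig (fun x => a * g x).
Proof. by move=> tg; have := TrigLin a tg (trig_cst 0); congr trig; apply/funext => x; ring. Qed.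

Lemma trig_mul_cos g u c : trig g -> trig (fun x => g x * cos (dot u x + c)).
Proof.
elim=> [v e|a g1 g2 _ t1 _ t2].
  have := trigZ (1 / 2) (trigD (TrigCos (v + u) (e + c)) (TrigCos (v - u) (e - c))).
  congr trig; apply/funext => x; rewrite !dotDl dotNl.
  have -> : dot v x + dot u x + (e + c) = (dot v x + e) + (dot u x + c) by ring.
  have -> : dot v x - dot u x + (e - c) = (dot v x + e) - (dot u x + c) by ring.
  by rewrite cosD cosB; field.
by have := TrigLin a t1 t2; congr trig; apply/funext => x; ring.
Qed.

Lemma trig_mul_sin g (i : 'I_d) (m : R) : trig g -> trig (fun x => g x * sin (x 0 i / m)).
Proof.
move=> /(trig_mul_cos (m^-1 *: delta_mx 0 i) (- (pi / 2))); congr trig; apply/funext => x.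
rewrite cosBpihalf; congr (_ * sin _).
rewrite /dot (bigD1 i)//= big1 ?addr0; first by rewrite !mxE !eqxx mulr1 mulrC.
by move=> j ji; rewrite !mxE eqxx (negPf ji) mulr0 mul0r.
Qed.

Lemma trig_bounded_continuous g : trig g -> bounded_continuous g.
Proof.
elim=> [u c|a g1 g2 _ b1 _ b2]; first exact: bounded_continuous_cos.
exact: bounded_continuous_lin.
Qed.

(** The success probability fed to the Bernstein walk: a trigonometric function of x_i with values
    in [0, 1], injective on a given box when [m] is large. *)
Definition unit_angle (m : R) x (i : 'I_d) : R := (1 + sin (x 0 i / m)) / 2.

Lemma unit_angle_itv m x i : 0 <= unit_angle m x i <= 1.
Proof.
rewrite /unit_angle; have := sin_geN1 (x 0 i / m); have := sin_le1 (x 0 i / m).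
by move=> h1 h2; apply/andP; split; lra.
Qed.

Lemma trig_walk m s (F : ('I_d -> nat) -> R) k :
  trig (fun x => walk (unit_angle m x) s F k).
Proof.
elim: s k => [|j s IH] k /=; first exact: trig_cst.
have h g : trig g -> trig (fun x => unit_angle m x j * g x).
  move=> tg; have := trigZ (1 / 2) (trigD tg (trig_mul_sin j m tg)).
  by congr trig; apply/funext => x; rewrite /unit_angle; field.
have := trigD (h _ (IH (bump k j))) (TrigLin (-1) (h _ (IH k)) (IH k)).
by congr trig; apply/funext => x; ring.
Qed.

(* On [-1/2, 1/2] the sine has slope at least [cos 1], so a value of the sine
   close to [sin a] is taken at a point close to [a]. *)
Lemma sin_slope (x y : R) : -1 <= x -> x <= y -> y <= 1 ->
  cos 1 * (y - x) <= sin y - sin x.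
Proof.
move=> x1 xy y1.
have [c] := MVT_segment xy (fun z _ => is_derive_sin z) (continuous_subspaceT (@continuous_sin R)).
rewrite in_itv/= => /andP[xc cy] ->; rewrite ler_wpM2r ?subr_ge0//.
have c1 : `|c| <= 1 by rewrite ler_norml; apply/andP; split; lra.
have pi1 := pi_ge2 R.
rewrite -(cos_norm c) leNgt ltr_cos ?in_itv/= ?normr_ge0 ?ler01//=.
- by rewrite -leNgt.
- lra.
- lra.
Qed.

(** If asin v were at distance [e] or more from [a], monotonicity of the sine and [sin_slope]
    between [a] and a - e or a + e would separate v from sin a by e cos 1. *)
Lemma asin_near (a v e : R) : `|a| <= 1 / 2 -> -1 <= v <= 1 -> 0 < e <= 1 / 2 ->
  `|v - sin a| < e * cos 1 -> `|asin v - a| < e.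
Proof.
move=> a1 v1 /andP[e0 e1]; have [/andP[b1 b2] bE] := asin_def v1.
move: a1; rewrite ler_norml => /andP[a1 a2].
have p1 := pihalf_ge1 R.
have sin_le (x y : R) : - (pi / 2) <= x <= pi / 2 -> - (pi / 2) <= y <= pi / 2 ->
    x <= y -> sin x <= sin y.
  by move=> hx hy xy; rewrite leNgt ltr_sin ?in_itv// -leNgt.
rewrite !ltr_norml => /andP[h1 h2]; apply/andP; split.
  rewrite ltNge; apply/negP => h; have s1 := @sin_slope (a - e) a.
  have s2 := sin_le (asin v) (a - e).
  rewrite bE in s2; have : v <= sin (a - e).
    by apply: s2; [rewrite b1|apply/andP; split; lra|lra].
  have : cos 1 * (a - (a - e)) <= sin a - sin (a - e) by apply: s1; lra.
  have -> : a - (a - e) = e by ring.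
  move: (sin a) (sin (a - e)) h1 => p q h1; lra.
rewrite ltNge; apply/negP => h; have s1 := @sin_slope a (a + e).
have s2 := sin_le (a + e) (asin v).
rewrite bE in s2; have : sin (a + e) <= v.
  by apply: s2; [apply/andP; split; lra|rewrite b1|lra].
have : cos 1 * (a + e - a) <= sin (a + e) - sin a by apply: s1; lra.
have -> : a + e - a = e by ring.
move: (sin a) (sin (a + e)) h2 => p q h2'; lra.
Qed.

(** Nodes are defined for every [k], even those the walk cannot reach; clipping keeps the argument
    of [asin] in its domain. *)
Definition clip (v : R) : R := if v < -1 then -1 else if 1 < v then 1 else v.

Lemma clip_itv v : -1 <= clip v <= 1.
Proof. by rewrite /clip; case: ltP => h1; [|case: ltP => h2]; apply/andP; split; lra. Qed.

Lemma clip_near (v s e : R) : -1 <= s <= 1 -> `|v - s| < e -> `|clip v - s| < e.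
Proof.
move=> /andP[s1 s2]; rewrite !ltr_norml => /andP[h1 h2].
rewrite /clip; have [h3|h3] := ltP v (-1); first by apply/andP; split; lra.
by have [h4|h4] := ltP 1 v; apply/andP; split; lra.
Qed.

(** Only [x] is confined to the ball: a node of the approximation may fall outside. *)
Lemma uniform_near (K : R) (g : 'rV[R]_d -> R) (e : R) : continuous g -> 0 < e ->
  exists2 r : R, 0 < r & forall x y, `|x| <= K -> `|y - x| <= r -> `|g y - g x| <= e.
Proof.
move=> cg e0.
have cK : compact [set x : 'rV[R]_d | `|x| <= K].
  apply: bounded_closed_compact.
    exists K; split; first exact: num_real.
    by move=> M KM x /= /le_trans; apply; exact: ltW.
  by apply: (@closed_comp _ _ _ [set y : R | y <= K]); [move=> x _; exact: norm_continuous|exact: closed_le].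
have /compact_near_coveringP := cK.
move=> /(_ R (nbhs (0 : R)^'+) (fun r x => forall y, `|y - x| <= r -> `|g y - g x| <= e) _).
case.
  move=> x xK; have /cvgrPdist_lt/(_ (e / 2)) := cg x.
  rewrite divr_gt0// => /(_ isT) /nbhs_ballP[r /= r0 hr].
  have r2 : 0 < r / 2 by rewrite divr_gt0.
  exists (ball x (r / 2), [set s | s < r / 2]) => /=.
    by split; [exact: nbhsx_ballx|exact: nbhs_right_lt].
  move=> [x' s] /= [bx sr] y ys.
  have bx' : `|x - x'| < r / 2 by move: bx; rewrite -ball_normE.
  have h1 : `|g x - g x'| < e / 2.
    by apply: (hr x'); rewrite -ball_normE /ball_/=; lra.
  have h2 : `|g x - g y| < e / 2.
    apply: (hr y); rewrite -ball_normE /ball_/=.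
    have -> : x - y = (x - x') - (y - x') by rewrite opprB addrA subrK.
    by apply: le_lt_trans (ler_normB _ _) _; lra.
  have -> : g y - g x' = (g x - g x') - (g x - g y) by ring.
  by apply: le_trans (ler_normB _ _) _; lra.
move=> r0 /= r00 hr; exists (r0 / 2); first by rewrite divr_gt0.
move=> x y xK yx; apply: (hr (r0 / 2) _ _ x xK) => //=.
- by rewrite sub0r normrN gtr0_norm ?divr_gt0//; lra.
- by rewrite divr_gt0.
Qed.

(** The approximation is an average of values of [g], hence bounded by [M] on the whole space; this
    controls it where it does not approximate. *)
Lemma trig_approx (K : R) (g : 'rV[R]_d -> R) (M e : R) : continuous g ->
  (forall x, `|g x| <= M) -> 0 < e ->
  exists T : 'rV[R]_d -> R, [/\ trig T, forall x, `|T x| <= M &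
    forall x, `|x| <= K -> `|T x - g x| <= e].
Proof.
move=> cg gM e0.
pose K1 : R := Num.max K 1.
have K1_gt0 : 0 < K1 by rewrite lt_max ltr01 orbT.
have e2 : 0 < e / 2 by lra.
have [r r0 hr] := uniform_near K1 cg e2.
(* On the box, x_i / m then lies in [-1/2, 1/2], as [asin_near] requires. *)
pose m : R := 2 * K1; have m0 : 0 < m by rewrite mulr_gt0.
pose eta : R := Num.min (r / m) (1 / 2).
have eta0 : 0 < eta <= 1 / 2.
  by rewrite lt_min ge_min lexx orbT divr_gt0//= andbT; lra.
have /andP[eta1 eta2] := eta0.
(* Frequencies within [del] of [t] put the sines within eta cos 1 of each other, and the node within
   m eta <= r of x. *)
pose del : R := eta * cos 1 / 2.
have del0 : 0 < del by rewrite divr_gt0// mulr_gt0// cos1_gt0.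
have M0 : 0 <= M by apply: le_trans (gM 0).
(* Chebyshev's inequality in each of the d coordinates, with variance at most 1 / N. *)
have [N N0 hN] : exists2 N, (0 < N)%N & 2 * M * d%:R / del ^+ 2 <= e / 2 * N%:R.
  set B := 2 * M * d%:R / del ^+ 2.
  have B0 : 0 <= B / (e / 2).
    by apply: divr_ge0; [apply: divr_ge0; [rewrite !mulr_ge0|exact: sqr_ge0]|exact: ltW].
  exists (Num.truncn (B / (e / 2))).+1 => //.
  rewrite mulrC -ler_pdivrMr//; apply: ltW.
  by have /andP[] := truncn_itv B0.
have n0 : 0 < (N%:R : R) by rewrite ltr0n.

(* The point whose [unit_angle] is given by the frequencies k / N. *)
pose node (k : 'I_d -> nat) : 'rV[R]_d := \row_i (m * asin (clip (2 * ((k i)%:R / N%:R) - 1))).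
exists (fun x => walk (unit_angle m x) (all_directions d N) (fun k => g (node k)) (fun=> 0%N)).
have t01 x j : 0 <= unit_angle m x j <= 1 by exact: unit_angle_itv.
split=> [|x|x xK]; first exact: trig_walk.
  by apply: norm_walk_le => // k; exact: gM.
move: {t01}(t01 x); set t := unit_angle m x => t01.
rewrite -(walk_cst t (all_directions d N) (g x) (fun=> 0%N)).
rewrite -mulN1r -walkZ -walkD.
have pt k : `|g (node k) + -1 * g x| <=
    e / 2 + \sum_(i <- enum 'I_d) 2 * M / del ^+ 2 * ((k i)%:R / N%:R - t i) ^+ 2.
  have s0 (i : 'I_d) : 0 <= 2 * M / del ^+ 2 * ((k i)%:R / N%:R - t i) ^+ 2.
    apply: mulr_ge0; last exact: sqr_ge0.
    by apply: divr_ge0; [exact: mulr_ge0|exact: sqr_ge0].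
  rewrite mulN1r; have [/forallP near|] := boolP [forall i, `|(k i)%:R / N%:R - t i| < del].
    apply: (@le_trans _ _ (e / 2)); last by rewrite lerDl sumr_ge0.
    apply: hr; first by apply: le_trans xK _; rewrite le_max lexx.
    apply: mx_norm_ler; first exact: ltW.
    move=> i0 i; rewrite ord1 !mxE.
    have -> : m * asin (clip (2 * ((k i)%:R / N%:R) - 1)) - x 0 i =
        m * (asin (clip (2 * ((k i)%:R / N%:R) - 1)) - x 0 i / m).
      by field; exact: lt0r_neq0.
    rewrite normrM gtr0_norm// mulrC -ler_pdivlMr//.
    apply: (@le_trans _ _ eta); last by rewrite ge_min lexx.
    apply/ltW/asin_near => //.
    - rewrite normrM normfV (gtr0_norm m0) ler_pdivrMr// /m mulrA divfK//.
        rewrite mul1r; apply: le_trans (mx_coord_le _ _ _) _.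
        by apply: le_trans xK _; rewrite le_max lexx.
    - exact: clip_itv.
    - apply: clip_near; first by rewrite sin_geN1 sin_le1.
      have := near i; rewrite /t /unit_angle /del.
      move: (sin _) (_%:R / _) => s q.
      by rewrite !ltr_norml => /andP[h1 h2]; apply/andP; split; lra.
  rewrite negb_forall => /existsP[i]; rewrite -leNgt => hi.
  apply: (@le_trans _ _ (2 * M)).
    by apply: le_trans (ler_normB _ _) _; have := gM (node k); have := gM x; lra.
  rewrite -[leLHS]add0r; apply: lerD; first exact: ltW.
  rewrite (bigD1_seq i) ?enum_uniq ?mem_enum//=.
  apply: (@le_trans _ _ (2 * M / del ^+ 2 * ((k i)%:R / N%:R - t i) ^+ 2)); last first.
    by rewrite lerDl sumr_ge0.
  rewrite mulrAC ler_pdivlMr ?exprn_gt0// ler_wpM2l ?mulr_ge0//.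
  by rewrite -[X in _ <= X](real_normK (num_real _)) lerXn2r ?nnegrE// ltW.
have b1 := @ler_walk _ _ t (all_directions d N) _ _ (fun=> 0%N) t01 pt.
apply: le_trans (ler_norm_walk _ _ _ t01) _; apply: le_trans b1 _.
rewrite walkD walk_cst walk_sum.
have : \sum_(i <- enum 'I_d) walk t (all_directions d N)
   (fun k => 2 * M / del ^+ 2 * ((k i)%:R / N%:R - t i) ^+ 2) (fun=> 0%N) <= e / 2.
  apply: (@le_trans _ _ (\sum_(i <- enum 'I_d) 2 * M / del ^+ 2 * N%:R^-1)).
    apply: ler_sum => i _; rewrite walkZ ler_wpM2l//.
      by apply: divr_ge0; [exact: mulr_ge0|exact: sqr_ge0].
    exact: walk_variance.
  rewrite big_const_seq count_predT size_enum_ord iter_addr_0.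
  rewrite -[leLHS]mulr_natr mulrAC ler_pdivrMr//; apply: le_trans hN.
  by rewrite mulrAC.
lra.
Qed.

End TrigonometricApproximation.

(** * Convergence in law from characteristic functions *)

Section Levy.
Variables (R : realType) (disp : measure_display) (T : measurableType disp).
Variables (P : probability T R) (d : nat).

Lemma trig_measurable (Y : T -> 'rV[R]_d) g :
  (forall i, measurable_fun setT (fun w => Y w 0 i)) -> trig g ->
  measurable_fun setT (fun w => g (Y w)).
Proof.
move=> mY; elim=> [u c|a g1 g2 _ m1 _ m2].
  apply: (@measurableT_comp _ _ _ _ _ _ cos _ (fun w => dot u (Y w) + c)).
    by apply: continuous_measurable_fun; exact: continuous_cos.
  apply: measurable_funD => //; apply: measurable_sum => i.
  by apply: measurable_funM => //; exact: mY.
by apply: measurable_funD => //; exact: measurable_funM.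
Qed.

(** Measurability is assumed coordinatewise. It passes to trigonometric polynomials, and then to [g]
    as a pointwise limit of approximations on growing boxes. *)
Lemma continuous_comp_measurable (Y : T -> 'rV[R]_d) g :
  (forall i, measurable_fun setT (fun w => Y w 0 i)) -> bounded_continuous g ->
  measurable_fun setT (fun w => g (Y w)).
Proof.
move=> mY [cg [M gM]].
have /choice[t ht] : forall n : nat, exists t : 'rV[R]_d -> R,
    [/\ trig t, forall x, `|t x| <= M & forall x, `|x| <= n%:R -> `|t x - g x| <= n.+1%:R^-1].
  by move=> n; apply: trig_approx => //; rewrite invr_gt0.
apply: (@measurable_fun_cvg _ _ _ setT (fun n w => t n (Y w))).
  by move=> n; apply: trig_measurable => //; have [] := ht n.
move=> w _; apply/cvgrPdist_le => e e0.
have h0 := @cvg_harmonic R; have /cvgrPdist_le/(_ _ e0) h := h0.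
near=> n; have [_ _ /(_ (Y w)) tn] := ht n; rewrite distrC.
apply: (le_trans (tn _)); first by near: n; exact: nbhs_infty_ger.
have : `|0 - n.+1%:R^-1| <= e by near: n.
by rewrite sub0r normrN ger0_norm.
Unshelve. all: by end_near. Qed.

Lemma norm_continuous_rV (g : 'rV[R]_d -> R) : continuous g -> continuous (fun x => `|g x|).
Proof. by apply: continuous_comp_real; exact: norm_continuous. Qed.

Lemma norm_ge_measurable (Y : T -> 'rV[R]_d) (x : 'rV[R]_d) (K : R) :
  (forall i, measurable_fun setT (fun w => Y w 0 i)) ->
  measurable [set w | K <= `|Y w - x|].
Proof.
move=> mY; have [K0|K0] := leP K 0.
  rewrite (_ : [set _ | _] = setT)//; apply/seteqP; split => // w _ /=.
  exact: le_trans K0 _.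
rewrite (_ : [set _ | _] = \bigcup_(i in [set: 'I_d]) [set w | K <= `|Y w 0 i - x 0 i|]).
  apply: fin_bigcup_measurable => // i _.
  have m : measurable_fun setT (fun w => `|Y w 0 i - x 0 i|).
    by apply: measurableT_comp => //; apply: measurable_funB.
  have := m measurableT _ (measurable_itv `[K, +oo[); rewrite setTI.
  by congr measurable; apply/seteqP; split => w /=; rewrite in_itv/= andbT.
apply/seteqP; split => w /=; last first.
  move=> [i _ /=] /le_trans; apply.
  by have := mx_coord_le (Y w - x) 0 i; rewrite !mxE.
move=> KY; have [|[i j] hij] := @mx_norm_neq0 _ _ _ (Y w - x).
  by rewrite gt_eqF// (lt_le_trans K0).
by exists j => //=; move: KY; rewrite [X in _ <= X -> _]hij/= (ord1 i) !mxE.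
Qed.

Lemma Rintegral_dist_le (g h : T -> R) (s B : R) (N : set T) :
  P.-integrable setT (EFin \o g) -> P.-integrable setT (EFin \o h) ->
  measurable N -> 0 <= B -> 0 <= s -> (forall w, ~ N w -> `|g w - h w| <= s) ->
  (forall w, `|g w - h w| <= B) ->
  `|\int[P]_(w in setT) g w - \int[P]_(w in setT) h w| <= s + B * fine (P N).
Proof.
move=> ig ih mN B0 s0 gs gB; rewrite -RintegralB//.
have igh : P.-integrable setT (EFin \o (fun w => g w - h w)).
  by have := integrableB measurableT ig ih; apply: eq_integrable.
have i1 : P.-integrable setT (EFin \o (fun w => (\1_N w : R))).
  apply: (@bounded_integrable _ _ _ _ 1); first exact: measurable_indic.
  by move=> w; rewrite indicE; case: (_ \in _); rewrite ?normr1 ?normr0.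
have i2 : P.-integrable setT (EFin \o (fun w => B * (\1_N w : R))).
  by have := integrableZl measurableT B i1; apply: eq_integrable.
have i3 : P.-integrable setT (EFin \o (fun=> s)) by exact: finite_measure_integrable_cst.
have i4 : P.-integrable setT (EFin \o (fun w => s + B * (\1_N w : R))).
  by have := integrableD measurableT i3 i2; apply: eq_integrable.
apply: le_trans (le_normr_Rintegral measurableT igh) _.
have -> : s + B * fine (P N) = \int[P]_(w in setT) (s + B * (\1_N w : R)).
  rewrite RintegralD// RintegralZl// Rintegral_cst//.
  have -> : fine (P setT) = 1 by rewrite probability_setT.
  by rewrite mulr1 /Rintegral integral_indic// setIT.
apply: le_Rintegral => //.
  by have := integrable_abse igh; apply: eq_integrable.
move=> w _; rewrite indicE; have [wN|wN] := boolP (w \in N).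
  by rewrite mulr1; apply: le_trans (gB w) _; rewrite lerDr.
by rewrite mulr0 addr0; apply: gs => /mem_set; apply/negP.
Qed.

Section NormalLimit.
Variables (X : nat -> T -> 'rV[R]_d) (L : 'M[R]_d).
Hypothesis mX : forall n i, measurable_fun setT (fun w => X n w 0 i).
Hypothesis X_tight : forall e : R, 0 < e -> exists K : R,
  \forall n \near \oo, (P [set w | (K <= `|X n w|)%R] <= e%:E)%E.
Hypothesis X_chf : forall (u : 'rV[R]_d) (c : R),
  (fun n => \int[P]_(w in setT) cos (dot u (X n w) + c)) @ \oo -->
  std_normal_mean (fun z => cos (dot u (z *m L) + c)).

Let mul_continuous : continuous (fun z : 'rV[R]_d => z *m L).
Proof.
apply: (@lipschitz_continuous R 'rV[R]_d 'rV[R]_d _ (d%:R * `|L|)) => x y.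
rewrite -mulmxBl; apply: mx_norm_ler => [|i j]; first by rewrite !mulr_ge0.
rewrite mxE; apply: le_trans (ler_norm_sum _ _ _) _.
apply: (@le_trans _ _ (\sum_(k < d) `|L| * `|x - y|)).
  by apply: ler_sum => k _; rewrite normrM mulrC ler_pM// mx_coord_le.
by rewrite sumr_const card_ord -[leLHS]mulr_natl mulrA.
Qed.

Let bcL g : bounded_continuous g -> bounded_continuous (fun z : 'rV[R]_d => g (z *m L)).
Proof.
move=> [cg [M gM]]; split; last by exists M.
by move=> z; apply: (@continuous_comp _ _ _ (fun z : 'rV[R]_d => z *m L) g); [exact: mul_continuous|exact: cg].
Qed.

Let iX g : bounded_continuous g -> forall n, P.-integrable setT (fun w => (g (X n w))%:E).
Proof.
move=> bg n; have [cg [M gM]] := bg.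
by apply: (@bounded_integrable _ _ _ _ M) => //; exact: continuous_comp_measurable.
Qed.

Lemma trig_cvg g : trig g -> (fun n => \int[P]_(w in setT) g (X n w)) @ \oo -->
  std_normal_mean (fun z => g (z *m L)).
Proof.
elim=> [u c|a g1 g2 t1 c1 t2 c2]; first exact: X_chf.
have b1 := trig_bounded_continuous t1; have b2 := trig_bounded_continuous t2.
rewrite (snf_lin (std_normal_factsP R d) a (bcL b1) (bcL b2)).
rewrite (_ : (fun n => _) = (fun n => a * \int[P]_(w in setT) g1 (X n w) + \int[P]_(w in setT) g2 (X n w))).
  by apply: cvgD => //; apply: cvgM => //; exact: cvg_cst.
apply/funext => n; rewrite RintegralD//; last first.
- exact: iX.
- by apply: (iX (g := fun x => a * g1 x)); have := bounded_continuous_lin a b1 (bounded_continuous_cst d 0); under eq_fun do rewrite addr0.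
by rewrite RintegralZl//; exact: iX.
Qed.

(** The facts on normal means concern bounded continuous functions, so the indicator of a tail is
    replaced by the continuous majorant min(1, |z L| / (n + 1)), whose mean tends to 0. *)
Lemma std_normal_tail (e : R) : 0 < e -> exists (K : R) (h : 'rV[R]_d -> R),
  [/\ bounded_continuous h, forall z, 0 <= h z,
      forall z, K <= `|z *m L| -> 1 <= h z & std_normal_mean h <= e].
Proof.
move=> e0.
pose h (n : nat) (z : 'rV[R]_d) := Num.min 1 (`|z *m L| / n.+1%:R).
have hE n z : h n z = (1 + `|z *m L| / n.+1%:R - `|1 - `|z *m L| / n.+1%:R|) / 2.
  by rewrite /h; move: (_ / _) => x; rewrite /Num.min; case: ltP => h1;
    [rewrite ltr0_norm ?subr_lt0//|rewrite ger0_norm ?subr_ge0//]; field.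
have h01 n z : 0 <= h n z <= 1.
  by rewrite /h le_min ler01 divr_ge0//= ge_min lexx.
have hc n : continuous (h n).
  rewrite (_ : h n = (fun z => 2^-1 * (1 + `|z *m L| / n.+1%:R) + (- 2^-1 * `|1 - `|z *m L| / n.+1%:R|))); last first.
    by apply/funext => z; rewrite hE; field.
  have c1 : continuous (fun z : 'rV[R]_d => `|z *m L|).
    by move=> z; apply: continuous_comp; [exact: mul_continuous|exact: norm_continuous].
  have c2 : continuous (fun z : 'rV[R]_d => n.+1%:R^-1 * `|z *m L| + 1).
    by apply: continuous_lin => //; exact: cst_continuous.
  have c3 : continuous (fun z : 'rV[R]_d => - n.+1%:R^-1 * `|z *m L| + 1).
    by apply: continuous_lin => //; exact: cst_continuous.
  have c4 := norm_continuous_rV c3.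
  apply: continuous_lin; first by under eq_fun do rewrite addrC mulrC.
  rewrite (_ : (fun z => _) = (fun z => - 2^-1 * `|- n.+1%:R^-1 * `|z *m L| + 1| + 0)).
    by apply: continuous_lin; [exact: c4|exact: cst_continuous].
  apply/funext => z; rewrite addr0; congr (_ * `|_|).
  by rewrite mulNr addrC mulrC.
have lim0 : (fun n => std_normal_mean (h n)) @ \oo --> std_normal_mean ((fun=> 0) : 'rV[R]_d -> R).
  apply: (snf_dct (std_normal_factsP R d) (M := 1)) => //.
  - exact: cst_continuous.
  - by move=> n x; have /andP[h1 h2] := h01 n x; rewrite ger0_norm.
  - move=> x; apply: (@squeeze_cvgr _ _ _ _ (cst 0) (fun n => `|x *m L| * n.+1%:R^-1)).
    + apply: nearW => n; have /andP[-> _] := h01 n x.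
      by rewrite /h ge_min lexx orbT.
    + exact: cvg_cst.
    + by apply: cvg0Z; exact: cvg_harmonic.
move: lim0; rewrite (snf_cst (std_normal_factsP R d)) => /cvgrPdist_le/(_ _ e0)[n _ /(_ n (leqnn n))].
rewrite /= sub0r normrN => /(le_trans (ler_norm _)) hn.
exists n.+1%:R, (h n); split => //.
- by split => //; exists 1 => x; have /andP[h1 h2] := h01 n x; rewrite ger0_norm.
- by move=> z; have /andP[] := h01 n z.
- by move=> z nz; rewrite /h le_min lexx ler_pdivlMr ?ltr0n// mul1r.
Qed.

Lemma levy_continuity g : continuous g -> (exists M : R, forall x, `|g x| <= M) ->
  (fun n => (\int[P]_w (g (X n w))%:E)%E) @ \oo -->
  std_normal_expectation (fun z => (g (z *m L))%:E).
Proof.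
move=> cg [M gM]; have bg : bounded_continuous g by split=> //; exists M.
have M0 : 0 <= M by apply: le_trans (gM 0).
rewrite -[X in _ --> X]fineK; last by apply: (snf_fin (std_normal_factsP R d)); exact: bcL.
rewrite (_ : (fun n => _) = (fun n => (\int[P]_(w in setT) g (X n w))%:E)); last first.
  by apply/funext => n; rewrite /Rintegral fineK//; apply: integrable_fin_num => //; exact: iX.
apply: cvg_EFin; first exact: nearW.
apply/cvgrPdist_le => e e0.
(* The normal side and the tree side cost s + 2 M s each, the limit of the trigonometric polynomial
   one more s. *)
pose s := e / (4 * (1 + M)); have s0 : 0 < s by rewrite divr_gt0// mulr_gt0//; lra.
have sE : 3 * s + 4 * M * s <= e.
  have -> : e = s * (4 * (1 + M)) by rewrite divfK// mulf_neq0// gt_eqF//; lra.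
  by nra.
have [K1 hK1] := X_tight s0; have [K2 [h [bh h0 hK2 hs]]] := std_normal_tail s0.
have [t [tt tM tg]] := trig_approx (Num.max K1 K2) cg gM s0.
have bt := trig_bounded_continuous tt.
have /cvgrPdist_le/(_ _ s0) ct := trig_cvg tt.
have normal_side : `|std_normal_mean (fun z : 'rV[R]_d => g (z *m L)) - std_normal_mean (fun z : 'rV[R]_d => t (z *m L))| <= s + 2 * M * s.
  apply: (@le_trans _ _ (2 * M * std_normal_mean h + s)); last first.
    by rewrite addrC lerD2l ler_wpM2l// mulr_ge0.
  have -> : 2 * M * std_normal_mean h + s = std_normal_mean (fun z => 2 * M * h z + s).
    rewrite (snf_lin (std_normal_factsP R d)) ?(snf_cst (std_normal_factsP R d))//.
    exact: bounded_continuous_cst.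
  apply: (snf_dist_le (std_normal_factsP R d)); try exact: bcL.
    exact: bounded_continuous_lin bh (bounded_continuous_cst _ _).
  move=> z; have [zK|zK] := leP `|z *m L| (Num.max K1 K2).
    by rewrite distrC; apply: le_trans (tg _ zK) _; rewrite lerDr !mulr_ge0.
  have hz : 1 <= h z by apply: hK2; apply: ltW; apply: le_lt_trans zK; rewrite le_max lexx orbT.
  apply: le_trans (ler_normB _ _) _; have := gM (z *m L); have := tM (z *m L).
  have : 2 * M <= 2 * M * h z by rewrite ler_peMr// mulr_ge0.
  lra.
near=> n.
have h1 : `|std_normal_mean (fun z : 'rV[R]_d => t (z *m L)) - \int[P]_(w in setT) t (X n w)| <= s by near: n.
have h2 : (P [set w | (K1 <= `|X n w|)%R] <= s%:E)%E by near: n.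
have h3 : `|\int[P]_(w in setT) t (X n w) - \int[P]_(w in setT) g (X n w)| <= s + 2 * M * s.
  pose N := [set w | (K1 <= `|X n w|)%R].
  have mN : measurable N.
    have := @norm_ge_measurable (X n) 0 K1 (mX n); congr measurable.
    by apply/seteqP; split=> w /=; rewrite subr0.
  have PN : fine (P N) <= s.
    by rewrite -lee_fin fineK//; exact: fin_num_measure.
  apply: (@le_trans _ _ (s + 2 * M * fine (P N))); last first.
    by rewrite lerD2l ler_wpM2l// mulr_ge0.
  apply: Rintegral_dist_le => //; try exact: iX.
  - by rewrite mulr_ge0.
  - exact: ltW.
  - move=> w /negP; rewrite -ltNge => wK; apply: tg.
    by apply: ltW; apply: lt_le_trans wK _; rewrite le_max lexx.
  - move=> w; apply: le_trans (ler_normB _ _) _.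
    by have := tM (X n w); have := gM (X n w); lra.
move: normal_side h1 h3; rewrite /= -/(std_normal_mean (fun z : 'rV[R]_d => g (z *m L))).
move: (std_normal_mean _) (std_normal_mean _) (Rintegral _ _ _) (Rintegral _ _ _) => a b c c'.
rewrite !ler_norml => /andP[k1 k2] /andP[k3 k4] /andP[k5 k6]; apply/andP; split; lra.
Unshelve. all: by end_near. Qed.

End NormalLimit.
End Levy.

(** * Tree averages and their limits *)

Section ChoiceSums.
Variable R : realType.
Implicit Types (a : attachments) (m n j k : nat).

(** The degree before the attachment, in the tree with [j.+1] nodes. *)
Definition chosen a j : nat := deg a j.+1 (a j).

Lemma PgtE a m k : Pgt R a m.+1 k = nsum (fun d => (k < d)%N%:R) a m.+1 / m.+1%:R.
Proof.
have -> : nsum (fun d => (k < d)%N%:R) a m.+1 / m.+1%:R =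
    \sum_(k.+1 <= l < m.+2) Pdeg R a m.+1 l.
  rewrite /Pdeg -mulr_suml; congr (_ / _).
  under eq_bigr do rewrite -cnt_Ndeg /cnt; rewrite -nsum_sum.
  apply: eq_bigr => i _; have := deg_le a m i; move: (deg _ _ _) => d dm.
  have [kd|dk] := ltnP k d.
    rewrite (bigD1_seq d) ?iota_uniq//=; last by rewrite mem_index_iota kd ltnS.
    by rewrite eqxx big1 ?addr0// => l ld; rewrite eq_sym (negPf ld).
  rewrite big_nat_cond big1// => l /andP[/andP[kl _] _].
  by rewrite ltn_eqF// (leq_ltn_trans dk).
apply/cvg_lim => //; apply: eventually_zero_sum => l ml.
by rewrite /Pdeg Ndeg_big// mul0r.
Qed.

(** A node of degree d has been chosen exactly once at each of the degrees 1, ..., d - 1. *)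
Lemma nsum_chosen (V : zmodType) (h : nat -> V) a m :
  nsum (fun d => \sum_(1 <= k < d) h k) a m.+1 = \sum_(j < m) h (chosen a j).
Proof.
elim: m => [|m IH]; first by rewrite nsum1 big_geq// big_ord0.
rewrite nsumS IH big_ord_recr/= [\sum_(1 <= k < 1) _]big_geq// addr0; congr (_ + _).
by rewrite big_nat_recr//= addrAC subrr add0r.
Qed.

(** P_{>k} thus counts, up to the factor 1 / n, the steps at which a node of degree k was chosen. *)
Lemma Pgt_sum (V : normedModType R) (h : nat -> V) a m :
  \sum_(1 <= k <oo) (Pgt R a m.+1 k *: h k) = m.+1%:R^-1 *: \sum_(j < m) h (chosen a j).
Proof.
have -> : m.+1%:R^-1 *: \sum_(j < m) h (chosen a j) =
    \sum_(1 <= k < m.+2) (Pgt R a m.+1 k *: h k).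
  rewrite -nsum_chosen; under [RHS]eq_bigr do rewrite PgtE mulrC -scalerA.
  rewrite -scaler_sumr; congr (_ *: _).
  under [RHS]eq_bigr do rewrite /nsum scaler_suml.
  rewrite exchange_big/=; apply: eq_bigr => i _; have := deg_le a m i.
  move: (deg _ _ _) => d dm; case: d dm => [_|d dm].
    rewrite big_geq// big1 => [//|k _]; by rewrite scale0r.
  rewrite [RHS](@big_cat_nat _ _ _ d.+1)//=; last exact: leqW.
  rewrite [X in _ = _ + X]big_nat_cond [X in _ = _ + X]big1 ?addr0; last first.
    by move=> k /andP[/andP[dk _] _]; rewrite ltnNge dk scale0r.
  by apply: eq_big_nat => k /andP[_ kd]; rewrite kd scale1r.
apply/cvg_lim => //; apply: eventually_zero_sum => k mk.
rewrite PgtE /nsum big1 ?mul0r ?scale0r// => i _.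
by rewrite ltnNge (leq_trans (deg_le _ _ _))// ltnW.
Qed.

Lemma time_sum (V : zmodType) (F : nat -> V) m :
  \sum_(2 <= t < m.+2) F t.-1 = \sum_(j < m) F j.+1.
Proof.
rewrite -(big_mkord xpredT (fun j => F j.+1)).
have -> : (2 = 0 + 2)%N by []. have -> : (m.+2 = m + 2)%N by rewrite addn2.
by rewrite big_addn addnK; apply: eq_bigr => j _; rewrite addn2.
Qed.

Lemma scoreE d (f : 'rV[R]_d -> nat -> R) a m theta : score f a m.+1 theta =
  m.+1%:R^-1 *: \sum_(j < m) ((f theta (chosen a j))^-1 *: fdot f theta (chosen a j)
    - (nsum (f theta) a j.+1)^-1 *: nsum (fdot f theta) a j.+1).
Proof.
rewrite /score Pgt_sum.
rewrite (time_sum (fun t => (Ssum (f theta) a t)^-1 *: Ssum (fdot f theta) a t)).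
rewrite -scalerBr -sumrB; congr (_ *: _); apply: eq_bigr => j _.
by rewrite !SsumE.
Qed.

Lemma loglikE d (f : 'rV[R]_d -> nat -> R) a m theta : loglik f a m.+1 theta =
  m.+1%:R^-1 * \sum_(j < m) (ln (f theta (chosen a j)) - ln (nsum (f theta) a j.+1)).
Proof.
rewrite /loglik.
have -> : \sum_(1 <= k <oo) (ln (f theta k) * Pgt R a m.+1 k) =
    \sum_(1 <= k <oo) (Pgt R a m.+1 k *: (ln (f theta k) : R^o)).
  by apply: eq_sum1 => k _; rewrite mulrC.
rewrite Pgt_sum (time_sum (fun t => ln (Ssum (f theta) a t))).
rewrite -mulrBr -sumrB; congr (_ * _); apply: eq_bigr => j _.
by rewrite SsumE.
Qed.

End ChoiceSums.

Section ChoiceMean.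
Variables (R : realType) (f b : nat -> R) (lam : R).
Hypothesis f_gt0 : forall k, (0 < k)%N -> 0 < f k.
Hypothesis b_ge1 : forall k, (0 < k)%N -> 1 <= b k.
Hypothesis b_nd : forall k l, (0 < k)%N -> (k <= l)%N -> b k <= b l.
Hypothesis lam_gt0 : 0 < lam.
Hypothesis surv_sum :
  (fun n => \sum_(1 <= k < n) surv f lam k) @ \oo --> (1 : R).
Let p := pdist f lam.
Let w k : R := k%:R * b k ^+ 3.
Hypothesis wp_summable : summable1 (fun k => w k * p k).
Implicit Types (g : nat -> R).

Let p_gt0 k : (0 < k)%N -> 0 < p k. Proof. by move=> k0; exact: pdist_gt0. Qed.

Let w_ge0 k : (0 < k)%N -> 0 <= w k.
Proof. by move=> k0; rewrite mulr_ge0// exprn_ge0// (le_trans _ (b_ge1 k0)). Qed.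

Lemma abel_surv g N : \sum_(1 <= d < N.+1) (\sum_(1 <= k < d) g k) * p d =
  \sum_(1 <= k < N) g k * surv f lam k - (\sum_(1 <= k < N) g k) * surv f lam N.
Proof.
elim: N => [|N IH]; first by rewrite !big_geq// mul0r subr0.
rewrite big_nat_recr//= IH /p pdistE//.
case: N {IH} => [|N]; first by rewrite !big_geq// !mul0r subr0 addr0.
by rewrite ![\sum_(1 <= k < N.+2) _]big_nat_recr//=; ring.
Qed.

(** [w] is nondecreasing, so w_N p_{>N} is at most the tail of the series of w p. This kills the
    boundary term of [abel_surv]. *)
Lemma w_surv_cvg0 (e : R) : 0 < e -> exists K, forall N, (K <= N)%N ->
  w N * surv f lam N <= e.
Proof.
move=> e0; have wp0 k : (0 < k)%N -> 0 <= w k * p k.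
  by move=> k0; rewrite mulr_ge0 ?w_ge0// ltW// p_gt0.
have [K hK] := ge0_tail_cut wp0 wp_summable e0; exists K.+1 => N KN.
have N0 : (0 < N)%N by apply: leq_trans KN.
have s0 := surv_cvg0 f_gt0 lam_gt0 surv_sum.
have lim1 : (fun M => w N * (surv f lam N - surv f lam M)) @ \oo --> w N * surv f lam N.
  by have := cvgM (cvg_cst (w N)) (cvgB (cvg_cst (surv f lam N)) s0); rewrite subr0; exact.
rewrite -(cvg_lim (@Rhausdorff _) lim1); apply: limr_le.
  by apply/cvg_ex; eexists; exact: lim1.
near=> M; have NM : (N <= M)%N by near: M; exact: nbhs_infty_ge.
apply: le_trans (hK N.+1 M.+1 (leqW (ltnW KN))).
have -> : surv f lam N - surv f lam M = \sum_(N.+1 <= d < M.+1) p d.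
  have := pdist_partial f_gt0 lam_gt0 M.
  rewrite (@big_cat_nat _ _ _ N.+1)//= pdist_partial//.
  by rewrite -/p; move: (\sum_(_ <= _ < _) _) => x; lra.
rewrite mulr_sumr; apply: ler_sum_nat => d /andP[Nd _].
have d0 : (0 < d)%N by apply: leq_trans Nd.
rewrite ler_wpM2r ?(ltW (p_gt0 _))// /w ler_pM ?ler_nat ?(ltnW Nd)//.
  by rewrite exprn_ge0// (le_trans _ (b_ge1 N0)).
have bN := b_ge1 N0; have bd := b_ge1 d0.
by rewrite lerXn2r ?nnegrE ?b_nd ?(ltnW Nd)//; lra.
Unshelve. all: by end_near. Qed.

Lemma cumul_le g Cg d : (forall k, (0 < k)%N -> `|g k| <= Cg * b k ^+ 2) ->
  (0 < d)%N -> `|\sum_(1 <= k < d) g k| <= Cg * w d.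
Proof.
move=> gC d0; have b1 := b_ge1 d0.
have Cg0 : 0 <= Cg.
  have := le_trans (normr_ge0 _) (gC 1%N isT).
  by rewrite pmulr_lge0// exprn_gt0// (lt_le_trans _ (b_ge1 (ltn0Sn 0))).
apply: le_trans (ler_norm_sum _ _ _) _.
apply: (@le_trans _ _ (\sum_(1 <= k < d) Cg * b d ^+ 2)).
  apply: ler_sum_nat => k /andP[k0 kd]; apply: le_trans (gC k k0) _.
  rewrite ler_wpM2l// lerXn2r ?nnegrE ?b_nd ?(ltnW kd)//; last by lra.
  by apply: le_trans (b_ge1 k0).
rewrite sumr_const_nat -[leLHS]mulr_natl /w mulrCA ler_wpM2l//.
apply: ler_pM => //; first by rewrite exprn_ge0//; lra.
- by rewrite ler_nat leq_subr.
- by rewrite ler_weXn2l.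
Qed.

Lemma choice_mean_limit g Cg : (forall k, (0 < k)%N -> `|g k| <= Cg * b k ^+ 2) ->
  (fun N => \sum_(1 <= k < N) g k * surv f lam k) @ \oo -->
  \sum_(1 <= d <oo) (\sum_(1 <= k < d) g k) * p d.
Proof.
move=> gC; pose G d := \sum_(1 <= k < d) g k.
have sG : summable1 (fun d => G d * p d).
  have sC : summable1 (fun k => Cg * (w k * p k)) by exact: summable1Z.
  apply: (le_summable1 _ sC) => d d0.
  by rewrite normrM (gtr0_norm (p_gt0 d0)) mulrA ler_pM2r ?p_gt0// cumul_le.
have G0 : (fun N => G N * surv f lam N) @ \oo --> (0 : R).
  have Cg1 : 0 < `|Cg| + 1 by rewrite ltr_wpDl.
  apply/cvgrPdist_le => e e0; have e1 : 0 < e / (`|Cg| + 1) by rewrite divr_gt0.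
  have [K hK] := w_surv_cvg0 e1.
  near=> N; have N0 : (0 < N)%N by near: N; exact: nbhs_infty_gt.
  have KN : (K <= N)%N by near: N; exact: nbhs_infty_ge.
  rewrite sub0r normrN normrM (gtr0_norm (surv_gt0 f_gt0 lam_gt0 N)).
  apply: (@le_trans _ _ (Cg * w N * surv f lam N)).
    by rewrite ler_wpM2r ?(ltW (surv_gt0 _ _ _))// cumul_le.
  have ws0 : 0 <= w N * surv f lam N by rewrite mulr_ge0 ?w_ge0// ltW// surv_gt0.
  have h := hK N KN; rewrite ler_pdivlMr// in h; apply: le_trans h.
  rewrite -mulrA mulrC ler_wpM2l//; have := ler_norm Cg; lra.
have -> : \sum_(1 <= d <oo) G d * p d = \sum_(1 <= d <oo) G d * p d + 0 by rewrite addr0.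
rewrite (_ : (fun N => _) = (fun N => \sum_(1 <= d < N.+1) G d * p d + G N * surv f lam N)).
  apply: cvgD => //; rewrite (cvg_shiftS (fun N => \sum_(1 <= d < N) G d * p d)); exact: sG.
by apply/funext => N; rewrite abel_surv subrK.
Unshelve. all: by end_near. Qed.

(** [nsum_chosen] turns an average over past choices into an average of the cumulated function over
    the present degrees, which costs one factor k. *)
Lemma choice_mean_gap g Cg a m : (forall k, (0 < k)%N -> `|g k| <= Cg * b k ^+ 2) ->
  `|m.+1%:R^-1 * \sum_(j < m) g (chosen a j) - \sum_(1 <= k <oo) g k * surv f lam k|
  <= Cg * wdist p w a m.
Proof.
move=> gC; have lim1 : (fun N => \sum_(1 <= k < N) g k * surv f lam k) @ \oo -->
  \sum_(1 <= d <oo) (\sum_(1 <= k < d) g k) * p d by exact: choice_mean_limit gC.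
rewrite (cvg_lim (@Rhausdorff _) lim1) -nsum_chosen mulrC.
apply: nsum_mean_gap => // d d0; exact: cumul_le.
Qed.

Lemma choice_summable g Cg : (forall k, (0 < k)%N -> `|g k| <= Cg * b k ^+ 2) ->
  summable1 (fun k => g k * surv f lam k).
Proof. by move=> gC; apply/cvg_ex; eexists; exact: choice_mean_limit gC. Qed.

End ChoiceMean.

(** * Bounds uniform over the family *)

Section UniformGaps.
Variables (R : realType) (p b : nat -> R).
Hypothesis p_gt0 : forall k, (0 < k)%N -> 0 < p k.
Hypothesis p_sum : (fun n => \sum_(1 <= k < n) p k) @ \oo --> (1 : R).
Hypothesis b_ge1 : forall k, (0 < k)%N -> 1 <= b k.
Let w k : R := k%:R * b k ^+ 3.
Hypothesis wp_summable : summable1 (fun k => w k * p k).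
Implicit Types (a : attachments) (m : nat) (h g : nat -> R).

Let w_ge0 k : (0 < k)%N -> 0 <= w k.
Proof. by move=> k0; rewrite mulr_ge0// exprn_ge0// (le_trans _ (b_ge1 k0)). Qed.

(** The mean of [g] at the degree of a node chosen with rates [h], which may differ from the rates
    that generate the tree. *)
Definition ratio h g a m : R := nsum (fun k => h k * g k) a m.+1 / nsum h a m.+1.
Definition lim_mass h : R := \sum_(1 <= k <oo) h k * p k.
Definition lim_ratio h g : R := lim_mass (fun k => h k * g k) / lim_mass h.

Section Bounds.
Variables (c0 Cf : R).
Hypothesis c0_gt0 : 0 < c0.
Hypothesis Cf_ge0 : 0 <= Cf.

Definition linear_between h := forall k, (0 < k)%N -> c0 <= h k <= Cf * k%:R.

Lemma linear_between_gt0 h k : linear_between h -> (0 < k)%N -> 0 < h k.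
Proof. by move=> hl /hl /andP[h0 _]; exact: lt_le_trans h0. Qed.

Lemma linear_between_w h k : linear_between h -> (0 < k)%N -> `|h k| <= Cf * w k.
Proof.
move=> hl k0; have /andP[_ h1] := hl k k0.
rewrite gtr0_norm; last exact: linear_between_gt0.
apply: le_trans h1 _; rewrite ler_wpM2l// ler_peMr// exprn_ege1// b_ge1//.
Qed.

Lemma mul_between_w h g (Cg : R) k : linear_between h -> (0 < k)%N -> 0 <= Cg ->
  `|g k| <= Cg * b k ^+ 2 -> `|h k * g k| <= Cf * Cg * w k.
Proof.
move=> hl k0 Cg0 gC; have /andP[_ h1] := hl k k0; have b1 := b_ge1 k0.
rewrite normrM gtr0_norm; last exact: linear_between_gt0.
apply: (@le_trans _ _ (Cf * k%:R * (Cg * b k ^+ 2))).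
  by apply: ler_pM => //; exact/ltW/linear_between_gt0.
rewrite /w -mulrA -[leRHS]mulrA ler_wpM2l// mulrCA ler_wpM2l// ler_wpM2l//.
by rewrite ler_weXn2l.
Qed.

Lemma w_dominated_summable g (C : R) : (forall k, (0 < k)%N -> `|g k| <= C * w k) ->
  summable1 (fun k => g k * p k).
Proof.
move=> gC; have sC : summable1 (fun k => C * (w k * p k)) by exact: summable1Z.
apply: (le_summable1 _ sC) => k k0.
by rewrite normrM (gtr0_norm (p_gt0 k0)) mulrA ler_pM2r ?p_gt0// gC.
Qed.

Lemma lim_mass_ge h : linear_between h -> c0 <= lim_mass h.
Proof.
move=> hl; have sh : summable1 (fun k => h k * p k).
  by apply: (@w_dominated_summable _ Cf) => k; exact: linear_between_w.
have sp : summable1 p by apply/cvg_ex; exists 1.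
have -> : c0 = \sum_(1 <= k <oo) c0 * p k.
  by rewrite sum1Z// (cvg_lim (@Rhausdorff _) p_sum) mulr1.
apply: ler_lim => //; first exact: summable1Z.
apply: nearW => n; apply: ler_sum_nat => k /andP[k0 _].
by rewrite ler_pM2r ?p_gt0//; have /andP[] := hl k k0.
Qed.

Lemma nsum_mean_ge h a m : linear_between h -> c0 <= nsum h a m.+1 / m.+1%:R.
Proof.
move=> hl; rewrite ler_pdivlMr ?ltr0n// -(nsum_cst c0 a); apply: ler_nsum => k k0.
by have /andP[] := hl k k0.
Qed.

Lemma mean_gap h a m : linear_between h ->
  `|nsum h a m.+1 / m.+1%:R - lim_mass h| <= Cf * wdist p w a m.
Proof.
by move=> hl; apply: nsum_mean_gap => // k; exact: linear_between_w.
Qed.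

(** The constant comes before [h] and [g]: it depends on their bounds only, hence serves all theta
    at once. *)
Lemma ratio_gap (Cg : R) : 0 <= Cg -> exists2 K : R, 0 <= K &
  forall h g, linear_between h -> (forall k, (0 < k)%N -> `|g k| <= Cg * b k ^+ 2) ->
  `|lim_ratio h g| <= K /\
  forall a m, `|ratio h g a m - lim_ratio h g| <= K * wdist p w a m.
Proof.
move=> Cg0; pose W := \sum_(1 <= k <oo) w k * p k.
have W0 : 0 <= W.
  apply: limr_ge; first exact: wp_summable.
  apply: nearW => n; rewrite big_nat_cond sumr_ge0// => k /andP[/andP[k0 _] _].
  by rewrite mulr_ge0 ?w_ge0// ltW// p_gt0.
pose E0 := Cf * Cg * W / c0.
have E00 : 0 <= E0 by rewrite divr_ge0 ?(ltW c0_gt0)// !mulr_ge0.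
exists (E0 + (Cf * Cg + E0 * Cf) / c0).
  by rewrite addr_ge0// divr_ge0 ?(ltW c0_gt0)// addr_ge0// mulr_ge0// mulr_ge0.
move=> h g hl gC.
have hgw k : (0 < k)%N -> `|h k * g k| <= Cf * Cg * w k.
  by move=> k0; apply: mul_between_w => //; exact: gC.
have S0 := lim_mass_ge hl; have S1 : 0 < lim_mass h by exact: lt_le_trans S0.
have X0 : `|lim_mass (fun k => h k * g k)| <= Cf * Cg * W.
  rewrite /lim_mass /W -sum1Z//; apply: ler_norm_sum1; last exact: summable1Z.
  by move=> k k0; rewrite normrM (gtr0_norm (p_gt0 k0)) mulrA ler_pM2r ?p_gt0// hgw.
have EE : `|lim_ratio h g| <= E0.
  rewrite /lim_ratio normrM normfV (gtr0_norm S1) /E0.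
  apply: ler_pM => //; first by rewrite invr_ge0 ltW.
  by rewrite lef_pV2 ?posrE.
have K2 : 0 <= (Cf * Cg + E0 * Cf) / c0.
  by rewrite divr_ge0 ?(ltW c0_gt0)// addr_ge0// mulr_ge0.
split; first by apply: le_trans EE _; rewrite lerDl.
move=> a m.
have h1 := nsum_mean_gap w_ge0 p_gt0 wp_summable (g := fun k => h k * g k) a m hgw.
have h2 := mean_gap a m hl.
have d0 : 0 <= wdist p w a m by exact: wdist_ge0.
have n0 : 0 < (m.+1%:R : R) by rewrite ltr0n.
have nS : 0 < nsum h a m.+1.
  have := nsum_mean_ge a m hl; rewrite ler_pdivlMr// => h3.
  by apply: lt_le_trans h3; rewrite mulr_gt0.
have -> : ratio h g a m = (nsum (fun k => h k * g k) a m.+1 / m.+1%:R) / (nsum h a m.+1 / m.+1%:R).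
  by rewrite /ratio; field; rewrite !gt_eqF.
have := nsum_mean_ge a m hl; move: h1 h2 EE; rewrite -/(lim_mass (fun k => h k * g k)) /lim_ratio.
move: (nsum _ _ _ / _) (nsum h _ _ / _) (wdist _ _ _ _) d0 (lim_mass h) S1 (lim_mass _).
move=> X S D D0 s s0 x hX hS hE S2.
have S3 : 0 < S by exact: lt_le_trans S2.
have -> : X / S - x / s = ((X - x) - (x / s) * (S - s)) / S.
  by field; rewrite !gt_eqF.
rewrite normrM normfV (gtr0_norm S3) ler_pdivrMr//.
apply: (@le_trans _ _ ((Cf * Cg + E0 * Cf) * D)).
  rewrite mulrDl; apply: le_trans (ler_normB _ _) _; apply: lerD => //.
  by rewrite normrM -mulrA ler_pM.
apply: (@le_trans _ _ ((Cf * Cg + E0 * Cf) / c0 * D * S)).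
  have -> : (Cf * Cg + E0 * Cf) / c0 * D * S = (Cf * Cg + E0 * Cf) * D * (S / c0).
    by field; exact: lt0r_neq0.
  rewrite ler_peMr//; last by rewrite ler_pdivlMr// mul1r.
  by rewrite mulr_ge0// addr_ge0// mulr_ge0.
by rewrite ler_wpM2r ?(ltW S3)// ler_wpM2r// lerDr.
Qed.

Lemma ratio_sqr_le h g a m : linear_between h ->
  ratio h g a m ^+ 2 <= ratio h (fun k => g k ^+ 2) a m.
Proof.
move=> hl; set r := ratio h g a m.
have n0 : 0 < nsum h a m.+1.
  have := nsum_mean_ge a m hl; rewrite ler_pdivlMr ?ltr0n// => h3.
  by apply: lt_le_trans h3; rewrite mulr_gt0// ltr0n.
have : 0 <= nsum (fun k => h k * (g k - r) ^+ 2) a m.+1.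
  by apply: nsum_ge0 => k k0; rewrite mulr_ge0 ?sqr_ge0// ltW// linear_between_gt0.
have -> : nsum (fun k => h k * (g k - r) ^+ 2) a m.+1 =
  nsum (fun k => h k * g k ^+ 2) a m.+1 + (- 2 * r) * nsum (fun k => h k * g k) a m.+1
  + r ^+ 2 * nsum h a m.+1.
  by rewrite -!nsumZ -!nsumD; apply: eq_nsum_fun => k _; ring.
have -> : nsum (fun k => h k * g k) a m.+1 = r * nsum h a m.+1.
  by rewrite /r /ratio divfK// gt_eqF.
move=> h0; rewrite /ratio ler_pdivlMr//; move: h0.
by move: (nsum _ _ _) (nsum h _ _) => x y; nra.
Qed.

(** A product of two errors is quadratic in [wdist]. When [wdist] exceeds 1, the Cauchy-Schwarz
    bound [ratio_sqr_le] by ratios of squares makes the estimate linear again. *)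
Lemma ratio_prod_gap (Cg : R) : 0 <= Cg -> exists2 K : R, 0 <= K &
  forall h g1 g2, linear_between h -> (forall k, (0 < k)%N -> `|g1 k| <= Cg * b k) ->
  (forall k, (0 < k)%N -> `|g2 k| <= Cg * b k) ->
  `|lim_ratio h g1 * lim_ratio h g2| <= K /\
  forall a m, `|ratio h g1 a m * ratio h g2 a m - lim_ratio h g1 * lim_ratio h g2|
    <= K * wdist p w a m.
Proof.
move=> Cg0; have [K1 K10 hK1] := ratio_gap Cg0.
have [K2 K20 hK2] := ratio_gap (sqr_ge0 Cg).
exists (2 * K1 ^+ 2 + K1 + 2 * K2 + K1 ^+ 2).
  by rewrite !addr_ge0// ?mulr_ge0// exprn_ge0.
move=> h g1 g2 hl g1C g2C.
have up g : (forall k, (0 < k)%N -> `|g k| <= Cg * b k) ->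
    forall k, (0 < k)%N -> `|g k| <= Cg * b k ^+ 2.
  move=> gC k k0; apply: le_trans (gC k k0) _; rewrite ler_wpM2l// expr2.
  by have := b_ge1 k0 => b1; rewrite ler_peMr//; lra.
have sq g : (forall k, (0 < k)%N -> `|g k| <= Cg * b k) ->
    forall k, (0 < k)%N -> `|g k ^+ 2| <= Cg ^+ 2 * b k ^+ 2.
  by move=> gC k k0; rewrite normrX -exprMn lerXn2r ?nnegrE ?gC// (le_trans _ (gC _ k0)).
have [e1 r1] := hK1 _ _ hl (up _ g1C); have [e2 r2] := hK1 _ _ hl (up _ g2C).
have [f1 s1] := hK2 _ _ hl (sq _ g1C); have [f2 s2] := hK2 _ _ hl (sq _ g2C).
have EE : `|lim_ratio h g1 * lim_ratio h g2| <= K1 ^+ 2 by rewrite normrM expr2 ler_pM.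
split.
  apply: le_trans EE _; rewrite lerDr !addr_ge0// ?mulr_ge0// exprn_ge0//.
move=> a m; have d0 : 0 <= wdist p w a m by exact: wdist_ge0.
have q1 := ratio_sqr_le g1 a m hl; have q2 := ratio_sqr_le g2 a m hl.
move: (r1 a m) (r2 a m) (s1 a m) (s2 a m) q1 q2.
move: (ratio h g1 a m) (ratio h g2 a m) => x1 x2.
move: (ratio h _ a m) (ratio h _ a m) => y1 y2.
move: (lim_ratio h g1) (lim_ratio h g2) e1 e2 EE (lim_ratio h _) (lim_ratio h _) f1 f2.
move: (wdist _ _ _ _) d0 => D D0 E1 E2 e1 e2 EE F1 F2 f1 f2 h1 h2 t1 t2 q1 q2.
have KK : 0 <= K1 ^+ 2 by exact: sqr_ge0.
have [D1|D1] := leP D 1.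
  have -> : x1 * x2 - E1 * E2 = (x1 - E1) * ((x2 - E2) + E2) + E1 * (x2 - E2) by ring.
  apply: (@le_trans _ _ (K1 * D * (K1 + K1) + K1 * (K1 * D))).
    apply: le_trans (ler_normD _ _) _; rewrite !normrM; apply: lerD; apply: ler_pM => //.
    apply: le_trans (ler_normD _ _) _; apply: lerD => //.
    by apply: le_trans h2 _; rewrite ler_piMr.
  have -> : K1 * D * (K1 + K1) + K1 * (K1 * D) = (2 * K1 ^+ 2 + K1 ^+ 2) * D by ring.
  by rewrite ler_wpM2r//; lra.
have ya : y1 <= K2 + K2 * D.
  by move: t2 f2; rewrite !ler_norml => /andP[_ t2] /andP[_ f2]; lra.
have yb : y2 <= K2 + K2 * D.
  by move: t1 f1; rewrite !ler_norml => /andP[_ t1] /andP[_ f1]; lra.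
have K2D : K2 <= K2 * D by rewrite ler_peMr// ltW.
have K1D : K1 ^+ 2 <= K1 ^+ 2 * D by rewrite ler_peMr// ltW.
have K1D' : 0 <= K1 * D by rewrite mulr_ge0.
have xx : `|x1 * x2| <= (y1 + y2) / 2.
  have : `|x1 * x2| <= (x1 ^+ 2 + x2 ^+ 2) / 2.
    rewrite normrM -(real_normK (num_real x1)) -(real_normK (num_real x2)).
    by move: `|x1| `|x2| => u v; have := sqr_ge0 (u - v); rewrite sqrrB; lra.
  lra.
apply: le_trans (ler_normB _ _) _.
have -> : (2 * K1 ^+ 2 + K1 + 2 * K2 + K1 ^+ 2) * D =
  3 * (K1 ^+ 2 * D) + K1 * D + 2 * (K2 * D) by ring.
lra.
Qed.

Lemma ln_lipschitz (x y : R) : c0 <= x -> c0 <= y -> `|ln x - ln y| <= `|x - y| / c0.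
Proof.
have h u v : c0 <= u -> c0 <= v -> ln u - ln v <= `|u - v| / c0.
  move=> cu cv; have u0 : 0 < u by exact: lt_le_trans cu.
  have v0 : 0 < v by exact: lt_le_trans cv.
  rewrite -ln_div ?posrE//.
  apply: (@le_trans _ _ ((u - v) / v)).
    have -> : u / v = 1 + (u - v) / v by field; exact: lt0r_neq0.
    by apply: le_ln1Dx; rewrite mulrBl divff ?gt_eqF// ltrBrDl subrr divr_gt0.
  apply: (@le_trans _ _ (`|u - v| / v)); first by rewrite ler_pM2r ?invr_gt0// ler_norm.
  by rewrite ler_wpM2l// lef_pV2 ?posrE.
move=> cx cy; rewrite ler_norml; apply/andP; split; last exact: h.
by have := h y x cy cx; rewrite distrC; lra.
Qed.

Lemma ln_mean_gap h a m : linear_between h ->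
  `|ln (nsum h a m.+1 / m.+1%:R) - ln (lim_mass h)| <= Cf / c0 * wdist p w a m.
Proof.
move=> hl; apply: le_trans (ln_lipschitz (nsum_mean_ge a m hl) (lim_mass_ge hl)) _.
by rewrite mulrAC ler_pM2r ?invr_gt0// mean_gap.
Qed.

End Bounds.
End UniformGaps.

Section DominatedContinuity.
Variables (R : realType) (V : normedModType R) (Theta : set V) (q D : nat -> R).
Hypothesis q_ge0 : forall k, (0 < k)%N -> 0 <= q k.
Hypothesis Dq_summable : summable1 (fun k => D k * q k).

(** The domination holds on [Theta] only, so the sum is continuous relative to [Theta], although
    each term is continuous at [x] in the whole space. *)
Lemma dominated_sum_continuous (g : V -> nat -> R) (x : V) (e : R) : Theta x ->
  (forall y k, Theta y -> (0 < k)%N -> `|g y k| <= D k) ->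
  (forall k, (0 < k)%N -> {for x, continuous (g^~ k)}) -> 0 < e ->
  exists2 r : R, 0 < r & forall y, Theta y -> `|y - x| < r ->
    `|\sum_(1 <= k <oo) g y k * q k - \sum_(1 <= k <oo) g x k * q k| <= e.
Proof.
move=> Tx gD gc e0; have e3 : 0 < e / 3 by lra.
have gqD y k : Theta y -> (0 < k)%N -> `|g y k * q k| <= D k * q k.
  by move=> Ty k0; rewrite normrM (ger0_norm (q_ge0 k0)) ler_wpM2r ?q_ge0// gD.
have Dq0 k : (0 < k)%N -> 0 <= D k * q k.
  by move=> k0; apply: le_trans (gqD x k Tx k0).
have [K hK] := ge0_tail_cut Dq0 Dq_summable e3.
have tail y : Theta y -> `|\sum_(1 <= k <oo) g y k * q k - \sum_(1 <= k < K.+1) g y k * q k| <= e / 3.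
  move=> Ty; have sy : summable1 (fun k => g y k * q k).
    by apply: (le_summable1 _ Dq_summable) => k k0; exact: gqD.
  have lim1 : (fun n => `|\sum_(1 <= k < n) g y k * q k - \sum_(1 <= k < K.+1) g y k * q k|) @ \oo -->
     `|\sum_(1 <= k <oo) g y k * q k - \sum_(1 <= k < K.+1) g y k * q k|.
    by apply: cvg_norm; apply: cvgB; [exact: sy|exact: cvg_cst].
  rewrite -(cvg_lim (@Rhausdorff _) lim1); apply: limr_le.
    by apply/cvg_ex; eexists; exact: lim1.
  near=> n; have Kn : (K.+1 <= n)%N by near: n; exact: nbhs_infty_ge.
  rewrite (@big_cat_nat _ _ _ K.+1)//= addrAC subrr add0r.
  apply: le_trans (ler_norm_sum _ _ _) _; apply: le_trans (hK K.+1 n (leqnSn K)).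
  apply: ler_sum_nat => k /andP[Kk _]; apply: gqD => //; exact: leq_trans Kk.
have : {for x, continuous (fun y => \sum_(1 <= k < K.+1) g y k * q k)}.
  elim: K.+1 => [|n IH].
    have -> : (fun y => \sum_(1 <= k < 0) g y k * q k) = (fun=> 0).
      by apply/funext => y; rewrite big_geq.
    exact: cvg_cst.
  case: n IH => [|n] IH.
    have -> : (fun y => \sum_(1 <= k < 1) g y k * q k) = (fun=> 0).
      by apply/funext => y; rewrite big_geq.
    exact: cvg_cst.
  have -> : (fun y => \sum_(1 <= k < n.+2) g y k * q k) =
     (fun y => \sum_(1 <= k < n.+1) g y k * q k + g y n.+1 * q n.+1).
    by apply/funext => y; rewrite big_nat_recr.
  by apply: cvgD => //; apply: cvgM; [exact: gc|exact: cvg_cst].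
move=> /cvgrPdist_lt/(_ _ e3)/nbhs_ballP[r /= r0 hr]; exists r => // y Ty yx.
have h1 := tail y Ty; have h2 := tail x Tx.
have h3 : `|\sum_(1 <= k < K.+1) g x k * q k - \sum_(1 <= k < K.+1) g y k * q k| < e / 3.
  by apply: hr; rewrite -ball_normE /ball_/= distrC.
move: h1 h2 h3; move: (\sum_(1 <= k <oo) g y k * q k) (\sum_(1 <= k < K.+1) g y k * q k)
  (\sum_(1 <= k <oo) g x k * q k) (\sum_(1 <= k < K.+1) g x k * q k) => A B A' B'.
rewrite ler_norml => /andP[a1 a2]; rewrite ler_norml => /andP[b1 b2].
by rewrite ltr_norml => /andP[c1 c2]; rewrite ler_norml; apply/andP; split; lra.
Unshelve. all: by end_near. Qed.

End DominatedContinuity.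

(** * Expansion of the score *)

Section Compactness.
Variables (R : realType) (V : normedModType R) (Theta : set V).
Hypothesis Theta_compact : compact Theta.

Lemma compact_norm_bound (g : V -> R) : (forall x, Theta x -> {for x, continuous g}) ->
  exists2 M : R, 0 <= M & forall x, Theta x -> `|g x| <= M.
Proof.
move=> cg; have /compact_near_coveringP := Theta_compact.
move=> /(_ R (pinfty_nbhs R) (fun M x => `|g x| <= M) _); case.
  move=> x Tx; have /cvgrPdist_lt/(_ 1 ltr01)/nbhs_ballP[r /= r0 hr] := cg x Tx.
  exists (ball x r, [set M | `|g x| + 1 < M]) => /=.
    by split; [exact: nbhsx_ballx|apply: nbhs_pinfty_gt; rewrite num_real].
  move=> [y M] /= [yr My]; have := hr y yr.
  move=> h; have -> : g y = g x - (g x - g y) by ring.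
  by apply: le_trans (ler_normB _ _) _; lra.
move=> M [Mr hM]; exists (`|M| + 1); first by rewrite addr_ge0.
by apply: hM; apply: le_lt_trans (ler_norm M) _; rewrite ltrDl.
Qed.

(** As [g] is continuous relative to [Theta] only, half of its value at each point is spread to a
    neighbourhood, and compactness makes the bound uniform. *)
Lemma compact_negative_bound (g : V -> R) (F : set V) : closed F ->
  (forall x, Theta x -> F x -> g x < 0) ->
  (forall x (e : R), Theta x -> 0 < e -> exists2 r : R, 0 < r &
     forall y, Theta y -> `|y - x| < r -> `|g y - g x| <= e) ->
  exists2 k : R, 0 < k & forall x, Theta x -> F x -> g x <= - k.
Proof.
move=> Fc g0 gc; have cK : compact (Theta `&` F) by exact: compact_closedI.
have /compact_near_coveringP := cK.
move=> /(_ R (nbhs (0 : R)^'+) (fun k x => Theta x -> F x -> g x <= - k) _); case.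
  move=> x [Tx Fx]; have gx := g0 x Tx Fx.
  have gx2 : 0 < - g x / 2 by lra.
  have [r r0 hr] := gc x (- g x / 2) Tx gx2.
  exists (ball x r, [set k | k < - g x / 2]) => /=.
    by split; [exact: nbhsx_ballx|exact: nbhs_right_lt].
  move=> [y k] /= [yr ky] Ty Fy.
  have : `|y - x| < r by move: yr; rewrite -ball_normE /ball_/= distrC.
  by move=> /(hr y Ty); rewrite ler_norml => /andP[_]; lra.
move=> r0 /= r00 hr; exists (r0 / 2); first by rewrite divr_gt0.
move=> x Tx Fx; apply: (hr (r0 / 2) _ _ x) => //=.
- by rewrite sub0r normrN gtr0_norm ?divr_gt0//; lra.
- by rewrite divr_gt0.
Qed.

End Compactness.

Section Segments.
Variables (R : realType) (d : nat).
Implicit Types (g : 'rV[R]_d -> R) (x h : 'rV[R]_d).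

Lemma mean_value_01 (phi dphi : R -> R) :
  (forall s : R, 0 <= s <= 1 -> is_derive s 1 phi (dphi s)) ->
  exists2 s : R, 0 <= s <= 1 & phi 1 - phi 0 = dphi s.
Proof.
move=> dE; have [||s] := @MVT_segment R phi dphi 0 1 ler01.
- by move=> x; rewrite in_itv/= => /andP[x0 x1]; apply: dE; rewrite !ltW.
- apply: derivable_within_continuous => x; rewrite in_itv/= => x01.
  by have [] := dE x x01.
by rewrite in_itv/= subr0 mulr1 => s01 ->; exists s.
Qed.

Lemma derive_sum_partial g x h : differentiable g x ->
  'D_h g x = \sum_j h 0 j * partial g j x.
Proof.
move=> dg; rewrite deriveE//.
have {1}-> : h = \sum_j h 0 j *: delta_mx 0 j by exact: row_sum_delta.
rewrite linear_sum; apply: eq_bigr => j _.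
by rewrite linearZ /partial deriveE.
Qed.

Lemma is_derive_segment g x h (s : R) : differentiable g (x + s *: h) ->
  is_derive s 1 (fun t : R => g (x + t *: h)) (\sum_j h 0 j * partial g j (x + s *: h)).
Proof.
move=> dg; have dh : derivable g (x + s *: h) h by exact: diff_derivable.
have e : (fun t : R => t^-1 *: (((fun t => g (x + t *: h)) \o shift s) (t *: 1) - g (x + s *: h))) =
    (fun t : R => t^-1 *: ((g \o shift (x + s *: h)) (t *: h) - g (x + s *: h))).
  apply/funext => t /=; congr (_ *: (g _ - _)).
  have -> : t%:A = t :> R by rewrite /GRing.scale/= mulr1.
  by rewrite scalerDl addrCA.
apply: DeriveDef.
  by rewrite /derivable e.
by rewrite -derive_sum_partial// /derive e.
Qed.

End Segments.

Section PointwiseContinuity.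
Variables (R : realType) (V : normedModType R) (x : V).
Implicit Types g h : V -> R.

Lemma continuous_at_inv g : g x != 0 -> {for x, continuous g} ->
  {for x, continuous (fun y => (g y)^-1)}.
Proof. by move=> gx cg; apply: cvgV. Qed.

Lemma continuous_at_mul g h : {for x, continuous g} -> {for x, continuous h} ->
  {for x, continuous (fun y => g y * h y)}.
Proof. by move=> cg ch; apply: cvgM. Qed.

Lemma continuous_at_sub g h : {for x, continuous g} -> {for x, continuous h} ->
  {for x, continuous (fun y => g y - h y)}.
Proof. by move=> cg ch; apply: cvgB. Qed.

End PointwiseContinuity.

(** * Regularity and growth of the family *)

Section Family.
Variables (R : realType) (d : nat) (Theta : set 'rV[R]_d) (f : 'rV[R]_d -> nat -> R).
Hypothesis Theta_compact : compact Theta.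
Hypothesis f_gt0 : forall theta k, Theta theta -> (0 < k)%N -> 0 < f theta k.
Hypothesis f_nondecreasing : forall theta k l, Theta theta ->
  (0 < k)%N -> (k <= l)%N -> f theta k <= f theta l.
Hypothesis f_C2 : forall k, (0 < k)%N -> C2_on Theta (fun theta => f theta k).

Definition lratio theta k i : R := (f theta k)^-1 * partial (f^~ k) i theta.
Definition lratio2 theta k i j : R :=
  (f theta k)^-1 * partial (partial (f^~ k) j) i theta.

Section Regularity.
Variables (theta : 'rV[R]_d) (k : nat).
Hypotheses (theta_in : Theta theta) (k_gt0 : (0 < k)%N).

Lemma f_differentiable : differentiable (f^~ k) theta.
Proof. by have [U [_ TU df _ _]] := f_C2 k_gt0; exact/df/TU. Qed.

Lemma partial_differentiable i : differentiable (partial (f^~ k) i) theta.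
Proof. by have [U [_ TU _ df _]] := f_C2 k_gt0; exact/df/TU. Qed.

Lemma partial2_continuous i j : {for theta, continuous (partial (partial (f^~ k) j) i)}.
Proof. by have [U [_ TU _ _ cf]] := f_C2 k_gt0; exact/cf/TU. Qed.

Lemma f_continuous : {for theta, continuous (f^~ k)}.
Proof. exact/differentiable_continuous/f_differentiable. Qed.

Let finv_continuous : {for theta, continuous (fun y => (f y k)^-1)}.
Proof.
by apply: (@continuous_at_inv R 'rV[R]_d); [rewrite gt_eqF// f_gt0|exact: f_continuous].
Qed.

Lemma lratio_continuous i : {for theta, continuous (fun y => lratio y k i)}.
Proof.
apply: (@continuous_at_mul R 'rV[R]_d); first exact: finv_continuous.
exact/differentiable_continuous/partial_differentiable.
Qed.

Lemma lratio2_continuous i j : {for theta, continuous (fun y => lratio2 y k i j)}.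
Proof.
by apply: (@continuous_at_mul R 'rV[R]_d); [exact: finv_continuous|exact: partial2_continuous].
Qed.

Lemma ln_f_continuous : {for theta, continuous (fun y => ln (f y k))}.
Proof.
apply: continuous_comp; first exact: f_continuous.
by apply: continuous_ln; rewrite f_gt0.
Qed.

End Regularity.

(** beta and alpha vary with theta, so a linear upper bound is what is uniform; alpha is recovered
    from f(1) = 1 + alpha, which compactness bounds. The lower bound comes from f(1) and
    monotonicity. *)
Lemma family_between (C : R) : 0 < C ->
  (forall theta, Theta theta ->
     (exists2 beta : R, beta < 1 & forall k, (0 < k)%N -> f theta k <= C * k%:R `^ beta) \/
     (exists2 alpha : R, -1 < alpha & forall k, (0 < k)%N -> f theta k = k%:R + alpha)) ->
  exists c0 Cf : R, [/\ 0 < c0, 0 <= Cf &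
    forall theta, Theta theta -> linear_between c0 Cf (f theta)].
Proof.
move=> C0 growth.
have [M M0 hM] := compact_norm_bound Theta_compact
  (fun x (Tx : Theta x) => f_continuous Tx (ltn0Sn 0)).
have [M' M'0 hM'] : exists2 M : R, 0 <= M & forall x, Theta x -> `|(f x 1%N)^-1| <= M.
  apply: (compact_norm_bound Theta_compact) => x Tx.
  by apply: (@continuous_at_inv R 'rV[R]_d); [rewrite gt_eqF// f_gt0|exact: f_continuous].
exists (M' + 1)^-1, (C + M + 1); split; first by rewrite invr_gt0; lra.
  lra.
move=> theta Tt k k0; apply/andP; split.
  apply: le_trans (f_nondecreasing Tt (ltn0Sn 0) k0).
  have f1 := f_gt0 Tt (ltn0Sn 0).
  rewrite -[leRHS]invrK lef_pV2 ?posrE ?invr_gt0//; last by lra.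
  by have := hM' theta Tt; have := ler_norm (f theta 1%N)^-1; lra.
have k1 : 1 <= (k%:R : R) by rewrite ler1n.
case: (growth theta Tt) => [[beta b1 hb]|[alpha a1 ha]].
  apply: le_trans (hb k k0) _.
  apply: (@le_trans _ _ (C * k%:R)).
    by rewrite ler_pM2l// -[leRHS](@powRr1 _ k%:R)// ler_powR// ltW.
  by rewrite ler_wpM2r//; lra.
have := hM theta Tt; rewrite (ha 1%N)// (ha k)// => h.
have : 1 + alpha <= M by apply: le_trans h; exact: ler_norm.
have : 0 <= C * k%:R by rewrite mulr_ge0// ltW.
have : M <= M * k%:R by rewrite ler_peMr.
rewrite !mulrDl mul1r; lra.
Qed.

(** At k = 1 the logarithm vanishes and the growth hypothesis is silent; the bound there comes from
    continuity and compactness. *)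
Lemma lratio_bound (b : nat -> R) (gamma C' Cb : R) :
  (forall k, (0 < k)%N -> 1 <= b k) -> 0 < Cb -> 0 < C' ->
  (forall k, (0 < k)%N -> ln k%:R `^ gamma <= Cb * b k) ->
  (forall theta k, Theta theta -> (2 <= k)%N ->
     `|(f theta k)^-1 *: fdot f theta k| + `|(f theta k)^-1 *: fddot f theta k|
       <= C' * ln k%:R `^ gamma) ->
  exists2 Cg : R, 0 <= Cg & forall theta k, Theta theta -> (0 < k)%N ->
    (forall i, `|lratio theta k i| <= Cg * b k) /\
    (forall i j, `|lratio2 theta k i j| <= Cg * b k).
Proof.
move=> b1 Cb0 C'0 lnb fb.
have /choice[M1 hM1] : forall i : 'I_d, exists M : R, 0 <= M /\
    forall x, Theta x -> `|lratio x 1 i| <= M.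
  move=> i; have [|M M0 hM] := compact_norm_bound Theta_compact (g := fun x => lratio x 1 i).
    by move=> x Tx; exact: lratio_continuous.
  by exists M.
have /choice[M2 hM2] : forall ij : 'I_d * 'I_d, exists M : R, 0 <= M /\
    forall x, Theta x -> `|lratio2 x 1 ij.1 ij.2| <= M.
  move=> [i j]; have [|M M0 hM] := compact_norm_bound Theta_compact (g := fun x => lratio2 x 1 i j).
    by move=> x Tx; exact: lratio2_continuous.
  by exists M.
pose S := \sum_i M1 i + \sum_ij M2 ij.
have S1 i : M1 i <= S.
  rewrite /S (bigD1 i)//= -addrA lerDl addr_ge0// sumr_ge0// => j _.
    by have [] := hM1 j.
  by have [] := hM2 j.
have S2 ij : M2 ij <= S.
  rewrite /S [X in _ + X](bigD1 ij)//= addrCA lerDl addr_ge0// sumr_ge0// => j _.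
    by have [] := hM1 j.
  by have [] := hM2 j.
have S0 : 0 <= S by rewrite addr_ge0// sumr_ge0// => j _; [have [] := hM1 j|have [] := hM2 j].
have Cg0 : 0 <= C' * Cb by rewrite mulr_ge0// ltW.
exists (S + C' * Cb); first by rewrite addr_ge0.
move=> theta [//|[|k]] Tt _.
  have h (x : R) : x <= S -> x <= (S + C' * Cb) * b 1%N.
    by move=> xS; have := ler_wpM2l (addr_ge0 S0 Cg0) (b1 1%N isT); lra.
  split=> [i|i j]; apply: h.
    by have [_ h] := hM1 i; exact: le_trans (h _ Tt) (S1 i).
  by have [_ h] := hM2 (i, j); exact: le_trans (h _ Tt) (S2 (i, j)).
have := fb theta k.+2 Tt isT; set A := (X in `|X| + _ <= _); set B := (X in _ + `|X| <= _) => h.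
have {}h : `|A| + `|B| <= (S + C' * Cb) * b k.+2.
  apply: le_trans h _; apply: (@le_trans _ _ (C' * Cb * b k.+2)).
    by rewrite -mulrA ler_pM2l// lnb.
  by rewrite ler_wpM2r ?(le_trans _ (b1 k.+2 isT))//; lra.
split=> [i|i j].
  have := mx_coord_le A 0 i; rewrite !mxE => h1; apply: le_trans h1 _.
  by have := normr_ge0 B; lra.
have := mx_coord_le B i j; rewrite !mxE => h1; apply: le_trans h1 _.
by have := normr_ge0 A; lra.
Qed.

End Family.

Section WithinContinuity.
Variables (R : realType) (V : normedModType R) (Theta : set V) (x : V).

Lemma within_cvgP (F : V -> R) : F @ within Theta (nbhs x) --> F x <->
  (forall e : R, 0 < e -> exists2 r : R, 0 < r & forall y, Theta y -> `|y - x| < r ->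
    `|F y - F x| <= e).
Proof.
split=> [/cvgrPdist_le h e e0|h].
  have /nbhs_ballP[r /= r0 hr] : \forall y \near x, Theta y -> `|F x - F y| <= e by exact: h.
  exists r => // y Ty yx; rewrite distrC; apply: hr => //.
  by rewrite -ball_normE /ball_/= distrC.
apply/cvgrPdist_le => e e0; have [r r0 hr] := h e e0.
apply/nbhs_ballP; exists r => //= y.
by rewrite -ball_normE /ball_/= distrC => yx Ty; rewrite distrC; exact: hr.
Qed.

Lemma within_cvg_forall (I : finType) (F : I -> V -> R) :
  (forall i, F i @ within Theta (nbhs x) --> F i x) ->
  forall e : R, 0 < e -> exists2 r : R, 0 < r & forall y, Theta y -> `|y - x| < r ->
    forall i, `|F i y - F i x| <= e.
Proof.
move=> cF e e0.
have /choice[r hr] : forall i, exists r : R, 0 < r /\ forall y, Theta y -> `|y - x| < r ->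
    `|F i y - F i x| <= e.
  by move=> i; have /within_cvgP/(_ e e0)[r r0 hr] := cF i; exists r.
have r0 : 0 < \big[Num.min/1]_i r i.
  by apply/bigmin_gtP; split=> // i _; have [] := hr i.
exists (\big[Num.min/1]_i r i) => // y Ty yx i; have [_] := hr i; apply=> //.
by apply: lt_le_trans yx _; exact: bigmin_le_cond.
Qed.

End WithinContinuity.

Section MatrixSeries.
Variable R : realType.

Lemma cvg_mx m n (u : nat -> 'M[R]_(m, n)) (l : 'M[R]_(m, n)) :
  (forall i j, (fun N => u N i j) @ \oo --> l i j) -> u @ \oo --> l.
Proof.
move=> ul; apply/cvgrPdist_le => e e0.
have /choice[K hK] : forall ij : 'I_m * 'I_n, exists K, forall N, (K <= N)%N ->
    `|l ij.1 ij.2 - u N ij.1 ij.2| <= e.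
  by move=> [i j]; have /cvgrPdist_le/(_ e e0)[K _ h] := ul i j; exists K => N; exact: h.
exists (\max_ij K ij)%N => // N /= KN; apply: mx_norm_ler; first exact: ltW.
move=> i j; rewrite !mxE; apply: (hK (i, j)); apply: leq_trans KN.
exact: leq_bigmax.
Qed.

Lemma sum1_mxE m n (M : nat -> 'M[R]_(m, n)) i j :
  (forall i j, summable1 (fun k => M k i j)) ->
  (\sum_(1 <= k <oo) M k) i j = \sum_(1 <= k <oo) M k i j.
Proof.
move=> sM; have h : (fun N => \sum_(1 <= k < N) M k) @ \oo -->
    (\matrix_(i, j) (\sum_(1 <= k <oo) M k i j) : 'M[R]_(m, n)).
  apply: cvg_mx => i' j'; rewrite mxE; under eq_fun do rewrite summxE.
  exact: sM.
by rewrite (cvg_lim (@norm_hausdorff _ _) h) mxE.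
Qed.

End MatrixSeries.

Section QuotientDerivative.
Variable R : realType.
Implicit Types (F G : R -> R) (s : R).

Lemma is_derive_quotient F G (dF dG s : R) : is_derive s 1 F dF -> is_derive s 1 G dG ->
  F s != 0 -> is_derive s 1 (fun t => (F t)^-1 * G t)
    ((F s)^-1 * dG - ((F s)^-1 * G s) * ((F s)^-1 * dF)).
Proof.
move=> hF hG Fs; have hV := is_deriveV Fs hF.
by apply: is_derive_eq; rewrite /GRing.scale/=; field.
Qed.

Lemma is_derive_bigsum n (h : 'I_n -> R -> R) (dh : 'I_n -> R) s :
  (forall i, is_derive s 1 (h i) (dh i)) ->
  is_derive s 1 (fun t => \sum_i h i t) (\sum_i dh i).
Proof.
by move=> hd; have := is_derive_sum hd; rewrite fct_sumE.
Qed.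

Lemma is_derive_scale (c : R) F (dF s : R) : is_derive s 1 F dF ->
  is_derive s 1 (fun t => c * F t) (c * dF).
Proof. by move=> hF; apply: is_derive_eq; rewrite /GRing.scale/=; ring. Qed.

Lemma is_derive_minus F G (dF dG s : R) : is_derive s 1 F dF -> is_derive s 1 G dG ->
  is_derive s 1 (fun t => F t - G t) (dF - dG).
Proof. by move=> hF hG; apply: is_derive_eq. Qed.

End QuotientDerivative.

(** * Derivative of the score and its limit *)

Section ScoreExpansion.
Variables (R : realType) (d : nat) (Theta : set 'rV[R]_d) (f : 'rV[R]_d -> nat -> R).
Hypothesis f_gt0 : forall theta k, Theta theta -> (0 < k)%N -> 0 < f theta k.
Hypothesis f_C2 : forall k, (0 < k)%N -> C2_on Theta (fun theta => f theta k).
Variables (b : nat -> R) (lam c0 Cf Cg : R) (theta0 : 'rV[R]_d).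
Hypothesis theta0_in : Theta theta0.
Hypothesis c0_gt0 : 0 < c0.
Hypothesis Cf_ge0 : 0 <= Cf.
Hypothesis Cg_ge0 : 0 <= Cg.
Hypothesis f_between : forall theta, Theta theta -> linear_between c0 Cf (f theta).
Hypothesis ratio_bound : forall theta k, Theta theta -> (0 < k)%N ->
  (forall i, `|lratio f theta k i| <= Cg * b k) /\
  (forall i j, `|lratio2 f theta k i j| <= Cg * b k).
Hypothesis b_ge1 : forall k, (0 < k)%N -> 1 <= b k.
Hypothesis b_nd : forall k l, (0 < k)%N -> (k <= l)%N -> b k <= b l.
Hypothesis lam_gt0 : 0 < lam.
Hypothesis surv_sum :
  (fun n => \sum_(1 <= k < n) surv (f theta0) lam k) @ \oo --> (1 : R).
Let f0 := f theta0.
Let p := pdist f0 lam.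
Let q := surv f0 lam.
Let w k : R := k%:R * b k ^+ 3.
Hypothesis wp_summable : summable1 (fun k => w k * p k).
Implicit Types (a : attachments) (m : nat) (theta h : 'rV[R]_d).

Let f0_gt0 k : (0 < k)%N -> 0 < f0 k. Proof. by move=> k0; exact: f_gt0. Qed.
Let p_gt0 k : (0 < k)%N -> 0 < p k. Proof. by move=> k0; exact: pdist_gt0. Qed.
Let w_ge0 k : (0 < k)%N -> 0 <= w k.
Proof. by move=> k0; rewrite mulr_ge0// exprn_ge0// (le_trans _ (b_ge1 k0)). Qed.
Let p_sum : (fun n => \sum_(1 <= k < n) p k) @ \oo --> (1 : R).
Proof. exact: pdist_cvg1. Qed.

(** The present error is for the sums over chosen degrees, the mean of the past errors for the
    conditional means at each step, and 1 / (m + 1) arises because [m] terms are divided by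
    [m.+1]. *)
Definition errbar a m : R := wdist p w a m
  + m.+1%:R^-1 * \sum_(t < m) wdist p w a t + m.+1%:R^-1.

Lemma errbar_ge0 a m : 0 <= errbar a m.
Proof.
by rewrite !addr_ge0 ?mulr_ge0 ?invr_ge0 ?sumr_ge0// => *; exact: wdist_ge0.
Qed.

Lemma wdist_le_errbar a m : wdist p w a m <= errbar a m.
Proof.
rewrite /errbar -addrA lerDl addr_ge0 ?mulr_ge0 ?invr_ge0 ?sumr_ge0// => *.
exact: wdist_ge0.
Qed.

Lemma mean_le_errbar (u : nat -> R) (l K : R) a m : 0 <= K ->
  `|l| <= K -> (forall t, `|u t - l| <= K * wdist p w a t) ->
  `|m.+1%:R^-1 * \sum_(t < m) u t - l| <= K * errbar a m.
Proof.
move=> K0 lK ul; have n0 : 0 < (m.+1%:R : R) by rewrite ltr0n.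
have -> : m.+1%:R^-1 * \sum_(t < m) u t - l =
    m.+1%:R^-1 * \sum_(t < m) (u t - l) - m.+1%:R^-1 * l.
  rewrite sumrB sumr_const card_ord mulrBr -mulr_natl -(natr1 m).
  by field; rewrite natr1 gt_eqF.
apply: le_trans (ler_normB _ _) _.
rewrite !normrM normfV (gtr0_norm n0) /errbar mulrDr mulrDr; apply: lerD; last first.
  by rewrite mulrC ler_wpM2r ?invr_ge0// ltW.
apply: (@le_trans _ _ (K * (m.+1%:R^-1 * \sum_(t < m) wdist p w a t))); last first.
  by rewrite lerDr mulr_ge0//; exact: wdist_ge0.
rewrite mulrCA ler_wpM2l ?invr_ge0 ?(ltW n0)// mulr_sumr.
by apply: le_trans (ler_norm_sum _ _ _) _; exact: ler_sum.
Qed.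

(** Minus the observed information: the derivative in direction [j] of coordinate [i] of the
    score. *)
Definition info_emp theta i j a m : R := m.+1%:R^-1 * \sum_(t < m)
  (lratio2 f theta (chosen a t) j i
   - lratio f theta (chosen a t) i * lratio f theta (chosen a t) j
   - (ratio (f theta) (fun k => lratio2 f theta k j i) a t
      - ratio (f theta) (fun k => lratio f theta k i) a t
        * ratio (f theta) (fun k => lratio f theta k j) a t)).

Definition info_lim theta i j : R :=
  \sum_(1 <= k <oo) (lratio2 f theta k j i - lratio f theta k i * lratio f theta k j) * q k
  - (lim_ratio p (f theta) (fun k => lratio2 f theta k j i)
     - lim_ratio p (f theta) (fun k => lratio f theta k i)
       * lim_ratio p (f theta) (fun k => lratio f theta k j)).

Let hess_bound theta k i j : Theta theta -> (0 < k)%N ->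
  `|lratio2 f theta k j i - lratio f theta k i * lratio f theta k j| <= (Cg + Cg ^+ 2) * b k ^+ 2.
Proof.
move=> Tt k0; have [h1 h2] := ratio_bound Tt k0; have b1 := b_ge1 k0.
apply: le_trans (ler_normB _ _) _; rewrite mulrDl; apply: lerD.
  by apply: le_trans (h2 _ _) _; rewrite ler_wpM2l// expr2 ler_peMr//; lra.
by rewrite normrM -exprMn expr2 ler_pM.
Qed.

Lemma info_gap : exists2 K : R, 0 <= K & forall theta i j a m, Theta theta ->
  `|info_emp theta i j a m - info_lim theta i j| <= K * errbar a m.
Proof.
have [K1 K10 hK1] := ratio_gap p_gt0 p_sum b_ge1 wp_summable c0_gt0 Cf_ge0 Cg_ge0.
have [K2 K20 hK2] := ratio_prod_gap p_gt0 p_sum b_ge1 wp_summable c0_gt0 Cf_ge0 Cg_ge0.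
have K3 : 0 <= Cg + Cg ^+ 2 by rewrite addr_ge0// sqr_ge0.
exists (Cg + Cg ^+ 2 + (K1 + K2)); first by apply: addr_ge0 => //; exact: addr_ge0.
move=> theta i j a m Tt.
have rb k : (0 < k)%N -> forall i, `|lratio f theta k i| <= Cg * b k.
  by move=> k0 i'; have [h1 _] := ratio_bound Tt k0.
have rb2 k : (0 < k)%N -> `|lratio2 f theta k j i| <= Cg * b k ^+ 2.
  move=> k0; have [_ h2] := ratio_bound Tt k0; have b1 := b_ge1 k0.
  by apply: le_trans (h2 _ _) _; rewrite ler_wpM2l// expr2 ler_peMr//; lra.
have [l1 g1] := hK1 _ _ (f_between Tt) rb2.
have [l2 g2] := hK2 _ _ _ (f_between Tt) (fun k k0 => rb k k0 i) (fun k k0 => rb k k0 j).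
have h1 := choice_mean_gap f0_gt0 b_ge1 b_nd lam_gt0 surv_sum wp_summable a m
  (fun k k0 => hess_bound i j Tt k0).
have h2 := @mean_le_errbar (fun t => ratio (f theta) (fun k => lratio2 f theta k j i) a t
      - ratio (f theta) (fun k => lratio f theta k i) a t
        * ratio (f theta) (fun k => lratio f theta k j) a t)
   (lim_ratio p (f theta) (fun k => lratio2 f theta k j i)
     - lim_ratio p (f theta) (fun k => lratio f theta k i)
       * lim_ratio p (f theta) (fun k => lratio f theta k j)) (K1 + K2) a m.
rewrite /info_emp sumrB mulrBr /info_lim opprD addrACA -opprD.
apply: le_trans (ler_normB _ _) _; rewrite mulrDl; apply: lerD.
  by apply: le_trans h1 _; rewrite ler_wpM2l// wdist_le_errbar.
apply: h2; first exact: addr_ge0.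
  by apply: le_trans (ler_normB _ _) _; exact: lerD.
move=> t; rewrite opprD addrACA -opprD mulrDl.
by apply: le_trans (ler_normB _ _) _; apply: lerD.
Qed.

Lemma lim_mass_truth : lim_mass p f0 = lam.
Proof.
rewrite /lim_mass (@eq_sum1 _ _ _ (fun k => lam * q k)); last by move=> k; exact: f_pdist.
have h : summable1 q by apply/cvg_ex; exists 1; exact: surv_sum.
by rewrite sum1Z// (cvg_lim (@Rhausdorff _) surv_sum) mulr1.
Qed.

Lemma lim_ratio0 g Cg' : (forall k, (0 < k)%N -> `|g k| <= Cg' * b k ^+ 2) ->
  lim_ratio p f0 g = \sum_(1 <= k <oo) g k * q k.
Proof.
move=> gC; rewrite /lim_ratio lim_mass_truth /lim_mass.
rewrite (@eq_sum1 _ _ _ (fun k => lam * (g k * q k))); last first.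
  by move=> k k0; rewrite [f0 k * _]mulrC -mulrA f_pdist// mulrCA.
have h : summable1 (fun k => g k * q k).
  by exact: (choice_summable f0_gt0 b_ge1 b_nd lam_gt0 surv_sum wp_summable gC).
by rewrite sum1Z// mulrC mulKf// gt_eqF.
Qed.

Lemma score_coord theta a m i : score f a m.+1 theta 0 i = m.+1%:R^-1 * \sum_(t < m)
  (lratio f theta (chosen a t) i
   - (nsum (f theta) a t.+1)^-1 * nsum (fun k => partial (f^~ k) i theta) a t.+1).
Proof.
rewrite scoreE mxE summxE; congr (_ * _); apply: eq_bigr => t _.
rewrite !mxE /lratio; congr (_ - _ * _).
by rewrite /nsum summxE; apply: eq_bigr => j _; rewrite mxE.
Qed.

Lemma nsum_lratio theta a t i : Theta theta ->
  nsum (fun k => partial (f^~ k) i theta) a t = nsum (fun k => f theta k * lratio f theta k i) a t.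
Proof.
by move=> Tt; apply: eq_nsum_fun => k k0; rewrite /lratio mulVKf// gt_eqF// f_gt0.
Qed.

Lemma nsum_lratio2 theta a t i j : Theta theta ->
  nsum (fun k => partial (partial (f^~ k) j) i theta) a t =
  nsum (fun k => f theta k * lratio2 f theta k i j) a t.
Proof.
by move=> Tt; apply: eq_nsum_fun => k k0; rewrite /lratio2 mulVKf// gt_eqF// f_gt0.
Qed.

Lemma score_derivative x h (s : R) a m i : Theta (x + s *: h) ->
  is_derive s 1 (fun t : R => score f a m.+1 (x + t *: h) 0 i)
    (\sum_j h 0 j * info_emp (x + s *: h) i j a m).
Proof.
move=> Ts; set th := x + s *: h in Ts *.
have -> : (fun t : R => score f a m.+1 (x + t *: h) 0 i) = (fun t : R => m.+1%:R^-1 * \sum_(j < m)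
  (lratio f (x + t *: h) (chosen a j) i
   - (nsum (f (x + t *: h)) a j.+1)^-1 * nsum (fun k => partial (f^~ k) i (x + t *: h)) a j.+1)).
  by apply/funext => t; rewrite score_coord.
have dF k : (0 < k)%N -> is_derive s 1 (fun t : R => f (x + t *: h) k)
    (\sum_j h 0 j * partial (f^~ k) j th).
  by move=> k0; apply: (is_derive_segment (g := f^~ k)); exact: (f_differentiable f_C2).
have dG k : (0 < k)%N -> is_derive s 1 (fun t : R => partial (f^~ k) i (x + t *: h))
    (\sum_j h 0 j * partial (partial (f^~ k) i) j th).
  by move=> k0; apply: (is_derive_segment (g := partial (f^~ k) i)); exact: (partial_differentiable f_C2).
have dN (g : 'rV[R]_d -> nat -> R) (dg : nat -> R) n : (forall k, (0 < k)%N ->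
    is_derive s 1 (fun t : R => g (x + t *: h) k) (dg k)) ->
    is_derive s 1 (fun t : R => nsum (g (x + t *: h)) a n) (nsum dg a n).
  by move=> dgk; apply: is_derive_bigsum => l; exact: dgk.
have fne k : (0 < k)%N -> f (x + s *: h) k != 0 by move=> k0; rewrite gt_eqF// f_gt0.
have nne t : nsum (f (x + s *: h)) a t.+1 != 0.
  by rewrite gt_eqF// nsum_gt0// => k k0; exact: f_gt0.
have lincomb (g : 'I_d -> nat -> R) n :
    nsum (fun k => \sum_j h 0 j * g j k) a n = \sum_j h 0 j * nsum (g j) a n.
  by rewrite /nsum exchange_big; apply: eq_bigr => j _; rewrite mulr_sumr.
have term (t : 'I_m) : is_derive s 1 (fun u : R => lratio f (x + u *: h) (chosen a t) i
      - (nsum (f (x + u *: h)) a t.+1)^-1 * nsum (fun k => partial (f^~ k) i (x + u *: h)) a t.+1)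
    (\sum_j h 0 j * (lratio2 f th (chosen a t) j i
       - lratio f th (chosen a t) i * lratio f th (chosen a t) j
       - (ratio (f th) (fun k => lratio2 f th k j i) a t
          - ratio (f th) (fun k => lratio f th k i) a t
            * ratio (f th) (fun k => lratio f th k j) a t))).
  have D1 := is_derive_quotient (dF (chosen a t) (deg_gt0 _ _ _)) (dG (chosen a t) (deg_gt0 _ _ _))
    (fne _ (deg_gt0 _ _ _)).
  have D2 := is_derive_quotient (dN _ _ t.+1 dF) (dN (fun th k => partial (f^~ k) i th) _ t.+1 dG) (nne t).
  apply: (is_derive_eq (is_derive_minus D1 D2)).
  (* The tree sums get opaque names, so that [ring] meets atoms instead of bigops. *)
  have [N0 N0E] : exists N : R, nsum (f th) a t.+1 = N by eexists.
  have [N1 N1E] : exists N : 'I_d -> R, forall j,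
      nsum (fun k => partial (f^~ k) j th) a t.+1 = N j by eexists.
  have [N2 N2E] : exists N : 'I_d -> R, forall j,
      nsum (fun k => partial (partial (f^~ k) i) j th) a t.+1 = N j by eexists.
  rewrite -/th !lincomb N0E N1E.
  under [\sum_j _ * nsum (fun k => partial (partial _ _) _ _) _ _]eq_bigr do rewrite N2E.
  under [\sum_j _ * nsum (fun k => partial _ _ _) _ _]eq_bigr do rewrite N1E.
  rewrite !mulr_sumr -!sumrB; apply: eq_bigr => j _.
  rewrite /ratio -(nsum_lratio a t.+1 i Ts) -(nsum_lratio a t.+1 j Ts).
  rewrite -(nsum_lratio2 a t.+1 j i Ts) N0E !N1E N2E /lratio /lratio2.
  by move: (f th _)^-1 N0^-1 => u v; ring.
have D := is_derive_scale m.+1%:R^-1 (is_derive_bigsum term).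
apply: (is_derive_eq D).
rewrite /info_emp; under [RHS]eq_bigr do rewrite mulrCA.
rewrite -mulr_sumr; congr (_ * _).
under [RHS]eq_bigr do rewrite mulr_sumr.
by rewrite exchange_big.
Qed.

Let within_sum (C : R) (g : 'rV[R]_d -> nat -> R) x : Theta x ->
  (forall y k, Theta y -> (0 < k)%N -> `|g y k| <= C * w k) ->
  (forall k, (0 < k)%N -> {for x, continuous (g^~ k)}) ->
  (fun y => \sum_(1 <= k <oo) g y k * p k) @ within Theta (nbhs x) -->
  \sum_(1 <= k <oo) g x k * p k.
Proof.
move=> Tx gC cg; apply/(@within_cvgP R 'rV[R]_d Theta x (fun y => \sum_(1 <= k <oo) g y k * p k)) => e e0.
apply: (@dominated_sum_continuous R 'rV[R]_d Theta p (fun k => C * w k)) => //.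
- by move=> k k0; exact/ltW/p_gt0.
- have sC : summable1 (fun k => C * (w k * p k)) by exact: summable1Z.
  by apply: eq_summable1 sC => k _; rewrite mulrA.
Qed.

Let within_surv_sum (C : R) (g : 'rV[R]_d -> nat -> R) x : Theta x ->
  (forall y k, Theta y -> (0 < k)%N -> `|g y k| <= C * b k ^+ 2) ->
  (forall k, (0 < k)%N -> {for x, continuous (g^~ k)}) ->
  (fun y => \sum_(1 <= k <oo) g y k * q k) @ within Theta (nbhs x) -->
  \sum_(1 <= k <oo) g x k * q k.
Proof.
move=> Tx gC cg; apply/(@within_cvgP R 'rV[R]_d Theta x (fun y => \sum_(1 <= k <oo) g y k * q k)) => e e0.
apply: (@dominated_sum_continuous R 'rV[R]_d Theta q (fun k => C * b k ^+ 2)) => //.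
- by move=> k k0; apply/ltW/surv_gt0.
- have C0 : 0 <= C.
    have := le_trans (normr_ge0 _) (gC x 1%N Tx isT).
    by rewrite pmulr_lge0// exprn_gt0// (lt_le_trans _ (b_ge1 (ltn0Sn 0))).
  apply: (choice_summable f0_gt0 b_ge1 b_nd lam_gt0 surv_sum wp_summable (Cg := C)).
  by move=> k k0; rewrite ger0_norm// mulr_ge0// exprn_ge0// (le_trans _ (b_ge1 k0)).
Qed.

Lemma lim_mass_within x : Theta x ->
  (fun y => lim_mass p (f y)) @ within Theta (nbhs x) --> lim_mass p (f x).
Proof.
move=> Tx; apply: (within_sum (C := Cf)) => //.
- by move=> y k Ty k0; apply: (linear_between_w b_ge1 c0_gt0 Cf_ge0 (f_between Ty)).
- by move=> k k0; exact: (f_continuous f_C2).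
Qed.

Let lim_ratio_within (g : 'rV[R]_d -> nat -> R) (C : R) x : Theta x -> 0 <= C ->
  (forall y k, Theta y -> (0 < k)%N -> `|g y k| <= C * b k) ->
  (forall k, (0 < k)%N -> {for x, continuous (g^~ k)}) ->
  (fun y => lim_ratio p (f y) (g y)) @ within Theta (nbhs x) --> lim_ratio p (f x) (g x).
Proof.
move=> Tx C0 gC cg; apply: cvgM.
  apply: (within_sum (C := Cf * C) (g := fun y k => f y k * g y k)) => //.
    move=> y k Ty k0; have b1 := b_ge1 k0.
    apply: (mul_between_w b_ge1 c0_gt0 Cf_ge0 (f_between Ty)) => //.
    by apply: le_trans (gC y k Ty k0) _; rewrite ler_wpM2l// expr2 ler_peMr//; lra.
  move=> k k0; apply: (@continuous_at_mul R 'rV[R]_d); last exact: cg.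
  exact: (f_continuous f_C2).
apply: cvgV; last exact: lim_mass_within.
rewrite gt_eqF//; apply: lt_le_trans c0_gt0 _.
exact: (lim_mass_ge p_gt0 p_sum b_ge1 wp_summable c0_gt0 Cf_ge0 (f_between Tx)).
Qed.

Lemma info_lim_within i j :
  (fun y => info_lim y i j) @ within Theta (nbhs theta0) --> info_lim theta0 i j.
Proof.
have rb y k : Theta y -> (0 < k)%N -> forall i, `|lratio f y k i| <= Cg * b k.
  by move=> Ty k0 i'; have [h1 _] := ratio_bound Ty k0.
have rb2 y k : Theta y -> (0 < k)%N -> forall i j, `|lratio2 f y k i j| <= Cg * b k.
  by move=> Ty k0 i' j'; have [_ h2] := ratio_bound Ty k0.
have c1 k i' : (0 < k)%N -> {for theta0, continuous (fun y => lratio f y k i')}.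
  by move=> k0; exact: (lratio_continuous f_gt0 f_C2).
have c2 k i' j' : (0 < k)%N -> {for theta0, continuous (fun y => lratio2 f y k i' j')}.
  by move=> k0; exact: (lratio2_continuous f_gt0 f_C2).
apply: cvgB; [|apply: cvgB; [|apply: cvgM]].
- apply: (within_surv_sum (C := Cg + Cg ^+ 2)) => //.
    by move=> y k Ty k0; exact: hess_bound.
  move=> k k0; apply: (@continuous_at_sub R 'rV[R]_d); first exact: c2.
  by apply: (@continuous_at_mul R 'rV[R]_d); exact: c1.
- apply: (lim_ratio_within (g := fun y k => lratio2 f y k j i) (C := Cg)) => //.
  + by move=> y k Ty k0; exact: rb2.
  + by move=> k k0; exact: c2.
- apply: (lim_ratio_within (g := fun y k => lratio f y k i) (C := Cg)) => //.
  + by move=> y k Ty k0; exact: rb.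
  + by move=> k k0; exact: c1.
- apply: (lim_ratio_within (g := fun y k => lratio f y k j) (C := Cg)) => //.
  + by move=> y k Ty k0; exact: rb.
  + by move=> k k0; exact: c1.
Qed.

Hypothesis lamE : lam = malthus f0.

Lemma plim_gtE k : plim_gt f0 k = q k.
Proof.
apply/cvg_lim => //.
rewrite -(cvg_shiftS (fun N => \sum_(k.+1 <= l < N) plim f0 l)) /=.
have s0 := surv_cvg0 f0_gt0 lam_gt0 surv_sum.
have lim1 : (fun N => q k - q N) @ \oo --> q k.
  by rewrite -[X in _ --> X]subr0; apply: cvgB => //; exact: cvg_cst.
apply: cvg_trans lim1; apply: near_eq_cvg; near=> N.
have kN : (k <= N)%N by near: N; exact: nbhs_infty_ge.
rewrite (@eq_big_nat _ _ _ _ _ _ (fun l => p l)); last first.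
  by move=> l /andP[kl _]; case: l kl => // l _; rewrite /p /pdist /plim lamE.
have := pdist_partial f0_gt0 lam_gt0 N.
rewrite (@big_cat_nat _ _ _ k.+1)//= pdist_partial//.
by rewrite -/p -/q; move: (\sum_(_ <= _ < _) _) => y; lra.
Unshelve. all: by end_near. Qed.

Let rb i k : (0 < k)%N -> `|lratio f theta0 k i| <= Cg * b k.
Proof. by move=> k0; have [h1 _] := ratio_bound theta0_in k0. Qed.

Let up (g : nat -> R) : (forall k, (0 < k)%N -> `|g k| <= Cg * b k) ->
  forall k, (0 < k)%N -> `|g k| <= Cg * b k ^+ 2.
Proof.
move=> gC k k0; apply: le_trans (gC k k0) _; rewrite ler_wpM2l// expr2.
by have := b_ge1 k0 => b1; rewrite ler_peMr//; lra.
Qed.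

Let sq (g : nat -> R) C : (forall k, (0 < k)%N -> `|g k| <= C * b k ^+ 2) ->
  summable1 (fun k => g k * q k).
Proof.
by move=> gC; exact: (choice_summable f0_gt0 b_ge1 b_nd lam_gt0 surv_sum wp_summable gC).
Qed.

Let rr i j k : (0 < k)%N ->
  `|lratio f theta0 k i * lratio f theta0 k j| <= Cg ^+ 2 * b k ^+ 2.
Proof. by move=> k0; rewrite normrM -exprMn expr2 ler_pM// rb. Qed.

(** The information identity: at the true parameter, the chosen degrees and the ratios have the same
    limit law [q], so the second derivatives cancel and minus a covariance remains. *)
Lemma info_lim0 i j : info_lim theta0 i j =
  (\sum_(1 <= k <oo) lratio f theta0 k i * q k) * (\sum_(1 <= k <oo) lratio f theta0 k j * q k)
  - \sum_(1 <= k <oo) lratio f theta0 k i * lratio f theta0 k j * q k.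
Proof.
have h2 k : (0 < k)%N -> `|lratio2 f theta0 k j i| <= Cg * b k.
  by move=> k0; have [_ h] := ratio_bound theta0_in k0.
rewrite /info_lim (lim_ratio0 (up (rb i))) (lim_ratio0 (up (rb j))) (lim_ratio0 (up h2)).
have -> : \sum_(1 <= k <oo) (lratio2 f theta0 k j i - lratio f theta0 k i * lratio f theta0 k j) * q k =
   \sum_(1 <= k <oo) lratio2 f theta0 k j i * q k
   - \sum_(1 <= k <oo) lratio f theta0 k i * lratio f theta0 k j * q k.
  rewrite -sum1B; [|exact: sq (up h2)|exact: sq (rr i j)].
  by apply: eq_sum1 => k _; rewrite mulrBl.
have alg (s1 s2 s3 s4 : R) : s1 - s2 - (s1 - s3 * s4) = s3 * s4 - s2 by ring.
exact: alg.
Qed.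

Lemma asym_infoE i j : asym_info f theta0 i j =
  \sum_(1 <= k <oo) lratio f theta0 k i * lratio f theta0 k j * q k
  - (\sum_(1 <= k <oo) lratio f theta0 k i * q k) * (\sum_(1 <= k <oo) lratio f theta0 k j * q k).
Proof.
have mE i' : (\sum_(1 <= k <oo) (plim_gt f0 k *: ((f theta0 k)^-1 *: fdot f theta0 k))) 0 i' =
    \sum_(1 <= k <oo) lratio f theta0 k i' * q k.
  have eE k j' : (plim_gt f0 k *: ((f theta0 k)^-1 *: fdot f theta0 k)) 0 j' = lratio f theta0 k j' * q k.
    by rewrite !mxE plim_gtE mulrC.
  rewrite sum1_mxE; first by under eq_fun do under eq_bigr do rewrite eE.
  move=> i0 j0; rewrite (ord1 i0); under eq_fun do rewrite eE.
  exact: sq (up (rb j0)).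
rewrite /asym_info !mxE big_ord1 !mxE !mE.
have eE k i' j' : (plim_gt f0 k *: (((f theta0 k)^-1 *: fdot f theta0 k)^T *m
    ((f theta0 k)^-1 *: fdot f theta0 k))) i' j' = lratio f theta0 k i' * lratio f theta0 k j' * q k.
  by rewrite mxE mxE big_ord1 !mxE plim_gtE mulrC.
rewrite sum1_mxE; last first.
  by move=> i0 j0; under eq_fun do rewrite eE; exact: sq (rr i0 j0).
by under eq_fun do under eq_bigr do rewrite eE.
Qed.

Lemma info_limE i j : info_lim theta0 i j = - asym_info f theta0 j i.
Proof.
have symE : \sum_(1 <= k <oo) lratio f theta0 k j * lratio f theta0 k i * q k =
    \sum_(1 <= k <oo) lratio f theta0 k i * lratio f theta0 k j * q k.
  by apply: eq_sum1 => k _; rewrite [lratio _ _ _ i * _]mulrC.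
have alg (s1 s2 s3 s4 : R) : s4 = s3 -> s1 * s2 - s3 = - (s4 - s2 * s1) by move=> ->; ring.
by rewrite info_lim0 asym_infoE; exact: (alg _ _ _ _ symE).
Qed.

(** Each coordinate has its own intermediate point, which depends on the tree; uniformity of
    [info_gap] over [Theta] and continuity of the limit at theta0 dispose of it. The segment must
    stay in [Theta], where the bounds hold. *)
Lemma score_expansion : exists2 K : R, 0 <= K & forall e : R, 0 < e ->
  exists2 r : R, 0 < r & forall theta, Theta theta -> `|theta - theta0| < r ->
  (forall s : R, 0 <= s <= 1 -> Theta (theta0 + s *: (theta - theta0))) ->
  forall a m, `|score f a m.+1 theta - score f a m.+1 theta0
      + (theta - theta0) *m asym_info f theta0|
    <= (e + K * errbar a m) * `|theta - theta0|.
Proof.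
have [K1 K10 hK1] := info_gap; exists (d%:R * K1); first by rewrite mulr_ge0.
(* [d.+1] rather than [d], as the dimension may be 0. *)
move=> e e0; have e1 : 0 < e / (d.+1%:R) by rewrite divr_gt0// ltr0n.
have [|r r0 hr] := @within_cvg_forall R 'rV[R]_d Theta theta0 ('I_d * 'I_d)%type
  (fun ij y => info_lim y ij.1 ij.2) _ (e / d.+1%:R) e1.
  by move=> [i j]; exact: info_lim_within.
exists r => // theta Tt tr seg a m; set h := theta - theta0 in tr seg *.
have eb0 := errbar_ge0 a m.
apply: mx_norm_ler.
  by apply: mulr_ge0 => //; apply: addr_ge0; [exact: ltW|rewrite !mulr_ge0].
move=> i0 i; rewrite (ord1 i0) {i0}.
have [s s01] := mean_value_01 (fun s s01 => score_derivative a m i (seg s s01)).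
rewrite scale1r scale0r addr0 {1}/h [theta0 + _]addrC subrK => mv.
rewrite mxE mxE [(- score _ _ _ _) 0 i]mxE mv mxE -big_split/=.
have ts := seg s s01.
have tsr : `|theta0 + s *: h - theta0| < r.
  rewrite addrAC subrr add0r normrZ; apply: le_lt_trans tr.
  by case/andP: s01 => s0 s1; rewrite ger0_norm// ler_piMl.
have b1 (j : 'I_d) : `|h 0 j * info_emp (theta0 + s *: h) i j a m + h 0 j * asym_info f theta0 j i|
    <= `|h| * (K1 * errbar a m + e / d.+1%:R).
  rewrite -[asym_info _ _ _ _]opprK -info_limE.
    rewrite -mulrDr normrM; apply: ler_pM => //; first exact: mx_coord_le.
  have -> : info_emp (theta0 + s *: h) i j a m - info_lim theta0 i j =
    (info_emp (theta0 + s *: h) i j a m - info_lim (theta0 + s *: h) i j)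
    + (info_lim (theta0 + s *: h) i j - info_lim theta0 i j) by ring.
  apply: le_trans (ler_normD _ _) _; apply: lerD; first exact: hK1.
  exact: (hr _ ts tsr (i, j)).
apply: le_trans (ler_norm_sum _ _ _) _.
apply: (@le_trans _ _ (\sum_(j < d) `|h| * (K1 * errbar a m + e / d.+1%:R))).
  exact: ler_sum.
rewrite sumr_const card_ord -[leLHS]mulr_natl mulrCA mulrC ler_wpM2r//.
rewrite mulrDr addrC; apply: lerD; last by rewrite mulrA.
rewrite mulrCA ler_piMr ?(ltW e0)//.
by rewrite ler_pdivrMr ?ltr0n// mul1r ler_nat.
Qed.

End ScoreExpansion.

(** * Likelihood contrast *)

Section NormSet.
Variables (R : realType) (V : normedModType R).

Lemma closed_norm_ge (x : V) (e : R) : closed [set y | e <= `|y - x|].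
Proof.
apply: (@closed_comp _ _ (fun y => `|y - x|) [set t | e <= t]); last exact: closed_ge.
move=> y _; apply: (@continuous_comp V V R (fun y => y - x) (@Num.norm R V)); last exact: norm_continuous.
by apply: cvgB; [exact: cvg_id|exact: cvg_cst].
Qed.

End NormSet.

Section LikelihoodContrast.
Variables (R : realType) (d : nat) (Theta : set 'rV[R]_d) (f : 'rV[R]_d -> nat -> R).
Hypothesis Theta_compact : compact Theta.
Hypothesis f_gt0 : forall theta k, Theta theta -> (0 < k)%N -> 0 < f theta k.
Hypothesis f_C2 : forall k, (0 < k)%N -> C2_on Theta (fun theta => f theta k).
Variables (b : nat -> R) (lam c0 Cf Cb : R) (theta0 : 'rV[R]_d).
Hypothesis theta0_in : Theta theta0.
Hypothesis c0_gt0 : 0 < c0.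
Hypothesis Cf_ge0 : 0 <= Cf.
Hypothesis Cb_gt0 : 0 < Cb.
Hypothesis f_between : forall theta, Theta theta -> linear_between c0 Cf (f theta).
Hypothesis ln_b : forall k, (0 < k)%N -> ln k%:R <= Cb * b k.
Hypothesis b_ge1 : forall k, (0 < k)%N -> 1 <= b k.
Hypothesis b_nd : forall k l, (0 < k)%N -> (k <= l)%N -> b k <= b l.
Hypothesis lam_gt0 : 0 < lam.
Hypothesis surv_sum :
  (fun n => \sum_(1 <= k < n) surv (f theta0) lam k) @ \oo --> (1 : R).
Let f0 := f theta0.
Let p := pdist f0 lam.
Let q := surv f0 lam.
Let w k : R := k%:R * b k ^+ 3.
Hypothesis wp_summable : summable1 (fun k => w k * p k).
Hypothesis ident : identifiable f Theta theta0.

Let f0_gt0 k : (0 < k)%N -> 0 < f0 k. Proof. by move=> k0; exact: f_gt0. Qed.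
Let p_gt0 k : (0 < k)%N -> 0 < p k. Proof. by move=> k0; exact: pdist_gt0. Qed.
Let p_sum : (fun n => \sum_(1 <= k < n) p k) @ \oo --> (1 : R).
Proof. exact: pdist_cvg1. Qed.
Let q_gt0 k : 0 < q k. Proof. exact: surv_gt0. Qed.

(** From c0 <= f(k) <= Cf k, two logarithms differ by at most ln Cf - ln c0 + ln k. *)
Let Cln : R := ln Cf - ln c0 + Cb.

Let c0Cf : c0 <= Cf.
Proof. by have /andP[h1 h2] := f_between theta0_in (ltn0Sn 0); lra. Qed.

Let Cf_gt0 : 0 < Cf. Proof. exact: lt_le_trans c0Cf. Qed.

Let Cln_ge0 : 0 <= Cln.
Proof.
have h : ln c0 <= ln Cf by rewrite ler_ln.
by rewrite /Cln addr_ge0 ?subr_ge0 ?(ltW Cb_gt0).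
Qed.

Let up (k : nat) (x : R) : (0 < k)%N -> 0 <= x -> x * b k <= x * b k ^+ 2.
Proof. by move=> k0 x0; rewrite ler_wpM2l// expr2 ler_peMr//; have := b_ge1 k0; lra. Qed.

Definition log_ratio theta k : R := ln (f theta k) - ln (f0 k).

Lemma log_ratio_bound theta k : Theta theta -> (0 < k)%N ->
  `|log_ratio theta k| <= Cln * b k ^+ 2.
Proof.
move=> Tt k0; apply: le_trans (up k0 Cln_ge0).
have lnf th : Theta th -> ln c0 <= ln (f th k) <= ln Cf + ln k%:R.
  move=> Tth; have /andP[h1 h2] := f_between Tth k0; have h3 := f_gt0 Tth k0.
  by rewrite -lnM ?posrE ?ltr0n// !ler_ln ?posrE ?mulr_gt0 ?ltr0n// h1 h2.
have /andP[h1 h2] := lnf _ Tt; have /andP[h3 h4] := lnf _ theta0_in.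
have h5 := ln_b k0.
have h6 : ln Cf - ln c0 <= (ln Cf - ln c0) * b k.
  by rewrite ler_peMr ?b_ge1// subr_ge0 ler_ln.
by rewrite /Cln /log_ratio mulrDl ler_norml; apply/andP; split; lra.
Qed.

Let summable_log_ratio theta : Theta theta -> summable1 (fun k => log_ratio theta k * q k).
Proof.
move=> Tt; exact: (choice_summable f0_gt0 b_ge1 b_nd lam_gt0 surv_sum wp_summable
  (fun k k0 => log_ratio_bound Tt k0)).
Qed.

(** The limit of the difference of the log-likelihoods at theta and theta0 ([loglik_gap]). *)
Definition contrast theta : R :=
  \sum_(1 <= k <oo) log_ratio theta k * q k - (ln (lim_mass p (f theta)) - ln (lim_mass p f0)).

Lemma loglik_gap : exists2 K : R, 0 <= K & forall theta a m, Theta theta ->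
  `|loglik f a m.+1 theta - loglik f a m.+1 theta0 - contrast theta|
    <= K * errbar f b lam theta0 a m.
Proof.
pose W : R := \sum_(1 <= k <oo) w k * p k.
have w0 k : (0 < k)%N -> 0 <= w k.
  by move=> k0; rewrite mulr_ge0// exprn_ge0// (le_trans _ (b_ge1 k0)).
have W0 : 0 <= W.
  apply: le_trans (ge0_partial_le_sum 0 _ wp_summable); first by rewrite big_geq.
  by move=> k k0; rewrite mulr_ge0 ?w0// ltW// p_gt0.
have mass_le theta : Theta theta -> `|lim_mass p (f theta)| <= Cf * W.
  move=> Tt; rewrite /lim_mass /W -sum1Z//; apply: ler_norm_sum1; last exact: summable1Z.
  move=> k k0; rewrite normrM (gtr0_norm (p_gt0 k0)) mulrA ler_wpM2r ?(ltW (p_gt0 k0))//.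
  exact: (linear_between_w b_ge1 c0_gt0 Cf_ge0 (f_between Tt)).
pose K := Cf / c0 + Cf / c0 + (Cf * W + Cf * W) / c0.
have c1 : 0 <= Cf / c0 by rewrite divr_ge0// ltW.
have c2 : 0 <= (Cf * W + Cf * W) / c0.
  by apply: divr_ge0; [rewrite addr_ge0// mulr_ge0|exact: ltW].
have K0 : 0 <= K by rewrite /K; lra.
exists (Cln + K); first by apply: addr_ge0; [exact: Cln_ge0|].
move=> theta a m Tt; rewrite !loglikE.
have h1 := choice_mean_gap f0_gt0 b_ge1 b_nd lam_gt0 surv_sum wp_summable a m
  (fun k k0 => log_ratio_bound Tt k0).
(* Dividing by the number of nodes does not change the difference of logarithms and makes each of
   them converge. *)
pose u t : R := ln (nsum (f theta) a t.+1 / t.+1%:R) - ln (nsum f0 a t.+1 / t.+1%:R).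
have h2 : `|m.+1%:R^-1 * \sum_(t < m) u t - (ln (lim_mass p (f theta)) - ln (lim_mass p f0))|
    <= K * errbar f b lam theta0 a m.
  apply: (mean_le_errbar f_gt0 theta0_in b_ge1 lam_gt0 wp_summable m K0).
    have l1 := lim_mass_ge p_gt0 p_sum b_ge1 wp_summable c0_gt0 Cf_ge0 (f_between Tt).
    have l2 := lim_mass_ge p_gt0 p_sum b_ge1 wp_summable c0_gt0 Cf_ge0 (f_between theta0_in).
    apply: le_trans (ln_lipschitz c0_gt0 l1 l2) _.
    rewrite /K; apply: (@le_trans _ _ ((Cf * W + Cf * W) / c0)); last by lra.
    rewrite ler_wpM2r ?invr_ge0 ?(ltW c0_gt0)//.
    by apply: le_trans (ler_normB _ _) _; apply: lerD; exact: mass_le.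
  move=> t; rewrite /u opprD addrACA -opprD.
  have g1 := ln_mean_gap p_gt0 p_sum b_ge1 wp_summable c0_gt0 Cf_ge0 a t (f_between Tt).
  have g2 := ln_mean_gap p_gt0 p_sum b_ge1 wp_summable c0_gt0 Cf_ge0 a t (f_between theta0_in).
  apply: le_trans (ler_normB _ _) _.
  apply: (@le_trans _ _ ((Cf / c0 + Cf / c0) * wdist p w a t)).
    by rewrite mulrDl; exact: lerD.
  by rewrite ler_wpM2r ?wdist_ge0// /K; lra.
have -> : m.+1%:R^-1 * \sum_(j < m) (ln (f theta (chosen a j)) - ln (nsum (f theta) a j.+1))
    - m.+1%:R^-1 * \sum_(j < m) (ln (f theta0 (chosen a j)) - ln (nsum (f theta0) a j.+1)) =
  m.+1%:R^-1 * \sum_(j < m) log_ratio theta (chosen a j) - m.+1%:R^-1 * \sum_(t < m) u t.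
  rewrite -!mulrBr; congr (_ * _); rewrite -!sumrB; apply: eq_bigr => j _.
  rewrite /u /log_ratio !ln_div ?posrE ?ltr0n ?nsum_gt0//; last by move=> k; exact: f_gt0.
  rewrite /f0; lra.
rewrite /contrast opprD addrACA -opprD.
apply: le_trans (ler_normB _ _) _; rewrite mulrDl; apply: lerD => //.
apply: le_trans h1 _; rewrite ler_wpM2l//.
exact: (wdist_le_errbar f_gt0).
Qed.

Lemma contrast_within x : Theta x -> contrast @ within Theta (nbhs x) --> contrast x.
Proof.
move=> Tx; have s1 : (fun y => \sum_(1 <= k <oo) log_ratio y k * q k) @ within Theta (nbhs x) -->
    \sum_(1 <= k <oo) log_ratio x k * q k.
  apply/(@within_cvgP R 'rV[R]_d Theta x (fun y => \sum_(1 <= k <oo) log_ratio y k * q k)) => e e0.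
  apply: (@dominated_sum_continuous R 'rV[R]_d Theta q (fun k => Cln * b k ^+ 2)) => //.
  - by move=> k _; exact/ltW.
  - apply: (choice_summable f0_gt0 b_ge1 b_nd lam_gt0 surv_sum wp_summable (Cg := Cln)).
    by move=> k k0; rewrite ger0_norm//; apply: mulr_ge0; [exact: Cln_ge0|exact: sqr_ge0].
  - by move=> y k Ty k0; exact: log_ratio_bound.
  - move=> k k0; apply: (@continuous_at_sub R 'rV[R]_d); first exact: (ln_f_continuous f_gt0 f_C2).
    exact: cst_continuous.
have s2 : (fun y => ln (lim_mass p (f y))) @ within Theta (nbhs x) --> ln (lim_mass p (f x)).
  have h := lim_mass_within f_gt0 f_C2 theta0_in c0_gt0 Cf_ge0 f_between b_ge1 lam_gt0 wp_summable Tx.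
  apply: (cvg_comp _ _ h); apply: continuous_ln.
  exact: lt_le_trans c0_gt0 (lim_mass_ge p_gt0 p_sum b_ge1 wp_summable c0_gt0 Cf_ge0 (f_between Tx)).
by apply: cvgB => //; apply: cvgB => //; exact: cvg_cst.
Qed.

(* Strict Jensen inequality: [contrast theta] is the mean under [q] of the logarithm
   of [f theta / f0] minus the logarithm of its mean. *)
Lemma contrast_lt0 theta : Theta theta -> theta <> theta0 -> contrast theta < 0.
Proof.
move=> Tt tt0; pose rho k : R := f theta k / f0 k.
have rho0 k : (0 < k)%N -> 0 < rho k by move=> k0; rewrite divr_gt0 ?f_gt0.
have m0E : lim_mass p f0 = lam by exact: (lim_mass_truth f_gt0 theta0_in).
have sq : summable1 q by apply/cvg_ex; exists 1; exact: surv_sum.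
have fp k : (0 < k)%N -> f theta k * p k = lam * (rho k * q k).
  move=> k0; rewrite [RHS]mulrCA -(f_pdist f0_gt0 lam_gt0 k0) -/p /rho.
  by move: (p k) => pk; rewrite mulrA divfK// gt_eqF// f0_gt0.
have sfp : summable1 (fun k => f theta k * p k).
  apply: (@le_summable1 _ _ (fun k => Cf * (w k * p k))); last exact: summable1Z.
  move=> k k0; rewrite normrM (gtr0_norm (p_gt0 k0)) mulrA ler_wpM2r ?(ltW (p_gt0 k0))//.
  exact: (linear_between_w b_ge1 c0_gt0 Cf_ge0 (f_between Tt)).
have srq : summable1 (fun k => rho k * q k).
  apply: (@eq_summable1 _ (fun k => lam^-1 * (f theta k * p k))); last exact: summable1Z.
  by move=> k k0; rewrite fp// mulKf// gt_eqF.
pose M : R := \sum_(1 <= k <oo) rho k * q k.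
have massE : lim_mass p (f theta) = lam * M.
  by rewrite /lim_mass /M -sum1Z//; apply: eq_sum1.
have M0 : 0 < M.
  have := lim_mass_ge p_gt0 p_sum b_ge1 wp_summable c0_gt0 Cf_ge0 (f_between Tt).
  by rewrite massE => /(lt_le_trans c0_gt0); rewrite pmulr_rgt0.
(* This is x - 1 - ln x >= 0 at x = rho / M. Its q-mean is minus the contrast, because q has mass 1
   and rho has q-mean M. *)
pose t k : R := rho k / M - 1 - (log_ratio theta k - ln M).
have tE k : (0 < k)%N -> t k = rho k / M - 1 - ln (rho k / M).
  move=> k0; rewrite /t /log_ratio; congr (_ - _).
  by rewrite ln_div ?posrE ?rho0// ln_div ?posrE ?f_gt0 ?f0_gt0.
have t0 k : (0 < k)%N -> 0 <= t k.
  move=> k0; rewrite tE// subr_ge0.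
  have : 0 < rho k / M by apply: divr_gt0 => //; exact: rho0.
  move: (rho k / M) => x x0; have := @le_ln1Dx _ (x - 1).
  have -> : 1 + (x - 1) = x by ring.
  by apply; lra.
have teq k : (0 < k)%N -> t k = 0 -> rho k = M.
  move=> k0; rewrite tE// => /eqP; rewrite subr_eq0 => /eqP tk.
  have [/eqP l0|l0] := boolP (ln (rho k / M) == 0).
    have : rho k / M = 1 by move: tk; rewrite l0; lra.
    by move/(congr1 (fun x => x * M)); rewrite mul1r divfK ?gt_eqF.
  have rM0 : 0 < rho k / M by apply: divr_gt0 => //; exact: rho0.
  by have := expR_gt1Dx l0; rewrite lnK ?posrE// -tk; lra.
have [k k0 tk] : exists2 k, (0 < k)%N & 0 < t k.
  (* Equality at every k would make f theta a multiple of f theta0, which identifiability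
     forbids. *)
  apply: contrapT => nt; apply: tt0; apply/(ident Tt); exists M => k k0.
  have tk : t k = 0.
    apply/eqP; rewrite eq_le t0// andbT leNgt; apply/negP => tk; apply: nt; by exists k.
  by rewrite -(teq k k0 tk) /rho divfK// gt_eqF// f0_gt0.
have stq : summable1 (fun k => t k * q k).
  have h1 : summable1 (fun k => M^-1 * (rho k * q k)) by exact: summable1Z.
  have h2 : summable1 (fun k => (ln M - 1) * q k) by exact: summable1Z.
  have h3 := summable1B (summable1D h1 h2) (summable_log_ratio Tt).
  by apply: eq_summable1 h3 => k' _; rewrite /t; ring.
have conE : \sum_(1 <= k <oo) t k * q k = - contrast theta.
  have h1 : summable1 (fun k => M^-1 * (rho k * q k)) by exact: summable1Z.
  have h2 : summable1 (fun k => (ln M - 1) * q k) by exact: summable1Z.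
  have -> : \sum_(1 <= k <oo) t k * q k =
      \sum_(1 <= k <oo) (M^-1 * (rho k * q k) + (ln M - 1) * q k - log_ratio theta k * q k).
    by apply: eq_sum1 => k' _; rewrite /t; ring.
  rewrite sum1B//; [|exact: summable1D|exact: summable_log_ratio].
  rewrite sum1D// sum1Z// sum1Z// -/M (cvg_lim (@Rhausdorff _) surv_sum).
  rewrite /contrast m0E massE lnM ?posrE// mulVf ?gt_eqF//.
  by move: (limn _) => z; ring.
rewrite -oppr_gt0 -conE.
apply: (@lt_le_trans _ _ (t k * q k)); first exact: mulr_gt0.
apply: le_trans (ge0_partial_le_sum k.+1 _ stq); last first.
  by move=> k' k'0; rewrite mulr_ge0 ?t0// ltW.
rewrite big_nat_recr//= lerDr big_nat sumr_ge0// => j /andP[j0 _].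
by rewrite mulr_ge0 ?t0// ltW.
Qed.

(** Compactness bounds the contrast away from 0 outside a ball, and [loglik_gap] is uniform in
    theta, so one threshold on the tree error serves all competitors. *)
Lemma loglik_separation (e : R) : 0 < e -> exists2 eta : R, 0 < eta &
  forall theta a m, Theta theta -> e <= `|theta - theta0| ->
    errbar f b lam theta0 a m < eta ->
    loglik f a m.+1 theta < loglik f a m.+1 theta0.
Proof.
move=> e0; have [K K0 hK] := loglik_gap.
have [|||k k0 hk] := @compact_negative_bound R 'rV[R]_d Theta Theta_compact contrast
    [set x | e <= `|x - theta0|].
- exact: (@closed_norm_ge R 'rV[R]_d).
- move=> x Tx Fx; apply: contrast_lt0 => // xE; move: Fx.
  by rewrite /= xE subrr normr0 leNgt e0.
- by move=> x e' Tx e'0; have /within_cvgP/(_ e' e'0) := contrast_within Tx.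
have K1 : 0 < K + 1 by rewrite ltr_wpDl.
exists (k / (K + 1)) => [|theta a m Tt te eb]; first exact: divr_gt0.
have h1 := hk theta Tt te; have := hK theta a m Tt.
have eb0 := errbar_ge0 f_gt0 theta0_in b_ge1 lam_gt0 wp_summable a m.
have h2 : (K + 1) * errbar f b lam theta0 a m < k by rewrite mulrC -ltr_pdivlMr.
rewrite ler_norml => /andP[_]; move: h1 h2 eb0.
move: (contrast _) (errbar _ _ _ _ _ _) => x y h1; rewrite mulrDl mul1r => h2 y0 h3.
have h4 : loglik f a m.+1 theta - loglik f a m.+1 theta0 < 0 by lra.
by rewrite -subr_lt0.
Qed.

End LikelihoodContrast.

(** * Asymptotic normality *)

Lemma cos_lipschitz (R : realType) (x y : R) : `|cos x - cos y| <= `|x - y|.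
Proof.
have -> : cos x - cos y = (- 2 * sin ((x + y) / 2)) * sin ((x - y) / 2).
  have := cosD ((x + y) / 2) ((x - y) / 2); have := cosB ((x + y) / 2) ((x - y) / 2).
  have -> : (x + y) / 2 + (x - y) / 2 = x by field.
  have -> : (x + y) / 2 - (x - y) / 2 = y by field.
  by move=> -> ->; ring.
rewrite normrM; apply: (@le_trans _ _ (2 * `|(x - y) / 2|)).
  apply: ler_pM => //; last exact: norm_sin_le.
  have := sin_max ((x + y) / 2); rewrite normrM normrN [`|2|]ger0_norm//.
  by move: (`|sin _|) => z; lra.
by rewrite normrM [`|2^-1|]ger0_norm ?invr_ge0// mulrCA mulfV// mulr1.
Qed.

(** * Positive definite matrices *)

Section PositiveDefinite.
Variable R : realType.

Lemma dotZl d (c : R) (u x : 'rV[R]_d) : dot (c *: u) x = c * dot u x.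
Proof. by rewrite /dot mulr_sumr; apply: eq_bigr => i _; rewrite mxE mulrA. Qed.

Lemma dot_mulmx d (u x : 'rV[R]_d) (M : 'M[R]_d) : dot u (x *m M) = dot (u *m M^T) x.
Proof. by rewrite !dotE trmx_mul trmxK mulmxA. Qed.

Lemma dot_ge0 d (u : 'rV[R]_d) : 0 <= dot u u.
Proof. by apply: sumr_ge0 => i _; rewrite -expr2 sqr_ge0. Qed.

Lemma dot_eq0 d (u : 'rV[R]_d) : dot u u = 0 -> u = 0.
Proof.
move=> /eqP; rewrite psumr_eq0 => [/allP h|i _]; last by rewrite -expr2 sqr_ge0.
apply/rowP => i; rewrite mxE; have /implyP/(_ isT) := h i (mem_index_enum i).
by rewrite mulf_eq0 orbb => /eqP.
Qed.

(** If y V y^T = 0, positivity at y + t y V for a suitable negative t forces y V to vanish, hence y,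
    as V is invertible. *)
Lemma psd_unit_definite d (V : 'M[R]_d) : V^T = V -> V \in unitmx ->
  (forall u, 0 <= dot (u *m V) u) -> forall u, u != 0 -> 0 < dot (u *m V) u.
Proof.
move=> sV uV pV y y0; rewrite lt_neqAle pV andbT eq_sym; apply: contra y0 => /eqP yVy.
pose z := y *m V.
have A0 := dot_ge0 z; have B0 := pV z.
have q t : 0 <= 2 * t * dot z z + t ^+ 2 * dot (z *m V) z.
  have := pV (y + t *: z).
  rewrite mulmxDl dotDl [dot _ (y + _)]dotC [dot (_ *m _) (y + _)]dotC !dotDl.
  rewrite -scalemxAl !dotZl [dot y (t *: _)]dotC dotZl [dot z (t *: _)]dotC dotZl.
  have -> : dot (z *m V) y = dot z z by rewrite dotC dot_mulmx sV.
  rewrite -/z [dot y z]dotC [dot z y]yVy.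
  move: (dot z z) (dot (z *m V) z) => A B.
  by have -> : 0 + t * A + (t * A + t * (t * B)) = 2 * t * A + t ^+ 2 * B by ring.
have zz : dot z z = 0.
  have := q (- (dot z z / (dot (z *m V) z + 1))); move: (dot z z) (dot (z *m V) z) A0 B0 => A B A0 B0.
  have B1 : 0 < B + 1 by lra.
  have -> : 2 * (- (A / (B + 1))) * A + (- (A / (B + 1))) ^+ 2 * B =
      - (A ^+ 2 * ((B + 2) / (B + 1) ^+ 2)) by field; rewrite gt_eqF.
  rewrite oppr_ge0 pmulr_lle0; last by rewrite divr_gt0 ?exprn_gt0//; lra.
  by rewrite exprn_even_le0//= => /eqP.
by rewrite -(mulmxK uV y) -/z (dot_eq0 zz) mul0mx.
Qed.

(** Supplies the factor [L] in the definition of the normal law, one pivot at a time through the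
    Schur complement. *)
Lemma cholesky d (M : 'M[R]_d) : M^T = M -> (forall u, u != 0 -> 0 < dot (u *m M) u) ->
  exists L : 'M[R]_d, L^T *m L = M.
Proof.
elim: d M => [|d IH] M; first by exists 0; apply/matrixP => -[].
rewrite -[d.+1]/(1 + d)%N in M *; move=> sM pM.
pose a := M 0 0; pose b : 'rV[R]_d := ursubmx M; pose D : 'M[R]_d := drsubmx M.
have aE : ulsubmx M = a%:M.
  apply/matrixP => i j; rewrite (ord1 i) (ord1 j) !mxE eqxx mulr1n /a.
  by congr (M _ _); apply/val_inj.
have bE : dlsubmx M = b^T by rewrite /b trmx_ursub sM.
have DE : D^T = D by rewrite /D trmx_drsub sM.
have ME : M = block_mx a%:M b b^T D by rewrite -aE -bE submxK.
have quad (x : 'M[R]_1) (y : 'rV[R]_d) : dot (row_mx x y *m M) (row_mx x y) =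
    (x *m a%:M *m x^T + y *m b^T *m x^T + x *m b *m y^T + y *m D *m y^T) 0 0.
  rewrite dotC dotE {1}ME mul_row_block tr_row_mx mul_row_col !mulmxDl.
  by rewrite !addrA.
have a0 : 0 < a.
  have := pM (row_mx 1%:M 0); rewrite quad trmx0 !mul0mx !mulmx0 !addr0 trmx1 mulmx1 mul1mx mxE eqxx mulr1n.
  apply; apply/eqP => /matrixP/(_ 0 0); rewrite !mxE split1 unlift_none/= mxE.
  by move/eqP; rewrite oner_eq0.
pose S := D - a^-1 *: (b^T *m b).
have [||L LE] := IH S.
- by rewrite /S linearB/= linearZ/= trmx_mul trmxK DE.
(* Completing the square: with this x, the form of [M] at (x, y) is the form of the Schur complement
   at y. *)
- move=> y y0; pose x := - a^-1 *: (y *m b^T).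
  have := pM (row_mx x y); have xy0 : row_mx x y != 0.
    by apply: contra y0 => /eqP; rewrite -row_mx0 => /eq_row_mx[_ ->].
  move=> /(_ xy0); rewrite quad; congr (0 < _).
  have xT : x^T = - a^-1 *: (b *m y^T) by rewrite /x linearZ/= trmx_mul trmxK.
  rewrite dotC dotE /S mulmxBr mulmxBl mul_mx_scalar xT /x.
  rewrite -!scalemxAl -!scalemxAr -!scalemxAl !scalerA !mulmxA.
  move: (y *m b^T *m b *m y^T) (y *m D *m y^T) => A B; rewrite !mxE.
  by move: (A 0 0) (B 0 0) => u v; field; rewrite gt_eqF.
exists (block_mx (Num.sqrt a)%:M ((Num.sqrt a)^-1 *: b) 0 L).
have sa0 : Num.sqrt a != 0 by rewrite gt_eqF// sqrtr_gt0.
rewrite [RHS]ME tr_block_mx mulmx_block !trmx0 !mul0mx !mulmx0 !addr0 tr_scalar_mx.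
congr block_mx.
- by rewrite -scalar_mxM -expr2 sqr_sqrtr// ltW.
- by rewrite mul_scalar_mx scalerA mulfV// scale1r.
- by rewrite linearZ/= -scalemxAl mul_mx_scalar scalerA mulVf// scale1r.
- have -> : ((Num.sqrt a)^-1 *: b)^T = (Num.sqrt a)^-1 *: b^T by rewrite linearZ.
  rewrite LE /S -scalemxAr -scalemxAl scalerA -invfM -expr2 sqr_sqrtr ?(ltW a0)//.
  by rewrite addrC subrK.
Qed.

Lemma mulmx_norm_le d (x : 'rV[R]_d) (M : 'M[R]_d) : `|x *m M| <= d%:R * `|M| * `|x|.
Proof.
apply: mx_norm_ler => [|i j]; first by rewrite !mulr_ge0.
rewrite mxE; apply: le_trans (ler_norm_sum _ _ _) _.
apply: (@le_trans _ _ (\sum_(k < d) `|M| * `|x|)).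
  by apply: ler_sum => k _; rewrite normrM mulrC ler_pM// mx_coord_le.
by rewrite sumr_const card_ord -[leLHS]mulr_natl mulrA.
Qed.

End PositiveDefinite.

(** * From the linearized equation to the limit law *)

Section Slutsky.
Variables (R : realType) (disp : measure_display) (T : measurableType disp).
Variables (P : probability T R) (d : nat) (X S : nat -> T -> 'rV[R]_d) (V : 'M[R]_d).
Hypothesis mX : random_vectors X.
Hypothesis mS : random_vectors S.
Hypothesis V_sym : V^T = V.
Hypothesis V_unit : V \in unitmx.
Hypothesis V_psd : forall u, 0 <= dot (u *m V) u.
Hypothesis S_tight : forall e : R, 0 < e -> exists K : R,
  forall n, (P [set w | (K <= `|S n w|)%R] <= e%:E)%E.
Hypothesis S_chf : forall (u : 'rV[R]_d) (c : R),
  (fun n => \int[P]_(w in setT) cos (dot u (S n w) + c)) @ \oo -->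
    cos c * expR (- (dot (u *m V) u / 2)).
Hypothesis XS_close : forall eta e : R, 0 < eta -> 0 < e ->
  \forall n \near \oo, exists N : set T, [/\ measurable N, (P N <= e%:E)%E &
    forall w, ~ N w -> `|X n w *m V - S n w| <= eta * `|X n w|].

Let U := invmx V.
Let kU : R := d%:R * `|U| + 1.
Let Y n w : 'rV[R]_d := S n w *m U.

Let kU_gt0 : 0 < kU. Proof. by rewrite ltr_wpDl ?mulr_ge0. Qed.

Let norm_mulU (x : 'rV[R]_d) : `|x *m U| <= kU * `|x|.
Proof. by apply: le_trans (mulmx_norm_le _ _) _; rewrite ler_wpM2r// lerDl. Qed.

(* On the good event |X - Y| <= kU eta |X|, so that |X| <= 2 |Y| for small eta. *)
Let close : forall e : R, 0 < e -> exists2 K : R, 0 < K & forall delta : R, 0 < delta ->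
  \forall n \near \oo, exists N : set T, [/\ measurable N, (P N <= e%:E)%E &
    forall w, ~ N w -> `|X n w - Y n w| <= delta /\ `|X n w| <= K].
Proof.
move=> e e0; have e2 : 0 < e / 2 by rewrite divr_gt0.
have [K0 hK0] := S_tight e2; pose K : R := `|K0| + 1.
have K_gt0 : 0 < K by rewrite ltr_wpDl.
have hK n : (P [set w | (K <= `|S n w|)%R] <= (e / 2)%:E)%E.
  apply: le_trans (hK0 n); apply: le_measure; rewrite ?inE.
  - have := @norm_ge_measurable _ _ _ _ _ 0 K (mS n).
    by congr measurable; apply/seteqP; split => w /=; rewrite subr0.
  - have := @norm_ge_measurable _ _ _ _ _ 0 K0 (mS n).
    by congr measurable; apply/seteqP; split => w /=; rewrite subr0.
  - move=> w /=; apply: le_trans; rewrite /K.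
    by apply: le_trans (ler_norm K0) _; rewrite lerDl.
exists (2 * (kU * K)); first by rewrite !mulr_gt0.
move=> delta delta0.
pose eta : R := Num.min (1 / (2 * kU)) (delta / (kU * (2 * (kU * K)))).
have eta0 : 0 < eta by rewrite lt_min !divr_gt0 ?mulr_gt0.
near=> n; have : exists N : set T, [/\ measurable N, (P N <= (e / 2)%:E)%E &
    forall w, ~ N w -> `|X n w *m V - S n w| <= eta * `|X n w|].
  by near: n; exact: XS_close.
move=> [N [mN PN hN]].
have mK : measurable [set w | (K <= `|S n w|)%R].
  have := @norm_ge_measurable _ _ _ _ _ 0 K (mS n).
  by congr measurable; apply/seteqP; split => w /=; rewrite subr0.
exists (N `|` [set w | (K <= `|S n w|)%R]); split.
- exact: measurableU.
- apply: (le_trans (measureU2 _ mN mK)).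
  by apply: le_trans (leeD PN (hK n)) _; rewrite -EFinD lee_fin; lra.
move=> w /not_orP[Nw /negP]; rewrite -ltNge => SK.
have h1 : `|X n w - Y n w| <= kU * (eta * `|X n w|).
  have -> : X n w - Y n w = (X n w *m V - S n w) *m U.
    by rewrite mulmxBl mulmxK.
  by apply: le_trans (norm_mulU _) _; rewrite ler_wpM2l ?(ltW kU_gt0)// hN.
have h2 : `|Y n w| <= kU * K.
  by apply: le_trans (norm_mulU _) _; rewrite ler_wpM2l ?(ltW kU_gt0)// ltW.
have h3 : kU * (eta * `|X n w|) <= `|X n w| / 2.
  rewrite mulrA [leRHS]mulrC ler_wpM2r//.
  have : eta <= 1 / (2 * kU) by rewrite ge_min lexx.
  by rewrite ler_pdivlMr ?mulr_gt0//; lra.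
have h4 : `|X n w| <= 2 * (kU * K).
  have h5 : `|X n w| <= `|X n w - Y n w| + `|Y n w|.
    by apply: le_trans (ler_normD _ _); rewrite subrK.
  by move: h1 h2 h3 h5; move: (`|X n w|) (kU * (_ * _)) => *; lra.
split=> //; apply: le_trans h1 _.
have : eta <= delta / (kU * (2 * (kU * K))) by rewrite ge_min lexx orbT.
rewrite ler_pdivlMr ?mulr_gt0// => h5; apply: le_trans h5.
by rewrite mulrCA ler_wpM2l ?(ltW eta0)// ler_wpM2l ?(ltW kU_gt0).
Unshelve. all: by end_near. Qed.

Let X_tight (e : R) : 0 < e -> exists K : R, \forall n \near \oo,
  (P [set w | (K <= `|X n w|)%R] <= e%:E)%E.
Proof.
move=> e0; have [K K0 hK] := close e0; exists (K + 1).
near=> n; have : exists N : set T, [/\ measurable N, (P N <= e%:E)%E &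
    forall w, ~ N w -> `|X n w - Y n w| <= 1 /\ `|X n w| <= K].
  by near: n; exact: hK.
move=> [N [mN PN hN]]; apply: le_trans PN; apply: le_measure; rewrite ?inE//.
  have := @norm_ge_measurable _ _ _ _ _ 0 (K + 1) (mX n).
  by congr measurable; apply/seteqP; split => w /=; rewrite subr0.
move=> w /= Kw; apply: contrapT => /hN[_]; lra.
Unshelve. all: by end_near. Qed.

Let iX (Z : T -> 'rV[R]_d) u c : (forall i, measurable_fun setT (fun w => Z w 0 i)) ->
  P.-integrable setT (EFin \o (fun w => cos (dot u (Z w) + c))).
Proof.
move=> mZ; apply: (@bounded_integrable _ _ _ _ 1) => [|w]; last exact: cos_max.
exact: (continuous_comp_measurable mZ (bounded_continuous_cos u c)).
Qed.

Let X_chf (u : 'rV[R]_d) (c : R) :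
  (fun n => \int[P]_(w in setT) cos (dot u (X n w) + c)) @ \oo -->
    cos c * expR (- (dot (u *m U) u / 2)).
Proof.
have SU n w : dot (u *m U^T) (S n w) = dot u (Y n w) by rewrite dot_mulmx.
(* The limit of S V^-1 has covariance V^-1 V V^-1 = V^-1. *)
have Ulim : dot (u *m U^T *m V) (u *m U^T) = dot (u *m U) u.
  have UT : U^T = U by rewrite /U trmx_inv V_sym.
  by rewrite UT mulmxKV// dotC.
have lim : (fun n => \int[P]_(w in setT) cos (dot (u *m U^T) (S n w) + c)) @ \oo -->
    cos c * expR (- (dot (u *m U^T *m V) (u *m U^T) / 2)) by exact: S_chf.
have : (fun n => \int[P]_(w in setT) cos (dot u (X n w) + c)
     - \int[P]_(w in setT) cos (dot (u *m U^T) (S n w) + c)) @ \oo --> (0 : R).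
  apply/cvgrPdist_le => e e0.
  have e4 : 0 < e / 4 by rewrite divr_gt0.
  have [K K0 hK] := close e4.
  pose delta : R := e / 2 / (d%:R * `|u| + 1).
  have du0 : 0 < d%:R * `|u| + 1 by rewrite ltr_wpDl ?mulr_ge0.
  have delta0 : 0 < delta by rewrite /delta divr_gt0// divr_gt0.
  near=> n; have : exists N : set T, [/\ measurable N, (P N <= (e / 4)%:E)%E &
    forall w, ~ N w -> `|X n w - Y n w| <= delta /\ `|X n w| <= K].
    by near: n; exact: hK.
  move=> [N [mN PN hN]]; rewrite sub0r normrN.
  have PNr : fine (P N) <= e / 4.
    by rewrite -lee_fin fineK// fin_num_measure.
  apply: (@le_trans _ _ (e / 2 + 2 * fine (P N))); last by lra.
  apply: Rintegral_dist_le => //; [exact: iX (mX n)|exact: iX (mS n)|lra| |].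
  - move=> w /hN[h _]; rewrite SU.
    apply: le_trans (cos_lipschitz _ _) _.
    have -> : dot u (X n w) + c - (dot u (Y n w) + c) = dot u (X n w - Y n w).
      by rewrite [RHS]dotC dotDl dotNl ![dot _ u]dotC; ring.
    apply: le_trans (norm_dot_le _ _) _.
    apply: (@le_trans _ _ ((d%:R * `|u| + 1) * delta)).
      by apply: ler_pM; rewrite ?mulr_ge0// lerDl.
    by rewrite /delta mulrC divfK// gt_eqF.
  - move=> w; apply: le_trans (ler_normB _ _) _.
    have := cos_max (dot u (X n w) + c); have := cos_max (dot (u *m U^T) (S n w) + c).
    by move: (`|cos _|) (`|cos _|) => *; lra.
move=> h; rewrite -Ulim -[X in _ --> X]add0r.
have -> : (fun n => \int[P]_(w in setT) cos (dot u (X n w) + c)) =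
    (fun n => (\int[P]_(w in setT) cos (dot u (X n w) + c)
     - \int[P]_(w in setT) cos (dot (u *m U^T) (S n w) + c))
     + \int[P]_(w in setT) cos (dot (u *m U^T) (S n w) + c)).
  by apply/funext => n; rewrite subrK.
exact: cvgD h lim.
Unshelve. all: by end_near. Qed.

Lemma normal_limit : cvg_in_distribution_normal P X (invmx V).
Proof.
have UT : U^T = U by rewrite /U trmx_inv V_sym.
have [||L LE] := @cholesky R d U => //.
  move=> u u0; have -> : dot (u *m U) u = dot ((u *m U) *m V) (u *m U).
    by rewrite mulmxKV// dotC.
  apply: psd_unit_definite => //; apply: contra u0 => /eqP uU.
  by rewrite -(mulmxKV V_unit u) uU mul0mx.
exists L => //; move=> g cg bg.
have chf (u : 'rV[R]_d) (c : R) :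
   (fun n => \int[P]_(w in setT) cos (dot u (X n w) + c)) @ \oo -->
    std_normal_mean (fun z => cos (dot u (z *m L) + c)).
  have -> : (fun z => cos (dot u (z *m L) + c)) = (fun z => cos (dot (u *m L^T) z + c)).
    by apply/funext => z; rewrite dot_mulmx.
  rewrite std_normal_mean_trig (_ : dot (u *m L^T) (u *m L^T) = dot (u *m U) u); last first.
    by rewrite -dot_mulmx -mulmxA LE dotC.
  exact: X_chf.
exact: (levy_continuity mX X_tight chf cg bg).
Qed.

End Slutsky.

Section FiniteSums.
Variable R : realType.

Lemma cvg_bigsum (S : Type) (F : set_system S) (FF : Filter F) n (h : 'I_n -> S -> R)
    (l : 'I_n -> R) :
  (forall i, h i @ F --> l i) -> (fun y => \sum_i h i y) @ F --> \sum_i l i.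
Proof.
elim: n h l => [|n IH] h l hl.
  by under eq_fun do rewrite big_ord0; rewrite big_ord0; exact: cvg_cst.
under eq_fun do rewrite big_ord_recr; rewrite big_ord_recr.
by apply: cvgD; [apply: IH => i; exact: hl|exact: hl].
Qed.

Lemma continuous_at_bigsum (V : normedModType R) (x : V) n (h : 'I_n -> V -> R) :
  (forall i, {for x, continuous (h i)}) -> {for x, continuous (fun y => \sum_i h i y)}.
Proof. by move=> ch; apply: cvg_bigsum => i; exact: ch. Qed.

Lemma sum1_bigsum n (u : 'I_n -> nat -> R) : (forall i, summable1 (u i)) ->
  \sum_(1 <= k <oo) \sum_i u i k = \sum_i \sum_(1 <= k <oo) u i k.
Proof.
move=> su; apply/cvg_lim => //; under eq_fun do rewrite exchange_big/=.
by apply: cvg_bigsum => i; exact: su.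
Qed.

End FiniteSums.

(** * Measurability of the likelihood equations *)

Section Measurability.
Variables (R : realType) (disp : measure_display) (T : measurableType disp).

(** A closed set is the zero set of the truncated distance to it, a bounded continuous function
    covered by [continuous_comp_measurable]. *)
Lemma closed_preimage_measurable d (Y : T -> 'rV[R]_d) (Z : set 'rV[R]_d) : closed Z ->
  (forall i, measurable_fun setT (fun w => Y w 0 i)) -> measurable [set w | Z (Y w)].
Proof.
move=> cZ mY; have [[z0 Zz0]|nZ] := pselect (exists z, Z z); last first.
  rewrite (_ : [set _ | _] = set0)//; apply/seteqP; split => w //= Zw.
  by apply: nZ; exists (Y w).
pose E x := [set `|x - z| | z in Z].
have E0 x : E x !=set0 by exists `|x - z0|; exists z0.
have Elb x : has_lbound (E x) by exists 0 => _ [z _ <-].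
pose g x : R := inf (E x).
have g0 x : 0 <= g x by apply: lb_le_inf => // _ [z _ <-].
have g_le x y : g x <= `|x - y| + g y.
  rewrite -lerBlDl; apply: lb_le_inf => // _ [z Zz <-]; rewrite lerBlDl.
  apply: (@le_trans _ _ `|x - z|); first by apply: ge_inf => //; exists z.
  by rewrite -[x - z](subrKA y) ler_normD.
pose h x : R := Num.min 1 (g x).
have bh : bounded_continuous h.
  split; last first.
    exists 1 => x; rewrite ger0_norm ?ge_min ?lexx//.
    by rewrite le_min ler01 g0.
  apply: (@lipschitz_continuous R 'rV[R]_d R^o _ 1) => x y; rewrite mul1r.
  have := g_le x y; have := g_le y x; rewrite [`|y - x|]distrC /h.
  move: (g x) (g y) (`|x - y|) (normr_ge0 (x - y)) => u v t t0 h1 h2.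
  rewrite ler_norml; apply/andP; split.
    by rewrite /Num.min; case: ltP => ?; case: ltP => ?; lra.
  by rewrite /Num.min; case: ltP => ?; case: ltP => ?; lra.
rewrite (_ : [set _ | _] = setT `&` (fun w => h (Y w)) @^-1` [set 0]).
  exact: (continuous_comp_measurable mY bh).
apply/seteqP; split => w /=.
  move=> Zw; split => //; rewrite /h (_ : g (Y w) = 0) ?min_r//.
  apply/eqP; rewrite eq_le g0 andbT; apply: ge_inf => //.
  by exists (Y w) => //; rewrite subrr normr0.
move=> [_ h0]; apply: cZ => B /nbhs_ballP[r /= r0 rB].
have gw : g (Y w) = 0.
  by move: h0; rewrite /h /Num.min; case: ltP => // _ /eqP; rewrite oner_eq0.
have [_ [z Zz <-] zr] : exists2 t, E (Y w) t & t < r.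
  by apply: inf_lt => //; rewrite -/(g (Y w)) gw.
by exists z; split => //; apply: rB; rewrite -ball_normE.
Qed.

(** The event involves the tree and the estimator jointly; on each of the finitely many histories
    only the estimator varies. *)
Lemma determined_joint_measurable (f : nat -> R) (P : probability T R) (A : T -> attachments) m
    (Q : attachments -> set T) : pa_tree P f A ->
  determined m Q -> (forall a, measurable (Q a)) -> measurable [set w | Q (A w) w].
Proof.
move=> A_pa; elim: m Q => [|m IH] Q dQ mQ.
  rewrite (_ : [set _ | _] = Q (fun=> ord0))//; apply/seteqP; split => w /=.
    by rewrite (dQ _ (fun=> ord0)).
  by rewrite (dQ (A w) (fun=> ord0)).
rewrite (_ : [set _ | _] = \bigcup_(i in `I_m.+1)
    ([set w | A w m = i :> nat] `&` [set w | Q (upd (A w) m i) w])); last first.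
  apply/seteqP; split => w /=.
    move=> Qw; exists (A w m); rewrite /= ?ltn_ord//; split => //.
    by rewrite (dQ _ (A w))//; exact: agree_upd_id.
  move=> [i im [<-]] /=; rewrite (dQ (upd (A w) m (A w m)) (A w))//.
  exact: agree_upd_id.
apply: bigcup_measurable => i /= im; apply: measurableI.
  exact: (choice_measurable A_pa).
apply: (IH (fun a => Q (upd a m i))) => // a b ab; apply: dQ; exact: agree_updS.
Qed.

Lemma cvg_fine_near (u : nat -> \bar R) (l : R) : u @ \oo --> l%:E ->
  forall e : R, 0 < e -> \forall n \near \oo, `|fine (u n) - l| <= e.
Proof.
move=> /fine_cvgP[_ h] e e0; have /cvgrPdist_le/(_ e e0) := h.
by apply: filterS => n; rewrite distrC.
Qed.

End Measurability.

(** * Limit law of consistent solutions *)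

Section Asymptotics.
Variables (R : realType) (d : nat) (Theta : set 'rV[R]_d) (f : 'rV[R]_d -> nat -> R).
Hypothesis Theta_compact : compact Theta.
Hypothesis f_gt0 : forall theta k, Theta theta -> (0 < k)%N -> 0 < f theta k.
Hypothesis f_C2 : forall k, (0 < k)%N -> C2_on Theta (fun theta => f theta k).
Variables (b : nat -> R) (lam c0 Cf Cg : R) (theta0 : 'rV[R]_d).
Hypothesis theta0_in : Theta theta0.
Hypothesis c0_gt0 : 0 < c0.
Hypothesis Cf_ge0 : 0 <= Cf.
Hypothesis Cg_ge0 : 0 <= Cg.
Hypothesis f_between : forall theta, Theta theta -> linear_between c0 Cf (f theta).
Hypothesis f0_ge1 : forall k, (0 < k)%N -> f theta0 1%N <= f theta0 k.
Hypothesis ratio_bound : forall theta k, Theta theta -> (0 < k)%N ->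
  (forall i, `|lratio f theta k i| <= Cg * b k) /\
  (forall i j, `|lratio2 f theta k i j| <= Cg * b k).
Hypothesis b_ge1 : forall k, (0 < k)%N -> 1 <= b k.
Hypothesis b_nd : forall k l, (0 < k)%N -> (k <= l)%N -> b k <= b l.
Hypothesis b_pow4 : forall k, (0 < k)%N -> b k ^+ 4 <= k%:R.
Hypothesis lam_gt0 : 0 < lam.
Hypothesis surv_sum :
  (fun n => \sum_(1 <= k < n) surv (f theta0) lam k) @ \oo --> (1 : R).
Hypothesis lamE : lam = malthus (f theta0).
Let f0 := f theta0.
Let p := pdist f0 lam.
Let q := surv f0 lam.
Let w k : R := k%:R * b k ^+ 3.
Hypothesis wp_summable : summable1 (fun k => w k * p k).
Hypothesis wdist_small : (fun m => expect f0 m (fun a => wdist p w a m)) @ \oo --> (0 : R).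
Variables (disp : measure_display) (T : measurableType disp) (P : probability T R).
Variable A : T -> attachments.
Hypothesis A_pa : pa_tree P f0 A.
Let V0 := asym_info f theta0.
Let eb := errbar f b lam theta0.

Let f0_gt0 k : (0 < k)%N -> 0 < f0 k. Proof. by move=> k0; exact: f_gt0. Qed.
Let p_gt0 k : (0 < k)%N -> 0 < p k. Proof. by move=> k0; exact: pdist_gt0. Qed.
Let f0_le k : (0 < k)%N -> f0 k <= Cf * k%:R.
Proof. by move=> k0; have /andP[] := f_between theta0_in k0. Qed.

Lemma wdist_determined m : determined m (fun a => wdist p w a m).
Proof.
move=> a c ac; apply: eq_sum1 => k _.
by rewrite /cnt (@eq_nsum _ a c _ m.+1).
Qed.

Lemma errbar_determined m : determined m (fun a => eb a m).
Proof.
move=> a c ac; rewrite /eb /errbar (wdist_determined ac); congr (_ + _ * _ + _).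
by apply: eq_bigr => t _; apply: wdist_determined => j jt; apply: ac; apply: ltn_trans jt _.
Qed.

(** Cesaro's lemma, a past error having the same mean under the later history as at its own time
    ([expect_widen]). *)
Lemma expect_errbar_cvg0 : (fun m => expect f0 m (fun a => eb a m)) @ \oo --> (0 : R).
Proof.
have ces := cesaro wdist_small.
have lim : (fun m => expect f0 m (fun a => wdist p w a m)
    + arithmetic_mean (fun m => expect f0 m (fun a => wdist p w a m)) m + m.+1%:R^-1) @ \oo --> (0 : R).
  rewrite -[X in _ --> X](addr0 0) -{1}[X in _ --> X + _](addr0 0).
  by apply: cvgD; [exact: cvgD|exact: cvg_harmonic].
have wd0 a m : 0 <= wdist p w a m.
  by apply: wdist_ge0 => //; move=> k k0; rewrite mulr_ge0// exprn_ge0// (le_trans _ (b_ge1 k0)).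
apply: (squeeze_cvgr _ (cvg_cst 0) lim); apply: nearW => m; apply/andP; split.
  by apply: expect_ge0 => // a; exact: (errbar_ge0 f_gt0 theta0_in b_ge1 lam_gt0 wp_summable a m).
rewrite /eb /errbar expectD expect_cst// lerD2r expectD// lerD2l expectZ expect_sum//.
rewrite /arithmetic_mean/= ler_wpM2l// /series/= big_mkord big_ord_recr/=.
apply: ler_wpDr; first by apply: expect_ge0 => // a.
apply: ler_sum => t _; rewrite (@expect_widen _ _ _ t)//; first exact: ltnW.
exact: wdist_determined.
Qed.

Lemma errbar_prob (eta e : R) : 0 < eta -> 0 < e ->
  \forall m \near \oo, (P [set w | (eta <= eb (A w) m)%R] <= e%:E)%E.
Proof.
move=> eta0 e0; have /cvgrPdist_le/(_ (e * eta) (mulr_gt0 e0 eta0)) := expect_errbar_cvg0.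
apply: filterS => m; rewrite sub0r normrN => h.
have ge0 a : 0 <= eb a m by exact: (errbar_ge0 f_gt0 theta0_in b_ge1 lam_gt0 wp_summable a m).
apply: le_trans (prob_law_le f0_gt0 A_pa eta0 (@errbar_determined m) ge0) _.
by rewrite lee_fin ler_pdivrMr//; apply: le_trans (ler_norm _) h.
Qed.

Lemma errbar_measurable (eta : R) m : measurable [set w | (eta <= eb (A w) m)%R].
Proof.
apply: (determined_measurable A_pa (m := m) (Q := fun a => eta <= eb a m)) => a c ac.
by rewrite (errbar_determined ac).
Qed.

Lemma score_continuous a m i x : Theta x ->
  {for x, continuous (fun theta => score f a m.+1 theta 0 i)}.
Proof.
move=> Tx; have -> : (fun theta => score f a m.+1 theta 0 i) = (fun theta => m.+1%:R^-1 * \sum_(t < m)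
  (lratio f theta (chosen a t) i
   - (nsum (f theta) a t.+1)^-1 * nsum (fun k => partial (f^~ k) i theta) a t.+1)).
  by apply/funext => y; rewrite score_coord.
apply: (@continuous_at_mul R 'rV[R]_d); first exact: cst_continuous.
apply: (@continuous_at_bigsum R 'rV[R]_d) => t; apply: (@continuous_at_sub R 'rV[R]_d).
  exact: (lratio_continuous f_gt0 f_C2 Tx (deg_gt0 _ _ _)).
apply: (@continuous_at_mul R 'rV[R]_d).
  apply: (@continuous_at_inv R 'rV[R]_d).
    by rewrite gt_eqF// nsum_gt0// => k; exact: f_gt0.
  apply: (@continuous_at_bigsum R 'rV[R]_d) => j.
  exact: (f_continuous f_C2 Tx (deg_gt0 _ _ _)).
apply: (@continuous_at_bigsum R 'rV[R]_d) => j.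
exact/differentiable_continuous/(partial_differentiable f_C2 Tx (deg_gt0 _ _ _)).
Qed.

(** Serves to make the event of solving the likelihood equations measurable for any measurable
    estimator. *)
Lemma score_zero_closed a m : closed [set theta | Theta theta /\ score f a m.+1 theta = 0].
Proof.
move=> x clx; have Tx : Theta x.
  apply: (compact_closed (@norm_hausdorff _ _) Theta_compact) => B /clx[y [[Ty _] By]].
  by exists y.
split => //; apply/rowP => i; rewrite [RHS]mxE.
suff : `|score f a m.+1 x 0 i| <= 0 by rewrite normr_le0 => /eqP.
apply/ler_addgt0Pr => e e0; rewrite add0r.
have /cvgrPdist_le/(_ e e0) := score_continuous (a := a) (m := m) (i := i) Tx.
by move=> /clx[y [[Ty sy]]] /=; rewrite sy [(0 : 'rV[R]_d) 0 i]mxE subr0.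
Qed.

Lemma score_determined theta m : determined m (fun a => score f a m.+1 theta).
Proof.
move=> a c ac; apply/rowP => i; rewrite !score_coord; congr (_ * _).
apply: eq_bigr => t _; have act : agree t.+1 a c by move=> j jt; apply: ac; exact: leq_trans jt _.
have act' : agree t a c by move=> j jt; apply: act; exact: ltnW.
rewrite /chosen act// (@eq_deg a c)//=.
by rewrite !(@eq_nsum _ a c _ t.+1).
Qed.

Lemma solution_measurable (hat : nat -> T -> 'rV[R]_d) m : random_vectors hat ->
  measurable [set w | Theta (hat m.+1 w) /\ score f (A w) m.+1 (hat m.+1 w) = 0].
Proof.
move=> mh; apply: (determined_joint_measurable (m := m) A_pa
  (Q := fun a => [set w | Theta (hat m.+1 w) /\ score f a m.+1 (hat m.+1 w) = 0])).
  by move=> a c ac; apply/funext => w' /=; rewrite (score_determined _ ac).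
move=> a; exact: (closed_preimage_measurable (@score_zero_closed a m) (mh m.+1)).
Qed.

(** The tree at time n has n - 1 attachments, whence [n.-1]. *)
Definition scaled_score n (t : T) : 'rV[R]_d :=
  \row_i (mart f0 (fun k => lratio f theta0 k i) (A t) n.-1 / Num.sqrt n%:R).

Lemma scaled_scoreE m t : scaled_score m.+1 t =
  Num.sqrt m.+1%:R *: score f (A t) m.+1 theta0.
Proof.
apply/rowP => i; rewrite mxE [RHS]mxE score_coord /mart mulrA /=.
have -> : Num.sqrt m.+1%:R * m.+1%:R^-1 = (Num.sqrt m.+1%:R)^-1 :> R.
  have s0 : Num.sqrt m.+1%:R != 0 :> R by rewrite gt_eqF// sqrtr_gt0 ltr0n.
  rewrite -{2}(@sqr_sqrtr _ (m.+1%:R : R)) ?ler0n// expr2 invfM mulrA mulfV// mul1r.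
  by [].
rewrite mulrC; congr (_ * _); apply: eq_bigr => j _.
by rewrite /incr /cond_mean (nsum_lratio f_gt0 _ _ _ theta0_in) /chosen mulrC.
Qed.

Let rho (u : 'rV[R]_d) k : R := \sum_i u 0 i * lratio f theta0 k i.

Let rho_le u k : (0 < k)%N -> `|rho u k| <= (d%:R * (`|u| * Cg)) * b k.
Proof.
move=> k0; apply: le_trans (ler_norm_sum _ _ _) _.
apply: (@le_trans _ _ (\sum_(i < d) `|u| * (Cg * b k))); last first.
  by rewrite sumr_const card_ord -[leLHS]mulr_natl !mulrA.
apply: ler_sum => i _; rewrite normrM ler_pM ?mx_coord_le//.
by have [h _] := ratio_bound theta0_in k0.
Qed.

Let mart_rho u a n : mart f0 (rho u) a n = \sum_i u 0 i * mart f0 (fun k => lratio f theta0 k i) a n.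
Proof.
rewrite /mart; under [RHS]eq_bigr do rewrite mulr_sumr.
rewrite exchange_big; apply: eq_bigr => m _ /=.
rewrite /incr /cond_mean.
have [N NE] : exists N : R, nsum f0 a m.+1 = N by eexists.
have [M ME] : exists M : 'I_d -> R, forall i,
  nsum (fun k => f0 k * lratio f theta0 k i) a m.+1 = M i by eexists.
under [RHS]eq_bigr do rewrite ME.
have -> : nsum (fun k => f0 k * rho u k) a m.+1 = \sum_i u 0 i * M i.
  under [RHS]eq_bigr do rewrite -ME /nsum mulr_sumr.
  rewrite exchange_big; apply: eq_bigr => j _; rewrite /rho mulr_sumr.
  by apply: eq_bigr => i _; rewrite mulrCA.
rewrite NE mulr_suml /rho -sumrB; apply: eq_bigr => i _.
by rewrite mulrBr mulrA.
Qed.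

Let dot_scaled_score u n t : dot u (scaled_score n t) = mart f0 (rho u) (A t) n.-1 / Num.sqrt n%:R.
Proof. by rewrite mart_rho mulr_suml; apply: eq_bigr => i _; rewrite mxE mulrA. Qed.

Let rb i k : (0 < k)%N -> `|lratio f theta0 k i| <= Cg * b k.
Proof. by move=> k0; have [h _] := ratio_bound theta0_in k0. Qed.

Let sq (g : nat -> R) C : (forall k, (0 < k)%N -> `|g k| <= C * b k ^+ 2) ->
  summable1 (fun k => g k * q k).
Proof.
by move=> gC; exact: (choice_summable f0_gt0 b_ge1 b_nd lam_gt0 surv_sum wp_summable gC).
Qed.

Let s1 i : summable1 (fun k => lratio f theta0 k i * q k).
Proof.
apply: (sq (C := Cg)) => k k0; apply: le_trans (rb i k0) _.
by rewrite ler_wpM2l// expr2 ler_peMr//; have := b_ge1 k0; lra.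
Qed.

Let s2 i j : summable1 (fun k => lratio f theta0 k i * lratio f theta0 k j * q k).
Proof.
by apply: (sq (C := Cg ^+ 2)) => k k0; rewrite normrM -exprMn expr2 ler_pM// rb.
Qed.

(** Along [u], V_0 is the limiting conditional variance of a scalar martingale: the limit theorem
    applies direction by direction, and V_0 is seen to be nonnegative. *)
Lemma quadratic_form_info u : dot (u *m V0) u = lim_var f0 lam (rho u).
Proof.
have infoE i j : V0 i j = \sum_(1 <= k <oo) lratio f theta0 k i * lratio f theta0 k j * q k
  - (\sum_(1 <= k <oo) lratio f theta0 k i * q k) * (\sum_(1 <= k <oo) lratio f theta0 k j * q k).
  exact: (asym_infoE f_gt0 theta0_in Cg_ge0 ratio_bound b_ge1 b_nd lam_gt0 surv_sum wp_summable lamE).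
have [m1 m1E] : exists m : 'I_d -> R, forall i, \sum_(1 <= k <oo) lratio f theta0 k i * q k = m i.
  by eexists.
have [m2 m2E] : exists m : 'I_d -> 'I_d -> R, forall i j,
    \sum_(1 <= k <oo) lratio f theta0 k i * lratio f theta0 k j * q k = m i j.
  by eexists.
have e1 : \sum_(1 <= k <oo) rho u k * q k = \sum_i u 0 i * m1 i.
  have -> : \sum_(1 <= k <oo) rho u k * q k = \sum_(1 <= k <oo) \sum_i u 0 i * (lratio f theta0 k i * q k).
    by apply: eq_sum1 => k _; rewrite /rho mulr_suml; apply: eq_bigr => i _; rewrite mulrA.
  rewrite sum1_bigsum => [|i]; last exact: summable1Z.
  by apply: eq_bigr => i _; rewrite sum1Z// m1E.
have e2 : \sum_(1 <= k <oo) rho u k ^+ 2 * q k = \sum_i \sum_j u 0 i * u 0 j * m2 i j.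
  have -> : \sum_(1 <= k <oo) rho u k ^+ 2 * q k = \sum_(1 <= k <oo)
      \sum_i \sum_j u 0 i * u 0 j * (lratio f theta0 k i * lratio f theta0 k j * q k).
    apply: eq_sum1 => k _; rewrite expr2 /rho mulr_suml mulr_suml; apply: eq_bigr => i _.
    rewrite mulr_sumr mulr_suml; apply: eq_bigr => j _.
    by move: (lratio _ _ _ _) (lratio _ _ _ _) (q k) => x y z; ring.
  rewrite sum1_bigsum => [|i].
    apply: eq_bigr => i _; rewrite sum1_bigsum => [|j]; last exact: summable1Z.
    by apply: eq_bigr => j _; rewrite sum1Z// m2E.
  have h (v : 'I_d -> nat -> R) : (forall j, summable1 (v j)) -> summable1 (fun k => \sum_j v j k).
    move=> sv; apply/cvg_ex; exists (\sum_j \sum_(1 <= k <oo) v j k).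
    under eq_fun do rewrite exchange_big/=.
    by apply: cvg_bigsum => j; exact: sv.
  by apply: h => j; exact: summable1Z.
rewrite /lim_var -/q e1 e2 expr2 /dot.
under eq_bigr do rewrite mxE mulr_suml.
under eq_bigr do under eq_bigr do rewrite infoE m2E !m1E.
rewrite exchange_big mulr_suml -sumrB; apply: eq_bigr => i _ /=.
rewrite mulr_sumr -sumrB; apply: eq_bigr => j _.
by ring.
Qed.

Lemma info_psd u : 0 <= dot (u *m V0) u.
Proof.
rewrite quadratic_form_info.
exact: (lim_var_ge0 f0_gt0 f0_ge1 f0_le b_ge1 lam_gt0 surv_sum wp_summable wdist_small (rho_le u)).
Qed.

Lemma info_sym : V0^T = V0.
Proof.
apply/matrixP => i j; rewrite mxE.
rewrite /V0 !(asym_infoE f_gt0 theta0_in Cg_ge0 ratio_bound b_ge1 b_nd lam_gt0 surv_sum wp_summable lamE).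
have alg (x y z t : R) : z = t -> z - x * y = t - y * x by move=> ->; rewrite mulrC.
apply: alg; apply: eq_sum1 => k _.
by rewrite [lratio _ _ _ j * _]mulrC.
Qed.

Lemma scaled_score_measurable : random_vectors scaled_score.
Proof.
move=> n i; under eq_fun do rewrite mxE.
apply: measurable_funM => //.
exact: (determined_measurable_fun A_pa (@mart_determined _ _ _ n.-1)).
Qed.

Lemma scaled_score_chf (u : 'rV[R]_d) (c : R) :
  (fun n => \int[P]_(t in setT) cos (dot u (scaled_score n t) + c)) @ \oo -->
    cos c * expR (- (dot (u *m V0) u / 2)).
Proof.
rewrite -(cvg_shiftS (fun n => \int[P]_(t in setT) cos (dot u (scaled_score n t) + c))) /=.
rewrite quadratic_form_info.
have h : (fun n => expect f0 n (fun a => cos (mart f0 (rho u) a n / Num.sqrt n.+1%:R + c))) @ \oo -->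
    cos c * expR (- (lim_var f0 lam (rho u) / 2)).
  exact: (mart_chf f0_gt0 f0_ge1 f0_le b_ge1 b_nd b_pow4 lam_gt0 surv_sum wp_summable wdist_small (rho_le u)).
apply: cvg_trans h; apply: near_eq_cvg; near=> n.
rewrite /Rintegral; under eq_integral do rewrite dot_scaled_score/=.
rewrite (integral_law A_pa (m := n)
  (phi := fun a => cos (mart f0 (rho u) a n / Num.sqrt n.+1%:R + c)))//.
by move=> a a' aa'; rewrite (mart_determined _ _ aa').
Unshelve. all: by end_near. Qed.

Lemma scaled_score_tight (e : R) : 0 < e -> exists K : R,
  forall n, (P [set t | (K <= `|scaled_score n t|)%R] <= e%:E)%E.
Proof.
move=> e0; have /choice[C hC] : forall i, exists C : R, 0 <= C /\ forall n,
    expect f0 n (fun a => mart f0 (fun k => lratio f theta0 k i) a n ^+ 2) <= C * n%:R.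
  move=> i; have [C C0 hC] := expect_mart_sq f0_gt0 f0_ge1 f0_le b_ge1 lam_gt0 surv_sum
    wp_summable wdist_small (rb i).
  by exists C.
pose B : R := \sum_i C i.
have B0 : 0 <= B by apply: sumr_ge0 => i _; have [] := hC i.
(* As K >= 1 and e K >= B, Chebyshev's bound B / K^2 is at most e. *)
pose K : R := B / e + 1; have K1 : 1 <= K by rewrite lerDr divr_ge0// ltW.
have K0 : 0 < K by exact: lt_le_trans K1.
exists K => -[|n].
  rewrite (_ : [set _ | _] = set0) ?measure0 ?lee_fin ?ltW//.
  apply/seteqP; split => // t /=.
  have -> : scaled_score 0 t = 0 by apply/rowP => i; rewrite !mxE sqrtr0 invr0 mulr0.
  by rewrite normr0 leNgt K0.
have n0 : 0 < (n.+1%:R : R) by rewrite ltr0n.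
pose phi a : R := \sum_i mart f0 (fun k => lratio f theta0 k i) a n ^+ 2.
have dphi : determined n phi.
  by move=> a a' aa'; apply: eq_bigr => i _; rewrite (mart_determined _ _ aa').
have phi0 a : 0 <= phi a by apply: sumr_ge0 => i _; exact: sqr_ge0.
have Kn0 : 0 < K ^+ 2 * n.+1%:R by rewrite mulr_gt0// exprn_gt0.
apply: (@le_trans _ _ (P [set t | (K ^+ 2 * n.+1%:R <= phi (A t))%R])).
  apply: le_measure; rewrite ?inE.
  - have := @norm_ge_measurable _ _ _ _ _ 0 K (scaled_score_measurable n.+1).
    by congr measurable; apply/seteqP; split => t /=; rewrite subr0.
  - apply: (determined_measurable A_pa (m := n) (Q := fun a => K ^+ 2 * n.+1%:R <= phi a)).
    by move=> a a' aa'; rewrite (dphi _ _ aa').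
  - move=> t /= Kt; have : `|scaled_score n.+1 t| <= Num.sqrt (phi (A t)) / Num.sqrt n.+1%:R.
      apply: mx_norm_ler => [|i j]; first by rewrite divr_ge0// sqrtr_ge0.
      rewrite (ord1 i) mxE normrM [`|_^-1|]ger0_norm ?invr_ge0 ?sqrtr_ge0//.
      rewrite ler_wpM2r ?invr_ge0 ?sqrtr_ge0// -sqrtr_sqr ler_wsqrtr//=.
      by rewrite /phi (bigD1 j)//= lerDl; apply: sumr_ge0 => k _; exact: sqr_ge0.
    move/(le_trans Kt); rewrite ler_pdivlMr ?sqrtr_gt0// => h.
    have : (K * Num.sqrt n.+1%:R) ^+ 2 <= (Num.sqrt (phi (A t))) ^+ 2.
      by rewrite lerXn2r ?nnegrE ?sqrtr_ge0// mulr_ge0 ?sqrtr_ge0// ltW.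
    by rewrite exprMn !sqr_sqrtr// ltW.
apply: le_trans (prob_law_le f0_gt0 A_pa Kn0 dphi phi0) _.
rewrite lee_fin ler_pdivrMr// /phi expect_sum//.
apply: (@le_trans _ _ (B * n%:R)).
  by rewrite /B mulr_suml; apply: ler_sum => i _; have [_] := hC i.
apply: (@le_trans _ _ (B * n.+1%:R)); first by rewrite ler_wpM2l// ler_nat.
rewrite mulrA ler_wpM2r ?(ltW n0)//.
have : B <= e * K by rewrite /K mulrDr mulrCA mulfV ?gt_eqF// !mulr1 lerDl ltW.
by move/le_trans; apply; rewrite ler_wpM2l ?(ltW e0)// expr2 ler_peMr// ltW.
Qed.

Hypothesis V0_unit : V0 \in unitmx.

(** Where the score vanishes at the estimator, [score_expansion] multiplied by sqrt n is the
    closeness hypothesis of [normal_limit]. Its error is relative to the normalized estimator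
    itself, so no rate of convergence has to be known beforehand. *)
Lemma normal_estimator (hat : nat -> T -> 'rV[R]_d) :
  star_shaped_near Theta theta0 -> random_vectors hat ->
  solves_likelihood_equations P A f Theta hat -> cvg_in_probability P hat theta0 ->
  cvg_in_distribution_normal P (fun n t => Num.sqrt n%:R *: (hat n t - theta0)) (invmx V0).
Proof.
move=> [r1 r10 star] mh sol cons.
have mX : random_vectors (fun n t => Num.sqrt n%:R *: (hat n t - theta0)).
  move=> n i; under eq_fun do rewrite !mxE.
  by apply: measurable_funM => //; apply: measurable_funB => //; exact: mh.
apply: (normal_limit mX scaled_score_measurable info_sym V0_unit info_psd scaled_score_tight).
  by move=> u c; exact: scaled_score_chf.
move=> eta e eta0 e0; have e3 : 0 < e / 3 by lra.
have [K K0 hK] := score_expansion f_gt0 f_C2 theta0_in c0_gt0 Cf_ge0 Cg_ge0 f_between ratio_bound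
  b_ge1 b_nd lam_gt0 surv_sum wp_summable lamE.
have eta2 : 0 < eta / 2 by lra.
have [r2 r20 hr2] := hK _ eta2; pose r : R := Num.min r1 r2.
have r0 : 0 < r by rewrite lt_min r10.
(* Below this tree error, the coefficient eta / 2 + K errbar is at most eta. *)
have ek : 0 < eta / 2 / (K + 1) by rewrite divr_gt0//; lra.
have [M _ hM] := errbar_prob ek e3.
have sol' := cvg_fine_near sol e3.
have cons' := cvg_fine_near (cons r r0) e3.
near=> n.
have n0 : (0 < n)%N by near: n; exact: nbhs_infty_gt.
have Mn : (M < n)%N by near: n; exact: nbhs_infty_gt.
have soln : `|fine (P [set w | Theta (hat n w) /\ score f (A w) n (hat n w) = 0]) - 1| <= e / 3.
  by near: n.
have consn : `|fine (P [set w | r <= `|hat n w - theta0|]) - 0| <= e / 3 by near: n.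
have erbn : (P [set t | (eta / 2 / (K + 1) <= eb (A t) n.-1)%R] <= (e / 3)%:E)%E.
  by apply: hM; rewrite /= -ltnS prednK.
have [m nm] : exists m, n = m.+1 by exists n.-1; rewrite prednK.
rewrite nm /= in soln consn erbn *.
have mG := solution_measurable m mh.
have mC := @norm_ge_measurable _ _ _ _ _ theta0 r (mh m.+1).
have mE := errbar_measurable (eta / 2 / (K + 1)) m.
set G := [set w | _] in soln mG; set D := [set w | _] in consn mC.
set E := [set w | _] in erbn mE.
have PG : (P (~` G) <= (e / 3)%:E)%E.
  rewrite probability_setC// -(@fineK _ (P G)) ?fin_num_measure// -EFinB lee_fin.
  by move: soln; rewrite ler_norml => /andP[]; lra.
have PD : (P D <= (e / 3)%:E)%E.
  rewrite -(@fineK _ (P D)) ?fin_num_measure// lee_fin.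
  by move: consn; rewrite subr0; apply: le_trans; exact: ler_norm.
have mGC : measurable (~` G) by exact: measurableC.
(* The equations fail, the estimator is far from theta0, or the tree error is large: each has
   probability at most e / 3. *)
exists (~` G `|` (D `|` E)); split; first by apply: measurableU => //; exact: measurableU.
  apply: (le_trans (measureU2 _ mGC (measurableU _ _ mC mE))).
  apply: (@le_trans _ _ ((e / 3)%:E + ((e / 3)%:E + (e / 3)%:E))%E).
    apply: leeD => //; apply: (le_trans (measureU2 _ mC mE)).
    exact: leeD.
  by rewrite -!EFinD lee_fin; lra.
move=> t /not_orP[/contrapT[Tt st] /not_orP[/negP Dt /negP Et]].
move: Dt Et; rewrite /D /E /= -!ltNge => Dt Et.
have := hr2 (hat m.+1 t) Tt; move: Dt; rewrite lt_min => /andP[Dt1 Dt2].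
move=> /(_ Dt2 (star _ Tt Dt1) (A t) m); rewrite st sub0r => h.
rewrite scaled_scoreE -scalemxAl -scalerBr normrZ normrZ [leRHS]mulrCA.
rewrite ler_wpM2l// addrC; apply: le_trans h _; rewrite ler_wpM2r//.
have K1 : 0 < K + 1 by lra.
have eb0 : 0 <= errbar f b lam theta0 (A t) m.
  exact: (errbar_ge0 f_gt0 theta0_in b_ge1 lam_gt0 wp_summable (A t) m).
move: Et; rewrite ltr_pdivlMr// -/(eb _ _); move: eb0; rewrite -/(eb _ _).
by move: (eb _ _) => y y0; rewrite mulrDr mulr1 mulrC; lra.
Unshelve. all: by end_near. Qed.

End Asymptotics.

(** * The maximum likelihood estimator *)

Section MaximumLikelihood.
Variables (R : realType) (d : nat) (Theta : set 'rV[R]_d) (f : 'rV[R]_d -> nat -> R).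
Hypothesis Theta_compact : compact Theta.
Hypothesis f_gt0 : forall theta k, Theta theta -> (0 < k)%N -> 0 < f theta k.
Hypothesis f_C2 : forall k, (0 < k)%N -> C2_on Theta (fun theta => f theta k).
Implicit Types (a : attachments) (m : nat) (x h : 'rV[R]_d).

Lemma is_derive_ln_comp (F : R -> R) (dF s : R) : 0 < F s -> is_derive s 1 F dF ->
  is_derive s 1 (fun t => ln (F t)) ((F s)^-1 * dF).
Proof. by move=> Fs hF; apply: is_derive1_comp; exact: is_derive1_ln. Qed.

Lemma loglik_derivative x h (s : R) a m : Theta (x + s *: h) ->
  is_derive s 1 (fun t : R => loglik f a m.+1 (x + t *: h))
    (\sum_j h 0 j * score f a m.+1 (x + s *: h) 0 j).
Proof.
move=> Ts; set th := x + s *: h in Ts *.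
have -> : (fun t : R => loglik f a m.+1 (x + t *: h)) = (fun t : R => m.+1%:R^-1 * \sum_(j < m)
  (ln (f (x + t *: h) (chosen a j)) - ln (nsum (f (x + t *: h)) a j.+1))).
  by apply/funext => t; rewrite loglikE.
have dF k : (0 < k)%N -> is_derive s 1 (fun t : R => f (x + t *: h) k)
    (\sum_j h 0 j * partial (f^~ k) j th).
  by move=> k0; apply: (is_derive_segment (g := f^~ k)); exact: (f_differentiable f_C2).
have dN n : is_derive s 1 (fun t : R => nsum (f (x + t *: h)) a n)
    (\sum_j h 0 j * nsum (fun k => partial (f^~ k) j th) a n).
  have D := is_derive_bigsum (fun l : 'I_n => dF (deg a n l) (deg_gt0 _ _ _)).
  apply: (is_derive_eq D); rewrite /nsum exchange_big; apply: eq_bigr => j _.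
  by rewrite mulr_sumr.
have term (t : 'I_m) : is_derive s 1
    (fun u : R => ln (f (x + u *: h) (chosen a t)) - ln (nsum (f (x + u *: h)) a t.+1))
    (\sum_j h 0 j * (lratio f th (chosen a t) j
       - (nsum (f th) a t.+1)^-1 * nsum (fun k => partial (f^~ k) j th) a t.+1)).
  have D1 := is_derive_ln_comp (f_gt0 Ts (deg_gt0 _ _ _)) (dF (chosen a t) (deg_gt0 _ _ _)).
  have D2 := is_derive_ln_comp (nsum_gt0 (fun k => f_gt0 Ts) a t) (dN t.+1).
  apply: (is_derive_eq (is_derive_minus D1 D2)).
  have [N0 N0E] : exists N : R, nsum (f th) a t.+1 = N by eexists.
  have [N1 N1E] : exists N : 'I_d -> R, forall j,
      nsum (fun k => partial (f^~ k) j th) a t.+1 = N j by eexists.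
  rewrite -/th N0E; under [X in _ - _ * X]eq_bigr do rewrite N1E.
  under [RHS]eq_bigr do rewrite N1E.
  rewrite !mulr_sumr -sumrB; apply: eq_bigr => j _; rewrite /lratio.
  by move: (f th _)^-1 N0^-1 => u v; ring.
have D := is_derive_scale m.+1%:R^-1 (is_derive_bigsum term).
apply: (is_derive_eq D).
under [RHS]eq_bigr do rewrite score_coord mulrCA.
rewrite -mulr_sumr; congr (_ * _).
by rewrite exchange_big; apply: eq_bigr => j _; rewrite mulr_sumr.
Qed.

(** Fermat's rule along each coordinate, the ball keeping the segments inside [Theta];
    [loglik_derivative] shows that the score is the gradient. *)
Lemma interior_max_score0 x (r : R) a m : 0 < r ->
  (forall y, `|y - x| < r -> Theta y) ->
  (forall y, Theta y -> loglik f a m.+1 y <= loglik f a m.+1 x) ->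
  score f a m.+1 x = 0.
Proof.
move=> r0 ball_in xmax; apply/rowP => i; rewrite [RHS]mxE.
pose h : 'rV[R]_d := delta_mx 0 i.
have hn : `|h| <= 1.
  apply: mx_norm_ler => // i' j; rewrite mxE.
  by case: (_ && _); rewrite ?normr1 ?normr0.
have seg (t : R) : t \in `]- r, r[ -> Theta (x + t *: h).
  rewrite in_itv/= => /andP[t1 t2]; apply: ball_in; rewrite addrAC subrr add0r normrZ.
  apply: (@le_lt_trans _ _ `|t|); first by rewrite ler_piMr.
  by rewrite ltr_norml t1.
have z0 : (0 : R) \in `]- r, r[ by rewrite in_itv/= oppr_lt0 r0.
have D1 := @derive1_at_max R (fun t : R => loglik f a m.+1 (x + t *: h)) (- r) r 0.
have {}D1 : is_derive (0 : R) 1 (fun t : R => loglik f a m.+1 (x + t *: h)) 0.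
  apply: D1 => //; first by rewrite ge0_cp// ltW.
  - by move=> t tr; have D := loglik_derivative a m (seg t tr); exact: ex_derive.
  - by move=> t tr; rewrite scale0r addr0; apply: xmax; exact: seg.
have D2 := loglik_derivative a m (seg 0 z0).
have := derive_val (is_derive := D1); rewrite (derive_val (is_derive := D2)).
rewrite scale0r addr0 (bigD1 i)//= mxE !eqxx mul1r big1 ?addr0// => j ji.
by rewrite mxE (negbTE ji) andbF mul0r.
Qed.

Variables (b : nat -> R) (lam c0 Cf Cb : R) (theta0 : 'rV[R]_d).
Hypothesis theta0_in : Theta theta0.
Hypothesis c0_gt0 : 0 < c0.
Hypothesis Cf_ge0 : 0 <= Cf.
Hypothesis Cb_gt0 : 0 < Cb.
Hypothesis f_between : forall theta, Theta theta -> linear_between c0 Cf (f theta).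
Hypothesis ln_b : forall k, (0 < k)%N -> ln k%:R <= Cb * b k.
Hypothesis b_ge1 : forall k, (0 < k)%N -> 1 <= b k.
Hypothesis b_nd : forall k l, (0 < k)%N -> (k <= l)%N -> b k <= b l.
Hypothesis lam_gt0 : 0 < lam.
Hypothesis surv_sum :
  (fun n => \sum_(1 <= k < n) surv (f theta0) lam k) @ \oo --> (1 : R).
Let f0 := f theta0.
Let p := pdist f0 lam.
Let w k : R := k%:R * b k ^+ 3.
Hypothesis wp_summable : summable1 (fun k => w k * p k).
Hypothesis wdist_small : (fun m => expect f0 m (fun a => wdist p w a m)) @ \oo --> (0 : R).
Hypothesis ident : identifiable f Theta theta0.
Hypothesis theta0_interior : interior Theta theta0.
Variables (disp : measure_display) (T : measurableType disp) (P : probability T R).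
Variable A : T -> attachments.
Hypothesis A_pa : pa_tree P f0 A.
Variable hat : nat -> T -> 'rV[R]_d.
Hypothesis hat_measurable : random_vectors hat.
Hypothesis hat_mle : is_mle A f Theta hat.

Let theta0_ball : exists2 r : R, 0 < r & forall y, `|y - theta0| < r -> Theta y.
Proof.
have /nbhs_ballP[r /= r0 hr] := theta0_interior; exists r => // y yr.
by apply: hr; rewrite -ball_normE /ball_/= distrC.
Qed.

Lemma interior_star_shaped : star_shaped_near Theta theta0.
Proof.
have [r r0 hr] := theta0_ball; exists r => // y _ yr s /andP[s0 s1]; apply: hr.
rewrite addrAC subrr add0r normrZ; apply: le_lt_trans yr.
by rewrite ger0_norm// ler_piMl.
Qed.

(** The deterministic part of consistency: whenever the tree error is small, [loglik_separation]
    excludes any maximizer far from theta0. *)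
Let mle_near (e : R) : 0 < e -> exists2 eta : R, 0 < eta & forall t m,
  errbar f b lam theta0 (A t) m < eta -> `|hat m.+1 t - theta0| < e.
Proof.
move=> e0; have [eta eta0 h] := loglik_separation Theta_compact f_gt0 f_C2 theta0_in c0_gt0 Cf_ge0
  Cb_gt0 f_between ln_b b_ge1 b_nd lam_gt0 surv_sum wp_summable ident e0.
exists eta => // t m eb; have [Th hmax] := hat_mle m.+1 t.
rewrite ltNge; apply/negP => eh; have := h _ (A t) m Th eh eb.
by rewrite ltNge hmax.
Qed.

Let errbar_small (eta e : R) : 0 < eta -> 0 < e -> \forall m \near \oo,
  (P [set t | (eta <= errbar f b lam theta0 (A t) m)%R] <= e%:E)%E.
Proof.
move=> eta0 e0.
exact: (errbar_prob f_gt0 theta0_in b_ge1 lam_gt0 wp_summable wdist_small A_pa eta0 e0).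
Qed.

Lemma mle_consistent : cvg_in_probability P hat theta0.
Proof.
move=> e e0; have [eta eta0 h] := mle_near e0.
have mD n := @norm_ge_measurable _ _ _ _ _ theta0 e (hat_measurable n).
apply/fine_cvgP; split; first by apply: nearW => n; exact: fin_num_measure.
apply/cvgrPdist_le => del del0.
have [M _ hM] := errbar_small eta0 del0.
near=> n; rewrite sub0r normrN ger0_norm ?fine_ge0//.
have n0 : (0 < n)%N by near: n; exact: nbhs_infty_gt.
have Mn : (M < n)%N by near: n; exact: nbhs_infty_gt.
rewrite -lee_fin fineK ?fin_num_measure//.
have := hM n.-1; rewrite /= -ltnS prednK// => /(_ Mn); apply: le_trans.
apply: le_measure; rewrite ?inE//; first exact: (errbar_measurable b lam A_pa).
move=> t /= et; rewrite leNgt; apply/negP => /h; rewrite prednK// ltNge.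
by rewrite et.
Unshelve. all: by end_near. Qed.

(** A small tree error puts the maximizer at the centre of a ball contained in [Theta], where the
    score must vanish. *)
Lemma mle_solves : solves_likelihood_equations P A f Theta hat.
Proof.
have [r r0 ball_in] := theta0_ball; have r2 : 0 < r / 2 by rewrite divr_gt0.
have [eta eta0 h] := mle_near r2.
have mG m := solution_measurable Theta_compact f_gt0 f_C2 A_pa m hat_measurable.
apply/fine_cvgP; split.
  (* [mG] concerns times n > 0, whence the restriction to large n. *)
  near=> n; have n0 : (0 < n)%N by near: n; exact: nbhs_infty_gt.
  by rewrite -(prednK n0); exact: fin_num_measure.
apply/cvgrPdist_le => del del0.
have [M _ hM] := errbar_small eta0 del0.
near=> n.
have n0 : (0 < n)%N by near: n; exact: nbhs_infty_gt.
have Mn : (M < n)%N by near: n; exact: nbhs_infty_gt.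
have [m nm] : exists m, n = m.+1 by exists n.-1; rewrite prednK.
have {hM}hMm : (P [set t | (eta <= errbar f b lam theta0 (A t) m)%R] <= del%:E)%E.
  by apply: hM; rewrite /= -ltnS -nm.
rewrite nm /=; set G := [set w | _].
have mGm : measurable G by exact: mG.
have P1 : (P G <= 1)%E by exact: probability_le1.
have -> : 1 - fine (P G) = fine (P (~` G)).
  by rewrite probability_setC// fineB// fin_num_measure.
rewrite ger0_norm ?fine_ge0// -lee_fin fineK ?fin_num_measure//; last exact: measurableC.
apply: le_trans hMm; apply: le_measure; rewrite ?inE.
- exact: measurableC.
- exact: (errbar_measurable b lam A_pa).
move=> t /= nG; rewrite leNgt; apply/negP => /h hr; apply: nG.
have [Th hmax] := hat_mle m.+1 t; split => //.
apply: (interior_max_score0 r2) => // y yr; apply: ball_in.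
by apply: le_lt_trans (ler_distD (hat m.+1 t) _ _) _; lra.
Unshelve. all: by end_near. Qed.

End MaximumLikelihood.
Theorem theorem5p1 (R : realType) (d : nat) (Theta : set 'rV[R]_d)
  (f : 'rV[R]_d -> nat -> R)
  (Theta_compact : compact Theta)
  (f_gt0 : forall theta k, Theta theta -> (0 < k)%N -> 0 < f theta k)
  (f_nondecreasing : forall theta k l, Theta theta ->
     (0 < k)%N -> (k <= l)%N -> f theta k <= f theta l)
  (f_C2 : forall k, (0 < k)%N -> C2_on Theta (fun theta => f theta k))
  (C : R) (C_gt0 : 0 < C)
  (f_growth : forall theta, Theta theta ->
     (exists2 beta : R, beta < 1 &
        forall k, (0 < k)%N -> f theta k <= C * k%:R `^ beta) \/
     (exists2 alpha : R, -1 < alpha &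
        forall k, (0 < k)%N -> f theta k = k%:R + alpha))
  (gamma C' : R) (gamma_gt0 : 0 < gamma) (C'_gt0 : 0 < C')
  (fdot_bound : forall theta k, Theta theta -> (2 <= k)%N ->
     `|fdot f theta k| + `|fddot f theta k| <= C' * k%:R * ln k%:R `^ gamma)
  (fdot_ratio_bound : forall theta k, Theta theta -> (2 <= k)%N ->
     `|(f theta k)^-1 *: fdot f theta k| + `|(f theta k)^-1 *: fddot f theta k|
       <= C' * ln k%:R `^ gamma)
  (theta0 : 'rV[R]_d) (theta0_in : Theta theta0)
  (disp : measure_display) (T : measurableType disp) (P : probability T R)
  (A : T -> attachments) (A_pa : pa_tree P (f theta0) A)
  (V0_nonsingular : asym_info f theta0 \in unitmx) :
  (forall hat : nat -> T -> 'rV[R]_d,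
     star_shaped_near Theta theta0 ->
     random_vectors hat ->
     solves_likelihood_equations P A f Theta hat ->
     cvg_in_probability P hat theta0 ->
     cvg_in_distribution_normal P
       (fun n w => Num.sqrt n%:R *: (hat n w - theta0))
       (invmx (asym_info f theta0)))
  /\
  (identifiable f Theta theta0 ->
   interior Theta theta0 ->
   forall hat : nat -> T -> 'rV[R]_d,
     random_vectors hat ->
     is_mle A f Theta hat ->
     cvg_in_distribution_normal P
       (fun n w => Num.sqrt n%:R *: (hat n w - theta0))
       (invmx (asym_info f theta0))).
Proof.
have f0_gt0 k : (0 < k)%N -> 0 < f theta0 k by exact: f_gt0.
have f0_nd k l : (0 < k)%N -> (k <= l)%N -> f theta0 k <= f theta0 l by exact: f_nondecreasing.
have [b [Cb [[b_ge1 b_nd Cb_gt0 b_ln b_pow4] [[lam_gt0 surv_sum] wp wsmall _]]]] :=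
  tree_lln f0_gt0 f0_nd C_gt0 gamma_gt0 (f_growth theta0 theta0_in).
have [c0 [Cf [c0_gt0 Cf_ge0 f_between]]] :=
  family_between Theta_compact f_gt0 f_nondecreasing f_C2 C_gt0 f_growth.
have [Cg Cg_ge0 ratio_bound] := lratio_bound Theta_compact f_gt0 f_C2 b_ge1 Cb_gt0 C'_gt0
  (fun k k0 => (b_ln k k0).1) fdot_ratio_bound.
have core (hat : nat -> T -> 'rV[R]_d) : star_shaped_near Theta theta0 ->
    random_vectors hat -> solves_likelihood_equations P A f Theta hat ->
    cvg_in_probability P hat theta0 ->
    cvg_in_distribution_normal P (fun n w => Num.sqrt n%:R *: (hat n w - theta0))
      (invmx (asym_info f theta0)).
  move=> star mh sol cons.
  exact: (normal_estimator Theta_compact f_gt0 f_C2 theta0_in c0_gt0 Cf_ge0 Cg_ge0 f_between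
    (fun k k0 => f0_nd 1%N k isT k0) ratio_bound b_ge1 b_nd b_pow4 lam_gt0 surv_sum erefl wp wsmall
    A_pa V0_nonsingular star mh sol cons).
split=> // ident inter hat mh mle.
have ln_b k : (0 < k)%N -> ln k%:R <= Cb * b k by move=> k0; have [] := b_ln k k0.
apply: core => //.
- exact: interior_star_shaped.
- exact: (mle_solves Theta_compact f_gt0 f_C2 theta0_in c0_gt0 Cf_ge0 Cb_gt0 f_between ln_b b_ge1
    b_nd lam_gt0 surv_sum wp wsmall ident inter A_pa mh mle).
- exact: (mle_consistent Theta_compact f_gt0 f_C2 theta0_in c0_gt0 Cf_ge0 Cb_gt0 f_between ln_b b_ge1
    b_nd lam_gt0 surv_sum wp wsmall ident A_pa mh mle).
Qed.
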